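(* The ETFS problem (defined in the context) can be solved in $\mathcal{O}\!\left(n^2+\frac{n^2k}{\log_\sigma n}\right)$ time, where $\sigma=|\Sigma|$.
   Context: Let $W$ be a string of length $n$ over an alphabet $\Sigma$ of size $\sigma$ (assumed to be a set of integers $\{1,\dots,n^{\mathcal{O}(1)}\}$), and let $k$ be an integer with $1<k<n$. Let $\mathcal{S}_k\subseteq\{0,\dots,n-k\}$ be a set of starting positions with the closure property: if $i\in\mathcal{S}_k$ and $W[j..j+k-1]=W[i..i+k-1]$, then $j\in\mathcal{S}_k$. The sensitive patterns are the strings $W[i..i+k-1]$ with $i\in\mathcal{S}_k$; with $\mathcal{I}=\{0,\dots,n-k\}\setminus\mathcal{S}_k$, the non-sensitive patterns are the strings $W[i..i+k-1]$ with $i\in\mathcal{I}$. Let $\#\notin\Sigma$. For a string $U$ over $\Sigma\cup\{\#\}$, let $\mathcal{I}_U$ be the set of positions $p$ such that $U[p..p+k-1]$ is a non-sensitive pattern. For strings $U,V$, $\mathcal{I}_U\equiv\mathcal{I}_V$ means $|\mathcal{I}_U|=|\mathcal{I}_V|$ and, for every $j$, if $u$ and $v$ are the $j$-th smallest elements of $\mathcal{I}_U$ and $\mathcal{I}_V$, then $U[u..u+k-1]=V[v..v+k-1]$. The ETFS problem: given $W$, $k$, $\mathcal{S}_k$, construct a string $X_{\mathrm{ED}}$ over $\Sigma\cup\{\#\}$ such that (C1) $X_{\mathrm{ED}}$ contains no sensitive pattern as a substring, (P1) $\mathcal{I}_W\equiv\mathcal{I}_{X_{\mathrm{ED}}}$,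 and $X_{\mathrm{ED}}$ has minimum edit distance to $W$ among all strings satisfying (C1) and (P1). *)

(* Defs.v *)
(* Mathematical Components, with MathComp-Analysis for the real logarithm. *)
From mathcomp Require Import all_boot all_order all_algebra finmap.
From mathcomp Require Import reals exp.

Set Implicit Arguments.
Unset Strict Implicit.
Unset Printing Implicit Defensive.

Local Open Scope nat_scope.

(** * Strings and the ETFS problem *)

(* Letters are natural numbers.  An alphabet only contains positive letters
   (see [etfs_instance]), so 0 is free to play the role of '#'. *)
Definition hash : nat := 0.

Definition string_over (Sigma : {fset nat}) (U : seq nat) : Prop :=
  {subset U <= Sigma}.

Definition string_over_hash (Sigma : {fset nat}) (U : seq nat) : Prop :=
  forall x, x \in U -> x \in Sigma \/ x = hash.

(* U[p..p+k-1]; only meaningful when p + k <= size U. *)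
Definition window (k p : nat) (U : seq nat) : seq nat := take k (drop p U).

(* The increasing list of the p with p + k <= size U, that is 0, ..., size U - k. *)
Definition positions (k : nat) (U : seq nat) : seq nat := iota 0 ((size U).+1 - k).

Record etfs_instance (Sigma : {fset nat}) (W : seq nat) (k : nat)
    (Sk : {fset nat}) : Prop := EtfsInstance {
  etfs_alphabet_pos : forall x, x \in Sigma -> 0 < x;
  etfs_string : string_over Sigma W;
  etfs_k_bounds : 1 < k < size W;
  etfs_positions : {subset Sk <= positions k W};
  etfs_closed : forall i j, i \in Sk -> j \in positions k W ->
    window k j W = window k i W -> j \in Sk
}.

Definition sensitive (W : seq nat) (k : nat) (Sk : {fset nat}) (P : seq nat) : bool :=
  has (fun i => (i \in Sk) && (window k i W == P)) (positions k W).

Definition nonsensitive (W : seq nat) (k : nat) (Sk : {fset nat}) (P : seq nat) : bool :=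
  has (fun i => (i \notin Sk) && (window k i W == P)) (positions k W).

(* I_U, listed in increasing order. *)
Definition nonsens_positions (W : seq nat) (k : nat) (Sk : {fset nat})
    (U : seq nat) : seq nat :=
  [seq p <- positions k U | nonsensitive W k Sk (window k p U)].

(* I_U \equiv I_V *)
Definition same_nonsens (W : seq nat) (k : nat) (Sk : {fset nat})
    (U V : seq nat) : Prop :=
  let IU := nonsens_positions W k Sk U in
  let IV := nonsens_positions W k Sk V in
  size IU = size IV /\
  forall j, j < size IU -> window k (nth 0 IU j) U = window k (nth 0 IV j) V.

Definition cond_C1 (W : seq nat) (k : nat) (Sk : {fset nat}) (X : seq nat) : Prop :=
  forall p, p \in positions k X -> ~~ sensitive W k Sk (window k p X).

Definition cond_P1 (W : seq nat) (k : nat) (Sk : {fset nat}) (X : seq nat) : Prop :=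
  same_nonsens W k Sk W X.

Inductive edit_step : seq nat -> seq nat -> Prop :=
| EditInsert A B x : edit_step (A ++ B) (A ++ x :: B)
| EditDelete A B x : edit_step (A ++ x :: B) (A ++ B)
| EditSubst A B x y : edit_step (A ++ x :: B) (A ++ y :: B).

Inductive edit_path : nat -> seq nat -> seq nat -> Prop :=
| EditNil U : edit_path 0 U U
| EditCons m U V Z : edit_step U V -> edit_path m V Z -> edit_path m.+1 U Z.

Definition is_edit_distance (U V : seq nat) (d : nat) : Prop :=
  edit_path d U V /\ forall m, edit_path m U V -> d <= m.

Definition etfs_feasible (Sigma : {fset nat}) (W : seq nat) (k : nat)
    (Sk : {fset nat}) (X : seq nat) : Prop :=
  [/\ string_over_hash Sigma X, cond_C1 W k Sk X & cond_P1 W k Sk X].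

Definition etfs_solution (Sigma : {fset nat}) (W : seq nat) (k : nat)
    (Sk : {fset nat}) (X : seq nat) : Prop :=
  etfs_feasible Sigma W k Sk X /\
  forall Y d e, etfs_feasible Sigma W k Sk Y ->
    is_edit_distance X W d -> is_edit_distance Y W e -> d <= e.

(** * The word RAM

   Words are the naturals below 2 ^ w.  A program uses finitely many registers
   and accesses the memory by indirect addressing; control flow is structured
   (sequence, conditional, loop), which a jump-based RAM simulates with a
   constant-factor overhead.  Every primitive instruction and every evaluation
   of a test takes unit time. *)

Inductive operand := Reg of nat | Cst of nat.

Inductive binop :=
| OpAdd | OpSub | OpMul | OpDiv | OpMod | OpAnd | OpOr | OpXor | OpShl | OpShr.

Inductive test := TestEq of operand & operand | TestLt of operand & operand.

Inductive program :=
| Skip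
| Assign of nat & binop & operand & operand
| Read of nat & operand                      (* register, address *)
| Write of operand & operand                 (* address, value *)
| Seq of program & program
| If of test & program & program
| While of test & program.

Record state := State { regs : nat -> nat; mem : nat -> nat }.

Definition update (f : nat -> nat) (i v : nat) : nat -> nat :=
  fun j => if j == i then v else f j.

Definition to_word (w x : nat) : nat := x %% 2 ^ w.

Section Semantics.
Variable w : nat.

Definition eval_operand (s : state) (o : operand) : nat :=
  match o with Reg r => regs s r | Cst x => to_word w x end.

Definition eval_binop (op : binop) (x y : nat) : nat :=
  to_word w
    match op with
    | OpAdd => x + y
    | OpSub => 2 ^ w + x - y
    | OpMul => x * y
    | OpDiv => x %/ y
    | OpMod => x %% y
    | OpAnd => Nat.land x y
    | OpOr => Nat.lor x y
    | OpXor => Nat.lxor x y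
    | OpShl => x * 2 ^ y
    | OpShr => x %/ 2 ^ y
    end.

Definition eval_test (s : state) (b : test) : bool :=
  match b with
  | TestEq x y => eval_operand s x == eval_operand s y
  | TestLt x y => eval_operand s x < eval_operand s y
  end.

(* [exec P s t s']: started in s, P halts in state s' after exactly t steps. *)
Inductive exec : program -> state -> nat -> state -> Prop :=
| ExecSkip s : exec Skip s 1 s
| ExecAssign s r op x y :
    exec (Assign r op x y) s 1
      (State (update (regs s) r
                (eval_binop op (eval_operand s x) (eval_operand s y))) (mem s))
| ExecRead s r a :
    exec (Read r a) s 1
      (State (update (regs s) r (mem s (eval_operand s a))) (mem s))
| ExecWrite s a x :
    exec (Write a x) s 1
      (State (regs s) (update (mem s) (eval_operand s a) (eval_operand s x)))
| ExecSeq P Q s t s' t' s'' :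
    exec P s t s' -> exec Q s' t' s'' -> exec (Seq P Q) s (t + t') s''
| ExecIf b P Q s t s' :
    exec (if eval_test s b then P else Q) s t s' -> exec (If b P Q) s t.+1 s'
| ExecWhileFalse b P s : ~~ eval_test s b -> exec (While b P) s 1 s
| ExecWhileTrue b P s t s' t' s'' :
    eval_test s b -> exec P s t s' -> exec (While b P) s' t' s'' ->
    exec (While b P) s (t + t').+1 s''.

End Semantics.

(* Word length c * ceil(log2 (n + 1)), i.e. Theta(log n). *)
Definition word_length (c n : nat) : nat := c * (trunc_log 2 n).+1.

(* Registers 0 and 1 hold n = size W and k; the memory holds the n letters of W
   followed by the n - k + 1 membership bits of Sk; everything else is 0. *)
Definition etfs_input (w : nat) (W : seq nat) (k : nat) (Sk : {fset nat}) : state :=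
  State (fun r => to_word w (nth 0 [:: size W; k] r))
        (fun i => to_word w
           (nth 0 (W ++ [seq nat_of_bool (p \in Sk) | p <- positions k W]) i)).

(* Register 0 holds the length of the output, whose letters are stored from
   address 0 on. *)
Definition string_output (s : state) : seq nat := mkseq (mem s) (regs s 0).

Import GRing.Theory.
Local Open Scope ring_scope.

Definition logb (R : realType) (b x : R) : R := ln x / ln b.

(* Main.v *)
(* A string is feasible iff its factor windows (its windows of length k that occur in W)
   are the non-sensitive patterns of W, in order; other windows are unconstrained.  For a
   position x let T_x be the set of strings that begin with the window of W at x and whose
   factor windows are that window and the non-sensitive patterns to its right, and A_x the
   strings with the same factor windows.  Let x' be the next non-sensitive position.
   Processing W from right to left one computes
     D_x(s): least distance to W[s..] of a string in T_x without its first k letters,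
     V_x,y(j): the same for W[j..] with the last y of these letters put back,
     K_x(j): least distance of a string in A_x to W[j..].
   After the window at x, an optimal string either overlaps it with the pattern of x'
   (V_x',d), or copies a factor of W and then starts the pattern of x' (V_x',k), or copies a
   factor of W and inserts or substitutes a # (1 + K_x'): the first deviation from copying
   costs at least 1, the price of a #, and a # in its place leaves the continuation
   unconstrained.  Likewise an optimal string for K_x(j) copies fewer than k letters before
   the window at x or a #.  Which lengths may be copied depends on windows of W that
   straddle the seams; these are found by propagating, in the tree of longest common
   prefixes, one bit vector of length k + 1 per node.

   V_x,y is an edit distance table, so consecutive entries of a column differ by at most 1.
   With tau = Theta(log n), blocks of tau entries are encoded in one word, and tables of size
   O(n) give the step to the next column and the minimum of a block under a mask.  This
   yields n^2 (k / tau + 2) word operations, and log_sigma n <= log_2 n as sigma >= 2.  An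
   optimal string is then read off in O(n k) steps. *)
Require Import Defs.
From mathcomp Require Import all_boot all_order all_algebra finmap.
From mathcomp Require Import reals exp.
From mathcomp Require Import zify ring.
From Stdlib Require PeanoNat FunctionalExtensionality.

Set Implicit Arguments.
Unset Strict Implicit.
Unset Printing Implicit Defensive.

Local Open Scope nat_scope.
Local Notation smem := Defs.mem.

(** * Edit distance *)

(** The mathematics and the machine are kept apart. The algorithm is a list of 35 tables, each entry
    given by an expression over entries filled earlier; one compiler turns such a list into nested
    loops, and one generic theorem shows that the final memory satisfies the defining equation of
    every entry. About the machine it remains to show that lookups respect the filling order, that
    values do not overflow, and how many entries there are. Two devices serve this. Indices are
    reduced modulo S and entries modulo Q - 1, so that running is safe whatever the entries mean;
    that this changes nothing is proved afterwards. A minimum is stored with its choice as value * S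
    + code, code < S, so that one comparison yields both; the code is also the state from which the
    reading of an optimal string continues.

    One vector per tree node suffices because a window that straddles a seam may occur in W at any p
    that shares the l copied letters with s. By the ultrametric inequality this sharing is an
    equivalence relation, and its classes are connected in the tree whose parents are the closest
    earlier positions. *)

Fixpoint lev (u : seq nat) : seq nat -> nat :=
  fix lev_u (v : seq nat) : nat :=
  match u, v with
  | [::], _ => size v
  | _, [::] => size u
  | a :: u', b :: v' =>
      minn (minn (lev u' v).+1 (lev_u v').+1) (lev u' v' + (a != b))
  end.

Arguments lev : simpl never.

Lemma lev0s v : lev [::] v = size v. Proof. by case: v. Qed.
Lemma levs0 u : lev u [::] = size u. Proof. by case: u. Qed.
Lemma lev_cons a u b v : lev (a :: u) (b :: v) =
  minn (minn (lev u (b :: v)).+1 (lev (a :: u) v).+1) (lev u v + (a != b)).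
Proof. by []. Qed.

Lemma lev_insl a u v : lev (a :: u) v <= (lev u v).+1.
Proof. by case: v => [|b v]; rewrite ?levs0 // lev_cons !geq_min leqnn. Qed.

Lemma lev_insr u b v : lev u (b :: v) <= (lev u v).+1.
Proof.
by case: u => [|a u]; rewrite ?lev0s // lev_cons !geq_min leqnn orbT.
Qed.

Lemma lev_del u a b v :
  lev u v <= (lev (a :: u) v).+1 /\ lev u v <= (lev u (b :: v)).+1.
Proof.
elim: u v a b => [|c u IHu].
  elim=> [|d v IHv] a b; split; rewrite ?lev0s ?levs0 //=; try lia.
  have [h _] := IHv a b.
  by move: h; rewrite lev_cons !lev0s /=; lia.
elim=> [|d v IHv] a b; split; rewrite ?levs0 //=; try lia.
- by have [_ h] := IHu [::] c b; have := lev_insr u b [::];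
    move: h; rewrite lev_cons !levs0 /=; lia.
- have [h1 h2] := IHv a d; have h4 := lev_insl c u (d :: v).
  have [h3 _] := IHu (d :: v) c d; have h5 := lev_insr (c :: u) d v.
  by rewrite (lev_cons a); lia.
- have [_ h2] := IHv a d; have [_ h3] := IHu (d :: v) c b.
  have h4 := lev_insl c u (d :: v); have h5 := lev_insr (c :: u) d v.
  by rewrite (lev_cons c u b); lia.
Qed.

Lemma lev_dell a u v : lev u v <= (lev (a :: u) v).+1.
Proof. by case: (lev_del u a 0 v). Qed.

Lemma lev_delr u b v : lev u v <= (lev u (b :: v)).+1.
Proof. by case: (lev_del u 0 b v). Qed.

Lemma lev_match a u b v : lev (a :: u) (b :: v) <= lev u v + (a != b).
Proof. by rewrite lev_cons geq_min leqnn orbT. Qed.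

Lemma lev_same s u v : lev (s ++ u) (s ++ v) <= lev u v.
Proof.
elim: s => //= a s IH; apply: leq_trans (lev_match _ _ _ _) _.
by rewrite eqxx addn0.
Qed.

Lemma lev_subst x y B Z : lev (x :: B) Z <= (lev (y :: B) Z).+1.
Proof.
elim: Z => [|z Z IH]; first by rewrite !levs0.
have h1 := lev_dell y B Z; have h2 := lev_delr B z Z.
rewrite !lev_cons; move: IH.
by case: (x != z); case: (y != z); lia.
Qed.

(** Carries a change by at most one below a common first letter, so that an edit step in the middle
    of a string reduces to one at its head. *)
Lemma lev_congr a U V : (forall Z, lev U Z <= (lev V Z).+1) ->
  forall Z, lev (a :: U) Z <= (lev (a :: V) Z).+1.
Proof.
move=> h; elim=> [|z Z IH].
  by have := h [::]; rewrite !levs0.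
have h1 := h (z :: Z); have h2 := h Z.
by rewrite !lev_cons; lia.
Qed.

Lemma lev_step U V : edit_step U V -> forall Z, lev U Z <= (lev V Z).+1.
Proof.
case=> A B x => [||y]; elim: A => [|a A IH] /= Z; try exact: lev_congr IH Z.
- exact: lev_dell.
- exact: lev_insl.
- exact: lev_subst.
Qed.

Lemma lev_path m U V : edit_path m U V -> lev U V <= m.
Proof.
elim=> [X|{}m X Y Z st _ IH].
  by have := lev_same X [::] [::]; rewrite cats0.
by apply: leq_trans (lev_step st Z) _.
Qed.

Lemma edit_path_cons a m U V : edit_path m U V -> edit_path m (a :: U) (a :: V).
Proof.
elim=> [X|{}m X Y Z st _ IH]; first exact: EditNil.
apply: EditCons IH; case: st => A B x => [||y].
- exact: (@EditInsert (a :: A)).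
- exact: (@EditDelete (a :: A)).
- exact: (@EditSubst (a :: A)).
Qed.

Lemma lev_edit_path U V : edit_path (lev U V) U V.
Proof.
elim: U V => [|a U IHU]; elim=> [|b V IHV].
- exact: EditNil.
- rewrite lev0s in IHV *; apply: EditCons (@EditInsert [::] [::] b) _ => /=.
  by apply: edit_path_cons.
- rewrite levs0; apply: EditCons (@EditDelete [::] U a) _.
  by have := IHU [::]; rewrite levs0.
- rewrite lev_cons.
  case: (leqP (minn (lev U (b :: V)).+1 (lev (a :: U) V).+1)
              (lev U V + (a != b))) => [_|_].
    case: (leqP (lev U (b :: V)).+1 (lev (a :: U) V).+1) => _.
      exact: EditCons (@EditDelete [::] U a) (IHU _).
    exact: EditCons (@EditInsert [::] (a :: U) b) (edit_path_cons b IHV).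
  case: eqP => [<-|_] /=; first by rewrite addn0; apply: edit_path_cons.
  by rewrite addn1; apply: EditCons (@EditSubst [::] U a b) (edit_path_cons b (IHU V)).
Qed.

Lemma lev_drop1 u W j : j < size W ->
  lev u (drop j W) <= (lev u (drop j.+1 W)).+1 /\
  lev u (drop j.+1 W) <= (lev u (drop j W)).+1.
Proof. by move=> h; rewrite (drop_nth 0 h) lev_insr lev_delr. Qed.

(** * Factor windows *)

Section Factors.
Variables (W : seq nat) (k : nat).

Definition isF (u : seq nat) : bool :=
  u \in [seq window k p W | p <- positions k W].

(** Near the end of the string [take k s] is shorter than [k]; such a truncated window is never
    counted, since [isF] only accepts strings of length exactly [k]. *)
Fixpoint fw (s : seq nat) : seq (seq nat) :=
  if s is _ :: s' then
    (if isF (take k s) then [:: take k s] else [::]) ++ fw s'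
  else [::].

(* No window that starts inside A is a factor of W, in the string A ++ B. *)
Fixpoint nof (A B : seq nat) : bool :=
  if A is _ :: A' then ~~ isF (take k (A ++ B)) && nof A' B else true.

Definition factor (s l : nat) : seq nat := take l (drop s W).

Lemma isFP u :
  reflect (exists2 p, p + k <= size W & window k p W = u) (isF u).
Proof.
apply: (iffP mapP) => [[p]|[p hp <-]].
  by rewrite mem_iota => hp ->; exists p => //; lia.
by exists p => //; rewrite mem_iota; lia.
Qed.

Lemma size_window p : p + k <= size W -> size (window k p W) = k.
Proof. by move=> h; rewrite size_take size_drop; case: ltnP; lia. Qed.

Lemma isF_size u : isF u -> size u = k.
Proof. by case/isFP=> p hp <-; apply: size_window. Qed.

Lemma size_sub s l : s + l <= size W -> size (factor s l) = l.
Proof. by move=> h; rewrite size_take size_drop; case: ltnP; lia. Qed.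

Lemma sub_cat s l m : s + l + m <= size W -> factor s l ++ factor (s + l) m = factor s (l + m).
Proof. by move=> h; rewrite /factor takeD drop_drop (addnC s). Qed.

Lemma sub_rcons s l : s + l < size W ->
  factor s l.+1 = rcons (factor s l) (nth 0 W (s + l)).
Proof.
move=> h; rewrite -addn1 -sub_cat; last by lia.
by rewrite /factor (drop_nth 0 h) /= take0 cats1.
Qed.

Lemma drop_sub s l : s + l <= size W -> drop s W = factor s l ++ drop (s + l) W.
Proof. by move=> h; rewrite -{1}(cat_take_drop l (drop s W)) drop_drop addnC. Qed.

Lemma isF_sub s : s + k <= size W -> isF (factor s k).
Proof. by move=> h; apply/isFP; exists s. Qed.

Hypothesis k_gt1 : 1 < k.
Hypothesis kW : k < size W.
Hypothesis W_pos : forall x, x \in W -> 0 < x.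

Lemma isF_pos u : isF u -> 0 \notin u.
Proof.
case/isFP=> p _ <-; apply/negP=> /mem_take /mem_drop /W_pos; lia.
Qed.

Lemma fw_cat A B : nof A B -> fw (A ++ B) = fw B.
Proof. by elim: A => //= a A IH /andP[/negPf-> /IH]. Qed.

Lemma nof_cat A1 A2 B : nof (A1 ++ A2) B = nof A1 (A2 ++ B) && nof A2 B.
Proof. by elim: A1 => //= a A1 ->; rewrite catA andbA. Qed.

(** A window that starts inside [A] reaches at most [k - 1] letters into what follows. *)
Lemma nof_take A B C : take k.-1 B = take k.-1 C -> nof A B = nof A C.
Proof.
move=> e; elim: A => //= a A ->; congr (~~ isF _ && _).
have -> : k = k.-1.+1 by lia.
rewrite /= !take_cat; case: ltnP => // h; congr (_ :: (_ ++ _)).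
by rewrite -(take_takel B (leq_subr (size A) k.-1)) e take_takel // leq_subr.
Qed.

(** Cutting off the continuation leaves a window unchanged or truncates it, and a truncated window
    is too short to be a factor window. *)
Lemma nof_weak A B C : nof A (B ++ C) -> nof A B.
Proof.
elim: A => //= a A IH /andP[h /IH->]; rewrite andbT.
apply: contra h => h; have := isF_size h.
rewrite size_take; case: ltnP => [h1 _|h1 h2].
  by move: h; rewrite -!cat_cons catA (takel_cat _ (ltnW h1)).
by move: h; rewrite take_oversize // -!cat_cons catA take_size_cat.
Qed.

(** A window that reaches the # contains 0, which no factor does, as the letters of W are positive;
    the other windows do not see what follows [A]. *)
Lemma nof_hash A z : nof A [::] -> nof A (hash :: z).
Proof.
elim: A => //= a A IH /andP[h /IH->]; rewrite andbT.
apply: contra h => h; have := isF_pos h; move: h.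
rewrite -!cat_cons cats0 take_cat; case: ltnP => // h1 h2.
case e: (k - size (a :: A)) => [|m]; last by rewrite mem_cat /= [X in _ || X]inE eqxx orbT.
by move: h2; rewrite e take0 cats0 take_oversize.
Qed.

Lemma fw_hash z : fw (hash :: z) = fw z.
Proof.
rewrite /=; case h: (isF _) => //.
have := isF_pos h; have -> : k = k.-1.+1 by lia.
by rewrite (_ : take _ _ = hash :: take k.-1 z) // inE eqxx.
Qed.

Lemma fw_split s p ps : fw s = p :: ps -> exists A B,
  [/\ s = A ++ B, nof A B, take k B = p, isF p & fw B = p :: ps].
Proof.
elim: s => //= a s IH; case h: (isF _) => /=.
  by case=> <- e; exists [::], (a :: s); split=> //=; rewrite h -e.
move=> /IH[A [B [e n1 n2 n3 n4]]]; exists (a :: A), B; split=> //=; rewrite ?e //.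
by rewrite -e h.
Qed.

Lemma fw_nil s : fw s = [::] -> nof s [::].
Proof.
elim: s => //= a s IH; case: ifP => //= h /IH ->.
by rewrite cats0 h.
Qed.

(** A copied factor of length at least [k] begins with a window of W. *)
Lemma nof_sub_lt s l A B : s + l <= size W -> nof (A ++ factor s l) B -> l < k.
Proof.
rewrite ltnNge => h; rewrite nof_cat => /andP[_ h1]; apply/negP => h2.
have hs := size_sub h; move: h1; case e: (factor s l) => [|a t] /=.
  by move: hs; rewrite e /=; lia.
rewrite -cat_cons -e => /andP[/negP[]].
rewrite takel_cat ?hs // take_takel //.
by apply: isF_sub; lia.
Qed.

Variable Sk : {fset nat}.

(* Stage 0 is the end of W; stage x >= 1 stands for the position size W - k + 1 - x. *)
Definition qpos (x : nat) : nat := if x == 0 then size W else size W - k + 1 - x.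
Definition pat (x : nat) : seq nat := window k (qpos x) W.

(* The next non-sensitive position to the right, as a stage. *)
Fixpoint pvs (x : nat) : nat :=
  if x is x'.+1 then
    if (0 < x') && (qpos x' \notin Sk) then x' else pvs x'
  else 0.

(** Stages count positions from the right, so [rev] restores the order of W. *)
Definition tailp (x : nat) : seq (seq nat) :=
  [seq pat y | y <- rev [seq y <- iota 1 x.-1 | qpos y \notin Sk]].
Definition pats (x : nat) : seq (seq nat) :=
  if x == 0 then [::] else pat x :: tailp x.

Lemma pvsS x :
  pvs x.+1 = if (0 < x) && (qpos x \notin Sk) then x else pvs x.
Proof. by []. Qed.

Lemma tailp_pats x : tailp x = pats (pvs x).
Proof.
elim: x => // -[|x] IH //; rewrite pvsS; move: IH; rewrite /tailp => IH.
have -> : iota 1 x.+2.-1 = iota 1 x ++ [:: x.+1].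
  have e : x.+2.-1 = x + 1 by rewrite addn1.
  by rewrite e iotaD add1n.
rewrite filter_cat rev_cat map_cat ltn0Sn andTb [filter _ [:: _]]/=.
by case: ifP => _; [rewrite /= | exact: IH].
Qed.

Lemma pvs_lt x : 0 < x -> pvs x < x.
Proof. by elim: x => //= -[|x] IH _ //=; case: ifP => // _; apply: leqW; apply: IH. Qed.

(** Stage 0 has the empty pattern and admits only the empty string; the end of the output is thereby
    treated as one more pattern to be entered. *)
Definition T x u := if x == 0 then u = [::] else take k u = pat x /\ fw u = pats x.
Definition Az x z := fw z = pats x.

Lemma pat_isF x : 0 < x <= size W - k + 1 -> isF (pat x).
Proof. by move=> h; apply/isFP; exists (qpos x); rewrite // /qpos; case: eqP; lia. Qed.

Lemma size_pat x : 0 < x <= size W - k + 1 -> size (pat x) = k.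
Proof. by move=> h; rewrite (isF_size (pat_isF h)). Qed.

Lemma pat0 : pat 0 = [::].
Proof. by rewrite /pat /window /qpos eqxx drop_size. Qed.

Lemma T_fw x u : T x u -> fw u = pats x.
Proof. by rewrite /T /pats; case: eqP => _ => [->|[]]. Qed.

Lemma T_pat x u : x <= size W - k + 1 -> T x u -> u = pat x ++ drop k u.
Proof.
rewrite /T; case: eqP => [->|h0] h; first by move=> ->; rewrite pat0.
by case=> e _; rewrite -e cat_take_drop.
Qed.

Lemma T_take x u : T x u -> take k.-1 u = take k.-1 (pat x).
Proof.
rewrite /T; case: eqP => [->->|h0 [<- _]]; first by rewrite pat0.
by rewrite take_takel //; lia.
Qed.

Lemma T_behead x u : 0 < x <= size W - k + 1 -> T x u ->
  fw (behead u) = pats (pvs x).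
Proof.
move=> hx; rewrite /T -tailp_pats /pats; case: eqP => [|_ [e]]; first by lia.
have hF := pat_isF hx.
case: u e => [|a u] e /=; first by move: (isF_size hF); rewrite -e /=; lia.
by rewrite e hF => -[].
Qed.

Lemma T_intro x z : 0 < x <= size W - k + 1 ->
  fw (behead (pat x) ++ z) = pats (pvs x) -> T x (pat x ++ z).
Proof.
move=> hx e; rewrite /T; case: eqP => [|_]; first by lia.
have hF := pat_isF hx; have hs := isF_size hF.
rewrite take_size_cat //; split=> //.
move: e hs hF; rewrite -tailp_pats /pats; case: (x =P 0) => [|_]; first by lia.
case: (pat x) => [|a t]; first by move=> _ /=; lia.
move=> /= e hs hF; rewrite -cat_cons.
by rewrite take_size_cat // hF /= e.
Qed.

(** The cut is made at the first factor window. What precedes sees only the first [k - 1] letters of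
    the rest, which are those of the pattern. *)
Lemma Az_split x z : x <= size W - k + 1 -> Az x z -> exists A u,
  [/\ z = A ++ u, nof A (pat x) & T x u].
Proof.
rewrite /Az /T /pats; case: eqP => [->|h0] h.
  by move=> /fw_nil h1; exists z, [::]; rewrite cats0 pat0.
move=> /fw_split[A [B [-> h1 h2 _ h4]]]; exists A, B; split=> //.
by rewrite (@nof_take _ _ B) // -h2 take_takel //; lia.
Qed.

Lemma nof_T A x u : T x u -> nof A (pat x) = nof A u.
Proof. by move=> h; apply: nof_take; rewrite (T_take h). Qed.

(* The pattern of the next stage may start d positions after that of stage x. *)
Definition ovl x d :=
  (pat x == take d (pat x) ++ take (k - d) (pat (pvs x))) &&
  nof (behead (take d (pat x))) (pat (pvs x)).
(** After the pattern of stage [x] the factor of length [l] at [s] is copied: [dir] if the next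
    pattern follows at once, [fok] if nothing (or a #) follows; [bok] concerns a factor copied in
    front of the pattern. [behead] exempts the window that is the pattern itself. *)
Definition dir x s l := nof (behead (pat x) ++ factor s l) (pat (pvs x)).
Definition fok x s l := nof (behead (pat x) ++ factor s l) [::].
Definition bok x j l := nof (factor j l) (pat x).

(** * Strings assembled from patterns, copied factors and # *)

Lemma comp_ovl x d u : 0 < x <= size W - k + 1 -> 0 < d < k -> ovl x d ->
  T (pvs x) u -> T x (take d (pat x) ++ u) /\
  drop k (take d (pat x) ++ u) = drop (k - d) u.
Proof.
move=> hx hd /andP[/eqP e h] hu.
have hs := size_pat hx.
have hp : pvs x <= size W - k + 1 by have := @pvs_lt x; lia.
have hd' : size (take d (pat x)) = d by rewrite size_take; case: ltnP; lia.
have hk : take k (take d (pat x) ++ u) = pat x.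
  rewrite take_cat hd' ltnNge ltnW /=; last by lia.
  rewrite [in RHS]e; congr (_ ++ _).
  by rewrite -(@take_takel _ _ k.-1 u) ?(T_take hu) ?take_takel //; lia.
split; last by rewrite drop_cat hd' ltnNge ltnW //; lia.
have eu : take d (pat x) ++ u = pat x ++ drop k (take d (pat x) ++ u).
  by rewrite -[in LHS](cat_take_drop k (_ ++ u)) hk.
rewrite eu; apply: T_intro => //.
have -> : behead (pat x) ++ drop k (take d (pat x) ++ u) =
          behead (take d (pat x)) ++ u.
  transitivity (behead (take d (pat x) ++ u)).
    by rewrite [in RHS]eu; case: (pat x) hs => //=; lia.
  by case: (take d _) hd' => //=; lia.
by rewrite fw_cat ?(T_fw hu) // -(nof_T _ hu).
Qed.

Lemma comp_dir x s l u : 0 < x <= size W - k + 1 -> dir x s l ->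
  T (pvs x) u -> T x (pat x ++ factor s l ++ u).
Proof.
move=> hx h hu; apply: T_intro => //; rewrite catA fw_cat ?(T_fw hu) //.
by rewrite -(nof_T _ hu).
Qed.

Lemma comp_hash x s l z : 0 < x <= size W - k + 1 -> fok x s l ->
  Az (pvs x) z -> T x (pat x ++ factor s l ++ hash :: z).
Proof.
move=> hx h hz; apply: T_intro => //; rewrite catA fw_cat.
  by rewrite fw_hash.
exact: nof_hash.
Qed.

Lemma comp_bok x j l u : bok x j l -> T x u -> Az x (factor j l ++ u).
Proof. by move=> h hu; rewrite /Az fw_cat ?(T_fw hu) // -(nof_T _ hu). Qed.

Lemma nof_short A : size A < k -> nof A [::].
Proof.
elim: A => //= a t IH h; rewrite IH ?andbT; last by lia.
by apply/negP => /isF_size; rewrite cats0 size_take /=; case: ltnP; lia.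
Qed.

Lemma comp_bhash x j l z : l < k -> Az x z -> Az x (factor j l ++ hash :: z).
Proof.
move=> h hz; rewrite /Az fw_cat ?fw_hash //; apply/nof_hash/nof_short.
by rewrite /factor size_take_min; lia.
Qed.

(** * Lower bounds *)

Section Lower.
Variables (x : nat) (D V' K' : nat -> nat).
Hypothesis hx : 0 < x <= size W - k + 1.
Local Notation x' := (pvs x).

Hypothesis hV : forall t u, t <= size W -> T x' u -> V' t <= lev u (drop t W).
Hypothesis hK : forall t z, t <= size W -> Az x' z -> K' t <= lev z (drop t W).
Hypothesis hovl : forall d s u, 0 < d < k -> ovl x d -> s <= size W -> T x' u ->
  D s <= lev (drop (k - d) u) (drop s W).
Hypothesis hdir : forall s l, s + l <= size W -> dir x s l -> D s <= V' (s + l).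
Hypothesis hhash0 : forall s, s <= size W -> D s <= (K' s).+1.
Hypothesis hhash : forall s l, s + l < size W -> fok x s l ->
  D s <= (K' (s + l.+1)).+1.

(** The induction on [Y] carries the number [l] of letters copied so far at no cost. Only a match
    extends it; the other three cases of the recurrence are absorbed by the bounds on [K'], as
    [Y ++ u] and its suffixes that contain [u] lie in [Az]. *)
Lemma D_lower_copy Y s l u : s + l <= size W -> T x' u ->
  nof (behead (pat x) ++ factor s l ++ Y) u ->
  D s <= lev (Y ++ u) (drop (s + l) W).
Proof.
move=> hs hu; have hxp : x' <= size W - k + 1 by have := @pvs_lt x; lia.
elim: Y l hs => [|c Y IH] l hs h.
  apply: leq_trans (hV hs hu); apply: hdir => //.
  by rewrite /dir (nof_T _ hu); move: h; rewrite cats0.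
have hf : fok x s l.
  by move: h; rewrite catA nof_cat => /andP[/(@nof_weak _ [::])].
have hz : Az x' (Y ++ u).
  move: h; rewrite catA nof_cat => /andP[_]; rewrite -cat1s nof_cat => /andP[_ h].
  by rewrite /Az fw_cat ?(T_fw hu).
have hz1 : Az x' ((c :: Y) ++ u).
  by move: h; rewrite catA nof_cat => /andP[_ h]; rewrite /Az fw_cat ?(T_fw hu).
(* An inserted letter is charged to a # that replaces the last copied letter, or to an inserted # if
   nothing has been copied yet. *)
have ins : D s <= (lev (Y ++ u) (drop (s + l) W)).+1.
  case: l {IH h} hs hf => [|l] hs hf.
    by rewrite addn0; apply: leq_trans (hhash0 _) _; rewrite ?ltnS ?hK //; lia.
  apply: leq_trans (@hhash s l _ _) _; first by lia.
    move: hf; rewrite /fok sub_rcons; last by lia.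
    by rewrite -cats1 catA nof_cat => /andP[/(@nof_weak _ [::])].
  by rewrite ltnS; apply: hK.
case: (ltnP (s + l) (size W)) => [hl|hl]; last first.
  have e : s + l = size W by lia.
  by move: ins; rewrite e drop_size !levs0 cat_cons /=.
have hh := @hhash s l hl hf; rewrite addnS in hh.
have K1 := hK hl hz; have K2 := hK hl hz1.
have K3 : c = nth 0 W (s + l) -> D s <= lev (Y ++ u) (drop (s + l).+1 W).
  move=> ec; rewrite -addnS; apply: IH; first by lia.
  by move: h; rewrite ec sub_rcons // cat_rcons.
move: ins K2; rewrite (drop_nth 0 hl) cat_cons !lev_cons => ins K2.
move: K3; case: (c =P _) => [e /(_ e)|_ _] /=; lia.
Qed.

Lemma D_lower s u : s <= size W -> T x u -> D s <= lev (drop k u) (drop s W).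
Proof.
move=> hs hu; have hxp : x' <= size W - k + 1 by have := @pvs_lt x; lia.
have hxle : x <= size W - k + 1 by lia.
have hb := T_behead hx hu.
have [A [u2 [e n1 n2]]] := Az_split hxp hb.
have eu := T_pat hxle hu; have hp := size_pat hx.
have [a [t ea]] : exists a t, pat x = a :: t.
  by case: (pat x) hp => [|a t] /=; [lia|exists a, t].
have eu2 : u = (a :: A) ++ u2.
  by rewrite cat_cons -e {1}eu ea /= {2}eu ea.
case: (ltnP (size A).+1 k) => hA.
  have ed : drop k u = drop (k - (size A).+1) u2.
    by rewrite eu2 drop_cat ltnNge ltnW.
  rewrite ed; apply: hovl => //.
  have ea2 : take (size A).+1 (pat x) = a :: A.
    have : take (size A).+1 u = a :: A by rewrite eu2 take_size_cat.
    by rewrite {1}eu takel_cat // hp ltnW.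
  rewrite /ovl ea2 /= n1 andbT; apply/eqP.
  have -> : pat x = take k u by rewrite {1}eu take_size_cat.
  rewrite [in LHS]eu2 take_cat ltnNge ltnW //=.
  congr (_ :: _ ++ _); rewrite -(@take_takel _ _ k.-1 u2); last by lia.
  by rewrite (T_take n2) take_takel //; lia.
have [Y eA] : exists Y, A = behead (pat x) ++ Y.
  exists (drop k.-1 A); rewrite -{1}(cat_take_drop k.-1 A); congr (_ ++ _).
  have : take k u = pat x by rewrite {1}eu take_size_cat.
  rewrite eu2 takel_cat // => <-.
  by have -> : k = k.-1.+1 by lia.
have -> : drop k u = Y ++ u2.
  have : u = pat x ++ (Y ++ u2) by rewrite eu2 eA ea /= -catA.
  by rewrite {1}eu => /eqP; rewrite eqseq_cat // => /andP[_ /eqP].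
rewrite -{2}(addn0 s); apply: D_lower_copy => //; rewrite ?addn0 //.
by rewrite /factor take0 -eA -(nof_T _ n2).
Qed.
End Lower.

Section LowerK.
Variables (x : nat) (V K : nat -> nat).
Hypothesis hx : x <= size W - k + 1.
Hypothesis hV : forall t u, t <= size W -> T x u -> V t <= lev u (drop t W).
Hypothesis hdir : forall j l, j + l <= size W -> bok x j l -> K j <= V (j + l).
Hypothesis hhash : forall j l, j + l < size W -> l < k ->
  K j <= (K (j + l.+1)).+1.

(** Here a # leads back to [K] itself at a later position, not to an earlier stage; hence an outer
    induction on the length of [z] plus that of the rest of W, around the induction over the copied
    letters. *)
Lemma K_lower j z : j <= size W -> Az x z -> K j <= lev z (drop j W).
Proof.
move: {2}(size z + (size W - j)) (leqnn (size z + (size W - j))) => m.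
elim: m j z => [|m IHm] j z hm hj hz.
  have [A [u [ez hA hu]]] := Az_split hx hz.
  case: z ez hm {hz} => // ez _; case: A ez hA => //= <- _ in hu *.
  have := @hdir j 0; rewrite addn0 => hh; apply: leq_trans (hh hj _) (hV hj hu).
  by rewrite /bok /factor take0.
have main Y l u : j + l <= size W -> T x u -> nof (factor j l ++ Y) u ->
    size (Y ++ u) + l <= size z ->
    K j <= lev (Y ++ u) (drop (j + l) W).
  elim: Y l => [|c Y IH] l hl hu h hsz.
    by apply: leq_trans (hV hl hu); apply: hdir => //; rewrite /bok (nof_T _ hu) -(cats0 (factor _ _)).
  have hlk : l < k.
    by move: h; rewrite nof_cat => /andP[h _]; apply: (@nof_sub_lt j l [::] _ hl h).
  have hz1 : Az x (Y ++ u).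
    move: h; rewrite nof_cat -cat1s nof_cat => /andP[_ /andP[_ h]].
    by rewrite /Az fw_cat ?(T_fw hu).
  have hz2 : Az x ((c :: Y) ++ u).
    by move: h; rewrite nof_cat => /andP[_ h]; rewrite /Az fw_cat ?(T_fw hu).
  have ins : K j <= (lev (Y ++ u) (drop (j + l) W)).+1.
    case: l {IH h} hl hsz hlk => [|l] hl hsz hlk.
      rewrite addn0; apply: leqW; apply: IHm => //.
      by move: hsz => /=; lia.
    apply: leq_trans (@hhash j l _ _) _; [lia|lia|rewrite ltnS].
    by apply: IHm => //; move: hsz; rewrite /=; lia.
  case: (ltnP (j + l) (size W)) => [hl2|hl2]; last first.
    have e : j + l = size W by lia.
    by move: ins; rewrite e drop_size !levs0 cat_cons /=.
  have hh := @hhash j l hl2 hlk; rewrite addnS in hh.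
  have K1 : K (j + l).+1 <= lev (Y ++ u) (drop (j + l).+1 W).
    by apply: IHm => //; move: hsz; rewrite /=; lia.
  have K2 : K (j + l).+1 <= lev ((c :: Y) ++ u) (drop (j + l).+1 W).
    by apply: IHm => //; move: hsz; rewrite /=; lia.
  have K3 : c = nth 0 W (j + l) -> K j <= lev (Y ++ u) (drop (j + l).+1 W).
    move=> ec; rewrite -addnS; apply: IH => //; try lia.
    - by move: h; rewrite ec sub_rcons // cat_rcons.
    - by move: hsz => /=; lia.
  move: ins K2; rewrite (drop_nth 0 hl2) cat_cons !lev_cons => ins K2.
  move: K3; case: (c =P _) => [e /(_ e)|_ _] /=; lia.
have [A [u [ez hA hu]]] := Az_split hx hz.
rewrite ez -{2}(addn0 j); apply: main => //; rewrite ?addn0 //.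
  by rewrite /factor take0 -(nof_T _ hu).
by rewrite ez.
Qed.
End LowerK.

End Factors.

(** * Feasible strings *)

Section Feasible.
Variables (Sigma : {fset nat}) (W : seq nat) (k : nat) (Sk : {fset nat}).
Hypothesis inst : etfs_instance Sigma W k Sk.

Let k_gt1 : 1 < k.
Proof. by have /andP[] := etfs_k_bounds inst. Qed.
Let kW : k < size W.
Proof. by have /andP[] := etfs_k_bounds inst. Qed.

Lemma etfs_W_pos x : x \in W -> 0 < x.
Proof. by move=> h; apply: (etfs_alphabet_pos inst); apply: (etfs_string inst). Qed.

Lemma fw_windows X :
  fw W k X = [seq w <- [seq window k p X | p <- positions k X] | isF W k w].
Proof.
elim: X => [|a X IH].
  by rewrite /positions /=; have -> : 1 - k = 0 by lia.
rewrite [LHS]/= IH /positions; case: (leqP k (size (a :: X))) => h.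
  have -> : (size (a :: X)).+1 - k = ((size X).+1 - k).+1 by move: h => /=; lia.
  rewrite [iota 0 _.+1]/= map_cons -[1]/(1 + 0) iotaDl -map_comp /=.
  by rewrite {1 2}/window drop0; case: ifP.
have -> : (size (a :: X)).+1 - k = 0 by move: h => /=; lia.
have -> : (size X).+1 - k = 0 by move: h => /=; lia.
case hF: (isF _ _ _) => //; have := isF_size hF.
by rewrite size_take_min; lia.
Qed.

Lemma sensitive_isF w : sensitive W k Sk w -> isF W k w.
Proof. by case/hasP=> p hp /andP[_ /eqP <-]; apply: map_f. Qed.

Lemma nonsensitive_isF w : nonsensitive W k Sk w -> isF W k w.
Proof. by case/hasP=> p hp /andP[_ /eqP <-]; apply: map_f. Qed.

Lemma isF_nonsens w : isF W k w -> ~~ sensitive W k Sk w -> nonsensitive W k Sk w.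
Proof.
case/mapP=> p hp -> /hasPn h; apply/hasP; exists p => //.
by have := h p hp; rewrite eqxx !andbT.
Qed.

Lemma sens_window p : p \in positions k W ->
  sensitive W k Sk (window k p W) = (p \in Sk).
Proof.
move=> hp; apply/hasP/idP => [[i _ /andP[h /eqP e]]|h].
  by apply: (etfs_closed inst h) => //; rewrite e.
by exists p; rewrite // h eqxx.
Qed.

Lemma nonsens_window p : p \in positions k W ->
  nonsensitive W k Sk (window k p W) = (p \notin Sk).
Proof.
move=> hp; apply/hasP/idP => [[i hi /andP[h /eqP e]]|h].
  apply: contra h => h; apply: (etfs_closed inst h) => //.
by exists p; rewrite // h eqxx.
Qed.

(** Stage [size W - k + 1] is position 0; one stage further, all positions lie to the right. *)
Definition goal_windows := tailp W k Sk (size W - k + 2).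

Lemma goal_windowsE :
  [seq window k p W | p <- nonsens_positions W k Sk W] = goal_windows.
Proof.
have -> : nonsens_positions W k Sk W = [seq p <- positions k W | p \notin Sk].
  by apply: eq_in_filter => p hp; apply: nonsens_window.
rewrite /goal_windows /tailp.
have -> : rev [seq y <- iota 1 (size W - k + 2).-1 | qpos W k y \notin Sk] =
   [seq y <- rev (iota 1 (size W - k + 1)) | qpos W k y \notin Sk].
  by rewrite filter_rev; congr (rev [seq _ <- iota _ _ | _]); lia.
have -> : positions k W =
    [seq qpos W k y | y <- rev (iota 1 (size W - k + 1))].
  have -> : positions k W = iota 0 (size W - k + 1) by congr iota; lia.
  apply: (@eq_from_nth _ 0); rewrite ?size_map ?size_rev ?size_iota // => i hi.
  rewrite nth_iota // (nth_map 0) ?size_rev ?size_iota // nth_rev ?size_iota //.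
  rewrite nth_iota; last by lia.
  by rewrite /qpos; case: eqP; lia.
by rewrite filter_map -map_comp.
Qed.

Lemma same_nonsensE X :
  same_nonsens W k Sk W X <->
  [seq window k p W | p <- nonsens_positions W k Sk W] =
  [seq window k p X | p <- nonsens_positions W k Sk X].
Proof.
rewrite /same_nonsens; split=> [[es h]|e].
  apply: (@eq_from_nth _ [::]); rewrite ?size_map // => i hi.
  by rewrite !(nth_map 0) -?es // h.
have es : size (nonsens_positions W k Sk W) = size (nonsens_positions W k Sk X).
  by have := congr1 size e; rewrite !size_map.
split=> // j hj; have := congr1 (fun s => nth [::] s j) e.
by rewrite !(nth_map 0) -?es.
Qed.

(** By (C1) every factor window of [X] is non-sensitive, so the windows compared by (P1) are all its
    factor windows. *)
Lemma feasible_fw X : etfs_feasible Sigma W k Sk X -> fw W k X = goal_windows.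
Proof.
case=> _ c1 /same_nonsensE; rewrite goal_windowsE => ->.
rewrite fw_windows filter_map; congr (map _ _); apply: eq_in_filter => p hp /=.
apply/idP/idP => h; first exact: isF_nonsens h (c1 _ hp).
exact: nonsensitive_isF h.
Qed.

(** A sensitive window of [X] would be a factor window, hence one of the listed patterns; the
    closure property of [Sk] makes sensitive and non-sensitive patterns disjoint. *)
Lemma fw_feasible X : string_over_hash Sigma X -> fw W k X = goal_windows ->
  etfs_feasible Sigma W k Sk X.
Proof.
move=> hX e; have c1 : cond_C1 W k Sk X.
  move=> p hp; apply/negP => h.
  have : window k p X \in fw W k X.
    by rewrite fw_windows mem_filter (sensitive_isF h) /=; apply: (map_f (fun p => window k p X)).
  rewrite e -goal_windowsE => /mapP[q]; rewrite mem_filter => /andP[hq hqp] ew.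
  by move: hq h; rewrite ew nonsens_window // sens_window // => /negP.
split=> //; apply/same_nonsensE; rewrite goal_windowsE -e fw_windows filter_map.
congr (map _ _); apply: eq_in_filter => p hp /=; apply/idP/idP => h.
  exact: isF_nonsens h (c1 _ hp).
exact: nonsensitive_isF h.
Qed.

Lemma solution_intro X : string_over_hash Sigma X -> fw W k X = goal_windows ->
  (forall Y, fw W k Y = goal_windows -> lev X W <= lev Y W) ->
  etfs_solution Sigma W k Sk X.
Proof.
move=> h1 h2 h3; split; first exact: fw_feasible.
move=> Y d e /feasible_fw /h3 h [_ hd] [he _].
exact: leq_trans (hd _ (lev_edit_path X W)) (leq_trans h (lev_path he)).
Qed.

End Feasible.

(** * Running programs within a time bound *)

Definition runs (w : nat) (P : program) (s : state) (T : nat)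
    (post : state -> Prop) : Prop :=
  exists t s', [/\ exec w P s t s', t <= T & post s'].

Lemma runs_weak w P s T T' (post post' : state -> Prop) :
  runs w P s T post -> T <= T' -> (forall s', post s' -> post' s') ->
  runs w P s T' post'.
Proof.
by case=> t [s' [h1 h2 h3]] hT h; exists t, s'; split; [|apply: leq_trans hT|apply: h].
Qed.

Lemma runs_seq w P1 P2 s T1 T2 (mid post : state -> Prop) :
  runs w P1 s T1 mid -> (forall s', mid s' -> runs w P2 s' T2 post) ->
  runs w (Seq P1 P2) s (T1 + T2) post.
Proof.
case=> t [s' [h1 h2 h3]] h; have [t' [s'' [h4 h5 h6]]] := h _ h3.
by exists (t + t'), s''; split; [apply: ExecSeq h1 h4|apply: leq_add|].
Qed.

Lemma runs_if w b P1 P2 s T1 T2 (post : state -> Prop) :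
  (eval_test w s b -> runs w P1 s T1 post) ->
  (~~ eval_test w s b -> runs w P2 s T2 post) ->
  runs w (If b P1 P2) s (maxn T1 T2).+1 post.
Proof.
move=> h1 h2; have e (c : bool) : eval_test w s b = c ->
    runs w (if c then P1 else P2) s (maxn T1 T2) post.
  case: c => hc; [have := h1 hc|have := h2 (negbT hc)] => h;
    by apply: runs_weak h _ _; rewrite ?leq_maxl ?leq_maxr.
have [t [s' [h3 h4 h5]]] := e _ erefl.
by exists t.+1, s'; split=> //; apply: ExecIf.
Qed.

Lemma runs_assign w r op x y s (post : state -> Prop) :
  post (State (update (regs s) r
    (eval_binop w op (eval_operand w s x) (eval_operand w s y))) (smem s)) ->
  runs w (Assign r op x y) s 1 post.
Proof. by move=> h; eexists 1, _; split; [apply: ExecAssign| |]. Qed.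

Lemma runs_read w r a s (post : state -> Prop) :
  post (State (update (regs s) r (smem s (eval_operand w s a))) (smem s)) ->
  runs w (Read r a) s 1 post.
Proof. by move=> h; eexists 1, _; split; [apply: ExecRead| |]. Qed.

Lemma runs_write w a x s (post : state -> Prop) :
  post (State (regs s)
    (update (smem s) (eval_operand w s a) (eval_operand w s x))) ->
  runs w (Write a x) s 1 post.
Proof. by move=> h; eexists 1, _; split; [apply: ExecWrite| |]. Qed.

Lemma runs_while w b P N T (I : nat -> state -> Prop) s :
  (forall i s', i < N -> I i s' -> eval_test w s' b /\ runs w P s' T (I i.+1)) ->
  (forall s', I N s' -> ~~ eval_test w s' b) -> I 0 s ->
  runs w (While b P) s (N * T.+1).+1 (I N).
Proof.
move=> hI hN; have main j s' : j <= N -> I (N - j) s' ->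
    runs w (While b P) s' (j * T.+1).+1 (I N).
  elim: j s' => [|j IH] s' hj hs.
    rewrite subn0 in hs; exists 1, s'; split=> //.
    by apply: ExecWhileFalse; apply: hN.
  have [ht hr] : eval_test w s' b /\ runs w P s' T (I (N - j.+1).+1).
    by apply: hI => //; lia.
  have [t [s1 [h1 h2 h3]]] := hr.
  have [|t' [s2 [h4 h5 h6]]] := IH s1 (ltnW hj).
    by have -> : N - j = (N - j.+1).+1 by lia.
  exists (t + t').+1, s2; split=> //; first exact: ExecWhileTrue h1 h4.
  by rewrite mulSn; lia.
by move=> h0; apply: main; rewrite ?subnn.
Qed.

Lemma update_eq f i v : update f i v i = v.
Proof. by rewrite /update eqxx. Qed.

Lemma update_neq f i v j : j != i -> update f i v j = f j.
Proof. by rewrite /update => /negPf ->. Qed.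

Lemma update_lt f i v j : j < i -> update f i v j = f j.
Proof. by move=> h; rewrite update_neq // neq_ltn h. Qed.

(** Induction by halving both numbers: the inequality holds for the parities and for the halves. *)
Lemma lor_le a b : Nat.lor a b <= a + b.
Proof.
move: {2}(a + b).+1 (leqnn (a + b).+1) => m; elim: m a b => // m IH a b hm.
case: (posnP (a + b)) => h.
  have ea : a = 0 by lia.
  have eb : b = 0 by lia.
  by rewrite ea eb PeanoNat.Nat.lor_0_l.
have hd x : (x = 2 * Nat.div2 x + PeanoNat.Nat.b2n (Nat.odd x)) by exact: PeanoNat.Nat.div2_odd.
have hl := hd (Nat.lor a b).
have h0 : Nat.odd (Nat.lor a b) = Nat.odd a || Nat.odd b.
  by rewrite -!PeanoNat.Nat.bit0_odd PeanoNat.Nat.lor_spec.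
have h2 : Nat.div2 (Nat.lor a b) = Nat.lor (Nat.div2 a) (Nat.div2 b).
  by apply: PeanoNat.Nat.bits_inj => i; rewrite PeanoNat.Nat.testbit_div2 !PeanoNat.Nat.lor_spec !PeanoNat.Nat.testbit_div2.
have ha := hd a; have hb := hd b.
rewrite h2 h0 in hl.
have : Nat.lor (Nat.div2 a) (Nat.div2 b) <= Nat.div2 a + Nat.div2 b.
  by apply: IH; move: ha hb; case: (Nat.odd a); case: (Nat.odd b) => /=; lia.
by move: ha hb hl; case: (Nat.odd a); case: (Nat.odd b) => /=; lia.
Qed.

Lemma land_le a b : Nat.land a b <= a.
Proof. by have := PeanoNat.Nat.land_le_l a b; lia. Qed.

Lemma runs_assign_seq w r op x y v P s T (post : state -> Prop) :
  eval_binop w op (eval_operand w s x) (eval_operand w s y) = v ->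
  (forall s', smem s' = smem s -> regs s' r = v ->
    (forall r', r' != r -> regs s' r' = regs s r') -> runs w P s' T post) ->
  runs w (Seq (Assign r op x y) P) s T.+1 post.
Proof.
move=> hv h; rewrite -add1n.
apply: runs_seq (_ : runs w _ s 1 (fun s' => [/\ smem s' = smem s, regs s' r = v &
  forall r', r' != r -> regs s' r' = regs s r'])) _ => [|s' [h1 h2 h3]]; last exact: h.
by apply: runs_assign; split=> //= [|r']; [rewrite update_eq|exact: update_neq].
Qed.

(** * Expressions over tables *)

Inductive aop := AAdd | AMul | ADiv | AMod | AAnd | AOr.

Definition binop_of o := match o with
  | AAdd => OpAdd | AMul => OpMul | ADiv => OpDiv | AMod => OpMod
  | AAnd => OpAnd | AOr => OpOr end.

Definition aopv o x y := match o with
  | AAdd => x + y | AMul => x * y | ADiv => x %/ y | AMod => x %% y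
  | AAnd => Nat.land x y | AOr => Nat.lor x y end.

(* [EL t a b c] is entry (a, b, c) of table t; [ES] is truncated subtraction and
   [EI q a b d e] is [if a = b then d else e] or [if a < b then d else e]. *)
Inductive expr :=
| EC of nat
| EV of nat
| EA of aop & expr & expr
| ES of expr & expr
| EI of bool & expr & expr & expr & expr
| EL of nat & expr & expr & expr.

(* Register 2 holds the side S of the table index space. *)
Definition rS := 2.

(* Registers below [nreg] are variables, the others are temporaries. *)
Definition nreg := 12.

(** The number with digits [t], [x], [y], [z] in base [S]. Reducing the coordinates keeps the
    address in bounds whatever the index expressions evaluate to. *)
Definition adr (S t x y z : nat) : nat :=
  ((t * S + x %% S) * S + y %% S) * S + z %% S.

Fixpoint eval (rho m : nat -> nat) (e : expr) : nat := match e with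
  | EC c => c
  | EV r => rho r
  | EA o a b => aopv o (eval rho m a) (eval rho m b)
  | ES a b => eval rho m a - eval rho m b
  | EI q a b d e => if (if q then eval rho m a == eval rho m b
                        else eval rho m a < eval rho m b)
                    then eval rho m d else eval rho m e
  | EL t a b c => m (adr (rho rS) t (eval rho m a) (eval rho m b) (eval rho m c))
  end.

(** Register [d] receives the value and the registers above it serve as an evaluation stack; those
    below stay untouched. Truncated subtraction needs a test because [OpSub] wraps around. *)
Fixpoint compile (e : expr) (d : nat) : program := match e with
  | EC c => Assign d OpAdd (Cst c) (Cst 0)
  | EV r => Assign d OpAdd (Reg r) (Cst 0)
  | EA o a b => Seq (compile a d) (Seq (compile b d.+1)
      (Assign d (binop_of o) (Reg d) (Reg d.+1)))
  | ES a b => Seq (compile a d) (Seq (compile b d.+1)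
      (If (TestLt (Reg d) (Reg d.+1)) (Assign d OpAdd (Cst 0) (Cst 0))
          (Assign d OpSub (Reg d) (Reg d.+1))))
  | EI q a b e1 e2 => Seq (compile a d) (Seq (compile b d.+1)
      (If (if q then TestEq (Reg d) (Reg d.+1) else TestLt (Reg d) (Reg d.+1))
          (compile e1 d) (compile e2 d)))
  | EL t a b c => Seq (compile a d) (Seq (compile b d.+1) (Seq (compile c d.+2)
      (Seq (Assign d OpMod (Reg d) (Reg rS))
      (Seq (Assign d.+1 OpMod (Reg d.+1) (Reg rS))
      (Seq (Assign d.+2 OpMod (Reg d.+2) (Reg rS))
      (Seq (Assign d.+3 OpMul (Cst t) (Reg rS))
      (Seq (Assign d OpAdd (Reg d.+3) (Reg d))
      (Seq (Assign d OpMul (Reg d) (Reg rS))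
      (Seq (Assign d OpAdd (Reg d) (Reg d.+1))
      (Seq (Assign d OpMul (Reg d) (Reg rS))
      (Seq (Assign d OpAdd (Reg d) (Reg d.+2))
           (Read d (Reg d)))))))))))))
  end.

Fixpoint cost (e : expr) : nat := match e with
  | EC _ | EV _ => 1
  | EA _ a b => cost a + (cost b + 1)
  | ES a b => cost a + (cost b + 2)
  | EI _ a b d e => cost a + (cost b + (maxn (cost d) (cost e)).+1)
  | EL _ a b c => cost a + (cost b + (cost c + 10))
  end.

(* The value of e is below Q ^ vdeg e, its intermediate results below Q ^ mdeg e. *)
Fixpoint vdeg (e : expr) : nat := match e with
  | EC _ | EV _ | EL _ _ _ _ => 1
  | EA (AAdd | AOr) a b => (maxn (vdeg a) (vdeg b)).+1
  | EA AMul a b => vdeg a + vdeg b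
  | EA _ a _ | ES a _ => vdeg a
  | EI _ _ _ d e => maxn (vdeg d) (vdeg e)
  end.

Fixpoint mdeg (e : expr) : nat := match e with
  | EC _ | EV _ => 2
  | EA _ a b => maxn (vdeg e) (maxn (mdeg a) (mdeg b))
  | ES a b => maxn (mdeg a) (mdeg b)
  | EI _ a b d e => maxn (maxn (mdeg a) (mdeg b)) (maxn (mdeg d) (mdeg e))
  | EL _ a b c => maxn 2 (maxn (mdeg a) (maxn (mdeg b) (mdeg c)))
  end.

Lemma vdeg_mdeg e : vdeg e <= mdeg e.
Proof.
elim: e => //= [o a _ b _|a IHa b _|q a _ b _ d IHd e IHe|t a _ b _ c _].
- exact: leq_maxl.
- by apply: leq_trans IHa (leq_maxl _ _).
- by lia.
- by rewrite leq_max.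
Qed.

(** Bounds the literals and the table numbers, so that [S ^ 3 * maxconst.+2] exceeds every literal
    and every address. *)
Definition maxconst := 100.

Fixpoint wfe (e : expr) : bool := match e with
  | EC c => c <= maxconst
  | EV r => r < nreg
  | EA _ a b | ES a b => wfe a && wfe b
  | EI _ a b d e => [&& wfe a, wfe b, wfe d & wfe e]
  | EL t a b c => [&& t <= maxconst, wfe a, wfe b & wfe c]
  end.

(** * Correctness of compiled expressions *)

Section Compile.
Variables (w Q S deg : nat).
Hypothesis S_pos : 0 < S.
Hypothesis QS : S ^ 3 * maxconst.+2 <= Q.
Hypothesis Qw : Q ^ deg <= 2 ^ w.

Let Q_gt1 : maxconst.+1 < Q.
Proof. by apply: leq_trans QS; rewrite -{1}(mul1n maxconst.+2) leq_pmul2r // expn_gt0 S_pos. Qed.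

Definition small s := (forall r, r < nreg -> regs s r < Q) /\
  (forall a, smem s a < Q) /\ regs s rS = S.

Lemma expQ i j : i <= j -> Q ^ i <= Q ^ j.
Proof. by move=> h; rewrite leq_pexp2l //; lia. Qed.

Lemma adr_lt t x y z : t <= maxconst -> adr S t x y z < Q ^ 2.
Proof.
move=> ht; rewrite /adr.
have hx := ltn_pmod x S_pos; have hy := ltn_pmod y S_pos; have hz := ltn_pmod z S_pos.
have step M u v : u < M -> v < S -> u * S + v < M * S.
  move=> h1 h2; apply: (@leq_trans (u.+1 * S)); last by rewrite leq_mul2r h1 orbT.
  by rewrite mulSn addnC ltn_add2r.
have ht' : t < maxconst.+2 by apply: leq_ltn_trans ht _.
apply: leq_trans (step _ _ _ (step _ _ _ (step _ _ _ ht' hx) hy) hz) _.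
apply: leq_trans (_ : Q <= _).
  by apply: leq_trans QS; rewrite !expnS expn0 muln1 [S * _ * _]mulnC !mulnA.
by rewrite expnS expn1 leq_pmull //; lia.
Qed.

Lemma eval_lt rho m e : (forall r, r < nreg -> rho r < Q) ->
  (forall a, m a < Q) -> wfe e -> eval rho m e < Q ^ vdeg e.
Proof.
move=> hr hm; have Q1 : Q = Q ^ 1 by rewrite expn1.
have pos i : 0 < Q ^ i by rewrite expn_gt0; lia.
have dbl i : Q ^ i + Q ^ i <= Q ^ i.+1 by rewrite expnS; have := pos i; nia.
elim: e => [c|r|o a IHa b IHb|a IHa b IHb|q a _ b _ d IHd e IHe|t a _ b _ c _] /=.
- by move=> h; rewrite expn1; lia.
- by move=> h; rewrite expn1 hr.
- move=> /andP[/IHa {}IHa /IHb {}IHb].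
  have mx1 : Q ^ vdeg a <= Q ^ maxn (vdeg a) (vdeg b) by rewrite expQ ?leq_maxl.
  have mx2 : Q ^ vdeg b <= Q ^ maxn (vdeg a) (vdeg b) by rewrite expQ ?leq_maxr.
  have d1 := dbl (maxn (vdeg a) (vdeg b)).
  case: o => /=.
  + by lia.
  + by rewrite expnD ltn_mul.
  + by apply: leq_ltn_trans (leq_div _ _) IHa.
  + by apply: leq_ltn_trans (leq_mod _ _) IHa.
  + by apply: leq_ltn_trans (land_le _ _) IHa.
  + by apply: leq_ltn_trans (lor_le _ _) _; lia.
- by move=> /andP[/IHa h _]; apply: leq_ltn_trans (leq_subr _ _) h.
- case/and4P=> _ _ /IHd {}IHd /IHe {}IHe.
  have mx1 : Q ^ vdeg d <= Q ^ maxn (vdeg d) (vdeg e) by rewrite expQ ?leq_maxl.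
  have mx2 : Q ^ vdeg e <= Q ^ maxn (vdeg d) (vdeg e) by rewrite expQ ?leq_maxr.
  by case: ifP => _; lia.
- by move=> _; rewrite expn1.
Qed.

Lemma eval_ext rho rho' m e : (forall r, r < nreg -> rho r = rho' r) ->
  wfe e -> eval rho m e = eval rho' m e.
Proof.
move=> h; elim: e => [c|r|o a IHa b IHb|a IHa b IHb|q a IHa b IHb d IHd e IHe|
  t a IHa b IHb c IHc] //=.
- exact: h.
- by case/andP=> /IHa-> /IHb->.
- by case/andP=> /IHa-> /IHb->.
- by case/and4P=> /IHa-> /IHb-> /IHd-> /IHe->.
- by case/and4P=> _ /IHa-> /IHb-> /IHc->; rewrite h.
Qed.

Lemma word_small x : x < Q ^ deg -> to_word w x = x.
Proof. by move=> h; rewrite /to_word modn_small //; apply: leq_trans Qw. Qed.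

Definition result s d v s' :=
  [/\ smem s' = smem s, forall r, r < d -> regs s' r = regs s r & regs s' d = v].

Lemma small_result s d v s' : nreg <= d -> small s -> result s d v s' -> small s'.
Proof.
move=> hd [h1 [h2 h3]] [e1 e2 _]; split; first by move=> r hr; rewrite e2 ?h1 //; lia.
by split=> [a|]; rewrite ?e1 // e2 ?h3 // /rS; move: hd; rewrite /nreg; lia.
Qed.

Lemma eval_result s d v s' e : nreg <= d -> wfe e -> result s d v s' ->
  eval (regs s') (smem s') e = eval (regs s) (smem s) e.
Proof.
by move=> hd hw [e1 e2 _]; rewrite e1; apply: eval_ext => // r hr; apply: e2; lia.
Qed.

(** The degree bounds every intermediate value by [Q ^ deg <= 2 ^ w], so no operation wraps around
    and machine arithmetic agrees with that of the naturals. *)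
Lemma comp_correct e d s : wfe e -> mdeg e <= deg -> nreg <= d -> small s ->
  runs w (compile e d) s (cost e) (result s d (eval (regs s) (smem s) e)).
Proof.
have expdeg i x : x < Q ^ i -> i <= deg -> x < Q ^ deg.
  by move=> h1 h2; apply: leq_trans h1 (expQ h2).
have ws x : 1 < deg -> x < Q -> to_word w x = x.
  move=> h1 h2; apply/word_small/(expdeg 1); rewrite ?expn1 //; exact: ltnW.
elim: e d s => [c|r|o a IHa b IHb|a IHa b IHb|q a IHa b IHb e1 IH1 e2 IH2|
  t a IHa b IHb c IHc] d s /= hwf hdeg hd hs.
- apply: runs_assign; split=> //= [r hr|]; first by rewrite update_lt.
  have hc : c < Q by lia.
  by rewrite update_eq /eval_binop /= (ws c) // (ws 0) ?addn0 ?(ws c) //; lia.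
- apply: runs_assign; split=> //= [r' hr|]; first by rewrite update_lt.
  case: hs => h _; have hc := h r hwf.
  by rewrite update_eq /eval_binop /= (ws 0) ?addn0 ?(ws (regs s r)) //; lia.
- case/andP: hwf => wa wb; move: hdeg; rewrite !geq_max => /and3P[hv ha hb].
  apply: runs_seq (IHa d s wa ha hd hs) _ => s1 r1.
  have hs1 := small_result hd hs r1.
  apply: runs_seq (IHb d.+1 s1 wb hb (leqW hd) hs1) _ => s2 r2.
  have eb := eval_result hd wb r1; rewrite eb in r2.
  case: r1 => m1 g1 v1; case: r2 => m2 g2 v2.
  apply: runs_assign; split=> /= [|r hr|]; first by rewrite m2.
    by rewrite update_lt // g2 ?g1 //; lia.
  rewrite update_eq v2 g2 // v1.
  have [hr [hm _]] := hs.
  have hb' := @eval_lt _ _ (EA o a b) hr hm; rewrite /= wa wb in hb'.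
  have := expdeg _ _ (hb' isT) hv; move=> h.
  by case: o {hv IHa IHb hb'} h => /= h; rewrite /eval_binop /= word_small.
- case/andP: hwf => wa wb; move: hdeg; rewrite !geq_max => /andP[ha hb].
  apply: runs_seq (IHa d s wa ha hd hs) _ => s1 r1.
  have hs1 := small_result hd hs r1.
  apply: runs_seq (IHb d.+1 s1 wb hb (leqW hd) hs1) _ => s2 r2.
  have eb := eval_result hd wb r1; rewrite eb in r2.
  case: r1 => m1 g1 v1; case: r2 => m2 g2 v2.
  have [hr [hm _]] := hs.
  have la : eval (regs s) (smem s) a < 2 ^ w.
    apply: leq_trans (eval_lt hr hm wa) (leq_trans (expQ _) Qw).
    exact: leq_trans (vdeg_mdeg a) ha.
  apply: (@runs_if _ _ _ _ _ 1 1) => /=; rewrite g2 // v1 v2 => hlt; apply: runs_assign;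
    split=> /= [|r hr'|]; rewrite ?m2 // ?update_eq.
  + by rewrite update_lt // g2 ?g1 //; lia.
  + by rewrite /eval_binop /to_word !mod0n; lia.
  + by rewrite update_lt // g2 ?g1 //; lia.
  + rewrite /= g2 // v1 v2 /eval_binop /to_word; rewrite -leqNgt in hlt.
    by rewrite -addnBA // modnDl modn_small //; lia.
- case/and4P: hwf => wa wb w1 w2; move: hdeg; rewrite !geq_max.
  case/andP=> /andP[ha hb] /andP[h1 h2].
  apply: runs_seq (IHa d s wa ha hd hs) _ => s1 r1.
  have hs1 := small_result hd hs r1.
  apply: runs_seq (IHb d.+1 s1 wb hb (leqW hd) hs1) _ => s2 r2.
  have eb := eval_result hd wb r1; rewrite eb in r2.
  have hs2 := small_result (leqW hd) hs1 r2.
  have e1' := eval_result (leqW hd) w1 r2; rewrite (eval_result hd w1 r1) in e1'.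
  have e2' := eval_result (leqW hd) w2 r2; rewrite (eval_result hd w2 r1) in e2'.
  have R1 := IH1 d s2 w1 h1 hd hs2; have R2 := IH2 d s2 w2 h2 hd hs2.
  rewrite e1' in R1; rewrite e2' in R2.
  case: r1 => m1 g1 v1; case: r2 => m2 g2 v2.
  have ev : eval_test w s2 (if q then TestEq (Reg d) (Reg d.+1) else
      TestLt (Reg d) (Reg d.+1)) = (if q then eval (regs s) (smem s) a ==
      eval (regs s) (smem s) b else eval (regs s) (smem s) a < eval (regs s) (smem s) b).
    by case: q {R1 R2} => /=; rewrite g2 // v1 v2.
  apply: runs_if; rewrite ev => hc.
  + rewrite hc; apply: runs_weak R1 _ _ => // s' [k1 k2 k3]; split=> //.
      by rewrite k1 m2.
    by move=> r hr; rewrite k2 // g2 ?g1 //; lia.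
  + rewrite (negPf hc); apply: runs_weak R2 _ _ => // s' [k1 k2 k3]; split=> //.
      by rewrite k1 m2.
    by move=> r hr; rewrite k2 // g2 ?g1 //; lia.
- case/and4P: hwf => ht wa wb wc; move: hdeg; rewrite !geq_max.
  case/and4P=> h2 ha hb hc.
  apply: runs_seq (IHa d s wa ha hd hs) _ => s1 r1.
  have hs1 := small_result hd hs r1.
  apply: runs_seq (IHb d.+1 s1 wb hb (leqW hd) hs1) _ => s2 r2.
  have hs2 := small_result (leqW hd) hs1 r2.
  apply: runs_seq (IHc d.+2 s2 wc hc (leqW (leqW hd)) hs2) _ => s3 r3.
  have hs3 := small_result (leqW (leqW hd)) hs2 r3.
  have eb := eval_result hd wb r1; rewrite eb in r2.
  have ec := eval_result (leqW hd) wc r2; rewrite (eval_result hd wc r1) in ec.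
  rewrite ec in r3.
  case: r1 => m1 g1 v1; case: r2 => m2 g2 v2; case: r3 => m3 g3 v3.
  have [_ [_ eS]] := hs3; have [_ [_ eS0]] := hs.
  have hdS : rS < d by move: hd; rewrite /nreg /rS; lia.
  have nS i : rS == d + i = false by apply/negbTE; rewrite neq_ltn; lia.
  have A := @adr_lt t (eval (regs s) (smem s) a) (eval (regs s) (smem s) b)
    (eval (regs s) (smem s) c) ht.
  have A' := leq_trans A (leq_trans (expQ h2) Qw).
  move: A'; rewrite /adr eS0; set xa := eval _ _ a; set xb := eval _ _ b; set xc := eval _ _ c => A'.
  have la := ltn_pmod xa S_pos; have lb := ltn_pmod xb S_pos; have lc := ltn_pmod xc S_pos.
  have SQ : S <= Q.
    apply: leq_trans QS; apply: (@leq_trans (S ^ 3)); last by rewrite leq_pmulr.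
    by rewrite -{1}(expn1 S) leq_pexp2l.
  have ST : S <= 2 ^ w.
    apply: leq_trans SQ (leq_trans _ Qw).
    by rewrite -{1}(expn1 Q) expQ // ltnW.
  have t5 := leq_ltn_trans (leq_addr _ _) A'.
  have t4 := leq_ltn_trans (leq_pmulr _ S_pos) t5.
  have t3 := leq_ltn_trans (leq_addr _ _) t4.
  have t2 := leq_ltn_trans (leq_pmulr _ S_pos) t3.
  have t1 := leq_ltn_trans (leq_addr _ _) t2.
  have ht0 := leq_ltn_trans (leq_pmulr _ S_pos) t1.
  have u0 : regs s3 d = xa by rewrite g3 // g2.
  have u1 : regs s3 d.+1 = xb by rewrite g3.
  have wm x : to_word w (x %% S) = x %% S.
    by rewrite /to_word modn_small //; apply: leq_trans (ltn_pmod _ S_pos) ST.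
  have wt x : x < 2 ^ w -> to_word w x = x by move=> h; rewrite /to_word modn_small.
  have ne i j : i < j -> (d + i != d + j) && (d + j != d + i) by lia.
  have := (ne 0 1 isT, ne 0 2 isT, ne 0 3 isT, ne 1 2 isT, ne 1 3 isT, ne 2 3 isT).
  rewrite addn0 addn1 addn2 addn3.
  case=> -[] [[]] [] /andP[n01 n10] /andP[n02 n20] /andP[n03 n30].
  move=> /andP[n12 n21] /andP[n13 n31] /andP[n23 n32].
  have [m0 [m1' [m2' m3']]] : rS != d /\ rS != d.+1 /\ rS != d.+2 /\ rS != d.+3.
    by split; [|split; [|split]]; apply/eqP; lia.
  apply: (runs_assign_seq (v := xa %% S)) => [|s4 q4 v4 f4].
    by rewrite /= u0 eS /eval_binop /=; apply: wm.
  have eS4 : regs s4 rS = S by rewrite f4.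
  apply: (runs_assign_seq (v := xb %% S)) => [|s5 q5 v5 f5].
    by rewrite /= f4 // u1 eS4 /eval_binop /=; apply: wm.
  have eS5 : regs s5 rS = S by rewrite f5.
  apply: (runs_assign_seq (v := xc %% S)) => [|s6 q6 v6 f6].
    by rewrite /= f5 // f4 // v3 eS5 /eval_binop /=; apply: wm.
  have eS6 : regs s6 rS = S by rewrite f6.
  apply: (runs_assign_seq (v := t * S)) => [|s7 q7 v7 f7].
    by rewrite /= eS6 /eval_binop /= (wt t) //; apply: wt.
  have eS7 : regs s7 rS = S by rewrite f7.
  apply: (runs_assign_seq (v := t * S + xa %% S)) => [|s8 q8 v8 f8].
    by rewrite /= v7 f7 // f6 // f5 // v4 /eval_binop /=; apply: wt.
  have eS8 : regs s8 rS = S by rewrite f8.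
  apply: (runs_assign_seq (v := (t * S + xa %% S) * S)) => [|s9 q9 v9 f9].
    rewrite /= v8 eS8 /eval_binop /=.
    exact: wt.
  have eS9 : regs s9 rS = S by rewrite f9.
  apply: (runs_assign_seq (v := (t * S + xa %% S) * S + xb %% S)) => [|s10 q10 v10 f10].
    by rewrite /= v9 f9 // f8 // f7 // f6 // v5 /eval_binop /=; apply: wt.
  have eS10 : regs s10 rS = S by rewrite f10.
  apply: (runs_assign_seq (v := ((t * S + xa %% S) * S + xb %% S) * S)) => [|s11 q11 v11 f11].
    by rewrite /= v10 eS10 /eval_binop /=; apply: wt.
  apply: (runs_assign_seq (v := ((t * S + xa %% S) * S + xb %% S) * S + xc %% S)) => [|s12 q12 v12 f12].
    rewrite /= v11 f11 // f10 // f9 // f8 // f7 // v6 /eval_binop /=.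
    exact: wt.
  have em : smem s12 = smem s.
    by rewrite q12 q11 q10 q9 q8 q7 q6 q5 q4 m3 m2 m1.
  apply: runs_read; split=> //= [r hr|]; last by rewrite update_eq v12 em.
  have nr i : r != d + i by lia.
  have := (nr 0, nr 1, nr 2, nr 3); rewrite addn0 addn1 addn2 addn3.
  case=> [[[r0 r1] r2] r3]; rewrite update_neq // f12 // f11 // f10 // f9 //.
  rewrite f8 // f7 // f6 // f5 // f4 //.
  by rewrite g3 ?g2 ?g1 //; lia.
Qed.
End Compile.

(** * Systems of tables *)

Definition rx := 8.
Definition ry := 9.
Definition rz := 10.

Record fill := Fill { f_ny : expr; f_nz : expr; f_e : expr }.

(* A group fills its tables slice by slice: for each x < nx, slice x of its first
   table, then slice x of its second table, and so on. *)
Record system := System { s_tabs : seq fill; s_groups : seq (expr * nat) }.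

(** The bound is recomputed in every round because the body uses register [nreg] as scratch. *)
Definition loopP (r : nat) (e : expr) (body : program) : program :=
  Seq (Assign r OpAdd (Cst 0) (Cst 0)) (Seq (compile e nreg)
    (While (TestLt (Reg r) (Reg nreg))
       (Seq body (Seq (Assign r OpAdd (Reg r) (Cst 1)) (compile e nreg))))).

Definition adrE (t : nat) : expr :=
  let S := EV rS in
  EA AAdd (EA AMul (EA AAdd (EA AMul (EA AAdd (EA AMul (EC t) S)
    (EA AMod (EV rx) S)) S) (EA AMod (EV ry) S)) S) (EA AMod (EV rz) S).

(* Register 3 holds the bound Q of the table entries. *)
Definition rQ := 3.

(** Reducing the entry modulo the content of [rQ] keeps the memory below [Q] without any knowledge
    of what the expression computes. *)
Definition cellP (t : nat) (e : expr) : program :=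
  Seq (compile (adrE t) nreg)
    (Seq (compile (EA AMod e (EV rQ)) nreg.+1) (Write (Reg nreg) (Reg nreg.+1))).

Definition fillP (t : nat) (f : fill) : program :=
  loopP ry (f_ny f) (loopP rz (f_nz f) (cellP t (f_e f))).

Definition seqP (ps : seq program) : program := foldr Seq Skip ps.

Definition dfill := Fill (EC 0) (EC 0) (EC 0).

Section System.
Variable sys : system.

(* Tables are numbered from 1; the addresses of table 0 hold the input. *)
Definition tab (t : nat) : fill := nth dfill (s_tabs sys) t.-1.
Definition ngrp := size (s_groups sys).
Definition nxe (i : nat) : expr := (nth (EC 0, 0) (s_groups sys) i).1.
Definition ntab (i : nat) : nat := (nth (EC 0, 0) (s_groups sys) i).2.
Definition off (i : nat) : nat := (sumn (take i [seq g.2 | g <- s_groups sys])).+1.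
Definition grp (t : nat) : nat := find (fun i => t < off i.+1) (iota 0 ngrp).

Definition groupP (i : nat) : program :=
  loopP rx (nxe i) (seqP [seq fillP t (tab t) | t <- iota (off i) (ntab i)]).

Definition systemP : program := seqP [seq groupP i | i <- iota 0 ngrp].

(** Loop bounds depend on the parameters only, hence stay constant while the loops run. *)
Fixpoint pure (e : expr) : bool := match e with
  | EC _ => true
  | EV r => r < rx
  | EA _ a b | ES a b => pure a && pure b
  | EI _ a b d e => [&& pure a, pure b, pure d & pure e]
  | EL _ _ _ _ => false
  end.

Definition ok_expr (deg : nat) (e : expr) : bool := wfe e && (mdeg e <= deg).
Definition ok_bound (deg : nat) (e : expr) : bool := ok_expr deg e && pure e.
Definition ok_system (deg : nat) : bool :=
  [&& all (fun f => [&& ok_bound deg (f_ny f), ok_bound deg (f_nz f) &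
                       ok_expr deg (f_e f)]) (s_tabs sys),
      all (fun g => ok_bound deg g.1) (s_groups sys),
      size (s_tabs sys) == sumn [seq g.2 | g <- s_groups sys],
      size (s_tabs sys) <= maxconst & 12 <= deg].

Lemma off_S i : i < ngrp -> off i.+1 = off i + ntab i.
Proof.
move=> h; rewrite /off (take_nth 0) ?size_map // -cats1 sumn_cat /= addn0.
by rewrite (nth_map (EC 0, 0)) // addSn.
Qed.

Lemma off_mono i j : i <= j -> off i <= off j.
Proof.
move=> h; rewrite /off ltnS; set s := map _ _.
by rewrite -(subnKC h) takeD sumn_cat leq_addr.
Qed.

Lemma grp_off i t : i < ngrp -> off i <= t < off i + ntab i -> grp t = i.
Proof.
move=> hi; rewrite -off_S // => /andP[h1 h2]; rewrite /grp.
have hh : has (fun i => t < off i.+1) (iota 0 ngrp).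
  by apply/hasP; exists i => //; rewrite mem_iota.
set j := find _ _; have hj : j < ngrp by rewrite -(size_iota 0 ngrp) -has_find.
have := nth_find 0 hh; rewrite -/j nth_iota // add0n => h3.
case: (ltngtP j i) => // hji.
  by have := off_mono hji; lia.
have := @before_find _ 0 (fun i => t < off i.+1) (iota 0 ngrp) i hji.
by rewrite nth_iota // add0n h2.
Qed.

Lemma off_grp t : 0 < t < off ngrp ->
  grp t < ngrp /\ off (grp t) <= t < off (grp t) + ntab (grp t).
Proof.
case/andP=> t0 ht.
have hh : has (fun i => t < off i.+1) (iota 0 ngrp).
  apply/hasP; exists ngrp.-1; last by case: ngrp ht => //; rewrite /off take0 /=; lia.
  by rewrite mem_iota; case: ngrp ht => //=; rewrite /off ?take0 /=; lia.
have hj : grp t < ngrp by rewrite -(size_iota 0 ngrp) -has_find.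
have := nth_find 0 hh; rewrite -/(grp t) nth_iota // add0n => h3; split=> //.
rewrite -off_S // h3 andbT.
case e : (grp t) => [|j]; first by rewrite /off take0.
have := @before_find _ 0 (fun i => t < off i.+1) (iota 0 ngrp) j.
rewrite -/(grp t) e ltnSn => /(_ isT); rewrite nth_iota; last by lia.
by rewrite add0n; case: ltnP.
Qed.

Variables (w Q S deg : nat) (rho : nat -> nat).
Hypothesis S_pos : 0 < S.
Hypothesis QS : S ^ 3 * maxconst.+2 <= Q.
Hypothesis Qw : Q ^ deg <= 2 ^ w.
Hypothesis rho_S : rho rS = S.
Hypothesis rho_Q : rho rQ = Q.-1.
Hypothesis sys_ok : ok_system deg.

Definition env (x y z r : nat) : nat :=
  if r == rx then x else if r == ry then y else if r == rz then z else rho r.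

Definition bound (e : expr) : nat := eval rho (fun=> 0) e.
Definition NX i := bound (nxe i).
Definition NY t := bound (f_ny (tab t)).
Definition NZ t := bound (f_nz (tab t)).
Hypothesis dims : forall t, 0 < t <= size (s_tabs sys) ->
  [/\ NX (grp t) <= S, NY t <= S & NZ t <= S].
Hypothesis dimX : forall i, i < ngrp -> NX i <= S.

Definition cell := (nat * nat * nat * nat)%type.

Definition store (m : nat -> nat) (c : cell) : nat -> nat :=
  let: (t, x, y, z) := c in
  update m (adr S t x y z) (eval (env x y z) m (f_e (tab t)) %% Q.-1).

Definition cellsY t x y : seq cell := [seq (t, x, y, z) | z <- iota 0 (NZ t)].
Definition cellsF t x := flatten [seq cellsY t x y | y <- iota 0 (NY t)].
Definition cellsX i x := flatten [seq cellsF t x | t <- iota (off i) (ntab i)].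
Definition cellsG i := flatten [seq cellsX i x | x <- iota 0 (NX i)].
Definition cells := flatten [seq cellsG i | i <- iota 0 ngrp].

Definition holds_params s := small Q S s /\ forall r, r < rx -> regs s r = rho r.

Let Q_big : maxconst.+1 < Q.
Proof. by apply: leq_trans QS; rewrite -{1}(mul1n maxconst.+2) leq_pmul2r // expn_gt0 S_pos. Qed.

Let SQ : S.+2 < Q.
Proof.
apply: leq_trans QS; rewrite /maxconst; have : S ^ 1 <= S ^ 3 by rewrite leq_pexp2l.
by rewrite expn1; lia.
Qed.

Lemma pure_eval rho' m e : (forall r, r < rx -> rho' r = rho r) -> pure e ->
  eval rho' m e = bound e.
Proof.
move=> h; rewrite /bound; elim: e => //= [o a IHa b IHb|a IHa b IHb|
  q a IHa b IHb d IHd e IHe].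
- by case/andP=> /IHa-> /IHb->.
- by case/andP=> /IHa-> /IHb->.
- by case/and4P=> /IHa-> /IHb-> /IHd-> /IHe->.
Qed.

Definition loopT (e : expr) (N T : nat) : nat :=
  1 + (cost e + (N * (T + (1 + cost e)).+1).+1).

(** The invariant has to be insensitive to the registers from [nreg] on, since recomputing the bound
    overwrites them. *)
Lemma loop_runs r e body N T (Inv : nat -> state -> Prop) s :
  rx <= r < nreg -> ok_bound deg e -> bound e = N -> N <= S -> holds_params s ->
  (forall i s1 s2, Inv i s1 -> smem s2 = smem s1 ->
     (forall q, q < nreg -> regs s2 q = regs s1 q) -> Inv i s2) ->
  (forall i s1, Inv i s1 -> holds_params s1 /\ regs s1 r = i) ->
  (forall s1, smem s1 = smem s -> (forall q, q < nreg -> q != r ->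
     regs s1 q = regs s q) -> regs s1 r = 0 -> holds_params s1 -> Inv 0 s1) ->
  (forall i s1, i < N -> Inv i s1 -> runs w body s1 T (fun s2 =>
     [/\ holds_params s2, regs s2 r = i & forall s3, smem s3 = smem s2 ->
       (forall q, q < nreg -> q != r -> regs s3 q = regs s2 q) ->
       regs s3 r = i.+1 -> holds_params s3 -> Inv i.+1 s3])) ->
  runs w (loopP r e body) s (loopT e N T) (Inv N).
Proof.
move=> /andP[hr1 hr2] /andP[/andP[wfe_e deg_e] pure_e] eN NS ps Ist Ipar I0 Istep.
have hd0 : 0 < deg by case/and5P: sys_ok => _ _ _ _; lia.
have wsm x : x < Q -> to_word w x = x.
  move=> h; rewrite /to_word modn_small //; apply: leq_trans h (leq_trans _ Qw).
  by rewrite -{1}(expn1 Q) leq_pexp2l //; lia.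
have parS s1 s2 : holds_params s1 -> smem s2 = smem s1 ->
    (forall q, q < nreg -> q != r -> regs s2 q = regs s1 q) -> regs s2 r < Q ->
    holds_params s2.
  move=> [[h1 [h2 h3]] h4] em er hrQ; have hreg q : q < nreg -> regs s2 q < Q.
    by move=> hq; case: (eqVneq q r) => [->//|hqr]; rewrite er ?h1.
  split; first split=> //; first split.
  - by move=> a; rewrite em.
  - by rewrite er ?h3 //; apply/eqP; move: hr1; rewrite /rx /rS; lia.
  - by move=> q hq; rewrite er ?h4 //; [move: hq; rewrite /rx /nreg; lia|lia].
have hcomp s1 : holds_params s1 -> runs w (compile e nreg) s1 (cost e) (result s1 nreg N).
  move=> [p1 p2]; rewrite -eN -(pure_eval (smem s1) p2 pure_e).
  exact: (comp_correct S_pos QS Qw).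
apply: (@runs_seq _ _ _ _ _ _ (fun s1 => [/\ smem s1 = smem s,
    forall q, q < nreg -> q != r -> regs s1 q = regs s q & regs s1 r = 0])).
  apply: runs_assign; split=> //= [q _ hq|]; first by rewrite update_neq.
  by rewrite update_eq /eval_binop /= !wsm ?addn0; lia.
move=> s1 [e1 e2 e3].
have p1 : holds_params s1 by apply: parS ps e1 e2 _; rewrite e3; lia.
apply: runs_seq (hcomp _ p1) _ => s2 [f1 f2 f3].
pose J i s' := Inv i s' /\ regs s' nreg = N.
apply: (runs_weak (@runs_while _ _ _ N (T + (1 + cost e)) J _ _ _ _)); last 2 first.
- exact: leqnn.
- by move=> s' [].
- move=> i s' hi [hI hN]; have [p' ri] := Ipar _ _ hI; split.
    by rewrite /= ri hN.
  apply: runs_seq (Istep _ _ hi hI) _ => s3 [p3 r3 n3].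
  apply: (@runs_seq _ _ _ _ _ _ (fun s4 => [/\ smem s4 = smem s3,
    forall q, q < nreg -> q != r -> regs s4 q = regs s3 q & regs s4 r = i.+1])).
    apply: runs_assign; split=> //= [q _ hq|]; first by rewrite update_neq.
    by rewrite update_eq /eval_binop /= r3 (wsm 1) ?wsm ?addn1; lia.
  move=> s4 [k1 k2 k3]; have p4 : holds_params s4 by apply: parS p3 k1 k2 _; rewrite k3; lia.
  apply: runs_weak (hcomp _ p4) (leqnn _) _ => s5 [l1 l2 l3]; split=> //.
  by apply: Ist (n3 _ k1 k2 k3 p4) l1 _ => q hq; rewrite l2.
- by move=> s' [hI hN]; have [_ ri] := Ipar _ _ hI; rewrite /= ri hN -leqNgt.
split; last exact: f3.
have p2 : holds_params s2.
  case: p1 => [[a1 [a2 a3]] a4]; split; first split; first by move=> q hq; rewrite f2 ?a1.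
    by split=> [a|]; rewrite ?f1 ?f2.
  by move=> q hq; rewrite f2 ?a4 //; move: hq; rewrite /rx /nreg; lia.
apply: (Ist _ s1) => //; first by apply: I0.
Qed.

Lemma par_env x y z s : holds_params s -> regs s rx = x -> regs s ry = y -> regs s rz = z ->
  regs s 11 = rho 11 -> forall r, r < nreg -> regs s r = env x y z r.
Proof.
move=> [_ h] h1 h2 h3 h4 r hr; rewrite /env.
case: eqP => [->//|]; case: eqP => [->//|]; case: eqP => [->//|] n1 n2 n3.
case: (ltnP r rx) => [/h//|hr'].
have -> // : r = 11 by move: n1 n2 n3 hr hr'; rewrite /rx /ry /rz /nreg; lia.
Qed.

Lemma tab_ok t : 0 < t <= size (s_tabs sys) -> [&& ok_bound deg (f_ny (tab t)),
  ok_bound deg (f_nz (tab t)), ok_expr deg (f_e (tab t)) & t <= maxconst].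
Proof.
move=> ht; case/and5P: sys_ok => /all_nthP-/(_ dfill) h _ _ hm _.
have /and3P[-> -> ->] /= : [&& ok_bound deg (f_ny (tab t)), ok_bound deg (f_nz (tab t))
  & ok_expr deg (f_e (tab t))] by apply: h; lia.
by lia.
Qed.

Definition parm (x : nat) (m : nat -> nat) s :=
  [/\ holds_params s, regs s 11 = rho 11, regs s rx = x & smem s =1 m].

Definition cellT (e : expr) : nat := cost (adrE 0) + (cost e + 1 + 1 + 1).
Definition fillT (t : nat) : nat :=
  loopT (f_ny (tab t)) (NY t) (loopT (f_nz (tab t)) (NZ t) (cellT (f_e (tab t)))).

Lemma foldl_rcons m L (c : cell) : foldl store m (rcons L c) = store (foldl store m L) c.
Proof. by rewrite -cats1 foldl_cat. Qed.

Lemma eval_mem_ext rho' m m' e : m =1 m' -> eval rho' m e = eval rho' m' e.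
Proof.
move=> h; elim: e => //= [o a -> b ->|a -> b ->|q a -> b -> d -> e ->|t a -> b -> c ->] //.
Qed.

Lemma cell_runs t x y z m s : 0 < t <= size (s_tabs sys) ->
  parm x m s -> regs s ry = y -> regs s rz = z ->
  runs w (cellP t (f_e (tab t))) s (cellT (f_e (tab t))) (fun s' =>
    [/\ parm x (store m (t, x, y, z)) s', regs s' ry = y & regs s' rz = z]).
Proof.
move=> ht [ps h11 hx hm] hy hz.
have /and4P[_ _ /andP[wf_e dg_e] tmax] := tab_ok ht.
have hdeg : 12 <= deg by case/and5P: sys_ok.
have cA : cost (adrE t) = cost (adrE 0) by [].
have sm := proj1 ps.
apply: runs_seq.
  rewrite -cA; apply: (comp_correct S_pos QS Qw _ _ (leqnn nreg) sm) => //.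
  by rewrite /= tmax.
  by apply: leq_trans hdeg.
move=> s1 r1; have sm1 := small_result S_pos QS Qw (leqnn _) sm r1.
apply: (@runs_seq _ _ _ _ (cost (f_e (tab t)) + 1 + 1) 1 (result s1 nreg.+1
  (eval (regs s1) (smem s1) (EA AMod (f_e (tab t)) (EV rQ))))).
  have e : cost (f_e (tab t)) + 1 + 1 = cost (EA AMod (f_e (tab t)) (EV rQ)).
    by rewrite /= addnA.
  rewrite e; apply: (comp_correct S_pos QS Qw _ _ (leqnSn nreg) sm1).
    by rewrite /= wf_e.
  rewrite /= !geq_max dg_e (leq_trans (vdeg_mdeg _) dg_e) /=.
  by apply: leq_trans hdeg.
move=> s2 r2.
have wf2 : wfe (EA AMod (f_e (tab t)) (EV rQ)) by rewrite /= wf_e.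
have ev := eval_result S_pos QS Qw (leqnn nreg) wf2 r1; rewrite ev in r2.
have re := par_env ps hx hy hz h11.
have hA : regs s1 nreg = adr S t x y z.
  case: r1 => _ _ ->.
  by rewrite /= hx hy hz; case: sm => _ [_ ->].
case: r1 => m1 g1 _; case: r2 => m2 g2 v2.
have vv : regs s2 nreg.+1 = eval (env x y z) m (f_e (tab t)) %% Q.-1.
  rewrite v2 /= (eval_mem_ext _ _ hm) (eval_ext _ re wf_e); congr (_ %% _).
  by rewrite (proj2 ps) // rho_Q.
have lt : regs s2 nreg.+1 < Q by rewrite vv; apply: leq_trans (ltn_pmod _ _) _; lia.
have reg q : q < nreg -> regs s2 q = regs s q by move=> hq; rewrite g2 ?g1 //; lia.
apply: runs_write => /=; rewrite g2 // hA vv; split; try by rewrite /= reg.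
split=> //=; try by rewrite reg.
- case: ps => [[a1 [a2 a3]] a4]; split; first split; rewrite /=.
  + by move=> r hr; rewrite reg ?a1.
  + split=> [a|]; last by rewrite reg.
    rewrite /update m2 m1; case: eqP => // _.
    by rewrite -vv.
  + by move=> r hr; rewrite reg ?a4 //; move: hr; rewrite /rx /nreg; lia.
- by move=> a; rewrite /update m2 m1 hm.
Qed.

Lemma parm_stab x m s s' : parm x m s -> smem s' = smem s ->
  (forall q, q < nreg -> regs s' q = regs s q) -> parm x m s'.
Proof.
move=> [[[a1 [a2 a3]] a4] h1 h2 h3] em er; split; rewrite ?er // ?em //.
split; first split; first by move=> q hq; rewrite er ?a1.
  by split=> [a|]; rewrite ?em ?er.
by move=> q hq; rewrite er ?a4 //; move: hq; rewrite /rx /nreg; lia.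
Qed.

Lemma iotaS N : iota 0 N.+1 = rcons (iota 0 N) N.
Proof. by rewrite -addn1 iotaD cats1. Qed.

Lemma fill_runs t x m s : 0 < t <= size (s_tabs sys) -> parm x m s ->
  runs w (fillP t (tab t)) s (fillT t) (parm x (foldl store m (cellsF t x))).
Proof.
move=> ht ps; have /and4P[oky okz oke tmax] := tab_ok ht.
have [_ hNY hNZ] := dims ht.
pose mY y := foldl store m (flatten [seq cellsY t x y' | y' <- iota 0 y]).
pose Inv y s1 := parm x (mY y) s1 /\ regs s1 ry = y.
apply: (runs_weak (@loop_runs ry _ _ (NY t) _ Inv s isT oky erefl hNY _ _ _ _ _)).
- by case: ps.
- by move=> i s1 s2 [h1 h2] e1 e2; split; [apply: parm_stab h1 e1 e2|rewrite e2].
- by move=> i s1 [[]].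
- move=> s1 e1 e2 e3 p1; split=> //; case: ps => [_ h2 h3 h4].
  by split=> //; rewrite ?e2 // e1.
- move=> y s1 hy [h1 h2].
  pose mZ z := foldl store (mY y) [seq (t, x, y, z') | z' <- iota 0 z].
  pose InvZ z s1 := [/\ parm x (mZ z) s1, regs s1 ry = y & regs s1 rz = z].
  apply: (runs_weak (@loop_runs rz _ _ (NZ t) _ InvZ s1 isT okz erefl hNZ _ _ _ _ _)).
  + by case: h1.
  + by move=> i u1 u2 [k1 k2 k3] e1 e2; split; [apply: parm_stab k1 e1 e2|rewrite e2..].
  + by move=> i u1 [[]].
  + move=> u1 e1 e2 e3 p1; case: h1 => [_ k2 k3 k4].
    by split=> //; [split=> //; rewrite ?e2 // e1|rewrite e2].
  + move=> z u1 hz [k1 k2 k3].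
    apply: runs_weak (cell_runs ht k1 k2 k3) (leqnn _) _ => u2 [l1 l2 l3].
    split=> //; first by case: l1.
    move=> u3 e1 e2 e3 p3; split=> //; last by rewrite e2.
    case: l1 => [_ q2 q3 q4]; split; rewrite ?e2 // e1 => a.
    by rewrite q4 /mZ iotaS map_rcons foldl_rcons.
  + exact: leqnn.
  move=> u1 [k1 k2 k3]; split=> //; first by case: k1.
  move=> u3 e1 e2 e3 p3; split=> //; case: k1 => [_ q2 q3 q4].
  split; rewrite ?e2 // e1 => a.
  rewrite q4 /mY iotaS map_rcons flatten_rcons foldl_cat.
  by rewrite /mZ /cellsY.
- exact: leqnn.
by move=> s1 [].
Qed.

Definition groupT i : nat := loopT (nxe i) (NX i)
  (sumn [seq fillT t | t <- iota (off i) (ntab i)]).+1.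
Definition systemT : nat := (sumn [seq groupT i | i <- iota 0 ngrp]).+1.

Lemma seqP_runs (P : nat -> program) (Tm : nat -> nat) (I : nat -> state -> Prop) c a s :
  (forall i s', a <= i < a + c -> I i s' -> runs w (P i) s' (Tm i) (I i.+1)) ->
  I a s ->
  runs w (seqP [seq P i | i <- iota a c]) s (sumn [seq Tm i | i <- iota a c]).+1
    (I (a + c)).
Proof.
elim: c a s => [|c IH] a s h hI /=.
  by exists 1, s; split=> //; [apply: ExecSkip|rewrite addn0].
rewrite -addnS; apply: runs_seq (h _ _ _ hI) _ => [|s' hs']; first by lia.
by rewrite -addSnnS; apply: IH => // i s2 hi; apply: h; lia.
Qed.

Lemma group_runs i m s : i < ngrp -> off ngrp = (size (s_tabs sys)).+1 ->
  (exists x, parm x m s) ->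
  runs w (groupP i) s (groupT i) (fun s' => exists x, parm x (foldl store m (cellsG i)) s').
Proof.
move=> hi eoff [x0 ps].
have okx : ok_bound deg (nxe i).
  by case/and5P: sys_ok => _ /all_nthP-/(_ (EC 0, 0)) h _ _ _; apply: h.
pose mX x := foldl store m (flatten [seq cellsX i x' | x' <- iota 0 x]).
pose Inv x s1 := parm x (mX x) s1.
apply: (runs_weak (@loop_runs rx _ _ (NX i) _ Inv s isT okx erefl (dimX hi) _ _ _ _ _)).
- by case: ps.
- by move=> j s1 s2 h1 e1 e2; apply: parm_stab h1 e1 e2.
- by move=> j s1 [].
- by move=> s1 e1 e2 e3 p1; case: ps => [_ h2 h3 h4]; split=> //; rewrite ?e2 // e1.
- move=> x s1 hx h1.
  pose mT t := foldl store (mX x) (flatten [seq cellsF t' x | t' <- iota (off i) (t - off i)]).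
  apply: (runs_weak (@seqP_runs _ _ (fun t s2 => parm x (mT t) s2) _ _ _ _ _)).
  + move=> t s2 ht h2.
    have ht2 : 0 < t <= size (s_tabs sys).
      have := @off_mono i.+1 ngrp hi; rewrite eoff off_S //.
      by have : 0 < off i by []; lia.
    apply: runs_weak (fill_runs ht2 h2) (leqnn _) _ => s3 h3.
    have -> : mT t.+1 = foldl store (mT t) (cellsF t x) => //.
    rewrite /mT subSn; last by lia.
    rewrite -addn1 iotaD map_cat flatten_cat foldl_cat /= cats0.
    by rewrite subnKC //; lia.
  + by rewrite /mT subnn.
  + exact: leqnn.
  move=> s2 h2; split; [by case: h2|by case: h2|].
  move=> s3 e1 e2 e3 p3; case: h2 => [_ q2 q3 q4].
  split=> //; rewrite ?e2 // e1 => a; by rewrite q4 /mX iotaS map_rcons flatten_rcons foldl_cat /mT addKn.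
- exact: leqnn.
by move=> s1 h1; exists (NX i).
Qed.

Lemma system_runs m s : off ngrp = (size (s_tabs sys)).+1 -> (exists x, parm x m s) ->
  runs w systemP s systemT (fun s' => exists x, parm x (foldl store m cells) s').
Proof.
move=> eoff ps.
pose mG i := foldl store m (flatten [seq cellsG j | j <- iota 0 i]).
apply: (runs_weak (@seqP_runs _ _ (fun i s2 => exists x, parm x (mG i) s2) _ _ _ _ _)).
- move=> i s2 hi h2; apply: runs_weak (group_runs _ eoff h2) (leqnn _) _ => // s3.
  by rewrite {2}/mG iotaS map_rcons flatten_rcons foldl_cat.
- exact: ps.
- exact: leqnn.
by [].
Qed.

(** ** The equations satisfied by the final memory *)

Definition before (c' c : cell) : bool :=
  let: (t', x', y', z') := c' in let: (t, x, y, z) := c in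
  (grp t' < grp t) || (grp t' == grp t) && ((x' < x) || (x' == x) &&
  ((t' < t) || (t' == t) && ((y' < y) || (y' == y) && (z' < z)))).

Definition inr (t x y z : nat) : bool :=
  [&& 0 < t <= size (s_tabs sys), x < NX (grp t), y < NY t & z < NZ t].

(** Only lookups that are really performed count: under a conditional, those of the branch taken.
    Guards in the entries can thus exclude lookups that would come too early. *)
Fixpoint lok (P : nat -> nat -> nat -> nat -> Prop) (rho' m : nat -> nat) (e : expr) : Prop :=
  match e with
  | EC _ | EV _ => True
  | EA _ a b | ES a b => lok P rho' m a /\ lok P rho' m b
  | EI q a b d e =>
      [/\ lok P rho' m a, lok P rho' m b &
        if (if q then eval rho' m a == eval rho' m b else eval rho' m a < eval rho' m b)
        then lok P rho' m d else lok P rho' m e]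
  | EL t a b c => [/\ lok P rho' m a, lok P rho' m b, lok P rho' m c &
        P t (eval rho' m a) (eval rho' m b) (eval rho' m c)]
  end.

Lemma eval_lok P rho' m m' e : rho' rS = S -> lok P rho' m e ->
  (forall t x y z, P t x y z -> m (adr S t x y z) = m' (adr S t x y z)) ->
  eval rho' m e = eval rho' m' e.
Proof.
move=> hS h hm; elim: e h => //= [o a IHa b IHb|a IHa b IHb|q a IHa b IHb d IHd e IHe|
  t a IHa b IHb c IHc].
- by case=> /IHa-> /IHb->.
- by case=> /IHa-> /IHb->.
- case=> /IHa ea /IHb eb; rewrite -ea -eb; set c := (if q then _ else _).
  by case: c.
- by case=> /IHa ea /IHb eb /IHc ec /hm; rewrite -ea -eb -ec hS.
Qed.

(** The memory is arbitrary because the contents at the time of filling are not yet known: the order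
    of the lookups has to follow from the form of the entry alone. An address outside all tables is
    harmless, as it is never written. *)
Definition load_ok (c : cell) : Prop := forall m, let: (t, x, y, z) := c in
  lok (fun t' x' y' z' => inr t' (x' %% S) (y' %% S) (z' %% S) ->
       before (t', x' %% S, y' %% S, z' %% S) c) (env x y z) m (f_e (tab t)).

Lemma pairwise_flatten (A : eqType) (r : rel A) (F : nat -> seq A) a c :
  (forall i, a <= i < a + c -> pairwise r (F i)) ->
  (forall i j u v, a <= i -> i < j < a + c -> u \in F i -> v \in F j -> r u v) ->
  pairwise r (flatten [seq F i | i <- iota a c]).
Proof.
elim: c a => //= c IH a h1 h2; rewrite pairwise_cat h1 ?IH /=; last by lia.
- rewrite andbT; apply/allrelP => u v hu /flattenP[l /mapP[i hi ->] hv].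
  by move: hi; rewrite mem_iota => hi; apply: (h2 a i) => //; lia.
- by move=> i hi; apply: h1; lia.
- by move=> i j u v hi hj; apply: h2; lia.
Qed.

Lemma mem_cellsY t x y c :
  reflect (exists2 z, z < NZ t & c = (t, x, y, z)) (c \in cellsY t x y).
Proof.
apply: (iffP mapP) => [[z hz ->]|[z hz ->]]; exists z => //.
  by move: hz; rewrite mem_iota.
by rewrite mem_iota.
Qed.

Lemma mem_cellsF t x c : reflect (exists y z, [/\ y < NY t, z < NZ t & c = (t, x, y, z)])
  (c \in cellsF t x).
Proof.
apply: (iffP flattenP) => [[l /mapP[y hy ->] /mem_cellsY[z hz ->]]|[y [z [hy hz ->]]]].
  by exists y, z; split=> //; move: hy; rewrite mem_iota.
exists (cellsY t x y); last by apply/mem_cellsY; exists z.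
by apply: map_f; rewrite mem_iota.
Qed.

Lemma mem_cellsX i x c : reflect (exists t y z, [/\ off i <= t < off i + ntab i,
  y < NY t, z < NZ t & c = (t, x, y, z)]) (c \in cellsX i x).
Proof.
apply: (iffP flattenP) => [[l /mapP[t ht ->] /mem_cellsF[y [z [hy hz ->]]]]|].
  by exists t, y, z; split=> //; move: ht; rewrite mem_iota.
case=> t [y [z [ht hy hz ->]]].
exists (cellsF t x); last by apply/mem_cellsF; exists y, z.
by apply: map_f; rewrite mem_iota.
Qed.

Lemma mem_cellsG i c : reflect (exists x t y z, [/\ x < NX i,
  off i <= t < off i + ntab i, y < NY t, z < NZ t & c = (t, x, y, z)])
  (c \in cellsG i).
Proof.
apply: (iffP flattenP) => [[l /mapP[x hx ->] /mem_cellsX[t [y [z [ht hy hz ->]]]]]|].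
  by exists x, t, y, z; split=> //; move: hx; rewrite mem_iota.
case=> x [t [y [z [hx ht hy hz ->]]]].
exists (cellsX i x); last by apply/mem_cellsX; exists t, y, z.
by apply: map_f; rewrite mem_iota.
Qed.

Hypothesis eoff : off ngrp = (size (s_tabs sys)).+1.

Lemma mem_cells t x y z : ((t, x, y, z) \in cells) = inr t x y z.
Proof.
apply/flattenP/and4P => [[l /mapP[i hi ->]]|[ht hx hy hz]].
  move: hi; rewrite mem_iota add0n => hi /mem_cellsG[x' [t' [y' [z' [hx ht hy hz]]]]].
  case=> -> -> -> ->; have := grp_off hi ht => ->; split=> //.
  have := off_mono (hi : i.+1 <= ngrp); rewrite off_S // eoff.
  by have : 0 < off i by []; lia.
have [] := @off_grp t; first by rewrite eoff.
move=> hg ho; exists (cellsG (grp t)); first by apply: map_f; rewrite mem_iota.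
by apply/mem_cellsG; exists x, t, y, z.
Qed.

Lemma cells_before : pairwise before cells.
Proof.
apply: pairwise_flatten => [i hi|i j u v _ hij]; last first.
  move=> /mem_cellsG[x1 [t1 [y1 [z1 [_ h1 _ _ ->]]]]].
  move=> /mem_cellsG[x2 [t2 [y2 [z2 [_ h2 _ _ ->]]]]].
  have h1' : i < ngrp by lia.
  have h2' : j < ngrp by lia.
  by rewrite /before (grp_off h1' h1) (grp_off h2' h2); lia.
have hi' : i < ngrp by lia.
apply: pairwise_flatten => [x hx|x x' u v _ hij]; last first.
  move=> /mem_cellsX[t1 [y1 [z1 [h1 _ _ ->]]]].
  move=> /mem_cellsX[t2 [y2 [z2 [h2 _ _ ->]]]].
  by rewrite /before (grp_off hi' h1) (grp_off hi' h2); lia.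
apply: pairwise_flatten => [t ht|t1 t2 u v h1 hij]; last first.
  move=> /mem_cellsF[y1 [z1 [_ _ ->]]] /mem_cellsF[y2 [z2 [_ _ ->]]].
  have h1' : off i <= t1 < off i + ntab i by lia.
  have h2' : off i <= t2 < off i + ntab i by lia.
  by rewrite /before (grp_off hi' h1') (grp_off hi' h2'); lia.
apply: pairwise_flatten => [y hy|y1 y2 u v h1 hij]; last first.
  by move=> /mem_cellsY[z1 _ ->] /mem_cellsY[z2 _ ->]; rewrite /before; lia.
rewrite /cellsY pairwise_map.
apply: sub_pairwise (_ : pairwise ltn _); first by move=> z1 z2 /= h; lia.
by rewrite -sorted_pairwise ?iota_ltn_sorted //; apply: ltn_trans.
Qed.

Lemma before_irr c : before c c = false.
Proof. by case: c => [[[t x] y] z]; rewrite /before; lia. Qed.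

Lemma before_asym c c' : before c c' -> before c' c -> False.
Proof. by case: c => [[[t x] y] z]; case: c' => [[[t' x'] y'] z']; rewrite /before; lia. Qed.

Lemma adr_inj t x y z t' x' y' z' : x < S -> y < S -> z < S ->
  adr S t x y z = adr S t' x' y' z' ->
  [/\ t = t', x = x' %% S, y = y' %% S & z = z' %% S].
Proof.
move=> hx hy hz; rewrite /adr !(modn_small hx, modn_small hy, modn_small hz) => e.
have inj a b a' b' : b < S -> b' < S -> a * S + b = a' * S + b' -> a = a' /\ b = b'.
  move=> hb hb' e1; have := congr1 (divn^~ S) e1; have := congr1 (modn^~ S) e1.
  by rewrite !modnMDl !divnMDl // !modn_small // !divn_small // !addn0.
have [e1 ez] := inj _ _ _ _ hz (ltn_pmod _ S_pos) e.
have [e2 ey] := inj _ _ _ _ hy (ltn_pmod _ S_pos) e1.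
by have [et ex] := inj _ _ _ _ hx (ltn_pmod _ S_pos) e2.
Qed.

Definition cadr (c : cell) := let: (t, x, y, z) := c in adr S t x y z.

Lemma inr_lt t x y z : inr t x y z -> [/\ x < S, y < S & z < S].
Proof. by case/and4P=> /dims[h1 h2 h3] k1 k2 k3; split; lia. Qed.

Lemma foldl_store_out L m a : (forall c, c \in L -> cadr c != a) ->
  foldl store m L a = m a.
Proof.
elim: L m => //= c L IH m h; rewrite IH; last by move=> c' hc'; apply: h; rewrite inE hc' orbT.
have := h c (mem_head _ _); case: c {h} => [[[t x] y] z] /= h.
by rewrite update_neq // eq_sym.
Qed.

(** When the cell is filled, all cells it reads already have their final contents; afterwards
    neither they nor the cell change, because each cell is filled once and addresses are
    injective. *)
Lemma cells_eq m t x y z : load_ok (t, x, y, z) -> inr t x y z ->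
  foldl store m cells (adr S t x y z) =
  eval (env x y z) (foldl store m cells) (f_e (tab t)) %% Q.-1.
Proof.
move=> hl hin; set c := (t, x, y, z) in hl *.
have [L1 [L2 eL]] : exists L1 L2, cells = L1 ++ c :: L2.
  by have := hin; rewrite -mem_cells => /splitPr[L1 L2]; exists L1, L2.
have inS c' : c' \in c :: L2 -> c' \in cells by rewrite eL mem_cat => ->; rewrite orbT.
have [_ _ hb] : [/\ true, true & all (before c) L2].
  by have := cells_before; rewrite eL pairwise_cat => /and3P[_ _ /andP[]].
have [tx ty tz] := inr_lt hin.
have eF m' : foldl store m cells m' = foldl store (store (foldl store m L1) c) L2 m'.
  by rewrite eL foldl_cat.
set m1 := foldl store m L1 in eF *.
rewrite eF foldl_store_out; last first.
  move=> c' hc'; apply/eqP => e; have := inS c'; rewrite inE hc' orbT => /(_ isT).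
  case: c' hc' e => [[[t' x'] y'] z'] hc' e; rewrite mem_cells => /inr_lt[hx hy hz].
  have [e1 e2 e3 e4] := adr_inj hx hy hz e.
  move: (allP hb _ hc'); rewrite e1 e2 e3 e4 !modn_small //.
  by rewrite -/c before_irr.
rewrite /= update_eq; congr (_ %% _); apply: eval_lok (hl m1) _ => // t' x' y' z' hP.
symmetry; rewrite eF; apply: (@foldl_store_out (c :: L2) m1) => c' hc'.
apply/eqP => e.
have := inS c' hc'; case: c' hc' e => [[[t2 x2] y2] z2] hc' e hm.
have hin2 : inr t2 x2 y2 z2 by rewrite -mem_cells.
have [hx hy hz] := inr_lt hin2.
have [e1 e2 e3 e4] := adr_inj hx hy hz e.
have hb2 : before (t2, x2, y2, z2) c by move: hP; rewrite -e1 -e2 -e3 -e4; apply.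
move: hc'; rewrite inE => /orP[/eqP e5|hc'].
  by move: hb2; rewrite e5 before_irr.
exact: before_asym hb2 (allP hb _ hc').
Qed.

Lemma cells_out m a : (forall t x y z, inr t x y z -> adr S t x y z != a) ->
  foldl store m cells a = m a.
Proof.
move=> h; apply: foldl_store_out => -[[[t x] y] z]; rewrite mem_cells; exact: h.
Qed.

Lemma cells_unused m t x y z : x < S -> y < S -> z < S -> ~~ inr t x y z ->
  foldl store m cells (adr S t x y z) = m (adr S t x y z).
Proof.
move=> hx hy hz h; apply: cells_out => t' x' y' z' h'; apply/eqP => e.
have [hx' hy' hz'] := inr_lt h'.
have [e1 e2 e3 e4] := adr_inj hx' hy' hz' e.
by move: h h'; rewrite e1 e2 e3 e4 !modn_small // => /negP.
Qed.

End System.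

(** * Words as bit vectors *)

Definition bit (a x : nat) : bool := Nat.testbit a x.

Lemma odd_Nat a : Nat.odd a = odd a.
Proof.
have : Nat.odd a = odd a /\ Nat.odd a.+1 = odd a.+1; last by case.
elim: a => [|a [h1 h2]] //; split=> //.
by rewrite [RHS]/= negbK -h1.
Qed.

Lemma div2_Nat a : Nat.div2 a = a./2.
Proof.
have : Nat.div2 a = a./2 /\ Nat.div2 a.+1 = a.+1./2; last by case.
elim: a => [|a [h1 h2]] //; split=> //.
have -> : a.+2./2 = a./2.+1 by [].
by rewrite -h1.
Qed.

Lemma bit0 a : bit a 0 = odd a.
Proof. by rewrite /bit PeanoNat.Nat.bit0_odd odd_Nat. Qed.

Lemma bitS a x : bit a x.+1 = bit a./2 x.
Proof. by rewrite /bit -PeanoNat.Nat.testbit_div2 div2_Nat. Qed.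

Lemma bit_land a b x : bit (Nat.land a b) x = bit a x && bit b x.
Proof. exact: PeanoNat.Nat.land_spec. Qed.

Lemma bit_lor a b x : bit (Nat.lor a b) x = bit a x || bit b x.
Proof. exact: PeanoNat.Nat.lor_spec. Qed.

Lemma bit_0 x : bit 0 x = false.
Proof. by elim: x => // x; rewrite bitS. Qed.

Lemma half_div_exp a j : a %/ 2 ^ j.+1 = a./2 %/ 2 ^ j.
Proof. by rewrite expnS divnMA divn2. Qed.

Lemma bit_divexp a j x : bit (a %/ 2 ^ j) x = bit a (x + j).
Proof.
elim: j a => [|j IH] a; first by rewrite divn1 addn0.
by rewrite half_div_exp IH addnS bitS.
Qed.

Lemma bit_high a j x : a < 2 ^ j -> j <= x -> bit a x = false.
Proof.
move=> h hx; have := bit_divexp a j (x - j).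
by rewrite divn_small // bit_0 subnK.
Qed.

Lemma bit_cat u v j x : u < 2 ^ j ->
  bit (u + v * 2 ^ j) x = if x < j then bit u x else bit v (x - j).
Proof.
elim: j u x => [|j IH] u x.
  by rewrite ltnS leqn0 => /eqP->; rewrite muln1 subn0.
rewrite expnS => hu; have hu2 : u./2 < 2 ^ j by lia.
have e : (u + v * (2 * 2 ^ j))./2 = u./2 + v * 2 ^ j by lia.
case: x => [|x]; first by rewrite !bit0 ltn0Sn oddD !oddM /= andbF addbF.
by rewrite !bitS e IH.
Qed.

Lemma bit_mulexp v j x : bit (v * 2 ^ j) x = (j <= x) && bit v (x - j).
Proof. by have := @bit_cat 0 v j x; rewrite expn_gt0 bit_0 => ->; case: ltnP. Qed.

Lemma bit_modexp a j x : bit (a %% 2 ^ j) x = (x < j) && bit a x.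
Proof.
have := @bit_cat (a %% 2 ^ j) (a %/ 2 ^ j) j x.
rewrite ltn_pmod ?expn_gt0 // addnC -divn_eq => -> //.
by case: ltnP => // h; apply: bit_high h; rewrite ltn_pmod ?expn_gt0.
Qed.

Lemma bit_ones j x : bit (2 ^ j).-1 x = (x < j).
Proof.
elim: j x => [|j IH] x; first by rewrite bit_0.
have e : ((2 ^ j.+1).-1)./2 = (2 ^ j).-1.
  by have := expn_gt0 2 j; rewrite expnS; lia.
case: x => [|x]; last by rewrite bitS e IH.
by rewrite bit0; have := expn_gt0 2 j; rewrite expnS; lia.
Qed.

Lemma bit_compl a j x : a < 2 ^ j ->
  bit (2 ^ j - 1 - a) x = (x < j) && ~~ bit a x.
Proof.
elim: j a x => [|j IH] a x; first by rewrite subnn bit_0.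
rewrite expnS => ha; have e : (2 * 2 ^ j - 1 - a)./2 = 2 ^ j - 1 - a./2 by lia.
case: x => [|x]; first by rewrite !bit0; lia.
by rewrite !bitS e IH //; lia.
Qed.

Lemma bit_pow j x : bit (2 ^ j) x = (x == j).
Proof.
have := bit_mulexp 1 j x; rewrite mul1n => ->; case: (ltngtP x j) => [h|h|->] //.
  have -> : x - j = (x - j).-1.+1 by lia.
  by rewrite bitS bit_0.
by rewrite subnn bit0.
Qed.

Lemma land_lt a b j : a < 2 ^ j -> Nat.land a b < 2 ^ j.
Proof. by apply: leq_ltn_trans; have := PeanoNat.Nat.land_le_l a b; lia. Qed.

Lemma bit_inj_lt a j : (forall x, j <= x -> bit a x = false) -> a < 2 ^ j.
Proof.
move=> h; have e : a %/ 2 ^ j = 0.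
  apply: PeanoNat.Nat.bits_inj => x; rewrite -[Nat.testbit _ _]/(bit _ _) bit_divexp.
  by rewrite h ?leq_addl // -[RHS]/(bit 0 x) bit_0.
by rewrite ltnNge; apply/negP => hl; move: e; have := @leq_div2r (2 ^ j) _ _ hl;
  rewrite divnn expn_gt0 /=; lia.
Qed.

Lemma lor_lt a b j : a < 2 ^ j -> b < 2 ^ j -> Nat.lor a b < 2 ^ j.
Proof.
by move=> ha hb; apply: bit_inj_lt => x hx; rewrite bit_lor (bit_high ha hx) (bit_high hb hx).
Qed.

Section Vectors.
Variable tau : nat.
Hypothesis tau_pos : 0 < tau.
Local Notation B := (2 ^ tau).

(* Bit l of the vector whose words are F 0, F 1, ... *)
Definition vbit (F : nat -> nat) (l : nat) : bool := bit (F (l %/ tau)) (l %% tau).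

Lemma vbitE F b x : x < tau -> vbit F (b * tau + x) = bit (F b) x.
Proof. by move=> h; rewrite /vbit divnMDl // divn_small // addn0 modnMDl modn_small. Qed.

(** For [r = c * tau + y], word [b] of the shifted vector joins the upper part of word [b + c] with
    the lowest [y] bits of the next word; the two parts do not overlap, so the sum has no carry. *)
Lemma vbit_shr F r l : (forall b, F b < B) ->
  vbit (fun b => F (b + r %/ tau) %/ 2 ^ (r %% tau) +
                 (F (b + r %/ tau + 1) * 2 ^ (tau - r %% tau)) %% B) l = vbit F (l + r).
Proof.
move=> hF; set b := l %/ tau; set x := l %% tau; set c := r %/ tau; set y := r %% tau.
have hx : x < tau by rewrite ltn_pmod.
have hy : y < tau by rewrite ltn_pmod.
have el : l = b * tau + x by apply: divn_eq.
have er : r = c * tau + y by apply: divn_eq.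
have -> : vbit (fun b => F (b + c) %/ 2 ^ y + (F (b + c + 1) * 2 ^ (tau - y)) %% B) l =
  bit (F (b + c) %/ 2 ^ y + (F (b + c + 1) * 2 ^ (tau - y)) %% B) x by [].
have eB : B = 2 ^ y * 2 ^ (tau - y) by rewrite -expnD subnKC // ltnW.
have -> : (F (b + c + 1) * 2 ^ (tau - y)) %% B = (F (b + c + 1) %% 2 ^ y) * 2 ^ (tau - y).
  by rewrite eB muln_modl.
rewrite bit_cat; last by rewrite ltn_divLR ?expn_gt0 // mulnC -eB.
rewrite bit_divexp bit_modexp; case: ltnP => h.
  have -> : l + r = (b + c) * tau + (x + y) by lia.
  by rewrite vbitE //; lia.
have -> : l + r = (b + c + 1) * tau + (x - (tau - y)) by nia.
by rewrite vbitE; [case: ltnP => //|]; lia.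
Qed.

Lemma vbit_shr1 F l : (forall b, F b < B) ->
  vbit (fun b => F b %/ 2 + (F (b + 1) %% 2) * (B %/ 2)) l = vbit F (l + 1).
Proof.
move=> hF; set b := l %/ tau; set x := l %% tau.
have hx : x < tau by rewrite ltn_pmod.
have el : l = b * tau + x by apply: divn_eq.
have -> : vbit (fun b => F b %/ 2 + (F (b + 1) %% 2) * (B %/ 2)) l =
  bit (F b %/ 2 + (F (b + 1) %% 2) * (B %/ 2)) x by [].
have eB : B %/ 2 = 2 ^ tau.-1 by rewrite -{1}(prednK tau_pos) expnS mulKn.
rewrite eB bit_cat; last first.
  by rewrite ltn_divLR // mulnC -expnS prednK.
rewrite -{1 2}(expn1 2) bit_divexp bit_modexp; case: ltnP => h.
  have -> : l + 1 = b * tau + (x + 1) by lia.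
  by rewrite vbitE //; lia.
have -> : l + 1 = (b + 1) * tau + (x - tau.-1) by nia.
by rewrite vbitE; [case: ltnP => //|]; lia.
Qed.

Lemma vbit_shl1 F l : (forall b, F b < B) ->
  vbit (fun b => (F b * 2) %% B + (if b < 1 then 0 else F (b - 1) %/ (B %/ 2))) l =
  (0 < l) && vbit F (l - 1).
Proof.
move=> hF; set b := l %/ tau; set x := l %% tau.
have hx : x < tau by rewrite ltn_pmod.
have el : l = b * tau + x by apply: divn_eq.
set G := (fun b => _); have -> : vbit G l = bit (G b) x by [].
have eB : B = 2 ^ tau.-1 * 2 by rewrite mulnC -expnS prednK.
have eB2 : B %/ 2 = 2 ^ tau.-1 by rewrite eB mulnK.
have -> : G b = (if b < 1 then 0 else F (b - 1) %/ 2 ^ tau.-1) +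
    (F b %% 2 ^ tau.-1) * 2 ^ 1 by rewrite /G eB2 {1}eB -muln_modl expn1 addnC.
rewrite bit_cat; last first.
  case: ifP => // _; rewrite ltn_divLR ?expn_gt0 // -expnD addnC addn1 prednK //.
rewrite bit_modexp; case: x el hx => [|x] el hx; rewrite ?ltn0Sn ?ltnn.
  case: ltnP => hb; first by rewrite el (_ : b = 0) ?mul0n ?bit_0 //; lia.
  rewrite bit_divexp add0n; have -> : 0 < l by nia.
  have -> /= : l - 1 = (b - 1) * tau + tau.-1 by nia.
  by rewrite vbitE //; lia.
have -> : 0 < l by lia.
have -> : l - 1 = b * tau + x by lia.
by rewrite vbitE ?subn1 /=; [case: ltnP => //|]; lia.
Qed.

Lemma vbit_trunc h l : vbit (fun b => 2 ^ minn (h - b * tau) tau - 1) l = (l < h).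
Proof.
rewrite {1}/vbit subn1 bit_ones; have := divn_eq l tau; have := ltn_pmod l tau_pos.
by set b := l %/ tau; set x := l %% tau; lia.
Qed.

Lemma vbit_single j l : vbit (fun b => if b == j %/ tau then 2 ^ (j %% tau) else 0) l =
  (l == j).
Proof.
rewrite /vbit; case: eqP => [e|ne]; last first.
  by rewrite bit_0; apply/esym/eqP => e; apply: ne; rewrite e.
rewrite bit_pow; apply/eqP/eqP => [e2|->] //.
by rewrite (divn_eq l tau) (divn_eq j tau) e e2.
Qed.

End Vectors.

(** * Difference codes *)

(* Digit i of a code is 1 plus the difference of the entries i + 1 and i of a block. *)
Definition dg (c i : nat) : nat := (c %/ 4 ^ i) %% 4.
Fixpoint dsum (c x : nat) : nat := if x is x'.+1 then dsum c x' + dg c x' else 0.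

Lemma dg0 c : dg c 0 = c %% 4. Proof. by rewrite /dg divn1. Qed.
Lemma dgS c i : dg c i.+1 = dg (c %/ 4) i.
Proof. by rewrite /dg expnS divnMA. Qed.
Lemma dg_push d c i : d < 4 -> dg (d + 4 * c) i.+1 = dg c i.
Proof. by move=> h; rewrite dgS /dg (_ : (d + 4 * c) %/ 4 = c) //; lia. Qed.
Lemma dg_push0 d c : d < 4 -> dg (d + 4 * c) 0 = d.
Proof. by move=> h; rewrite dg0; lia. Qed.
Lemma dg_mod c j i : i < j -> dg (c %% 4 ^ j) i = dg c i.
Proof.
move=> h; rewrite /dg {2}(divn_eq c (4 ^ j)).
have -> : 4 ^ j = 4 ^ (j - i).-1 * 4 * 4 ^ i.
  by rewrite -expnSr -expnD; congr (4 ^ _); lia.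
by rewrite mulnA divnMDl ?expn_gt0 // mulnA modnMDl.
Qed.

Lemma dsumS c x : dsum c x.+1 = c %% 4 + dsum (c %/ 4) x.
Proof. elim: x => [|x IH]; first by rewrite /= dg0 addn0.
by rewrite -[LHS]/(dsum c x.+1 + dg c x.+1) IH dgS -addnA. Qed.

(** * Minimum of a coded block under a mask *)

Section MaskedMin.
Variables (tau S INF : nat) (MP : nat -> nat -> nat -> nat).
Local Notation B := (2 ^ tau).
Hypothesis MP0 : forall y z, y < B * B -> z < B -> MP 0 y z = INF + tau * S.
Hypothesis MPS : forall x y z, x < tau -> y < B * B -> z < B -> MP x.+1 y z =
  let r := (y %% 4) * S + 1 + MP x (y %/ 4) (z %/ 2) in
  if z %% 2 == 1 then minn (x.+1 * S) r else r.

(** As [dsum y i] is entry [i] minus entry 0 plus [i], the number [x - i + dsum y i] is entry [i]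
    minus entry 0 plus [x]. The shift by [x] keeps it nonnegative, as entries drop by at most 1 per
    step; the position sits in the part below [S]. An empty mask gives at least [INF + tau * S]. *)
Lemma MP_spec x y z : x <= tau -> y < B * B -> z < B ->
  (forall i, i < x -> bit z i -> MP x y z <= (x - i + dsum y i) * S + i) /\
  ((exists i, [/\ i < x, bit z i & MP x y z = (x - i + dsum y i) * S + i]) \/
   INF + tau * S <= MP x y z).
Proof.
elim: x y z => [|x IH] y z hx hy hz; first by rewrite MP0 //; split=> //; right.
have hy' : y %/ 4 < B * B by lia.
have hz' : z %/ 2 < B by lia.
have [h1 h2] := IH _ _ (ltnW hx) hy' hz'; rewrite MPS //.
set r := _ + _; set m := MP x _ _ in h1 h2 r *.
have eb i : bit z i.+1 = bit (z %/ 2) i by rewrite bitS divn2.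
have e0 : bit z 0 = (z %% 2 == 1) by rewrite bit0 modn2; case: odd.
have hr i : m <= (x - i + dsum (y %/ 4) i) * S + i ->
    r <= (x.+1 - i.+1 + dsum y i.+1) * S + i.+1.
  by move=> h; rewrite /r dsumS subSS; lia.
have le_r i : i < x -> bit z i.+1 -> r <= (x.+1 - i.+1 + dsum y i.+1) * S + i.+1.
  by rewrite eb => hi hb; apply: hr => //; apply: h1.
have ex_r : (exists i, [/\ i < x.+1, bit z i & r = (x.+1 - i + dsum y i) * S + i]) \/
   INF + tau * S <= r.
  case: h2 => [[i [hi hb e]]|h2]; last by right; rewrite /r; lia.
  by left; exists i.+1; split; rewrite ?eb // /r dsumS subSS e; lia.
rewrite /=; split.
  case=> [_|i hi hb].
    by rewrite e0 => ->; rewrite subn0 addn0 geq_min /= addn0 leqnn.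
  by case: ifP => _; rewrite ?geq_min le_r ?orbT.
case: ifP => // hb; case: (leqP (x.+1 * S) r) => _; last exact: ex_r.
by left; exists 0; split; rewrite ?e0 // subn0 /= !addn0.
Qed.

(* The base value of the block is [base]; the result is scaled by S, with the
   position plus [o] in the low part. *)
Definition cand (base c m o : nat) : nat := base * S + MP tau c m + o - tau * S.

Lemma cand_le base c m o i v : c < B * B -> m < B -> i < tau -> bit m i ->
  base + dsum c i = v + i -> cand base c m o <= v * S + i + o.
Proof.
move=> hc hm hi hb e; have [h _] := MP_spec (leqnn tau) hc hm.
have {}h := h i hi hb; rewrite /cand.
have : (base + (tau - i + dsum c i)) * S = (v + tau) * S by congr (_ * _); lia.
by rewrite !mulnDl; lia.
Qed.

Lemma cand_ex base c m o : c < B * B -> m < B ->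
  (exists2 i, i < tau & bit m i /\ forall v, base + dsum c i = v + i ->
     cand base c m o = v * S + i + o) \/ INF <= cand base c m o.
Proof.
move=> hc hm; have [_ h] := MP_spec (leqnn tau) hc hm; rewrite /cand.
case: h => [[i [hi hb ->]]|h]; last by right; lia.
left; exists i => //; split=> // v e.
have : (base + (tau - i + dsum c i)) * S = (v + tau) * S by congr (_ * _); lia.
by rewrite !mulnDl; lia.
Qed.
End MaskedMin.

(** * One column step through a coded block *)

Section BlockStep.
Variables (tau : nat) (ST : nat -> nat -> nat -> nat).
Local Notation B := (2 ^ tau).
Hypothesis ST0 : forall y z, y < B * B -> z < 4 * B -> ST 0 y z = z %% 4.
Hypothesis STS : forall x y z, x < tau -> y < B * B -> z < 4 * B -> ST x.+1 y z =
  let h := z %% 4 in let e := z %/ 4 in let d := y %% 4 in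
  let m := minn h (minn d (1 - e %% 2)) in
  let r := ST x (y %/ 4) (e %/ 2 * 4 + (m + 2 - d)) in
  16 * (r %/ 4) + 4 * (m + 2 - h) + r %% 4.

(* One column step of the edit distance recurrence through a block of x rows: o and v
   are the entries of the old and of the new column. *)
Lemma ST_spec x c e h (o v : nat -> nat) : x <= tau -> c < B * B -> e < B -> h <= 2 ->
  v 0 + 1 = o 0 + h ->
  (forall i, i < x -> dg c i <= 2 /\ o i.+1 + 1 = o i + dg c i) ->
  (forall i, i < x -> v i.+1 =
     minn (minn (v i + 1) (o i.+1 + 1)) (o i + (1 - bit e i))) ->
  let r := ST x c (e * 4 + h) in
  [/\ r %/ 4 < 4 ^ x, r %% 4 <= 2, v x + 1 = o x + r %% 4 &
    forall i, i < x -> dg (r %/ 4) i <= 2 /\ v i.+1 + 1 = v i + dg (r %/ 4) i].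
Proof.
elim: x c e h o v => [|x IH] c e h o v hx hc he hh h0 ho hv /=.
  have -> : ST 0 c (e * 4 + h) = h by rewrite ST0 //; lia.
  by rewrite divn_small ?modn_small //; lia.
have hz : e * 4 + h < 4 * B by lia.
rewrite STS //= divnMDl // (@divn_small h) ?addn0 ?modnMDl ?(@modn_small h); try by lia.
have [hd ed] := ho 0 isT; have ev := hv 0 isT; rewrite dg0 in hd ed.
have eb : bit e 0 = e %% 2 :> nat by rewrite bit0 modn2.
rewrite eb in ev; set d := c %% 4 in hd ed *; set q := 1 - e %% 2 in ev *.
have hq : q <= 1 by rewrite /q; lia.
(* Relative to [o 0] the three candidates for [v 1] are [h], [d] and [q], so [v 1 = o 0 + m]. Then
   [m + 2 - d] is the horizontal difference passed to the next row and [m + 2 - h] the new vertical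
   digit, each increased by 1. *)
set m := minn h (minn d q); have em : m = minn h (minn d q) by [].
have [] := IH (c %/ 4) (e %/ 2) (m + 2 - d) (fun i => o i.+1) (fun i => v i.+1).
- exact: ltnW.
- by lia.
- by lia.
- by lia.
- by move: ev ed h0; lia.
- by move=> i hi; rewrite -dgS; apply: ho.
- by move=> i hi; have := hv i.+1 hi; rewrite bitS divn2.
set r := ST _ _ _ => r1 r2 r3 r4.
have e16 : 16 * (r %/ 4) + 4 * (m + 2 - h) + r %% 4 =
    ((m + 2 - h) + 4 * (r %/ 4)) * 4 + r %% 4 by lia.
have hm : m + 2 - h <= 2 by lia.
rewrite e16 divnMDl // (@divn_small (r %% 4)) ?ltn_pmod // addn0 modnMDl modn_mod.
split=> //; first by rewrite expnS; lia.
case=> [_|i hi]; last by rewrite dg_push //; [apply: r4|lia].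
rewrite dg_push0; last by lia.
by split=> //; move: ev ed h0; lia.
Qed.
End BlockStep.

(** * Propagation in a tree of closest earlier nodes *)

Section Tree.
Variables (n : nat) (L : nat -> nat -> nat) (par Lp : nat -> nat).
Hypothesis Lsym : forall a b, L a b = L b a.
Hypothesis Lultra : forall a b c, minn (L a b) (L b c) <= L a c.
Hypothesis par_lt : forall s, 0 < s <= n -> par s < s.
Hypothesis Lp_par : forall s, 0 < s <= n -> Lp s = L s (par s).
Hypothesis Lp_max : forall s p, 0 < s <= n -> p < s -> L s p <= Lp s.

(** The first disjunct makes the relation reflexive even for [l > L s s]; with the ultrametric
    inequality it becomes an equivalence. *)
Definition near (l s p : nat) : bool := (p == s) || (l <= L s p).

Lemma near_trans l a b c : near l a b -> near l b c -> near l a c.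
Proof.
rewrite /near; case: eqP => [->//|_] /=; case: eqP => [->|_] /=.
  by move=> ->; rewrite orbT.
by move=> h1 h2; apply/orP; right; apply: leq_trans (Lultra a b c); rewrite leq_min h1.
Qed.

Lemma near_sym l a b : near l a b = near l b a.
Proof. by rewrite /near eq_sym Lsym. Qed.

Lemma near_par l s : 0 < s <= n -> l <= Lp s -> near l s (par s).
Proof. by move=> hs h; rewrite /near -Lp_par // h orbT. Qed.

Variables (mask A DN : nat -> Prop) (l : nat).

(* Information flows up to the least node of the class of s, then down to s. *)
Lemma tree_complete s p :
  (forall s, s <= n -> mask s -> A s) ->
  (forall c, 0 < c <= n -> A c -> l <= Lp c -> A (par c)) ->
  (forall s, s <= n -> A s -> DN s) ->
  (forall s, 0 < s <= n -> DN (par s) -> l <= Lp s -> DN s) ->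
  s <= n -> p <= n -> near l s p -> mask p -> DN s.
Proof.
move=> h1 h2 h3 h4 hs hp hn hm.
have up q : q <= n -> A q -> exists r, [/\ r <= q, near l q r, A r &
    (forall t, t < r -> ~~ near l r t)].
  elim/ltn_ind: q => q IH hq hA.
  case: (posnP q) => [e|q0]; first by exists q; split; rewrite // /near ?eqxx // e.
  case: (leqP l (Lp q)) => hl.
    have hpq : par q < q by apply: par_lt; rewrite q0.
    have q0n : 0 < q <= n by rewrite q0.
    have [|r [k1 k2 k3 k4]] := IH _ hpq _ (h2 _ q0n hA hl); first by lia.
    exists r; split=> //; first by lia.
    exact: near_trans (near_par q0n hl) k2.
  exists q; split=> //; first by rewrite /near eqxx.
  move=> t ht; rewrite /near negb_or neq_ltn ht /= -ltnNge.
  by apply: leq_ltn_trans hl; apply: Lp_max => //; rewrite q0.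
have [r [r1 r2 r3 r4]] := up p hp (h1 _ hp hm).
have hnr : near l s r := near_trans hn r2.
have down t : t <= n -> near l t r -> DN t.
  elim/ltn_ind: t => t IH ht hr.
  case: (ltngtP t r) => htr.
  - by have := r4 _ htr; rewrite near_sym hr.
  - have ht0 : 0 < t <= n by lia.
    have hl : l <= Lp t.
      have := Lp_max ht0 htr; move: hr; rewrite /near; case: eqP => [|_] /=; lia.
    apply: h4 => //; apply: IH; first exact: par_lt.
      by have := par_lt ht0; lia.
    by apply: near_trans hr; rewrite near_sym; apply: near_par.
  - by rewrite htr; apply: h3 => //; lia.
exact: down.
Qed.

(** Information for length [l] crosses an edge only if the label is at least [l], so it never leaves
    the class in which it arose. *)
Lemma tree_sound s :
  (forall s, s <= n -> A s -> mask s \/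
     exists c, [/\ 0 < c <= n, par c = s, A c & l <= Lp c]) ->
  (forall s, s <= n -> DN s -> A s \/ [/\ 0 < s, DN (par s) & l <= Lp s]) ->
  s <= n -> DN s -> exists p, [/\ p <= n, near l s p & mask p].
Proof.
move=> h1 h2.
have hA m q : n - q <= m -> q <= n -> A q -> exists p, [/\ p <= n, near l q p & mask p].
  elim: m q => [|m IH] q hm hq /(h1 _ hq)[h|[c [hc e hA hl]]].
  - by exists q; rewrite /near eqxx.
  - by have := par_lt hc; rewrite e; lia.
  - by exists q; rewrite /near eqxx.
  have hqc := par_lt hc; rewrite e in hqc.
  have [||p [k1 k2 k3]] := IH c _ _ hA; try by lia.
  exists p; split=> //; apply: near_trans k2; rewrite -e near_sym.
  exact: near_par.
elim/ltn_ind: s => s IH hs /(h2 _ hs)[h|[s0 hD hl]]; first exact: hA (leqnn _) hs h.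
have hs0 : 0 < s <= n by rewrite s0.
have hps := par_lt hs0.
have [|p [k1 k2 k3]] := IH _ hps _ hD; first by lia.
by exists p; split=> //; apply: near_trans k2; apply: near_par.
Qed.
End Tree.

(** * Detecting factor windows across the seams *)

Section Seams.
Variables (W : seq nat) (k : nat).
Hypothesis k_gt1 : 1 < k.
Hypothesis kW : k < size W.
Local Notation n := (size W).
Local Notation sub := (factor W).
Local Notation isF := (isF W k).
Local Notation nof := (nof W k).

Lemma take_sub s l m : l <= m -> take l (sub s m) = sub s l.
Proof. by move=> h; rewrite /factor take_takel. Qed.

Lemma drop_sub2 s l m : l <= m -> drop l (sub s m) = sub (s + l) (m - l).
Proof.
by move=> h; rewrite /factor -{1}(subnK h) -take_drop drop_drop (addnC l).
Qed.

Lemma sub_n l : sub n l = [::].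
Proof. by rewrite /factor drop_size. Qed.

Lemma sub_add s l m : sub s (l + m) = sub s l ++ sub (s + l) m.
Proof. by rewrite /factor takeD drop_drop (addnC s). Qed.

Lemma sub_cons s l : s < n -> sub s l.+1 = nth 0 W s :: sub s.+1 l.
Proof. by move=> h; rewrite /factor (drop_nth 0 h). Qed.

Lemma sub_eq_le l a b m : sub a m = sub b m -> l <= m -> sub a l = sub b l.
Proof. by move=> e h; rewrite -(take_sub a h) e take_sub. Qed.

Variables (lcp lcs : nat -> nat -> nat).
Hypothesis lcpE : forall a b, a <= n -> b <= n -> lcp a b =
  if (a == n) || (b == n) then 0 else
  if nth 0 W a == nth 0 W b then (lcp a.+1 b.+1).+1 else 0.
Hypothesis lcsE : forall a b, a <= n -> b <= n -> lcs a b =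
  if (a == 0) || (b == 0) then 0 else
  if nth 0 W a.-1 == nth 0 W b.-1 then (lcs a.-1 b.-1).+1 else 0.

Lemma lcpP a b l : a <= n -> b <= n ->
  (l <= lcp a b) = [&& a + l <= n, b + l <= n & sub a l == sub b l].
Proof.
elim: l a b => [|l IH] a b ha hb; first by rewrite !addn0 ha hb /factor !take0 eqxx.
rewrite lcpE //; case: (a =P n) => [->|na] /=; first by lia.
case: (b =P n) => [->|nb] /=; first by lia.
have ha' : a < n by lia.
have hb' : b < n by lia.
rewrite !sub_cons // eqseq_cons; case: eqP => [e|ne] /=; last by rewrite ltn0 !andbF.
by rewrite ltnS IH // !addSnnS.
Qed.

Lemma lcsP a b l : a <= n -> b <= n ->
  (l <= lcs a b) = [&& l <= a, l <= b & sub (a - l) l == sub (b - l) l].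
Proof.
elim: l a b => [|l IH] a b ha hb; first by rewrite /factor !take0 eqxx.
rewrite lcsE //; case: a ha => [|a] ha //=; case: b hb => [|b] hb /=; first by rewrite andbF.
rewrite !ltnS !subSS; case: (leqP l a) => h1 /=; last first.
  case: eqP => _; rewrite ?ltn0 // ltnS (IH a b (ltnW ha) (ltnW hb)).
  by rewrite leqNgt h1.
case: (leqP l b) => h2 /=; last first.
  case: eqP => _; rewrite ?ltn0 // ltnS (IH a b (ltnW ha) (ltnW hb)).
  by rewrite (leqNgt l b) h2 andbF.
have s1 c : c < n -> sub c 1 = [:: nth 0 W c].
  by move=> h; rewrite sub_cons // /factor take0.
rewrite -addn1 !sub_add !subnK // eqseq_cat; last by rewrite !size_sub; lia.
rewrite !s1 // eqseq_cons andbT addn1; case: (nth 0 W a =P _) => e; last by rewrite andbF.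
rewrite andbT ltnS.
by rewrite (IH a b (ltnW ha) (ltnW hb)) h1 h2.
Qed.

Lemma lcp_sym a b : a <= n -> b <= n -> lcp a b = lcp b a.
Proof.
move=> ha hb; apply/eqP; rewrite eqn_leq; apply/andP; split; rewrite lcpP //.
  by have := leqnn (lcp a b); rewrite lcpP // => /and3P[-> -> /eqP->] /=.
by have := leqnn (lcp b a); rewrite lcpP // => /and3P[-> -> /eqP->] /=.
Qed.

Lemma lcp_ultra a b c : a <= n -> b <= n -> c <= n ->
  minn (lcp a b) (lcp b c) <= lcp a c.
Proof.
move=> ha hb hc; set m := minn _ _.
have : m <= lcp a b by exact: geq_minl.
have : m <= lcp b c by exact: geq_minr.
by rewrite !lcpP // => /and3P[h1 h2 /eqP e1] /and3P[h3 _ /eqP e2]; rewrite h3 h2 e2 e1 /=.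
Qed.

(* Window p splits after c > 0 letters so that its right part is a prefix of the
   pattern at q. *)
Definition prb (q p c : nat) : bool :=
  [&& 0 < c <= k, p + k <= n & sub (p + c) (k - c) == sub q (k - c)].

Lemma prbS q p c : q < n -> 0 < c < k ->
  prb q p c = (nth 0 W (p + c) == nth 0 W q) && prb q.+1 p c.+1 && (p + k <= n).
Proof.
move=> hq hc; rewrite /prb; case: (leqP (p + k) n) => hp; rewrite ?andbF ?andbT //.
have -> : k - c = (k - c.+1).+1 by lia.
rewrite !sub_cons //; last by lia.
rewrite eqseq_cons addnS; have -> : 0 < c <= k by lia.
by have -> : 0 < c.+1 <= k by lia.
Qed.

Lemma prbk q p : prb q p k = (p + k <= n).
Proof. by rewrite /prb subnn /factor !take0 eqxx andbT; have -> : 0 < k <= k by lia. Qed.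

Lemma prb_n p c : prb n p c = (c == k) && (p + k <= n).
Proof.
case: (c =P k) => [->|nc]; first by rewrite prbk.
rewrite /prb sub_n; case: (leqP c k) => hc; rewrite ?andbF //.
case: (leqP (p + k) n) => hp; rewrite ?andbF //.
apply/negbTE/negP => /and3P[_ _ /eqP/(congr1 size)]; rewrite size_sub //=; lia.
Qed.

Definition nearp := near lcp.

Lemma near_sub l s p : s <= n -> p <= n -> p + l <= n -> nearp l s p ->
  s + l <= n /\ sub s l = sub p l.
Proof.
by move=> hs hp hl; rewrite /nearp /near; case: eqP => [<-|_] //=; rewrite lcpP // => /and3P[-> _ /eqP].
Qed.

Lemma sub_near l s p : s <= n -> p <= n -> p + l <= n -> s + l <= n ->
  sub s l = sub p l -> nearp l s p.
Proof. by move=> hs hp h1 h2 e; rewrite /nearp /near lcpP // h1 h2 e eqxx orbT. Qed.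

Section Right.
Variables (q' : nat).
Hypothesis hq' : q' <= n.
Let P := sub q' k.

(** The occurrence [p] in W of the window made of [l] copied letters and a prefix of the pattern
    need not be [s]: it has to share [l] letters with [s] and to continue like the pattern. The
    second condition does not mention [s], so it can be computed once per [p] and spread over the
    classes. *)
Lemma mb_char s l : s <= n ->
  (exists p, [/\ p <= n, nearp l s p & prb q' p l]) <->
  [/\ 0 < l <= k, s + l <= n & isF (sub s l ++ take (k - l) P)].
Proof.
move=> hs; split=> [[p [hp hn /and3P[hl hpk /eqP e]]]|[hl hsl /isFP[p hp e]]].
  have [h1 e1] := @near_sub l s p hs hp ltac:(lia) hn.
  split=> //; rewrite e1 take_sub ?leq_subr // -e -sub_add subnKC; last by lia.
  exact: isF_sub.
have ek : k = l + (k - l) by lia.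
have e2 : sub p l = sub s l /\ sub (p + l) (k - l) = take (k - l) P.
  move/eqP: e; rewrite -[window _ _ _]/(sub p k) {1}ek sub_add eqseq_cat; last first.
    by rewrite !size_sub //; lia.
  by case/andP=> /eqP-> /eqP->.
have [ea eb] := e2; exists p; split; first by lia.
  by apply: sub_near => //; lia.
by rewrite /prb hl hp eb /P take_sub ?leq_subr //= eqxx.
Qed.

Variable Bb : nat -> nat -> bool.
Hypothesis BbE : forall s l, s <= n -> l < k -> s + l <= n ->
  Bb s l <-> (exists p, [/\ p <= n, nearp l s p & prb q' p l]) \/
             [/\ 0 < l, s < n & Bb s.+1 l.-1].

(** A window of W that starts in the copied factor and reaches the pattern starts either at its
    first letter, which is [mb_char], or in the shorter factor from [s + 1] on. *)
Lemma bb_char s l : s <= n -> l < k -> s + l <= n -> ~~ Bb s l = nof (sub s l) P.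
Proof.
elim: l s => [|l IH] s hs hl hsl.
  rewrite {1}/factor take0 /=; apply/negP=> /(BbE hs hl hsl)[|[]] //.
  by move/(mb_char _ hs)=> [].
have hs' : s < n by lia.
rewrite sub_cons //= -IH; try by lia.
rewrite -[_ :: _ ++ P]cat_cons -sub_cons // take_cat size_sub // ltnNge ltnW //=.
apply/idP/andP => [h|[h1 h2]].
  split; apply: contra h => h; apply/(BbE hs hl hsl); last by right.
  by left; apply/(mb_char _ hs); split=> //; lia.
apply/negP=> /(BbE hs hl hsl)[/(mb_char _ hs)[_ _ h]|[_ _ h]].
  by rewrite h in h1.
by rewrite /= in h; rewrite h in h2.
Qed.

Section Left.
Variables (q : nat).
Hypothesis hq : q + k <= n.
Let N := sub q k.
(** Length of the longest proper suffix of the pattern [N] that ends just before position [p] of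
    W. *)
Let lam p := minn k.-1 (lcs p (q + k)).

Lemma size_N : size N = k. Proof. exact: size_sub. Qed.

Lemma lamP p a : p <= n -> a <= k.-1 ->
  (a <= lam p) = (a <= p) && (sub (p - a) a == drop (k - a) N).
Proof.
move=> hp ha; rewrite /lam leq_min ha lcsP //= drop_sub2 ?leq_subr //.
have -> : k - (k - a) = a by lia.
have -> : q + (k - a) = q + k - a by lia.
by have -> : a <= q + k by lia.
Qed.

Lemma lam_sub p : p <= n -> lam p <= p /\ sub (p - lam p) (lam p) = drop (k - lam p) N.
Proof.
move=> hp; have h : lam p <= k.-1 by exact: geq_minl.
by have := leqnn (lam p); rewrite (lamP hp h) => /andP[-> /eqP].
Qed.

Lemma lcs_ext_lt p : lam p < k.
Proof. by have : lam p <= k.-1 by [exact: geq_minl]; lia. Qed.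

Variable f : nat -> nat.
Hypothesis f_le : forall s, s <= n -> f s <= k.
Hypothesis f_min : forall s p, s <= n -> p <= n -> p + (k - lam p) <= n ->
  nearp (k - lam p) s p -> f s <= k - lam p.
Hypothesis f_ex : forall s, s <= n -> f s < k ->
  exists p, [/\ p <= n, p + f s <= n, nearp (f s) s p & f s = k - lam p].

Lemma nof_behead A B : (nof (behead N ++ A) B) =
  nof (behead N) (A ++ B) && nof A B.
Proof. exact: nof_cat. Qed.

Lemma nofP A B : reflect (forall i, i < size A -> ~~ isF (take k (drop i (A ++ B)))) (nof A B).
Proof.
elim: A => [|a A IH] /=; first by left.
apply: (iffP andP) => [[h1 /IH h2] [|i] hi|h]; [by []|exact: h2|].
by split; [apply: (h 0)|apply/IH => i hi; apply: (h i.+1)].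
Qed.

Lemma nof_beheadN B : reflect (forall a, 0 < a < k -> ~~ isF (take k (drop (k - a) N ++ B)))
  (nof (behead N) B).
Proof.
have eN i : i < k.-1 -> drop i (behead N ++ B) = drop i.+1 N ++ B.
  move=> hi; rewrite drop_cat size_behead size_N hi.
  by congr (_ ++ _); rewrite -drop1 drop_drop addn1.
apply: (iffP (nofP _ _)) => h.
  move=> a ha; have := h (k - a).-1; rewrite size_behead size_N eN; last by lia.
  by rewrite prednK; [apply|]; lia.
move=> i; rewrite size_behead size_N => hi; rewrite eN //.
have := h (k - i.+1); have -> : k - (k - i.+1) = i.+1 by lia.
by apply; lia.
Qed.

Lemma fok_char s l : s + l <= n -> nof (behead N ++ sub s l) [::] = (l < f s).
Proof.
move=> hsl; have hs : s <= n by lia.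
case: (ltnP l k) => hlk; last first.
  apply/idP/idP => [h|]; last by have := f_le hs; lia.
  by have := nof_sub_lt k_gt1 kW hsl h; lia.
rewrite nof_behead cats0 [nof (sub s l) _](nof_short k_gt1 kW) ?andbT; last first.
  by rewrite size_sub.
apply/nof_beheadN/idP => [h|h a ha].
  rewrite ltnNge; apply/negP=> hf; have [p [hp1 hp2 hp3 hp4]] := f_ex hs ltac:(lia).
  have [l1 l2] := lam_sub hp1; have l3 := lcs_ext_lt p.
  have /negP[] := h (lam p) ltac:(lia).
  have [_ e] := near_sub hs hp1 hp2 hp3.
  have -> : take k (drop (k - lam p) N ++ sub s l) = sub (p - lam p) k.
    rewrite take_cat size_drop size_N; have -> : k - (k - lam p) = lam p by lia.
    rewrite ltnNge ltnW //= -l2 -hp4 take_sub // e.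
    have -> : sub (p - lam p) k = sub (p - lam p) (lam p + f s) by congr factor; lia.
    by rewrite sub_add subnK.
  by apply: isF_sub; lia.
apply/negP => hF; have hsz := isF_size hF.
have al : k <= a + l.
  move: hsz; rewrite size_take_min size_cat size_drop size_N size_sub //; lia.
move: hF; rewrite take_cat size_drop size_N; have -> : k - (k - a) = a by lia.
rewrite ltnNge ltnW //=; last by lia.
rewrite take_sub; last by lia.
case/isFP=> p hp; rewrite -[window _ _ _]/(sub p k); have {1}-> : k = a + (k - a) by lia.
rewrite sub_add => /eqP; rewrite eqseq_cat; last by rewrite size_sub ?size_drop ?size_N; lia.
case/andP=> /eqP e1 /eqP e2.
have hla : a <= lam (p + a).
  by rewrite lamP; [rewrite leq_addl addnK e1 eqxx|lia|lia].
have : f s <= k - lam (p + a).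
  apply: f_min => //; try by lia.
  apply: sub_near => //; try by lia.
  by apply: sub_eq_le (esym e2) _; lia.
by lia.
Qed.

(** For windows that span [N], the whole copied factor and a part of the next pattern, again only
    the longest suffix [lam p] has to be tried: the window that starts earlier asks for a shorter
    prefix of the next pattern. *)
Lemma m1_char s l : s + l <= n -> l < f s ->
  (exists p, [/\ p <= n, nearp l s p & prb q' (p - lam p) (l + lam p)]) <->
  exists a, [/\ a < k, 0 < a + l <= k &
    isF (drop (k - a) N ++ sub s l ++ take (k - (a + l)) P)].
Proof.
move=> hsl hf; have hs : s <= n by lia.
split=> [[p [hp hn /and3P[hl hpk /eqP e]]]|[a [ha hal /isFP[p hp]]]].
  have [l1 l2] := lam_sub hp; have l3 := lcs_ext_lt p.
  have [_ e1] := @near_sub l s p hs hp ltac:(lia) hn.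
  exists (lam p); split=> //; rewrite ?(addnC (lam p)) //.
  rewrite take_sub ?leq_subr // -e e1 -l2.
  have -> : p - lam p + (l + lam p) = p + l by lia.
  have -> : sub p l ++ sub (p + l) (k - (l + lam p)) = sub (p - lam p + lam p) (k - lam p).
    by rewrite -sub_add subnK //; congr factor; lia.
  rewrite -sub_add subnKC; last by lia.
  exact: isF_sub.
rewrite -[window _ _ _]/(sub p k); have {1}-> : k = a + (l + (k - (a + l))) by lia.
rewrite !sub_add => /eqP; rewrite eqseq_cat; last by rewrite size_sub ?size_drop ?size_N; lia.
case/andP=> /eqP e1; rewrite eqseq_cat; last by rewrite !size_sub //; lia.
case/andP=> /eqP e2 /eqP e3.
have hla : a <= lam (p + a).
  by rewrite lamP; [rewrite leq_addl addnK e1 eqxx|lia|lia].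
have hnear : nearp l s (p + a) by apply: sub_near => //; lia.
have l3 := lcs_ext_lt (p + a); have [l1 l2] := @lam_sub (p + a) ltac:(lia).
(* Otherwise the longer suffix would complete a window inside the copied factor, against
   [l < f s]. *)
have hk : l + lam (p + a) <= k.
  rewrite leqNgt; apply/negP=> h.
  have : f s <= k - lam (p + a); last by lia.
  apply: f_min => //; try by lia.
  by apply: sub_near; try lia; apply: sub_eq_le (esym e2) _; lia.
exists (p + a); split=> //; first by lia.
apply/and3P; split; try by lia.
have -> : p + a - lam (p + a) + (l + lam (p + a)) = p + a + l by lia.
apply/eqP; rewrite -(take_sub q' (leq_subr (l + lam (p + a)) k)) -/P.
rewrite -(@take_takel _ _ (k - (a + l))); last by lia.
by rewrite -e3 take_sub //; lia.
Qed.

Variable M1 : nat -> nat -> bool.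
Hypothesis M1E : forall s l, s <= n -> l < k -> s + l <= n ->
  M1 s l <-> exists p, [/\ p <= n, nearp l s p & prb q' (p - lam p) (l + lam p)].

(** Three kinds of windows must be avoided: those that start in [N] and end in the factor ([f]),
    those that start in [N] or at [s] and end in the next pattern ([M1]), and those that start
    strictly inside the factor ([Bb]). *)
Lemma dir_char s l : s + l <= n -> l < k ->
  nof (behead N ++ sub s l) P =
  [&& l < f s, ~~ M1 s l & (l == 0) || ~~ Bb s.+1 l.-1].
Proof.
move=> hsl hlk; have hs : s <= n by lia.
have tk a : a + l <= k -> a < k -> take k (drop (k - a) N ++ sub s l ++ P) =
    drop (k - a) N ++ sub s l ++ take (k - (a + l)) P.
  move=> h1 h2; rewrite take_cat size_drop size_N; have -> : k - (k - a) = a by lia.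
  rewrite ltnNge ltnW //= take_cat size_sub // ltnNge.
  have -> /= : l <= k - a by lia.
  by rewrite subnDA.
have tail : (l == 0) || ~~ Bb s.+1 l.-1 -> forall i, i < l -> 0 < i ->
    ~~ isF (take k (drop i (sub s l ++ P))).
  case: l hsl hlk {tk} => [|l] hsl hlk //=.
  rewrite bb_char; [|lia|lia|lia] => /nofP h [|i] // hi _.
  rewrite sub_cons //=; last by lia.
  by apply: h; rewrite size_sub; lia.
rewrite nof_behead; apply/andP/and3P => [[h1 h2]|[h1 h2 h3]].
  have hf : l < f s.
    rewrite -fok_char // nof_behead cats0 [nof (sub s l) _](nof_short k_gt1 kW) ?size_sub //.
    by rewrite andbT; exact: nof_weak h1.
  split=> //.
    apply/negP=> /(M1E hs hlk hsl)/(m1_char hsl hf)[a [ha1 ha2 hF]].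
    case: (posnP a) => [a0|a0]; last first.
      by move/nof_beheadN: h1 => /(_ a ltac:(lia)); rewrite tk ?hF //; lia.
    case: l hsl hlk hf h1 h2 ha2 hF {tk tail} => [|l] hsl hlk hf h1 h2 ha2 hF.
      by move: ha2; rewrite a0.
    move/nofP: h2 => /(_ 0); rewrite size_sub // => /(_ isT)/negP; apply.
    move: hF; rewrite a0 subn0 drop_oversize ?size_N // add0n drop0 cat0s.
    by rewrite take_cat size_sub // ltnNge ltnW.
  case: l hsl hlk hf h1 h2 {tk tail} => [|l] hsl hlk hf h1 h2 //=.
  rewrite bb_char; [|lia|lia|lia]; move: h2; rewrite sub_cons /=; last by lia.
  by case/andP.
split.
  apply/nof_beheadN=> a ha; case: (leqP (a + l) k) => hal.
    rewrite tk //; last by lia.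
    apply: contra h2 => hF; apply/(M1E hs hlk hsl)/(m1_char hsl h1).
    by exists a; split=> //; lia.
  have := h1; rewrite -fok_char // nof_behead cats0 => /andP[/nof_beheadN/(_ a ha) h _].
  move: h; rewrite catA [in X in _ -> X]takel_cat //.
  by rewrite size_cat size_drop size_N size_sub //; lia.
apply/nofP=> i; rewrite size_sub // => hi; case: (posnP i) => [i0|]; last exact: tail.
apply: contra h2; rewrite i0 drop0 => hF; apply/(M1E hs hlk hsl)/(m1_char hsl h1).
exists 0; split; try by lia.
rewrite subn0 drop_oversize ?size_N // add0n.
by move: hF; rewrite take_cat size_sub // ltnNge ltnW.
Qed.

(** If the patterns share [k - d] letters, then appending the last [d] letters of the next pattern
    to [N] is copying from [q' + k - d]. The first [d - 1] of them must not complete a window, which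
    [f] decides; the last one completes the next pattern itself. *)
Lemma ovl_char d : 0 < d < k -> q' + k <= n ->
  (N == take d N ++ take (k - d) P) && nof (behead (take d N)) P =
  (k - d <= lcp (q + d) q') && (d <= f (q' + k - d)).
Proof.
move=> hd hq2; have -> : (N == take d N ++ take (k - d) P) = (k - d <= lcp (q + d) q').
  rewrite -{1}(cat_take_drop d N) eqseq_cat // eqxx /= lcpP; try by lia.
  rewrite drop_sub2 ?take_sub ?leq_subr //; last by lia.
  have -> : q + d + (k - d) <= n by lia.
  by have -> : q' + (k - d) <= n by lia.
case h : (k - d <= lcp _ _) => //=.
move: h; rewrite lcpP; [|lia|lia]; case/and3P=> _ _ /eqP e.
have hs : q' + k - d + d.-1 <= n by lia.
have -> : d <= f (q' + k - d) = (d.-1 < f (q' + k - d)) by lia.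
rewrite -(fok_char hs).
have -> : behead N ++ sub (q' + k - d) d.-1 = behead (take d N) ++ take k.-1 P.
  have -> : behead N = behead (take d N) ++ drop d N.
    rewrite -{1}(cat_take_drop d N); case et : (take d N) => [|a t] //.
    by have := congr1 size et; rewrite size_take size_N; case: ltnP => /=; lia.
  rewrite -catA; congr (_ ++ _); rewrite drop_sub2 ?e; last by lia.
  rewrite take_sub; last by lia.
  have -> : k.-1 = (k - d) + d.-1 by lia.
  by rewrite sub_add; congr (_ ++ sub _ _); lia.
rewrite nof_cat cats0 [nof (take _ _) _](nof_short k_gt1 kW) ?andbT; last first.
  by rewrite size_take_min; lia.
by apply: (nof_take k_gt1 kW); rewrite take_takel.
Qed.

End Left.
End Right.
End Seams.

(** * Optimal values *)

Section Optimal.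
Variables (W : seq nat) (k : nat).
Hypothesis k_gt1 : 1 < k.
Hypothesis kW : k < size W.
Hypothesis W_pos : forall x, x \in W -> 0 < x.
Variable Sk : {fset nat}.
Local Notation n := (size W).
Local Notation sub := (factor W).
Local Notation pvs := (pvs W k Sk).
Local Notation T := (T W k Sk).
Local Notation Az := (Az W k Sk).
Local Notation pat := (pat W k).
Local Notation fok := (fok W k).
Local Notation ovl := (ovl W k Sk).
Local Notation dir := (dir W k Sk).

(** [F s] is an attained minimum over [P]; this form asks neither decidability nor finiteness of
    [P]. *)
Definition exact (P : seq nat -> Prop) (g : seq nat -> seq nat) (F : nat -> nat) : Prop :=
  forall s, s <= n -> (forall u, P u -> F s <= lev (g u) (drop s W)) /\
    (exists2 u, P u & lev (g u) (drop s W) <= F s).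

Lemma exact_lip P g F j : exact P g F -> j < n ->
  F j <= (F j.+1).+1 /\ F j.+1 <= (F j).+1.
Proof.
move=> h hj; have [l1 [u1 p1 e1]] := h j (ltnW hj); have [l2 [u2 p2 e2]] := h j.+1 hj.
have [a1 _] := lev_drop1 (g u2) hj; have [_ b1] := lev_drop1 (g u1) hj.
by have := l1 _ p2; have := l2 _ p1; lia.
Qed.

Lemma exact_eq P g F F' s : exact P g F -> exact P g F' -> s <= n -> F s = F' s.
Proof.
move=> h h' hs; have [l1 [u1 p1 e1]] := h s hs; have [l2 [u2 p2 e2]] := h' s hs.
by have := l1 _ p2; have := l2 _ p1; lia.
Qed.

Lemma exact_ext P g g' F F' : (forall s, s <= n -> F' s = F s) ->
  (forall u, P u -> g' u = g u) -> exact P g F -> exact P g' F'.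
Proof.
move=> eF eg h s hs; have [l1 [u1 p1 e1]] := h s hs; rewrite eF //; split.
  by move=> u hu; rewrite eg //; apply: l1.
by exists u1; rewrite ?eg.
Qed.

(** The edit distance recurrence passes to minima because all strings receive the same new first
    letter: each of its three terms can be minimised separately. *)
Lemma exact_cons P g g' F F' c : exact P g F ->
  (forall u, P u -> g' u = c :: g u) -> F' n = (F n).+1 ->
  (forall j, j < n -> F' j =
    minn (minn (F j).+1 (F' j.+1).+1) (F j.+1 + (c != nth 0 W j))) ->
  exact P g' F'.
Proof.
move=> h eg hn hj s hs.
move: {2}(n - s) (leqnn (n - s)) => m; elim: m s hs => [|m IH] s hs hm.
  have -> : s = n by lia.
  have [l1 [u1 p1 e1]] := h n (leqnn _); rewrite hn drop_size; split.
    by move=> u hu; rewrite eg // levs0 /=; have := l1 _ hu; rewrite drop_size levs0.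
  by exists u1; rewrite ?eg // levs0 /=; move: e1; rewrite drop_size levs0.
case: (ltnP s n) => hsn; last by apply: IH; lia.
have [l1 [u1 p1 e1]] := h s hs; have [l2 [u2 p2 e2]] := h s.+1 hsn.
have [l3 [u3 p3 e3]] := IH s.+1 hsn ltac:(lia).
rewrite hj // (drop_nth 0 hsn); split.
  move=> u hu; rewrite eg // lev_cons -(drop_nth 0 hsn).
  have := l1 u hu; have := l2 u hu; have := l3 u hu; rewrite eg //.
  by case: (c == _) => /=; lia.
move: e1; rewrite (drop_nth 0 hsn) => e1.
set b1 := (F s).+1; set b2 := (F' s.+1).+1; set b3 := _ + _.
have [e|[e|e]] : minn (minn b1 b2) b3 = b1 \/ minn (minn b1 b2) b3 = b2 \/
   minn (minn b1 b2) b3 = b3 by lia.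
- exists u1 => //; rewrite e eg // /b1.
  exact: leq_trans (lev_insl _ _ _) _.
- by exists u3 => //; rewrite e /b2; apply: leq_trans (lev_insr _ _ _) _.
- exists u2 => //; rewrite e eg // /b3; apply: leq_trans (lev_match _ _ _ _) _.
  by rewrite leq_add2r.
Qed.

Section StageD.
Variables (x : nat) (V : nat -> nat -> nat) (D K f : nat -> nat).
Hypothesis hx : 0 < x <= n - k + 1.
Local Notation x' := (pvs x).
Hypothesis hV : forall y, y <= k -> exact (T x') (fun u => drop (k - y) u) (V y).
Hypothesis hK : exact (Az x') id K.
Hypothesis K_att : forall j, j <= n ->
  [\/ exists l, [/\ j + l <= n, bok W k x' j l & K j = V k (j + l)],
      exists l, [/\ j + 1 + l <= n, l < k & K j = (V k (j + 1 + l)).+1] |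
      j + k <= n /\ K j = (K (j + k)).+1].
Hypothesis f_gt0 : forall s, s <= n -> 0 < f s <= k.
Hypothesis fE : forall s l, s + l <= n -> fok x s l = (l < f s).
Hypothesis D_ovl : forall s d, s <= n -> 0 < d < k -> ovl x d -> D s <= V d s.
Hypothesis D_dir : forall s l, s + l <= n -> dir x s l -> D s <= V k (s + l).
Hypothesis D_hash : forall s l, s + l <= n -> l < f s -> D s <= (V k (s + l)).+1.
Hypothesis D_hashK : forall s, s + f s <= n -> D s <= (K (s + f s)).+1.
Hypothesis D_att : forall s, s <= n ->
  [\/ exists d, [/\ 0 < d < k, ovl x d & D s = V d s],
      exists l, [/\ s + l <= n, dir x s l & D s = V k (s + l)],
      exists l, [/\ s + l <= n, l < f s & D s = (V k (s + l)).+1] |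
      s + f s <= n /\ D s = (K (s + f s)).+1].

Lemma dropkk (u : seq nat) : drop (k - k) u = u.
Proof. by rewrite subnn drop0. Qed.

Lemma bok_suffix y j l m : j + l + m <= n -> bok W k y j (l + m) -> bok W k y (j + l) m.
Proof. by move=> h; rewrite /bok -(sub_cat h) nof_cat => /andP[]. Qed.

Lemma K_copy j l : j + l <= n -> bok W k x' j l -> K j <= V k (j + l).
Proof.
move=> hj hb; have [_ [u hu e]] := hV (leqnn k) hj; rewrite dropkk in e.
have [h _] := hK (leq_trans (leq_addr l j) hj).
apply: leq_trans (h _ (comp_bok k_gt1 kW hb hu)) _.
by rewrite (drop_sub hj); apply: leq_trans (lev_same _ _ _) e.
Qed.

Lemma K_hash j l : j + l < n -> l < k -> K j <= (K (j + l.+1)).+1.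
Proof.
move=> hj hl; have hj' : j + l.+1 <= n by lia.
have [_ [z hz e]] := hK hj'; have [h _] := @hK j ltac:(lia).
apply: leq_trans (h (sub j l ++ hash :: z) _) _; first exact: comp_bhash.
rewrite (drop_sub (ltnW hj)); apply: leq_trans (lev_same _ _ _) _.
by rewrite (drop_nth 0 hj) -addnS; apply: leq_trans (lev_match _ _ _ _) _; case: eqP => /=; lia.
Qed.

Lemma V_K j : j <= n -> K j <= V k j.
Proof.
by move=> hj; have := @K_copy j 0; rewrite addn0 => h; apply: h; rewrite // /bok /factor take0.
Qed.

(** The candidates for [D] contain a # only directly before the next pattern, or at the last
    admissible place [f s] with a free continuation. This is enough because a # can be delayed over
    letters that are copied: either the copying ends before [f s], or the # moves to [f s] and the
    rest is a continuation counted by [K]. *)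
Lemma D_hash_gen s l : s + l <= n -> l <= f s -> D s <= (K (s + l)).+1.
Proof.
move=> hs hl; have hf := f_gt0 (leq_trans (leq_addr l s) hs).
case: (ltngtP l (f s)) hl => // [hl _|e _]; last first.
  by move: hs; rewrite e; exact: D_hashK.
case: (K_att hs) => [[m [h1 h2 ->]]|[m [h1 h2 ->]]|[h1 ->]].
- case: (ltnP (l + m) (f s)) => h3.
    by have := @D_hash s (l + m); rewrite addnA; apply.
  have e : s + l + m = s + f s + (l + m - f s) by lia.
  have hb : bok W k x' (s + f s) (l + m - f s).
    have -> : s + f s = s + l + (f s - l) by lia.
    apply: bok_suffix; first by lia.
    by have -> : f s - l + (l + m - f s) = m by lia.
  have h4 : s + f s <= n by lia.
  have := @K_copy (s + f s) (l + m - f s) ltac:(lia) hb.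
  by rewrite -e; have := D_hashK h4; lia.
- case: (ltnP (l + 1 + m) (f s)) => h3.
    by have := @D_hash s (l + 1 + m); rewrite !addnA => /(_ h1 h3); lia.
  have h4 : s + f s <= n by lia.
  have := D_hashK h4.
  case: (ltnP (l + m) (f s)) => h5.
    have -> : s + l + 1 + m = s + f s by lia.
    by have := V_K h4; lia.
  have := @K_hash (s + f s) (l + m - f s) ltac:(lia) ltac:(lia).
  have -> : s + f s + (l + m - f s).+1 = s + l + 1 + m by lia.
  by have := V_K h1; lia.
- have h4 : s + f s <= n by lia.
  have := D_hashK h4; case: (ltnP (f s) (l + k)) => h5; last first.
    have -> : s + l + k = s + f s by lia.
    exact: leqW.
  have := @K_hash (s + f s) (l + k - f s).-1 ltac:(lia) ltac:(lia).
  have -> : s + f s + (l + k - f s).-1.+1 = s + l + k by lia.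
  by lia.
Qed.

(** For [l = 0] the # is inserted; otherwise it takes the place of the letter at [s + l - 1]. *)
Lemma D_upper_hash s l : s + l <= n -> l <= f s ->
  exists2 u, T x u & lev (drop k u) (drop s W) <= (K (s + l)).+1.
Proof.
have dk u : drop k (pat x ++ u) = u by rewrite drop_size_cat // size_pat.
move=> hs hl; have [_ [z hz e]] := hK hs.
have hf := f_gt0 (leq_trans (leq_addr l s) hs).
case: l hs hl e => [|l] hs hl e.
  exists (pat x ++ sub s 0 ++ hash :: z).
    by apply: comp_hash => //; rewrite fE ?addn0; lia.
  rewrite dk /factor take0; apply: leq_trans (lev_insl _ _ _) _.
  by rewrite -[s in drop s]addn0.
have hs' : s + l < n by lia.
exists (pat x ++ sub s l ++ hash :: z).
  by apply: comp_hash => //; rewrite fE //; lia.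
rewrite dk (drop_sub (ltnW hs')); apply: leq_trans (lev_same _ _ _) _.
rewrite (drop_nth 0 hs') -addnS; apply: leq_trans (lev_match _ _ _ _) _.
by case: eqP => /=; lia.
Qed.

Lemma D_exact : exact (T x) (drop k) D.
Proof.
have dk u : drop k (pat x ++ u) = u by rewrite drop_size_cat // size_pat.
move=> s hs; split=> [u hu|].
  apply: (@D_lower W k k_gt1 kW Sk x D (V k) K hx) => //.
  - by move=> t v ht hv; have [h _] := hV (leqnn k) ht; rewrite -{1}(dropkk v) h.
  - by move=> t z ht hz; have [h _] := hK ht; apply: h.
  - move=> d t v hd ho ht hv; apply: leq_trans (D_ovl ht hd ho) _.
    by have [h _] := @hV d ltac:(lia) _ ht; apply: h.
  - by move=> t ht; have := @D_hash_gen t 0; rewrite addn0; apply.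
  - move=> t l ht hf; have ht' : t + l.+1 <= n by lia.
    by apply: D_hash_gen => //; rewrite -fE // ltnW.
case: (D_att hs) => [[d [hd ho ->]]|[l [hl hd ->]]|[l [h1 h2 ->]]|[h1 ->]].
- have [_ [u hu e]] := @hV d ltac:(lia) _ hs.
  have [h1 h2] := comp_ovl k_gt1 kW hx hd ho hu.
  by exists (take d (pat x) ++ u) => //; rewrite h2.
- have [_ [u hu e]] := hV (leqnn k) hl; rewrite dropkk in e.
  exists (pat x ++ sub s l ++ u); first exact: comp_dir.
  by rewrite dk (drop_sub hl); apply: leq_trans (lev_same _ _ _) e.
- have [u hu e] := D_upper_hash h1 (ltnW h2); exists u => //.
  by apply: leq_trans e _; rewrite ltnS; apply: V_K.
- exact: D_upper_hash.
Qed.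
End StageD.

Section StageK.
Variables (x : nat) (V K : nat -> nat).
Hypothesis hx : x <= n - k + 1.
Hypothesis hV : exact (T x) id V.
Hypothesis K_copy' : forall j l, j + l <= n -> l < k -> bok W k x j l -> K j <= V (j + l).
Hypothesis K_sub : forall j l, j + 1 + l <= n -> l < k -> K j <= (V (j + 1 + l)).+1.
Hypothesis K_far : forall j, j + k <= n -> K j <= (K (j + k)).+1.
Hypothesis K_att : forall j, j <= n ->
  [\/ exists l, [/\ j + l <= n, bok W k x j l & K j = V (j + l)],
      exists l, [/\ j + 1 + l <= n, l < k & K j = (V (j + 1 + l)).+1] |
      j + k <= n /\ K j = (K (j + k)).+1].

Lemma bok_lt j l : j + l <= n -> bok W k x j l -> l < k.
Proof. by move=> h h2; apply: (@nof_sub_lt W k k_gt1 kW j l [::] _ h h2). Qed.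

(** As for [D], a # can be delayed: it suffices to try it directly before the pattern, or after
    [k - 1] copied letters, which is as late as possible. *)
Lemma K_hash' j l : j + l < n -> l < k -> K j <= (K (j + l.+1)).+1.
Proof.
move: {2}(n - j) (leqnn (n - j)) => m; elim: m j => [|m IH] j hm hj hl; first by lia.
have hj' : j + l.+1 <= n by lia.
case: (K_att hj') => [[i [h1 h2 ->]]|[i [h1 h2 ->]]|[h1 ->]].
- have hi := bok_lt h1 h2; case: (ltnP (l + i) k) => h3.
    have := @K_sub j (l + i) ltac:(lia) h3.
    by have -> : j + 1 + (l + i) = j + l.+1 + i by lia.
  have hjk : j + k <= n by lia.
  have hb : bok W k x (j + k) (l.+1 + i - k).
    have -> : j + k = j + l.+1 + (k - l.+1) by lia.
    apply: bok_suffix; first by lia.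
    by have -> : k - l.+1 + (l.+1 + i - k) = i by lia.
  have := @K_copy' (j + k) (l.+1 + i - k) ltac:(lia) ltac:(lia) hb.
  have -> : j + k + (l.+1 + i - k) = j + l.+1 + i by lia.
  by have := K_far hjk; lia.
- case: (ltnP (l.+1 + i) k) => h3.
    have := @K_sub j (l.+1 + i) ltac:(lia) h3.
    have -> : j + 1 + (l.+1 + i) = j + l.+1 + 1 + i by lia.
    exact: leqW.
  have hjk : j + k <= n by lia.
  have := @K_sub (j + k) (l.+1 + i - k) ltac:(lia) ltac:(lia).
  have -> : j + k + 1 + (l.+1 + i - k) = j + l.+1 + 1 + i by lia.
  by have := K_far hjk; lia.
- have hjk : j + k <= n by lia.
  have := IH (j + k) ltac:(lia) ltac:(lia) hl.
  have -> : j + k + l.+1 = j + l.+1 + k by lia.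
  by have := K_far hjk; lia.
Qed.

Lemma K_exact : exact (Az x) id K.
Proof.
move=> j hj; split=> [z hz|].
  apply: (@K_lower W k k_gt1 kW Sk x V K hx) => //.
  - by move=> t u ht hu; have [h _] := hV ht; apply: h.
  - by move=> i l hi hb; apply: K_copy' => //; apply: bok_lt hb.
  - by move=> i l hi hl; apply: K_hash'.
move: {2}(n - j) (leqnn (n - j)) => m; elim: m j hj => [|m IH] j hj hm.
all: case: (K_att hj) => [[l [h1 h2 ->]]|[l [h1 h2 ->]]|[h1 ->]].
1, 4: have [_ [u hu e]] := hV h1; exists (sub j l ++ u);
  [exact: comp_bok|by rewrite (drop_sub h1); apply: leq_trans (lev_same _ _ _) e].
1, 3: have [_ [u hu e]] := hV h1; have h3 : j + l < n by lia.
1, 2: exists (sub j l ++ hash :: u); first by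
  apply: comp_bhash => //; apply: T_fw hu.
1, 2: rewrite (drop_sub (ltnW h3)) (drop_nth 0 h3); apply: leq_trans (lev_same _ _ _) _;
  apply: leq_trans (lev_match _ _ _ _) _; move: e; rewrite (_ : j + 1 + l = (j + l).+1) /=;
  [case: eqP => /=; lia|lia].
- by lia.
have [z hz e] := IH (j + k) h1 ltac:(lia).
have h3 : j + k.-1 < n by lia.
exists (sub j k.-1 ++ hash :: z); first by apply: comp_bhash => //; lia.
rewrite (drop_sub (ltnW h3)) (drop_nth 0 h3); apply: leq_trans (lev_same _ _ _) _.
apply: leq_trans (lev_match _ _ _ _) _; move: e.
have -> : j + k = (j + k.-1).+1 by lia.
by case: eqP => /=; lia.
Qed.
End StageK.

End Optimal.

(** * The tables of the algorithm *)

Declare Scope expr_scope.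
Delimit Scope expr_scope with E.
Bind Scope expr_scope with expr.
Coercion EC : nat >-> expr.
Notation "a + b" := (EA AAdd a b) : expr_scope.
Notation "a * b" := (EA AMul a b) : expr_scope.
Notation "a %/ b" := (EA ADiv a b) : expr_scope.
Notation "a %% b" := (EA AMod a b) : expr_scope.
Notation "a - b" := (ES a b) : expr_scope.
Notation "a .&& b" := (EA AAnd a b) (at level 40, left associativity) : expr_scope.
Notation "a .|| b" := (EA AOr a b) (at level 50, left associativity) : expr_scope.
Notation "'IFEQ' a b 'THEN' c 'ELSE' d" := (EI true a b c d)
  (at level 80, a at level 9, b at level 9, c at level 79, d at level 80) : expr_scope.
Notation "'IFLT' a b 'THEN' c 'ELSE' d" := (EI false a b c d)
  (at level 80, a at level 9, b at level 9, c at level 79, d at level 80) : expr_scope.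
Definition emin (a b : expr) : expr := ES a (ES a b).
Definition emax (a b : expr) : expr := EA AAdd a (ES b a).

Notation eN := (EV 0).
Notation eK := (EV 1).
Notation eS := (EV 2).
Notation eTau := (EV 4).
Notation eB := (EV 5).
Notation eNB := (EV 6).
Notation eX := (EV rx).
Notation eY := (EV ry).
Notation eZ := (EV rz).

Section Tables.
Local Open Scope expr_scope.

(* PW: powers of two.  MP, ST: masked minimum and column step of a block of tau entries.
   LCP, LCS: common extensions of two positions.  EQF, EQR: words of letter comparisons.
   PR: words of prefix comparisons with the pattern of a stage.  BP, NX: parent and next
   sibling in the tree of longest common prefixes.  PV: next non-sensitive stage.
   LM ... DF: where a window of W first arises after the pattern of stage x is followed
   by a copied factor.  AW, MD: admissible overlaps and copied lengths.  DD, KF: values D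
   and K with the optimal choice.  RR, BS, VV, VC: columns of the edit distance tables, as
   differences and base values, and the differences of the last row.  UX0 ... BB: copied
   factors that may precede a pattern.  TX ... TL: the trace of an optimal string. *)
Definition tPW := 1%N.
Definition tMP := 2%N.
Definition tST := 3%N.
Definition tLCP := 4%N.
Definition tLCS := 5%N.
Definition tEQF := 6%N.
Definition tEQR := 7%N.
Definition tPR := 8%N.
Definition tBP := 9%N.
Definition tNX := 10%N.
Definition tPV := 11%N.
Definition tLM := 12%N.
Definition tMK := 13%N.
Definition tUX1 := 14%N.
Definition tDN1 := 15%N.
Definition tUF := 16%N.
Definition tDF := 17%N.
Definition tAW := 18%N.
Definition tMD := 19%N.
Definition tDD := 20%N.
Definition tRR := 21%N.
Definition tBS := 22%N.
Definition tVV := 23%N.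
Definition tVC := 24%N.
Definition tUX0 := 25%N.
Definition tDN0 := 26%N.
Definition tBB := 27%N.
Definition tKF := 28%N.
Definition tTX := 29%N.
Definition tTY := 30%N.
Definition tTJ := 31%N.
Definition tTO := 32%N.
Definition tTV := 33%N.
Definition tTA := 34%N.
Definition tTL := 35%N.

Definition xPW (i : expr) : expr := EL tPW 0 0 i.
Definition xW (i : expr) : expr := EL 0 0 0 i.
(** Indexed by the distance to the end of W, because the recurrence runs from right to left while
    tables are filled with increasing indices. *)
Definition xLCP (a b : expr) : expr := EL tLCP (eN - a) (eN - b) 0.
(** [tBP] holds the maximum of lcp * S + position over the earlier positions, so quotient and
    remainder give the longest common prefix and a position that attains it. *)
Definition xLen (s : expr) : expr := EL tBP s s 0 %/ eS.
Definition xPar (s : expr) : expr := EL tBP s s 0 %% eS.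
(** Entry y of row s of [tNX] is the least child of s not below n + 1 - y, or n + 1 if there is
    none; at y = n - s this is the first child of s, and in the row of the parent the next sibling
    of s. *)
Definition xFC (s : expr) : expr := EL tNX s (eN - s) 0.
Definition xNS (s : expr) : expr := EL tNX (xPar s) (eN - s) 0.
(** The minimum with x - 1 makes it evident, whatever the table contains, that only earlier stages
    are read. *)
Definition xPrev (x : expr) : expr := emin (x - 1) (EL tPV x 0 0).
(* The low h bits of a vector, restricted to word b. *)
Definition xLow (h b : expr) : expr := xPW (emin eTau (h - b * eTau)) - 1.
Definition xRow (x : expr) : expr := IFEQ x 0 THEN 0 ELSE eK - 1 + x.
Definition xCand (base c m o : expr) : expr :=
  base * eS + EL tMP eTau c m + o - eTau * eS.
(** The test s < c ensures, independently of the contents of the tables, that the lookup in [e]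
    concerns a later position, whose cell is already filled. *)
Definition xNext (c s d e : expr) : expr :=
  IFLT s c THEN (IFLT eN c THEN d ELSE e) ELSE d.
Definition stg (e : expr) : expr := IFEQ eX 0 THEN 0 ELSE e.

Definition ePW := IFEQ eZ 0 THEN 1 ELSE 2 * xPW (eZ - 1).

Definition eMP :=
  let r := (eY %% 4) * eS + 1 + EL tMP (eX - 1) (eY %/ 4) (eZ %/ 2) in
  IFEQ eX 0 THEN eS * eS + eTau * eS ELSE
  (IFEQ (eZ %% 2) 1 THEN emin (eX * eS) r ELSE r).

Definition eST :=
  let h := eZ %% 4 in let e := eZ %/ 4 in let d := eY %% 4 in
  let m := emin h (emin d (1 - e %% 2)) in
  let r := EL tST (eX - 1) (eY %/ 4) ((e %/ 2) * 4 + (m + 2 - d)) in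
  IFEQ eX 0 THEN h ELSE 16 * (r %/ 4) + 4 * (m + 2 - h) + r %% 4.

Definition eLCP := IFEQ eX 0 THEN 0 ELSE (IFEQ eY 0 THEN 0 ELSE
  (IFEQ (xW (eN - eX)) (xW (eN - eY)) THEN EL tLCP (eX - 1) (eY - 1) 0 + 1 ELSE 0)).
Definition eLCS := IFEQ eX 0 THEN 0 ELSE (IFEQ eY 0 THEN 0 ELSE
  (IFEQ (xW (eX - 1)) (xW (eY - 1)) THEN EL tLCS (eX - 1) (eY - 1) 0 + 1 ELSE 0)).
Definition eEQF := stg ((IFEQ (xW (eN - eX)) (xW eY) THEN 1 ELSE 0) +
  2 * (EL tEQF (eX - 1) eY 0 %% (eB %/ 2))).
Definition eEQR := stg ((IFEQ (xW (eX - 1)) (xW eY) THEN 1 ELSE 0) +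
  2 * (EL tEQR (eX - 1) eY 0 %% (eB %/ 2))).

(** Passing from q + 1 to q shifts the vector of [prb] down by one bit, masks it with the comparison
    of the letters with W[q], and sets bit k, where the right part is empty. Bit 0 is cleared, since
    a split has c > 0. *)
Definition ePR :=
  let hi := IFEQ eZ (eK %/ eTau) THEN xPW (eK %% eTau) ELSE 0 in
  let v := IFEQ eX 0 THEN hi ELSE
    ((EL tPR (eX - 1) eY eZ %/ 2 + (EL tPR (eX - 1) eY (eZ + 1) %% 2) * (eB %/ 2)) .&&
     EL tEQF (eN - (eY + eZ * eTau)) (eN - eX) 0) .|| hi in
  IFEQ eZ 0 THEN (v %/ 2) * 2 ELSE v.

Definition eBP := IFEQ eY 0 THEN 0 ELSE
  emax (EL tBP eX (eY - 1) 0) (xLCP eX (eY - 1) * eS + (eY - 1)).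

Definition eNX :=
  let c := eN + 1 - eY in
  IFEQ eY 0 THEN eN + 1 ELSE (IFLT eX c THEN (IFEQ (xPar c) eX THEN c
    ELSE EL tNX eX (eY - 1) 0) ELSE EL tNX eX (eY - 1) 0).

Definition ePV := IFLT eX 2 THEN 0 ELSE
  (IFEQ (xW (eN + (eN + 2 - (eK + eX)))) 0 THEN eX - 1 ELSE EL tPV (eX - 1) 0 0).

Definition eLM := stg (emin (eK - 1) (EL tLCS eY (eN + 1 - eX) 0)).

(** Bit l tells whether the window that starts l0 = [tLM] letters before the position splits after
    l0 + l letters into a part before the seam and a prefix of the next pattern; hence the shift by
    l0. *)
Definition eMK :=
  let l := EL tLM eX eY 0 in
  let w c := EL tPR (xRow (xPrev eX)) (eY - l) c in
  stg (w (eZ + l %/ eTau) %/ xPW (l %% eTau) +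
       (w (eZ + l %/ eTau + 1) * xPW (eTau - l %% eTau)) %% eB).

(** The upward vector of a node gathers its own information, cut at the common prefix length with
    the parent, and that of its later siblings, so the first child stands for all children; the
    downward pass adds what comes from the parent. *)
Definition xUp (src : expr -> expr) (ux : nat) (s : expr) : expr :=
  src s .|| xNext (xFC s) s 0 (EL ux eX (eN - xFC s) eZ).
Definition eUX (src : expr -> expr) (ux : nat) : expr :=
  let s := eN - eY in
  (xUp src ux s .&& xLow (xLen s + 1) eZ) .||
  xNext (xNS s) s 0 (EL ux eX (eN - xNS s) eZ).
Definition eDN (src : expr -> expr) (ux dn : nat) : expr :=
  xUp src ux eY .|| (IFLT (xPar eY) eY THEN
    EL dn eX (xPar eY) eZ .&& xLow (xLen eY + 1) eZ ELSE 0).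

Definition src1 (s : expr) : expr := EL tMK eX s eZ.
Definition src0 (s : expr) : expr := EL tPR (xRow eX) s eZ.

(** The least number of copied letters that completes a window with its seam at s, or k if W ends
    before. The two tree passes are those of the bit vectors with minima in place of unions. *)
Definition xIni (s : expr) : expr :=
  let r := eK - EL tLM eX s 0 in IFLT eN (s + r) THEN eK ELSE r.
Definition xUpF (s : expr) : expr :=
  emin (xIni s) (xNext (xFC s) s eK (EL tUF eX (eN - xFC s) 0)).
Definition eUF := let s := eN - eY in
  stg (emin (IFLT (xLen s) (xUpF s) THEN eK ELSE xUpF s)
            (xNext (xNS s) s eK (EL tUF eX (eN - xNS s) 0))).
Definition eDF := stg (emin (xUpF eY) (IFLT (xPar eY) eY THEN
  (let r := EL tDF eX (xPar eY) 0 in IFLT (xLen eY) r THEN eK ELSE r) ELSE eK)).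
Definition xF (s : expr) : expr := EL tDF eX s 0.

Definition xQ (x : expr) : expr := IFEQ x 0 THEN eN ELSE eN + 1 - (eK + x).

Definition eAW :=
  let d := eY * eTau + eTau - eZ in
  let q := xQ (xPrev eX) in
  stg (IFEQ eZ 0 THEN 0 ELSE
    (IFLT 0 d THEN (IFLT d eK THEN
      (IFLT (xLCP (eN + 1 - (eK + eX) + d) q) (eK - d) THEN 0 ELSE
       (IFLT (xF (q + (eK - d))) d THEN 0 ELSE 1)) ELSE 0) ELSE 0) +
    2 * EL tAW eX eY (eZ - 1)).

Definition xShl (t : nat) (x y : expr) : expr :=
  (EL t x y eZ * 2) %% eB + (IFLT eZ 1 THEN 0 ELSE EL t x y (eZ - 1) %/ (eB %/ 2)).

Definition xLim (s : expr) : expr := emin (eN + 1 - s) (xF s).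

Definition eMD :=
  stg (xLow (xLim eY) eZ .&&
    (eB - 1 - (EL tDN1 eX eY eZ .||
      (IFLT eY eN THEN xShl tBB (xPrev eX) (eN - eY - 1) ELSE 0)))).

(** A running minimum over the blocks, with S * S as infinity. Codes: d < k for an overlap at
    distance d; k + l for copying l letters and then the pattern; 3k + l for advancing by l letters
    of W of which the last becomes a # (inserted if l = 0). *)
Definition eDD :=
  let X := xPrev eX in let b := eZ - 1 in let j := eY + b * eTau in
  let V := EL tVV X (eN - j) 0 in let VC := EL tVC X (eN - j) 0 in
  stg (IFEQ eZ 0 THEN
    (IFLT eN (eY + xF eY) THEN eS * eS ELSE
     (EL tKF X (eN - (eY + xF eY)) eNB %/ eS + 1) * eS + (3 * eK + xF eY)) ELSE
    (emin (EL tDD eX eY b)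
    (emin (xCand (EL tBS X (eN - eY) b) (EL tRR X (eN - eY) b %/ 4) (EL tAW eX b eTau) (b * eTau))
    (emin (xCand V VC (EL tMD eX eY b) (eK + b * eTau))
          (xCand (V + 1) VC (xLow (xLim eY) b) (3 * eK + b * eTau)))))).

Definition xD (j : expr) : expr := EL tDD eX j eNB %/ eS.

(** The entry is 4 * code + h: the code of the vertical differences in the block, and 1 plus the
    horizontal difference below its last row, which the next block takes over. In the column of the
    end of W all vertical differences are 1, so the code consists of digits 2. *)
Definition eRR :=
  let j := eN - eY in
  let h := IFEQ eZ 0 THEN xD j + 1 - xD (j + 1) ELSE EL tRR eX eY (eZ - 1) %% 4 in
  stg (IFEQ eY 0 THEN ((eB * eB - 1) %/ 3 * 2) * 4 + 2 ELSE
    EL tST eTau (EL tRR eX (eY - 1) eZ %/ 4)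
       (EL tEQR (eN + 1 - eX - eZ * eTau) j 0 * 4 + h)).

Definition eBS :=
  stg (IFEQ eZ 0 THEN xD (eN - eY) ELSE (IFEQ eY 0 THEN xD eN + eZ * eTau ELSE
    EL tBS eX (eY - 1) eZ + EL tRR eX eY (eZ - 1) %% 4 - 1)).

(* Entry y of column j of stage x. *)
Definition xVal (x y j : expr) : expr :=
  EL tBS x (eN - j) (y %/ eTau) +
  EL tMP eTau (EL tRR x (eN - j) (y %/ eTau) %/ 4) (xPW (y %% eTau)) %/ eS - eTau.

Definition eVV := IFEQ eX 0 THEN eY ELSE xVal eX eK (eN - eY).

(** A code is kept for every starting position of the last row, obtained from its right neighbour by
    pushing one digit, so that a scan may begin anywhere without realignment. *)
Definition eVC := IFEQ eY 0 THEN 0 ELSE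
  EL tVV eX (eY - 1) 0 + 1 - EL tVV eX eY 0 +
  4 * (EL tVC eX (eY - 1) 0 %% (eB * eB %/ 4)).

Definition eBB := EL tDN0 eX (eN - eY) eZ .||
  (IFLT 0 eY THEN xShl tBB eX (eY - 1) ELSE 0).

(** Codes: k + l for copying l letters and then the pattern; 3k + 1 + l for copying l letters,
    turning the next one into #, and then the pattern; 4k for copying k - 1 letters, turning the
    next into #, and choosing anew. *)
Definition eKF :=
  let b := eZ - 1 in let i := eY - b * eTau in let i1 := eY - (b * eTau + 1) in
  IFEQ eZ 0 THEN
    (IFLT eY eK THEN eS * eS ELSE (EL tKF eX (eY - eK) eNB %/ eS + 1) * eS + 4 * eK) ELSE
  (emin (EL tKF eX eY b)
  (emin (xCand (EL tVV eX i 0) (EL tVC eX i 0)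
          (xLow (emin (eY + 1) eK) b .&& (eB - 1 - EL tBB eX eY b)) (eK + b * eTau))
        (xCand (EL tVV eX i1 0 + 1) (EL tVC eX i1 0)
          (xLow (emin eY eK) b) (3 * eK + 1 + b * eTau)))).

Definition xOld (t : nat) : expr := EL t (eX - 1) 0 0.
Definition xLetter (x y : expr) : expr := xW (eN + 1 - (x + y)).
Definition start (a b : expr) : expr := IFEQ eX 0 THEN a ELSE b.

(* Actions: 0 halt, 1 choose how to enter the next pattern, 2 choose what precedes the
   next pattern, 3 delete a letter, 4 and 5 emit a pattern letter (4 consumes one),
   6 copy a letter, 7 and 8 emit # (7 consumes one). *)
Definition eTX := start (xPrev (eN + 2 - eK))
  (IFEQ (xOld tTA) 1 THEN xPrev (xOld tTX) ELSE xOld tTX).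
Definition eTY := start (2 * eK + 1)
  (let a := xOld tTA in
   IFEQ a 1 THEN EL tDD (xOld tTX) (xOld tTJ) eNB %% eS ELSE
   (IFEQ a 2 THEN EL tKF (xOld tTX) (eN - xOld tTJ) eNB %% eS ELSE
   (IFLT a 4 THEN xOld tTY ELSE
   (IFLT a 7 THEN xOld tTY - 1 ELSE 2 * eK + 1)))).
Definition eTJ := start 0
  (let a := xOld tTA in
   IFLT a 3 THEN xOld tTJ ELSE (IFEQ a 5 THEN xOld tTJ ELSE
   (IFEQ a 8 THEN xOld tTJ ELSE xOld tTJ + 1))).
Definition eTO := start 0 (IFLT (xOld tTA) 4 THEN xOld tTO ELSE xOld tTO + 1).

Definition xCur (t : nat) : expr := EL t eX 0 0.
Definition eTV := xVal (xCur tTX) (xCur tTY - (IFLT eY 2 THEN 0 ELSE 1))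
  (xCur tTJ + (IFEQ eY 0 THEN 0 ELSE 1)).
Definition eTA :=
  let X := xCur tTX in let Y := xCur tTY in let J := xCur tTJ in
  let v i := EL tTV eX i 0 in
  let body :=
    IFEQ Y 0 THEN 1 ELSE
    (IFLT Y (eK + 1) THEN
      (IFLT J eN THEN (IFEQ (v 0%N) (v 1%N + 1) THEN 3 ELSE
        (IFEQ (v 0%N) (v 2%N + (IFEQ (xLetter X Y) (xW J) THEN 0 ELSE 1)) THEN 4 ELSE 5))
       ELSE 5) ELSE
    (IFLT Y (2 * eK + 1) THEN 6 ELSE
    (IFEQ Y (2 * eK + 1) THEN 2 ELSE
    (IFEQ Y (3 * eK) THEN 8 ELSE
    (IFEQ Y (3 * eK + 1) THEN 7 ELSE 6))))) in
  IFEQ X 0 THEN (IFEQ Y eK THEN 0 ELSE body) ELSE body.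
Definition eTL :=
  IFLT (xCur tTA) 4 THEN 0 ELSE
  (IFLT (xCur tTA) 6 THEN xLetter (xCur tTX) (xCur tTY) ELSE
  (IFEQ (xCur tTA) 6 THEN xW (xCur tTJ) ELSE 0)).

Definition xSteps : expr := (eN + 2) * (eK + 8).

(** The 17 tables from [tLM] to [tKF] form one group: all of stage x is filled before stage x + 1,
    as a stage reads every table of its predecessor stage. The last group runs along the steps of
    the trace. *)
Definition etfs_system : system := System
  [:: Fill 1 (eTau + 1) ePW;
      Fill (eB * eB) eB eMP;
      Fill (eB * eB) (4 * eB) eST;
      Fill (eN + 1) 1 eLCP;
      Fill (eN + 1) 1 eLCS;
      Fill eN 1 eEQF;
      Fill eN 1 eEQR;
      Fill (eN + 1 - eK) eNB ePR;
      Fill (eN + 1) 1 eBP;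
      Fill (eN + 2) 1 eNX;
      Fill 1 1 ePV;
      Fill (eN + 1) 1 eLM;
      Fill (eN + 1) eNB eMK;
      Fill (eN + 1) eNB (stg (eUX src1 tUX1));
      Fill (eN + 1) eNB (stg (eDN src1 tUX1 tDN1));
      Fill (eN + 1) 1 eUF;
      Fill (eN + 1) 1 eDF;
      Fill eNB (eTau + 1) eAW;
      Fill (eN + 1) eNB eMD;
      Fill (eN + 1) (eNB + 1) eDD;
      Fill (eN + 1) eNB eRR;
      Fill (eN + 1) eNB eBS;
      Fill (eN + 1) 1 eVV;
      Fill (eN + 1) 1 eVC;
      Fill (eN + 1) eNB (eUX src0 tUX0);
      Fill (eN + 1) eNB (eDN src0 tUX0 tDN0);
      Fill (eN + 1) eNB eBB;
      Fill (eN + 1) (eNB + 1) eKF;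
      Fill 1 1 eTX;
      Fill 1 1 eTY;
      Fill 1 1 eTJ;
      Fill 1 1 eTO;
      Fill 4 1 eTV;
      Fill 1 1 eTA;
      Fill 1 1 eTL]
  [:: (EC 1, 1%N); (eTau + 1, 2%N); (eN + 1, 4%N); (eN + 1, 1%N); (eN + 1, 1%N);
      (eN + 1, 1%N); (eN + 3 - eK, 1%N); (eN + 2 - eK, 17%N); (xSteps + 1, 7%N)].

End Tables.

(** Every intermediate value of the entries and of the addresses is below [Q ^ 12], which is checked
    by computation and determines the word length. *)
Definition sdeg := 12.

Lemma etfs_system_ok : ok_system etfs_system sdeg.
Proof. by vm_compute. Qed.

Local Notation sys := etfs_system.

(** * The equations of the tables *)

Section Equations.
Variables (n k S M tau : nat).
Local Notation B := (2 ^ tau).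
Local Notation NB := (k %/ tau + 2).
Hypothesis k_gt1 : 1 < k.
Hypothesis kn : k < n.
Hypothesis tau_pos : 0 < tau.
Hypothesis S_def : S = 256 * (n + 1) ^ 2.
Hypothesis B8 : B ^ 8 <= 256 * n.
Hypothesis SM : S ^ 3 <= M.

Definition prm (r : nat) : nat := nth 0 [:: n; k; S; M; tau; B; NB] r.

Lemma env_nth x y z :
  env prm x y z = nth 0 [:: n; k; S; M; tau; B; NB; 0; x; y; z].
Proof.
apply: FunctionalExtensionality.functional_extensionality => r.
by do 11! [case: r => [|r] //]; rewrite /env /prm /= !nth_nil.
Qed.

Definition steps := (n + 2) * (k + 8).

Definition gnum (t : nat) : nat :=
  nth 0 [:: 9; 0; 1; 1; 2; 2; 2; 2; 3; 4; 5; 6; 7; 7; 7; 7; 7; 7; 7; 7; 7; 7; 7; 7; 7; 7;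
            7; 7; 7; 8; 8; 8; 8; 8; 8; 8] t.
Definition dimx (t : nat) : nat :=
  nth 0 [:: 1; tau + 1; n + 1; n + 1; n + 1; n + 1; n + 3 - k; n + 2 - k; steps + 1]
    (gnum t).
Definition dimy (t : nat) : nat :=
  nth 0 [:: 0; 1; B * B; B * B; n + 1; n + 1; n; n; n + 1 - k; n + 1; n + 2; 1;
    n + 1; n + 1; n + 1; n + 1; n + 1; n + 1; NB; n + 1; n + 1; n + 1; n + 1; n + 1;
    n + 1; n + 1; n + 1; n + 1; n + 1; 1; 1; 1; 1; 4; 1; 1] t.
Definition dimz (t : nat) : nat :=
  nth 0 [:: 0; tau + 1; B; 4 * B; 1; 1; 1; 1; NB; 1; 1; 1;
    1; NB; NB; NB; 1; 1; tau + 1; NB; NB + 1; NB; NB; 1; 1; NB; NB; NB; NB + 1;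
    1; 1; 1; 1; 1; 1; 1] t.

Lemma grp_num t : 0 < t <= 35 -> grp sys t = gnum t.
Proof. by case: t => // t; do 35! [case: t => [|t] //]. Qed.

Lemma NX_dim t : 0 < t <= 35 -> NX sys prm (grp sys t) = dimx t.
Proof. by move=> h; rewrite grp_num //; case: t h => // t; do 35! [case: t => [|t] //]. Qed.

Lemma NY_dim t : 0 < t <= 35 -> NY sys prm t = dimy t.
Proof. by case: t => // t; do 35! [case: t => [|t] //]. Qed.

Lemma NZ_dim t : 0 < t <= 35 -> NZ sys prm t = dimz t.
Proof. by case: t => // t; do 35! [case: t => [|t] //]. Qed.

Lemma tau_S : tau + 2 <= S /\ [/\ B * B <= S, 4 * B <= S, n + 5 <= S & steps + 1 <= S].
Proof.
have h1 : tau < B by exact: ltn_expl.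
have h2 : B * B <= B ^ 8 by rewrite -[B * B]/(B ^ 2) leq_pexp2l ?expn_gt0.
rewrite /steps S_def; have h3 : 1 < B by rewrite -{1}(expn0 2) ltn_exp2l.
by split; [nia|split; nia].
Qed.

Lemma NB_S : NB + 1 <= S.
Proof. by have := leq_div k tau; case: tau_S => _ [_ _ h _]; lia. Qed.

Lemma dims_S t : [/\ dimx t <= S, dimy t <= S & dimz t <= S].
Proof.
have [h0 [h1 h2 h3 h4]] := tau_S; have h5 := NB_S.
have h6 : B <= S by lia.
rewrite /dimx /dimy /dimz; split.
- by do 36! [case: t => [|t]; first by rewrite /=; lia]; rewrite /gnum /= ?nth_nil /=; lia.
- by do 36! [case: t => [|t]; first by rewrite /=; lia]; rewrite /= ?nth_nil /=; lia.
- by do 36! [case: t => [|t]; first by rewrite /=; lia]; rewrite /= ?nth_nil /=; lia.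
Qed.

Definition in_dims (t x y z : nat) : bool := [&& 0 < t <= 35, x < dimx t, y < dimy t & z < dimz t].

Lemma inr_inrt t x y z : inr sys prm t x y z = in_dims t x y z.
Proof.
rewrite /inr /in_dims; have -> : size (s_tabs sys) = 35 by [].
by case: (boolP (0 < t <= 35)) => // h; rewrite NX_dim ?NY_dim ?NZ_dim.
Qed.

Definition beforeS (t' x' y' z' t x y z : nat) : Prop :=
  in_dims t' (x' %% S) (y' %% S) (z' %% S) -> before sys (t', x' %% S, y' %% S, z' %% S) (t, x, y, z).

Lemma before_grp t' a b c t x y z : gnum t' < gnum t -> 0 < t <= 35 ->
  beforeS t' a b c t x y z.
Proof.
by move=> h1 h2 /and4P[h3 _ _ _]; rewrite /before !grp_num // h1.
Qed.

Lemma before_zero a b c t x y z : beforeS 0 a b c t x y z.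
Proof. by case/and4P. Qed.

Lemma before_in t' a b c t x y z : gnum t' = gnum t -> 0 < t <= 35 ->
  x < S -> y < S -> z < S ->
  (a < x) || (a == x) && ((t' < t) || (t' == t) && ((b < y) || (b == y) && (c < z))) ->
  beforeS t' a b c t x y z.
Proof.
move=> h1 h2 hx hy hz h /and4P[h5 _ _ _]; rewrite /before !grp_num // h1 ltnn eqxx /=.
case/orP: h => [h|/andP[/eqP-> h]]; first by rewrite modn_small ?h //; lia.
rewrite modn_small // ltnn eqxx /=; case/orP: h => [->//|/andP[-> h]]; apply/orP; right=> /=.
case/orP: h => [h|/andP[/eqP-> h]]; first by rewrite modn_small ?h //; lia.
by rewrite modn_small // ltnn eqxx /= modn_small ?h //; lia.
Qed.

Ltac leaf := first
  [ apply: before_zero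
  | by apply: before_grp
  | by apply: before_in => //; lia ].
Ltac lok := repeat first
  [ exact I | leaf | split | match goal with |- if ?b then _ else _ => case: (boolP b) => ? end ].

Lemma lok_weak (P P' : nat -> nat -> nat -> nat -> Prop) r m e :
  (forall t x y z, P t x y z -> P' t x y z) -> lok P r m e -> lok P' r m e.
Proof.
move=> h; elim: e => //= [o a IHa b IHb|a IHa b IHb|q a IHa b IHb d IHd e IHe|
  t a IHa b IHb c IHc].
- by case=> /IHa ? /IHb.
- by case=> /IHa ? /IHb.
- case=> /IHa ? /IHb ?; set c := (if q then _ else _).
  by case: c => [/IHd|/IHe].
- by case=> /IHa ? /IHb ? /IHc ? /h.
Qed.

(** Arithmetic on the indices alone: the guards of the entries provide the inequalities, and nothing
    about the meaning of the tables enters. *)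
Lemma loads_ok t x y z : in_dims t x y z -> load_ok sys S prm (t, x, y, z).
Proof.
move=> /and4P[ht hx hy hz]; have [dx dy dz] := dims_S t.
have {dx} xS := leq_trans hx dx; have {dy} yS := leq_trans hy dy.
have {dz} zS := leq_trans hz dz; have [_ [_ _ nS _]] := tau_S.
rewrite /load_ok env_nth => m.
suff : lok (fun t' x' y' z' => beforeS t' x' y' z' t x y z)
   (nth 0 [:: n; k; S; M; tau; B; NB; 0; x; y; z]) m (f_e (tab sys t)).
  apply: lok_weak => t' x' y' z'; rewrite /beforeS => h; rewrite inr_inrt; exact: h.
case: t ht hx hy hz => // t.
do 35! [case: t => [|t]; first by
  move=> _; rewrite /dimx /dimy /dimz /= => hx hy hz;
  rewrite /emin /xPar /xRow /xPrev /tPW /tMP /tST /tLCP /tLCS /tEQF /tEQR /tPR /tBP /tNX /tPV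
    /tLM /tMK /tUX1 /tDN1 /tUF /tDF /tAW /tMD /tDD /tRR /tBS /tVV /tVC /tUX0 /tDN0 /tBB /tKF
    /tTX /tTY /tTJ /tTO /tTV /tTA /tTL; lok].
by [].
Qed.
End Equations.

(** * The program *)

(** Quadratic in n because it must exceed the number of trace steps, of order n k, and the
    distances, of order n + n k; it also leaves room for the codes up to 4k and for the squares of 2
    ^ tau. *)
Definition side (n : nat) : nat := 256 * (n + 1) ^ 2.
(** The factor S ^ a covers letters up to n ^ a, and S ^ 4 the addresses of all tables. *)
Definition range (a n : nat) : nat := side n ^ (a + 4).
(** The base 256 = 2 ^ 8 gives [(2 ^ tau) ^ 8 <= 256 * n]; a fourth power of 2 ^ tau is all that the
    tables of blocks require. *)
Definition wbits (n : nat) : nat := (trunc_log 256 n).+1.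

Fixpoint powerP (i : nat) : program :=
  if i is i'.+1 then Seq (Assign 3 OpMul (Reg 3) (Reg 2)) (powerP i') else Skip.

Definition wbitsP : program :=
  While (TestLt (Reg 12) (Reg 13))
    (Seq (Assign 12 OpMul (Reg 12) (Cst 256)) (Seq (Assign 4 OpAdd (Reg 4) (Cst 1))
      (Assign 5 OpMul (Reg 5) (Cst 2)))).

Definition setupP (a : nat) : program :=
  Seq (Assign 2 OpAdd (Reg 0) (Cst 1)) (Seq (Assign 2 OpMul (Reg 2) (Reg 2))
  (Seq (Assign 2 OpMul (Reg 2) (Cst 256)) (Seq (Assign 3 OpAdd (Cst 1) (Cst 0))
  (Seq (powerP (a + 4)) (Seq (Assign 3 OpSub (Reg 3) (Cst 1))
  (Seq (Assign 12 OpAdd (Cst 256) (Cst 0)) (Seq (Assign 4 OpAdd (Cst 1) (Cst 0))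
  (Seq (Assign 5 OpAdd (Cst 2) (Cst 0)) (Seq (Assign 13 OpAdd (Reg 0) (Cst 1))
  (Seq wbitsP (Seq (Assign 6 OpDiv (Reg 1) (Reg 4)) (Assign 6 OpAdd (Reg 6) (Cst 2))))))))))))).

Definition setupT (a n : nat) : nat := 9 + (a + 5) + ((wbits n).-1 * 4).+1 + 2.

Lemma size_bounds a n : 2 < n -> [/\ 4096 <= side n, n + 5 <= side n & side n ^ 4 <= range a n].
Proof.
move=> hn; have h1 : 4 * 4 <= (n + 1) ^ 2 by rewrite expnS expn1 leq_mul //; lia.
have h2 : n + 1 <= (n + 1) ^ 2 by rewrite expnS expn1 leq_pmulr // addn1.
rewrite /range /side; split; try lia.
by rewrite leq_pexp2l ?leq_addl //; lia.
Qed.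

Section Setup.
Variables (w a n k : nat).
Hypothesis k_gt1 : 1 < k.
Hypothesis kn : k < n.
Local Notation S := (side n).
Local Notation Q := (range a n).
Hypothesis Qw : Q ^ 12 <= 2 ^ w.

Let n2 : 2 < n. Proof. lia. Qed.

Lemma word_range x : x <= Q -> to_word w x = x.
Proof.
move=> h; rewrite /to_word modn_small //; apply: leq_ltn_trans h (leq_trans _ Qw).
have [h1 _ h2] := size_bounds a n2.
have h3 : 1 < Q by apply: leq_trans h2; rewrite -{1}(exp1n 4) ltn_exp2r //; lia.
by rewrite -{1}(expn1 Q) ltn_exp2l.
Qed.

Lemma S4 x : x <= S ^ 4 -> to_word w x = x.
Proof. by move=> h; apply: word_range; apply: leq_trans h _; have [_ _] := size_bounds a n2. Qed.

Lemma S1 x : x <= S -> to_word w x = x.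
Proof.
move=> h; apply: S4; apply: leq_trans h _; rewrite -{1}(expn1 S) leq_pexp2l //.
by have [h1 _ _] := size_bounds a n2; lia.
Qed.

Definition known (L : seq nat) (s : state) : Prop := forall r, regs s r = nth 0 L r.

Lemma set_seq L r op x y v P s T (post : state -> Prop) : known L s ->
  eval_binop w op (eval_operand w s x) (eval_operand w s y) = v ->
  (forall s', smem s' = smem s -> known (set_nth 0 L r v) s' -> runs w P s' T post) ->
  runs w (Seq (Assign r op x y) P) s T.+1 post.
Proof.
move=> hL hv h; apply: (runs_assign_seq hv) => s' e1 e2 e3; apply: h => // q.
by rewrite nth_set_nth /=; case: eqP => [->//|/eqP hq]; rewrite e3.
Qed.

Lemma power_runs i L s P T v (post : state -> Prop) : known L s -> nth 0 L 2 = S ->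
  nth 0 L 3 = v -> v * S ^ i <= Q ->
  (forall s', smem s' = smem s -> known (set_nth 0 L 3 (v * S ^ i)) s' -> runs w P s' T post) ->
  runs w (Seq (powerP i) P) s (i.+1 + T) post.
Proof.
move=> hL h2 h3 hv h.
apply: (@runs_seq _ _ _ _ _ _ (fun s' => smem s' = smem s /\ known (set_nth 0 L 3 (v * S ^ i)) s'));
  last by move=> s' [? ?]; apply: h.
elim: i v L s hL h2 h3 hv {h} => [|i IH] v L s hL h2 h3 hv /=.
  eexists 1, s; split=> //; first exact: ExecSkip.
  by split=> // r; rewrite nth_set_nth /= expn0 muln1; case: eqP => [->|]; rewrite hL.
have h1 : v * S * S ^ i <= Q by move: hv; rewrite expnS mulnA.
have Spos : 0 < S ^ i by rewrite expn_gt0; have [? _ _] := size_bounds a n2; lia.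
apply: (set_seq hL (v := v * S)).
  rewrite /= !hL h2 h3 /eval_binop /= word_range //; apply: leq_trans h1; exact: leq_pmulr.
move=> s' e1 e2; apply: runs_weak (IH (v * S) _ _ e2 _ _ h1) (leqnn _) _.
- by rewrite nth_set_nth.
- by rewrite nth_set_nth.
move=> s'' [f1 f2]; split; first by rewrite f1.
move=> r; rewrite f2 !nth_set_nth /= expnS mulnA nth_set_nth /=.
by case: (r == 3).
Qed.

Lemma wbits_runs s : regs s 12 = 256 -> regs s 4 = 1 -> regs s 5 = 2 -> regs s 13 = n + 1 ->
  runs w wbitsP s ((wbits n).-1 * 4).+1 (fun s' => [/\ smem s' = smem s,
    forall r, r \notin [:: 4; 5; 12] -> regs s' r = regs s r,
    regs s' 4 = wbits n & regs s' 5 = 2 ^ wbits n]).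
Proof.
move=> h12 h4 h5 h13; have [h1 h2 h3] := size_bounds a n2.
pose I i s' := [/\ smem s' = smem s, forall r, r \notin [:: 4; 5; 12] -> regs s' r = regs s r,
  regs s' 4 = i.+1, regs s' 5 = 2 ^ i.+1 & regs s' 12 = 256 ^ i.+1].
have hlog : 256 ^ (trunc_log 256 n) <= n by apply: trunc_logP; lia.
have hlt : n < 256 ^ (trunc_log 256 n).+1 by exact: trunc_log_ltn.
have SS : 256 * n <= S ^ 4.
  apply: (@leq_trans (S * S)); last by rewrite -[S * S]/(S ^ 2) leq_pexp2l //; lia.
  by apply: leq_mul; lia.
have e2 i : 2 ^ i <= 256 ^ i by case: i => // i; rewrite leq_exp2r.
have e1 i : i < 256 ^ i by exact: ltn_expl.
apply: (runs_weak (@runs_while _ _ _ (trunc_log 256 n) 3 I _ _ _ _)); last 2 first.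
- by [].
- by move=> s' [? ? ? ? _].
- move=> i s' hi [i1 i2 i3 i4 i5]; have hp : 256 ^ i.+1 <= n.
    by apply: leq_trans hlog; rewrite leq_pexp2l.
  split; first by rewrite /= i5 i2 // h13 addn1 ltnS.
  have b1 : 256 ^ i.+2 <= 256 * n by rewrite expnS leq_mul2l hp orbT.
  apply: (runs_assign_seq (v := 256 ^ i.+2)) => [|s1 f1 f2 f3].
    rewrite /= i5 /eval_binop /= (@S1 256) ?S4 -?expnSr //; try lia.
  apply: (runs_assign_seq (v := i.+2)) => [|s2 g1 g2 g3].
    rewrite /= f3 // i3 /eval_binop /= (@S1 1) ?S4 ?addn1 //; try lia.
    by have := e1 i.+2; lia.
  apply: runs_assign; split=> /= [|r hr|||].
  + by rewrite g1 f1.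
  + rewrite !inE !negb_or in hr; case/and3P: hr => r1 r2 r3.
    by rewrite update_neq // g3 // f3 // i2 // !inE !negb_or r1 r2.
  + by rewrite update_neq // g2.
  + rewrite update_eq g3 // f3 // i4 /eval_binop /= (@S1 2) ?S4 -?expnSr //; try lia.
    by have := e2 i.+2; lia.
  + by rewrite update_neq // g3 // f2.
- by move=> s' [i1 i2 i3 i4 i5]; rewrite /= i5 i2 // h13 -leqNgt addn1.
- by split.
Qed.

Definition params : seq nat :=
  [:: n; k; S; Q.-1; wbits n; 2 ^ wbits n; k %/ wbits n + 2].

Lemma setup_runs s : known [:: n; k] s ->
  runs w (setupP a) s (setupT a n) (fun s' => smem s' = smem s /\
    forall r, r < 12 -> regs s' r = nth 0 params r).
Proof.
move=> hs; have [h1 h2 h3] := size_bounds a n2.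
have SS : 256 * n <= S ^ 4.
  apply: (@leq_trans (S * S)); last by rewrite -[S * S]/(S ^ 2) leq_pexp2l //; lia.
  by apply: leq_mul; lia.
have Qpos : 0 < Q by apply: leq_trans h3; rewrite expn_gt0; lia.
rewrite /setupT /setupP.
apply: runs_weak (_ : runs w _ s (4 + ((a + 4).+1 + (5 + (((wbits n).-1 * 4).+1 + 2)))) _) _ _;
  [|by lia|by move=> ?; exact].
apply: (set_seq hs (v := n + 1)) => [|s1 e1 k1].
  by rewrite /= hs /eval_binop /= (@S1 1) ?S1 //; lia.
apply: (set_seq k1 (v := (n + 1) ^ 2)) => [|s2 e2 k2].
  by rewrite /= k1 /eval_binop /= S1 ?expnS ?expn0 ?muln1 // /side !expnS expn0; lia.
apply: (set_seq k2 (v := S)) => [|s3 e3 k3].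
  have h256 : to_word w 256 = 256 by apply: S1; lia.
  by rewrite /eval_binop /= k2 h256 /= mulnC S1.
apply: (set_seq k3 (v := 1)) => [|s4 e4 k4].
  by rewrite /eval_binop /= (@S1 1) ?S1 ?(@S1 0) //; lia.
apply: (power_runs (v := 1) k4) => //; first by rewrite mul1n.
rewrite mul1n => s5 e5 k5.
apply: (set_seq k5 (v := Q.-1)) => [|s6 e6 k6].
  rewrite /= k5 /eval_binop /= (@S1 1); last by lia.
  have -> : 2 ^ w + Q - 1 = Q.-1 + 2 ^ w by lia.
  by rewrite /to_word modnDr -[_ %% _]/(to_word w _) word_range //; lia.
apply: (set_seq k6 (v := 256)) => [|s7 e7 k7].
  by rewrite /eval_binop /= (@S1 0) ?S1 ?addn0 ?S1 //; lia.
apply: (set_seq k7 (v := 1)) => [|s8 e8 k8].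
  by rewrite /eval_binop /= (@S1 0) ?S1 ?addn0 ?S1 //; lia.
apply: (set_seq k8 (v := 2)) => [|s9 e9 k9].
  by rewrite /eval_binop /= (@S1 0) ?S1 ?addn0 ?S1 //; lia.
apply: (set_seq k9 (v := n + 1)) => [|s10 e10 k10].
  by rewrite /= k9 /eval_binop /= (@S1 1) ?S1 //; lia.
have [q12 q4 q5 q13] : [/\ regs s10 12 = 256, regs s10 4 = 1, regs s10 5 = 2 &
  regs s10 13 = n + 1] by rewrite !k10.
apply: runs_seq (wbits_runs q12 q4 q5 q13) _ => s11 [e11 f11 g4 g5].
have hw : k %/ wbits n <= k by exact: leq_div.
apply: (runs_assign_seq (v := k %/ wbits n)) => [|s12 e12 f12 g12].
  by rewrite /= g4 f11 // k10 /eval_binop /= S1 //; lia.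
apply: runs_assign; split=> /=; first by rewrite e12 e11 e10 e9 e8 e7 e6 e5 e4 e3 e2 e1.
move=> r hr; rewrite /eval_binop /= f12 (@S1 2) ?S1; try lia.
case: (r =P 6) => [->|n6]; first by rewrite update_eq.
rewrite update_neq; last exact/eqP.
rewrite g12; last exact/eqP.
case: (r =P 4) => [->|n4]; first by rewrite g4.
case: (r =P 5) => [->|n5]; first by rewrite g5.
rewrite f11; last by rewrite !inE; lia.
rewrite k10; do 12! [case: r hr n4 n5 n6 => [|r] hr n4 n5 n6 //].
Qed.

End Setup.

(** * Semantics of the tables *)

Local Opaque modn divn expn adr.

Lemma size_facts n k S M tau : 1 < k -> k < n -> 0 < tau -> S = 256 * (n + 1) ^ 2 ->
  (2 ^ tau) ^ 8 <= 256 * n -> S ^ 3 <= M ->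
  [/\ 1000 <= S, n + 5 <= S, 2 ^ tau * 2 ^ tau <= S, tau + 2 <= S &
      2 * (k %/ tau + 2) + 5 <= S].
Proof.
move=> k_gt1 kn tau_pos S_def B8 SM.
have [h0 [h1 h2 h3 h4]] := tau_S k_gt1 kn tau_pos S_def B8 SM.
have hk := leq_div k tau; have h5 : n + 1 <= (n + 1) ^ 2 by rewrite expnS expn1 leq_pmulr // addn1.
have h6 : 4 * 4 <= (n + 1) ^ 2 by rewrite expnS expn1 leq_mul //; lia.
by split=> //; rewrite S_def; lia.
Qed.

Section Semantics.
Variables (W : seq nat) (k S M tau : nat) (Sk : {fset nat}) (m : nat -> nat).
Local Notation n := (size W).
Local Notation B := (2 ^ tau).
Local Notation NB := (k %/ tau + 2).
Hypothesis k_gt1 : 1 < k.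
Hypothesis kn : k < n.
Hypothesis tau_pos : 0 < tau.
Hypothesis S_facts :
  [/\ 1000 <= S, n + 5 <= S, B * B <= S, tau + 2 <= S & 2 * NB + 5 <= S].
Hypothesis SM : S ^ 3 <= M.
Local Notation inrt := (in_dims n k tau).
Hypothesis m_eq : forall t x y z, inrt t x y z -> m (adr S t x y z) =
  eval (nth 0 [:: n; k; S; M; tau; B; NB; 0; x; y; z]) m (f_e (tab sys t)) %% M.
Hypothesis m_out : forall t x y z, 0 < t -> x < S -> y < S -> z < S ->
  ~~ inrt t x y z -> m (adr S t x y z) = 0.
Hypothesis m_W : forall z, z < n -> m (adr S 0 0 0 z) = nth 0 W z.
Hypothesis m_Sk : forall p, p <= n - k -> m (adr S 0 0 0 (n + p)) = (p \in Sk).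

(* Tables are denoted by their numbers, from tPW = 1 to tTL = 35. *)
Definition TT (t x y z : nat) : nat := m (adr S t x y z).

Lemma modM v : v < S * S * S -> v %% M = v.
Proof. by move=> h; rewrite modn_small //; apply: leq_trans SM; rewrite !expnS muln1 mulnA. Qed.

Lemma modS1 a : a <= S * S -> a %% M = a.
Proof. by move=> h; apply: modM; case: S_facts; nia. Qed.

Lemma modS a : a <= S -> a %% M = a.
Proof. by move=> h; apply: modS1; nia. Qed.

Lemma B_gt1 : 1 < B. Proof. by rewrite -{1}(expn0 2) ltn_exp2l. Qed.

Lemma BS : B <= S.
Proof. by case: S_facts => _ _ h _ _; have := B_gt1; nia. Qed.

Ltac inr := rewrite /in_dims /dimx /dimy /dimz /=; try lia.

Lemma PW_val z : z <= tau -> TT 1 0 0 z = 2 ^ z.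
Proof.
elim: z => [|z IH] hz; rewrite /TT m_eq; try by inr.
  by rewrite /= modS //; case: S_facts; lia.
rewrite /= -/(TT 1 0 0 (z.+1 - 1)) subn1 IH /=; last exact: ltnW.
rewrite -expnS modS //; apply: leq_trans BS; by rewrite leq_exp2l.
Qed.

(** Serves only to show that the reduction modulo [M] leaves the entries unchanged. *)
Lemma MP_le x y z : x <= tau -> y < B * B -> z < B ->
  TT 2 x y z <= S * S + tau * S + x * (3 * S + 1).
Proof.
elim: x y z => [|x IH] y z hx hy hz; rewrite /TT m_eq; try by inr.
  by rewrite /= addn0 leq_mod.
have h := IH (y %/ 4) (z %/ 2) (ltnW hx) ltac:(lia) ltac:(lia).
apply: leq_trans (leq_mod _ _) _; rewrite /= subSS subn0 -/(TT tMP x (y %/ 4) (z %/ 2)).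
have h4 : y %% 4 * S <= 3 * S by rewrite leq_mul2r; lia.
by rewrite mulSn; case: ifP => _; move: h; rewrite /tMP; lia.
Qed.

Lemma MP_small x y z v : x <= tau -> y < B * B -> z < B ->
  v <= TT 2 x y z + 4 * S -> v %% M = v.
Proof.
move=> hx hy hz h; apply: modM; have := MP_le hx hy hz; case: S_facts => h1 _ _ h2 _.
have : x * (3 * S + 1) <= S * (3 * S + 1) by rewrite leq_mul2r; lia.
have : tau * S <= S * S by rewrite leq_mul2r; lia.
have : 1000 * (S * S) <= S * (S * S) by rewrite leq_mul2r h1 orbT.
by rewrite mulnDr mulnCA -mulnA; nia.
Qed.

Lemma MP_eq0 y z : y < B * B -> z < B -> TT 2 0 y z = S * S + tau * S.
Proof.
move=> hy hz; rewrite /TT m_eq; last by inr.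
by rewrite /= modM //; case: S_facts => h1 _ _ h2 _; nia.
Qed.

Lemma MP_eqS x y z : x < tau -> y < B * B -> z < B -> TT 2 x.+1 y z =
  let r := (y %% 4) * S + 1 + TT 2 x (y %/ 4) (z %/ 2) in
  if z %% 2 == 1 then minn (x.+1 * S) r else r.
Proof.
move=> hx hy hz; rewrite {1}/TT m_eq; last by inr.
rewrite /= subSS subn0 -/(TT tMP x (y %/ 4) (z %/ 2)) /tMP.
have h4 : y %% 4 * S <= 3 * S by rewrite leq_mul2r; lia.
have h5 : 1 <= S by case: S_facts; lia.
rewrite (@MP_small x (y %/ 4) (z %/ 2)); try by lia.
  by case: ifP => _ //; lia.
by case: ifP => _; lia.
Qed.

Lemma subminn a b : a - (a - b) = minn a b. Proof. lia. Qed.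

Lemma ST_eq0 y z : y < B * B -> z < 4 * B -> TT 3 0 y z = z %% 4.
Proof.
move=> hy hz; rewrite /TT m_eq; last by inr.
by rewrite /= modS //; case: S_facts; lia.
Qed.

Definition STf (r : nat -> nat -> nat) (y z : nat) : nat :=
  let h := z %% 4 in let e := z %/ 4 in let d := y %% 4 in
  let m := minn h (minn d (1 - e %% 2)) in
  let v := r (y %/ 4) (e %/ 2 * 4 + (m + 2 - d)) in
  16 * (v %/ 4) + 4 * (m + 2 - h) + v %% 4.

Lemma ST_mod x y z : x < tau -> y < B * B -> z < 4 * B ->
  TT 3 x.+1 y z = STf (TT 3 x) y z %% M.
Proof.
move=> hx hy hz; rewrite {1}/TT m_eq; last by inr.
by rewrite /= subSS subn0 !subminn.
Qed.

Lemma ST_small x y z : x <= tau -> y < B * B -> z < 4 * B -> TT 3 x y z < 4 ^ x.+1.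
Proof.
elim: x y z => [|x IH] y z hx hy hz; first by rewrite ST_eq0 // ltn_pmod.
rewrite ST_mod //; apply: leq_ltn_trans (leq_mod _ _) _; rewrite /STf.
set u := minn _ _; set r := TT _ _ _ _.
have hm : u <= 1 by rewrite /u; lia.
have : r < 4 ^ x.+1 by apply: IH; [exact: ltnW|lia|lia].
by rewrite !expnS; lia.
Qed.

Lemma B4 : 4 ^ tau = B * B.
Proof. by rewrite -expnMn. Qed.

Lemma ST_eqS x y z : x < tau -> y < B * B -> z < 4 * B -> TT 3 x.+1 y z = STf (TT 3 x) y z.
Proof.
move=> hx hy hz; rewrite ST_mod // modS1 //; rewrite /STf.
set u := minn _ _; set r := TT _ _ _ _.
have hm : u <= 1 by rewrite /u; lia.
have : r < 4 ^ x.+1 by apply: ST_small; [exact: ltnW|lia|lia].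
have : 4 ^ x.+1 <= 4 ^ tau by rewrite leq_exp2l.
by rewrite B4; case: S_facts; nia.
Qed.

Lemma TT_W z : z < n -> TT 0 0 0 z = nth 0 W z. Proof. exact: m_W. Qed.

Definition lcp a b := TT 4 (n - a) (n - b) 0.
Definition lcs a b := TT 5 a b 0.

Lemma LCP_le x y : x <= n -> y <= n -> TT 4 x y 0 <= x.
Proof.
elim: x y => [|x IH] y hx hy; rewrite /TT m_eq; try by inr.
  by rewrite /= mod0n.
apply: leq_trans (leq_mod _ _) _; rewrite /= subSS subn0 -/(TT 4 x (y - 1) 0).
have := IH (y - 1) (ltnW hx) ltac:(lia).
by case: ifP => // _; case: ifP => // _; rewrite addn1.
Qed.

Lemma LCS_le x y : x <= n -> y <= n -> TT 5 x y 0 <= x.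
Proof.
elim: x y => [|x IH] y hx hy; rewrite /TT m_eq; try by inr.
  by rewrite /= mod0n.
apply: leq_trans (leq_mod _ _) _; rewrite /= subSS subn0 -/(TT 5 x (y - 1) 0).
have := IH (y - 1) (ltnW hx) ltac:(lia).
by case: ifP => // _; case: ifP => // _; rewrite addn1.
Qed.

Lemma lcpE a b : a <= n -> b <= n -> lcp a b =
  if (a == n) || (b == n) then 0 else
  if nth 0 W a == nth 0 W b then (lcp a.+1 b.+1).+1 else 0.
Proof.
move=> ha hb; rewrite {1}/lcp /TT m_eq; last by inr.
rewrite modS; last first.
  have := @LCP_le (n - a - 1) (n - b - 1) ltac:(lia) ltac:(lia); rewrite /TT.
  have [? ? _ _ _] := S_facts; rewrite /= /tLCP /tLCS; case: ifP => // _; case: ifP => // _; case: ifP => // _; lia.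
rewrite /=; have -> : (n - a == 0) = (a == n) by lia.
have -> : (n - b == 0) = (b == n) by lia.
case: (a =P n) => //= na; case: (b =P n) => //= nb.
rewrite -!/(TT _ _ _ _) !subKn // !TT_W; try by lia.
have -> : n - a - 1 = n - a.+1 by lia.
have -> : n - b - 1 = n - b.+1 by lia.
by rewrite addn1.
Qed.

Lemma lcsE a b : a <= n -> b <= n -> lcs a b =
  if (a == 0) || (b == 0) then 0 else
  if nth 0 W a.-1 == nth 0 W b.-1 then (lcs a.-1 b.-1).+1 else 0.
Proof.
move=> ha hb; rewrite {1}/lcs /TT m_eq; last by inr.
rewrite modS; last first.
  have := @LCS_le (a - 1) (b - 1) ltac:(lia) ltac:(lia); rewrite /TT.
  have [? ? _ _ _] := S_facts; rewrite /= /tLCP /tLCS; case: ifP => // _; case: ifP => // _; case: ifP => // _; lia.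
rewrite /=; case: (a =P 0) => //= na; case: (b =P 0) => //= nb.
rewrite -!/(TT _ _ _ _) !subn1 !TT_W; try by lia.
by rewrite addn1.
Qed.

Lemma lcp_clip a b : lcp a b = lcp (minn a n) (minn b n).
Proof. by rewrite /lcp; congr (TT 4 _ _ _); lia. Qed.

Lemma lcp_symt a b : lcp a b = lcp b a.
Proof. by rewrite lcp_clip (lcp_clip b) (lcp_sym k_gt1 kn lcpE) // geq_minr. Qed.

Lemma lcp_ultrat a b c : minn (lcp a b) (lcp b c) <= lcp a c.
Proof.
by rewrite lcp_clip (lcp_clip b) (lcp_clip a c) (lcp_ultra k_gt1 kn lcpE) // geq_minr.
Qed.

Lemma bit_push (b : bool) v i : bit (b + 2 * v) i = if i is i'.+1 then bit v i' else b.
Proof.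
case: i => [|i]; first by rewrite bit0 oddD oddM /= addbF; case: b.
by rewrite bitS; congr bit; case: b; lia.
Qed.

Lemma half_B : B %/ 2 = 2 ^ tau.-1.
Proof. by rewrite -{1}(prednK tau_pos) expnS mulKn. Qed.

Lemma push_lt (b : bool) v : b + 2 * (v %% (B %/ 2)) < B.
Proof.
have : v %% (B %/ 2) < B %/ 2 by rewrite ltn_pmod // half_B expn_gt0.
by case: b => /=; lia.
Qed.

Lemma EQ_eqn t x y (a : bool) v : (t == 6) || (t == 7) -> x < n -> y < n ->
  (t == 6 -> a = (nth 0 W (n - x.+1) == nth 0 W y)) ->
  (t == 7 -> a = (nth 0 W x == nth 0 W y)) -> v = TT t x y 0 ->
  TT t x.+1 y 0 = a + 2 * (v %% (B %/ 2)).
Proof.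
move=> ht hx hy h6 h7 ->; rewrite -(@modS (a + _)); last first.
  by apply: leq_trans (ltnW (push_lt _ _)) BS.
case/orP: ht => /eqP et; move: h6 h7; rewrite et /= => h6 h7; rewrite {1}/TT m_eq; try by inr.
  rewrite h6 //= -!/(TT _ _ _ _) subn1 !TT_W //; lia.
by rewrite (h7 erefl) /= -!/(TT _ _ _ _) subSS subn0 !TT_W // /tEQR; case: (nth 0 W x == _).
Qed.

Lemma EQF_eq x y : x < n -> y < n ->
  TT 6 x.+1 y 0 = (nth 0 W (n - x.+1) == nth 0 W y) + 2 * (TT 6 x y 0 %% (B %/ 2)).
Proof. by move=> hx hy; apply: EQ_eqn. Qed.

Lemma EQR_eq x y : x < n -> y < n ->
  TT 7 x.+1 y 0 = (nth 0 W x == nth 0 W y) + 2 * (TT 7 x y 0 %% (B %/ 2)).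
Proof. by move=> hx hy; apply: EQ_eqn. Qed.

Lemma EQ0 t y : (t == 6) || (t == 7) -> y < n -> TT t 0 y 0 = 0.
Proof.
by move=> /orP[] /eqP-> hy; rewrite /TT m_eq; try (by inr); rewrite /= mod0n.
Qed.

Lemma EQ_lt t x y : (t == 6) || (t == 7) -> x <= n -> y < n -> TT t x y 0 < B.
Proof.
move=> ht; case: x => [|x] hx hy; first by rewrite EQ0 // expn_gt0.
by case/orP: ht => /eqP->; rewrite ?EQF_eq ?EQR_eq // push_lt.
Qed.

Lemma EQF_bit x y i : x <= n -> y < n -> i < tau ->
  bit (TT 6 x y 0) i = (i < x) && (nth 0 W (n - x + i) == nth 0 W y).
Proof.
elim: x i => [|x IH] i hx hy hi; first by rewrite EQ0 // bit_0.
rewrite EQF_eq // bit_push; case: i hi => [|i] hi; first by rewrite addn0.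
rewrite half_B bit_modexp IH //; try by lia.
have -> : i < tau.-1 by lia.
by rewrite ltnS; congr (_ && (nth 0 W _ == _)); lia.
Qed.

Lemma EQR_bit x y i : x <= n -> y < n -> i < tau ->
  bit (TT 7 x y 0) i = (i < x) && (nth 0 W (x - 1 - i) == nth 0 W y).
Proof.
elim: x i => [|x IH] i hx hy hi; first by rewrite EQ0 // bit_0.
rewrite EQR_eq // bit_push; case: i hi => [|i] hi; first by rewrite subn0 subn1.
rewrite half_B bit_modexp IH //; try by lia.
have -> : i < tau.-1 by lia.
by rewrite ltnS; congr (_ && (nth 0 W _ == _)); lia.
Qed.

Lemma word_lt l : l <= k -> l %/ tau < NB.
Proof. by move=> h; have := leq_div2r tau h; lia. Qed.

Definition Rw (t x y b : nat) : nat := if b < NB then TT t x y b else 0.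

(** No window starts at p > n - k, and the table has no cells there; these addresses are never
    written and hold 0, which is the correct word. *)
Definition row8 (x p b : nat) : nat := if p + k <= n then Rw 8 x p b else 0.

Lemma PR_load x p b : x <= n -> p <= n -> b <= 2 * NB -> TT 8 x p b = row8 x p b.
Proof.
move=> hx hp hb; rewrite /row8 /Rw /TT; have [_ ? _ _ ?] := S_facts.
by case: (leqP (p + k)) => h1; [case: ltnP => h2 //|]; apply: m_out; try lia; inr.
Qed.

Definition hi8 (b : nat) : nat := if b == k %/ tau then 2 ^ (k %% tau) else 0.

Lemma hi8_lt b : hi8 b < B.
Proof. by rewrite /hi8; case: eqP => _; rewrite ?expn_gt0 // ltn_exp2l // ltn_pmod. Qed.

Definition pr8 (x p b : nat) : nat :=
  if x == 0 then hi8 b else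
  Nat.lor (Nat.land (row8 (x - 1) p b %/ 2 + (row8 (x - 1) p (b + 1) %% 2) * (B %/ 2))
                    (TT 6 (n - (p + b * tau)) (n - x) 0)) (hi8 b).

Lemma pr8_lt x p b : x <= n -> pr8 x p b < B.
Proof.
move=> hx; rewrite /pr8; case: eqP => h; first exact: hi8_lt.
apply: lor_lt; last exact: hi8_lt.
rewrite PeanoNat.Nat.land_comm; apply: land_lt.
by apply: EQ_lt => //; lia.
Qed.

Lemma PR_eq x p b : x <= n -> row8 x p b =
  if (p + k <= n) && (b < NB) then (if b == 0 then pr8 x p b %/ 2 * 2 else pr8 x p b) else 0.
Proof.
move=> hx; rewrite {1}/row8 /Rw; case: (leqP (p + k)) => // hp; case: ltnP => //= hb.
rewrite {1}/TT m_eq; last by inr.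
have e : (if x == 0 then (if b == k %/ tau then TT 1 0 0 (k %% tau) else 0) else
   Nat.lor (Nat.land (TT 8 (x - 1) p b %/ 2 + (TT 8 (x - 1) p (b + 1) %% 2) * (B %/ 2))
                    (TT 6 (n - (p + b * tau)) (n - x) 0))
           (if b == k %/ tau then TT 1 0 0 (k %% tau) else 0)) = pr8 x p b.
  rewrite /pr8 /hi8 PW_val; last by rewrite ltnW // ltn_pmod.
  by rewrite -!PR_load //; try lia.
have h2 := pr8_lt p b hx; have h3 := BS.
rewrite modS; first by rewrite /= -!/(TT _ _ _ _) e.
by rewrite /= -!/(TT _ _ _ _) e; case: ifP => _; have := leq_divM (pr8 x p b) 2; lia.
Qed.

Lemma row8_lt x p b : x <= n -> row8 x p b < B.
Proof.
move=> hx; rewrite PR_eq //; have h2 := pr8_lt p b hx.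
case: ifP => _; last by rewrite expn_gt0.
by case: ifP => _ //; apply: leq_ltn_trans (leq_divM _ _) h2.
Qed.

Lemma PR_bit x p c : x <= n -> vbit tau (row8 x p) c = prb W k (n - x) p c.
Proof.
elim: x p c => [|x IH] p c hx.
  rewrite subn0 (prb_n k_gt1 kn) /vbit PR_eq //=.
  case: (leqP (p + k)) => hp; last by rewrite /= bit_0 andbF.
  rewrite /= andbT.
  case: ltnP => hb; last by rewrite bit_0; apply/esym/eqP => e; move: hb; rewrite e; have := word_lt (leqnn k); lia.
  have := vbit_single tau k c; rewrite /vbit -/(hi8 _) => h.
  case: eqP => hb0; last exact: h.
  rewrite -{2}(expn1 2) -{1}(expn1 2) bit_mulexp bit_divexp.
  case: (leqP 1 (c %% tau)) => h1 /=; first by rewrite subnK.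
  apply/esym/eqP => e; move: h1; have := divn_eq c tau; rewrite hb0; lia.
have -> : n - x.+1 = (n - x).-1 by lia.
have eP c' := IH p c' (ltnW hx).
rewrite /vbit PR_eq //.
case: (leqP (p + k)) => hp /=; last by rewrite bit_0 /prb [p + k <= n]leqNgt hp /= andbF.
case: ltnP => hb; last first.
  rewrite bit_0 /prb; case: (leqP c k) => [h|h]; last by rewrite andbF.
  by have := word_lt h; lia.
have main : bit (pr8 x.+1 p (c %/ tau)) (c %% tau) =
    (prb W k (n - x) p c.+1 && (p + c < n) && (nth 0 W (p + c) == nth 0 W (n - x).-1)) || (c == k).
  rewrite /pr8 /= subSS subn0 bit_lor bit_land; congr (_ || _); last first.
    by have := vbit_single tau k c; rewrite /vbit -/(hi8 _).
  rewrite -andbA; congr (_ && _).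
    by rewrite -eP -[c.+1]addn1 -(vbit_shr1 tau_pos) // => b; apply: row8_lt; lia.
  have ec := divn_eq c tau; rewrite EQF_bit ?ltn_pmod ?leq_subr //; try by lia.
  have -> : (c %% tau < n - (p + c %/ tau * tau)) = (p + c < n) by lia.
  case: (ltnP (p + c)) => //= hc; have -> : n - x.+1 = (n - x).-1 by lia.
  suff -> : n - (n - (p + c %/ tau * tau)) + c %% tau = p + c by [].
  by move: ec; set u := c %/ tau * tau; set v := c %% tau; lia.
have hq : (n - x).-1 < n by lia.
have hS : (n - x).-1.+1 = n - x by lia.
have rhs : prb W k (n - x).-1 p c = (0 < c) && bit (pr8 x.+1 p (c %/ tau)) (c %% tau).
  rewrite main; case: (ltngtP c k) => hck; first last.
  - by rewrite hck (prbk k_gt1 kn) hp orbT andbT; lia.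
  - rewrite /prb; have -> : c <= k = false by lia.
    have -> : (c < k) = false by lia.
    by case: (0 < c).
  case: (posnP c) => [->//|c0]; rewrite orbF /=.
  rewrite (prbS k_gt1 kn) //; last by lia.
  rewrite hS hp; have -> : p + c < n by lia.
  by rewrite !andbT; case: (prb _ _ _ _ _); rewrite ?andbT ?andbF.
rewrite rhs; case: eqP => hb0; last first.
  by have -> : 0 < c by case: (c) hb0 => //; rewrite div0n.
rewrite -{2}(expn1 2) -{1}(expn1 2) bit_mulexp bit_divexp.
case: (leqP 1 (c %% tau)) => h1 /=; last first.
  have -> // : 0 < c = false by have := divn_eq c tau; rewrite hb0; lia.
rewrite subnK //.
by have -> : 0 < c by have := divn_eq c tau; lia.
Qed.

(** ** The tree of longest common prefixes *)

Definition par (s : nat) : nat := TT 9 s s 0 %% S.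
Definition len (s : nat) : nat := TT 9 s s 0 %/ S.

Lemma nS_le : n * S + n <= S * S.
Proof.
have [_ h _ _ _] := S_facts; apply: (@leq_trans (n.+1 * S)); last by rewrite leq_mul2r; lia.
by rewrite mulSn addnC leq_add2r; lia.
Qed.

Lemma BP_spec s y : s <= n -> y <= n ->
  [/\ TT 9 s y 0 = if y == 0 then 0 else
        maxn (TT 9 s (y - 1) 0) (lcp s (y - 1) * S + (y - 1)),
      TT 9 s y 0 <= n * S + n &
      0 < y -> exists2 p, p < y & TT 9 s y 0 = lcp s p * S + p].
Proof.
move=> hs; have [s1 s2 _ _ _] := S_facts; elim: y => [|y IH] hy.
  by rewrite /TT m_eq; [rewrite /= mod0n|inr].
have [e1 e2 e3] := IH (ltnW hy).
have hl : lcp s y <= n by apply: leq_trans (LCP_le _ _) _; lia.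
have hl2 : lcp s y * S <= n * S by rewrite leq_mul2r hl orbT.
have e : TT 9 s y.+1 0 = maxn (TT 9 s y 0) (lcp s y * S + y).
  rewrite {1}/TT m_eq; last by inr.
  rewrite /= -!/(TT _ _ _ _) !subn1 [y.+1.-1]/= -/(lcp s y) -maxnE modS1 //.
  apply: leq_trans nS_le; rewrite geq_max e2 leq_add //; exact: ltnW.
rewrite e !subn1 /=; split=> //; first by rewrite geq_max e2; lia.
move=> _; rewrite /maxn; case: ifP => h; first by exists y.
case: (posnP y) => [y0|/e3[p hp e4]]; last by exists p => //; lia.
have e0 : TT 9 s y 0 = 0 by rewrite e1 y0.
by exists y => //; move: h; rewrite e0; lia.
Qed.

(** In lcp * S + p the position is below [S], so the packed maximum compares the common prefix
    lengths first. *)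
Lemma par_spec s : 0 < s <= n -> [/\ par s < s, len s = lcp s (par s) &
  forall p, p < s -> lcp s p <= len s].
Proof.
case/andP=> s0 hs; have [_ s2 _ _ _] := S_facts.
have [_ _ /(_ s0)[p hp e]] := BP_spec hs hs.
have hpS : p < S by lia.
have ep : par s = p by rewrite /par e modnMDl modn_small.
have el : len s = lcp s p by rewrite /len e divnMDl ?divn_small ?addn0 //; lia.
rewrite el ep; split=> // q hq.
have : lcp s q * S + q <= TT 9 s s 0.
  have gen y : y <= s -> q < y -> lcp s q * S + q <= TT 9 s y 0.
    elim: y => // y IH hy hqy; have [-> _ _] := BP_spec hs (leq_trans hy hs).
    rewrite subn1 /= leq_max; case: (q =P y) => [->|ne]; first by rewrite leqnn orbT.
    by rewrite IH //; lia.
  exact: gen.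
by rewrite e; case: (ltnP (lcp s p) (lcp s q)) => // h; nia.
Qed.

Lemma par0 : par 0 = 0 /\ len 0 = 0.
Proof.
by have [e _ _] := @BP_spec 0 0 (leq0n _) (leq0n _); rewrite /par /len e mod0n div0n.
Qed.

Lemma par_le s : s <= n -> par s <= s.
Proof.
case: s => [|s] hs; first by case: par0 => ->.
by case: (@par_spec s.+1) => // h _ _; apply: ltnW.
Qed.

Lemma NX_spec s y : s <= n -> y <= n.+1 ->
  [/\ TT 10 s y 0 <= n.+1, n.+1 - y <= TT 10 s y 0,
      TT 10 s y 0 <= n -> s < TT 10 s y 0 /\ par (TT 10 s y 0) = s &
      forall c, n.+1 - y <= c -> c < TT 10 s y 0 -> s < c -> par c != s].
Proof.
move=> hs; have [s1 s2 _ _ _] := S_facts; elim: y => [|y IH] hy.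
  have -> : TT 10 s 0 0 = n.+1.
    by rewrite /TT m_eq; [rewrite /= addn1 modS //; lia|inr].
  by rewrite subn0 ltnn; split=> // c; lia.
have [h1 h2 h3 h4] := IH (ltnW hy); set r := TT 10 s y 0 in h1 h2 h3 h4.
pose c := n - y.
have e : TT 10 s y.+1 0 = if (s < c) && (par c == s) then c else r.
  rewrite {1}/TT m_eq; last by inr.
  rewrite /= -!/(TT _ _ _ _) !subn1 addn1 subSS [y.+1.-1]/= -/r -/c -/(par c).
  by case: ifP => _; [case: ifP => _ /=; rewrite modS //; rewrite /c; lia|rewrite modS //; lia].
have hc : n.+1 - y = c.+1 \/ c = 0 /\ y = n.+1 by rewrite /c; lia.
rewrite e; case: ifP => [/andP[k1 /eqP k2]|hf].
  by split=> //; rewrite ?subSS /c; try lia; move=> d; lia.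
split=> //; first by lia.
move=> d hd1 hd2 hd3; case: (ltngtP d c) => hdc; try by rewrite /c in hdc; lia.
  by apply: h4 => //; rewrite /c in hdc; lia.
by move: hf; rewrite -hdc hd3 /= => ->.
Qed.

Definition fch (s : nat) : nat := TT 10 s (n - s) 0.
Definition nsb (s : nat) : nat := TT 10 (par s) (n - s) 0.

Lemma fch_spec s : s <= n -> [/\ s < fch s, fch s <= n -> par (fch s) = s &
  forall c, s < c -> c < fch s -> par c != s].
Proof.
move=> hs; have [h1 h2 h3 h4] := @NX_spec s (n - s) hs ltac:(lia).
rewrite /fch; split; first by lia.
  by move/h3=> [].
by move=> c hc1 hc2; apply: h4 => //; lia.
Qed.

Lemma nsb_spec s : s <= n -> [/\ s < nsb s, nsb s <= n -> par (nsb s) = par s &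
  forall c, s < c -> c < nsb s -> par c != par s].
Proof.
move=> hs; have hp := par_le hs.
have [h1 h2 h3 h4] := @NX_spec (par s) (n - s) ltac:(lia) ltac:(lia).
rewrite /nsb; split; first by lia.
  by move/h3=> [].
by move=> c hc1 hc2; apply: h4 => //; lia.
Qed.

Lemma lowE h : TT 1 0 0 (tau - (tau - h)) - 1 = 2 ^ minn h tau - 1.
Proof. by rewrite subminn PW_val ?geq_minl // minnC. Qed.

Lemma lowM h : TT 1 0 0 (minn tau h) - 1 = 2 ^ minn h tau - 1.
Proof. by rewrite -lowE subminn. Qed.

Lemma low_lt h : 2 ^ minn h tau - 1 < B.
Proof.
have h1 : 2 ^ minn h tau <= B by rewrite leq_exp2l // geq_minr.
have : 0 < 2 ^ minn h tau by rewrite expn_gt0.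
by lia.
Qed.

Lemma if_lt (c : bool) u v N : (c -> u < N) -> (~~ c -> v < N) -> (if c then u else v) < N.
Proof. by case: c => h1 h2; [apply: h1|apply: h2]. Qed.

Lemma land_ltr u v : v < B -> Nat.land u v < B.
Proof. by move=> h; rewrite PeanoNat.Nat.land_comm; apply: land_lt. Qed.

Lemma B_gt0 : 0 < B. Proof. by rewrite expn_gt0. Qed.

Lemma low_bit h l : bit (2 ^ minn (h - l %/ tau * tau) tau - 1) (l %% tau) = (l < h).
Proof. exact: (vbit_trunc tau_pos h l). Qed.

(* The children of a node are visited through the chain of their siblings. *)
Lemma chain_up (A U P : nat -> Prop) :
  (forall s, s <= n -> A s -> P s -> U s) ->
  (forall s, s <= n -> nsb s <= n -> U (nsb s) -> U s) ->
  forall c, 0 < c <= n -> A c -> P c -> fch (par c) <= n /\ U (fch (par c)).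
Proof.
move=> h1 h2; have chain d c c' : c' - c <= d -> 0 < c -> c <= c' <= n ->
    par c' = par c -> A c' -> P c' -> U c.
  elim: d c => [|d IH] c hd c0 hc e a p.
    have -> : c = c' by lia.
    by apply: h1 => //; lia.
  have [n1 n2 n3] := @nsb_spec c ltac:(lia).
  case: (c =P c') => [->|nc]; first by apply: h1 => //; lia.
  have h5 : nsb c <= c'.
    by rewrite leqNgt; apply/negP => h5; have := n3 c' ltac:(lia) h5; rewrite e eqxx.
  by apply: h2; try lia; apply: IH => //; lia.
move=> c hc a p; have [hp _ _] := par_spec hc.
have [f1 f2 f3] := @fch_spec (par c) ltac:(lia).
have h5 : fch (par c) <= c.
  by rewrite leqNgt; apply/negP => h5; have := f3 c hp h5; rewrite eqxx.
split; first by lia.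
by apply: (chain n _ c) => //; try lia; rewrite f2 //; lia.
Qed.

Lemma chain_down (A U P : nat -> Prop) :
  (forall s, s <= n -> U s -> (A s /\ P s) \/ (nsb s <= n /\ U (nsb s))) ->
  forall s, s <= n -> fch s <= n -> U (fch s) ->
    exists c, [/\ 0 < c <= n, par c = s, A c & P c].
Proof.
move=> hU; have chain d c : n - c <= d -> 0 < c <= n -> U c ->
    exists c', [/\ 0 < c' <= n, par c' = par c, A c' & P c'].
  elim: d c => [|d IH] c hd hc hUc; have [[a p]|[h1 h2]] := hU c ltac:(lia) hUc;
    have [n1 n2 n3] := @nsb_spec c ltac:(lia).
  - by exists c.
  - by lia.
  - by exists c.
  have [||c' [k1 k2 k3 k4]] := IH (nsb c) _ _ h2; try by lia.
  by exists c'; rewrite k2 n2.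
move=> s hs hf h; have [f1 f2 f3] := fch_spec hs.
have [||c [k1 k2 k3 k4]] := chain n (fch s) _ _ h; try by lia.
by exists c; rewrite k2 f2.
Qed.

Lemma par_lt s : 0 < s <= n -> par s < s. Proof. by case/par_spec. Qed.
Lemma len_par s : 0 < s <= n -> len s = lcp s (par s). Proof. by case/par_spec. Qed.
Lemma len_max s p : 0 < s <= n -> p < s -> lcp s p <= len s.
Proof. by case/par_spec=> _ _ h; apply: h. Qed.

(** * Spreading bit vectors over the tree *)

Section TreePass.
Variables (src ux dn : nat -> nat -> nat).
Let A (s b : nat) : nat := Nat.lor (src s b)
  (if s < fch s then (if n < fch s then 0 else ux (fch s) b) else 0).
Hypothesis src_lt : forall s b, s <= n -> b < NB -> src s b < B.
Hypothesis ux_eq : forall s b, s <= n -> b < NB -> ux s b =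
  Nat.lor (Nat.land (A s b) (2 ^ minn (len s + 1 - b * tau) tau - 1))
    (if s < nsb s then (if n < nsb s then 0 else ux (nsb s) b) else 0) %% M.
Hypothesis dn_eq : forall s b, s <= n -> b < NB -> dn s b =
  Nat.lor (A s b) (if par s < s then
     Nat.land (dn (par s) b) (2 ^ minn (len s + 1 - b * tau) tau - 1) else 0) %% M.

Lemma ux_lt s b : s <= n -> b < NB -> ux s b < B.
Proof.
move: {2}(n - s) (leqnn (n - s)) => d; elim: d s => [|d IH] s hd hs hb;
  rewrite ux_eq //; apply: leq_ltn_trans (leq_mod _ _) _; apply: lor_lt.
- exact/land_ltr/low_lt.
- by apply: if_lt => h1; [apply: if_lt => h2; [exact: B_gt0|lia]|exact: B_gt0].
- exact/land_ltr/low_lt.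
- apply: if_lt => h1; last exact: B_gt0.
  by apply: if_lt => h2; [exact: B_gt0|apply: IH => //; lia].
Qed.

Lemma upd_lt s b : s <= n -> b < NB -> A s b < B.
Proof.
move=> hs hb; apply: lor_lt; first exact: src_lt.
apply: if_lt => h1; last exact: B_gt0.
by apply: if_lt => h2; [exact: B_gt0|apply: ux_lt; rewrite // leqNgt].
Qed.

Lemma dn_lt s b : s <= n -> b < NB -> dn s b < B.
Proof.
move=> hs hb; rewrite dn_eq //; apply: leq_ltn_trans (leq_mod _ _) _; apply: lor_lt.
  exact: upd_lt.
by apply: if_lt => _; [exact/land_ltr/low_lt|exact: B_gt0].
Qed.

Lemma modB v : v < B -> v %% M = v.
Proof. by move=> h; apply: modS; have := BS; lia. Qed.

(** The passes act on each bit separately, and the mask on an edge keeps the bits 0 to [len]: bit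
    [l] crosses exactly the edges inside a class for length [l]. *)
Lemma tree_pass s l : s <= n -> l <= k ->
  bit (dn s (l %/ tau)) (l %% tau) <->
  exists p, [/\ p <= n, nearp lcp l s p & bit (src p (l %/ tau)) (l %% tau)].
Proof.
move=> hs hl; have hb := word_lt hl; set b := l %/ tau in hb *; set i := l %% tau.
have uE r : r <= n -> bit (ux r b) i =
   (bit (A r b) i && (l <= len r)) || ((nsb r <= n) && bit (ux (nsb r) b) i).
  move=> hr; rewrite {1}ux_eq // modB; last first.
    apply: lor_lt; first exact/land_ltr/low_lt.
    apply: if_lt => h1; last exact: B_gt0.
    by apply: if_lt => h2; [exact: B_gt0|apply: ux_lt; rewrite // leqNgt].
  rewrite bit_lor bit_land low_bit addn1 ltnS; congr (_ || _).
  have [-> _ _] := nsb_spec hr.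
  by case: ltnP => h; rewrite ?bit_0 //=.
have aE r : r <= n -> bit (A r b) i =
   bit (src r b) i || ((fch r <= n) && bit (ux (fch r) b) i).
  move=> hr; rewrite bit_lor; congr (_ || _); have [-> _ _] := fch_spec hr.
  by case: ltnP => h; rewrite ?bit_0 //=.
have dE r : r <= n -> bit (dn r b) i =
   bit (A r b) i || [&& par r < r, bit (dn (par r) b) i & l <= len r].
  move=> hr; rewrite {1}dn_eq // modB; last first.
    apply: lor_lt; first exact: upd_lt.
    by apply: if_lt => _; [exact/land_ltr/low_lt|exact: B_gt0].
  rewrite bit_lor; congr (_ || _); case: ltnP => h /=; last by rewrite bit_0.
  by rewrite bit_land low_bit addn1 ltnS.
split=> [h|[p [hp hn hm]]].
  apply: (tree_sound lcp_symt lcp_ultrat par_lt len_par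
    (mask := fun r => bit (src r b) i) (A := fun r => bit (A r b) i)
    (DN := fun r => bit (dn r b) i)) => // r hr.
    rewrite aE // => /orP[->|/andP[h1 h2]]; [by left|right].
    apply: (@chain_down (fun r => bit (A r b) i) (fun r => bit (ux r b) i)) h1 h2 => // u hu.
    by rewrite uE // => /orP[/andP[]|/andP[]]; [left|right].
  rewrite dE // => /orP[->|/and3P[h1 h2 h3]]; [by left|right].
  by split=> //; lia.
apply: (tree_complete lcp_symt lcp_ultrat par_lt len_par len_max
    (mask := fun r => bit (src r b) i) (A := fun r => bit (A r b) i)
    (DN := fun r => bit (dn r b) i)) hn hm => //.
- by move=> r hr; rewrite aE // => ->.
- move=> c hc hA hlen; have hpc := par_lt hc; rewrite aE; last by lia.
  have [||-> ->] := @chain_up (fun r => bit (A r b) i) (fun r => bit (ux r b) i)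
    (fun r => l <= len r) _ _ c hc hA hlen; last by rewrite orbT.
    by move=> u hu h1 h2; rewrite uE // h1 h2.
  by move=> u hu h1 h2; rewrite uE // h1 h2 orbT.
- by move=> r hr; rewrite dE // => ->.
- by move=> r hr h1 h2; rewrite dE ?h1 ?h2 ?par_lt ?orbT //; lia.
Qed.
End TreePass.

(** * Spreading minima over the tree *)

Section FirstBad.
Variables (ini uf df : nat -> nat).
Let A (s : nat) : nat := minn (ini s)
  (if s < fch s then (if n < fch s then k else uf (fch s)) else k).
Hypothesis ini_le : forall s, s <= n -> ini s <= k.
Hypothesis uf_eq : forall s, s <= n -> uf s =
  minn (if len s < A s then k else A s)
    (if s < nsb s then (if n < nsb s then k else uf (nsb s)) else k).
Hypothesis df_eq : forall s, s <= n -> df s =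
  minn (A s) (if par s < s then (if len s < df (par s) then k else df (par s)) else k).

Lemma df_le s : s <= n -> df s <= k.
Proof. by move=> hs; rewrite df_eq // geq_min /A geq_min ini_le. Qed.

(** A value that exceeds the edge label is replaced by [k], which plays the role of infinity; for a
    threshold [l] the statement value <= l propagates like a bit. *)
Lemma df_min s p l : s <= n -> p <= n -> ini p <= l -> nearp lcp l s p -> df s <= l.
Proof.
move=> hs hp hi hn; case: (leqP k l) => hl; first by apply: leq_trans (df_le hs) hl.
apply: (tree_complete lcp_symt lcp_ultrat par_lt len_par len_max
    (mask := fun r => ini r <= l) (A := fun r => A r <= l)
    (DN := fun r => df r <= l)) hn hi => //.
- by move=> r hr h; rewrite /A geq_min h.
- move=> c hc hA hlen; have hpc := par_lt hc.
  have [||h1 h2] := @chain_up (fun r => A r <= l) (fun r => uf r <= l)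
    (fun r => l <= len r) _ _ c hc hA hlen.
  + move=> u hu h1 h2; rewrite uf_eq // geq_min ltnNge (leq_trans h1 h2) /=.
    by rewrite h1.
  + move=> u hu h1 h2; rewrite uf_eq // [X in minn _ X](_ : _ = uf (nsb u)); last first.
      by have [-> _ _] := nsb_spec hu; rewrite ltnNge h1.
    by rewrite geq_min h2 orbT.
  rewrite /A geq_min; have [|-> _ _] := @fch_spec (par c); first by lia.
  by rewrite (ltnNge n) h1 h2 orbT.
- by move=> r hr h; rewrite df_eq // geq_min h.
- move=> r hr h1 h2; rewrite df_eq ?geq_min ?par_lt //; last by lia.
  by rewrite (ltnNge (len r)) (leq_trans h1 h2) /= h1 orbT.
Qed.

Lemma df_ex s : s <= n -> df s < k ->
  exists p, [/\ p <= n, nearp lcp (df s) s p & ini p = df s].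
Proof.
move=> hs; set l := df s => hl.
apply: (tree_sound lcp_symt lcp_ultrat par_lt len_par
    (mask := fun r => ini r = l) (A := fun r => A r = l) (DN := fun r => df r = l)) => // r hr.
  move=> hA; have : ini r = l \/ fch r <= n /\ uf (fch r) = l.
    move: hA; rewrite /A; have [-> _ _] := fch_spec hr; case: ltnP; lia.
  case=> [->|[h1 h2]]; [by left|right].
  apply: (@chain_down (fun r => A r = l) (fun r => uf r = l)) h1 h2 => // u hu.
  rewrite uf_eq //; have [-> _ _] := nsb_spec hu.
  by case: ltnP => h1; case: ltnP => h2; lia.
rewrite df_eq //; case: ltnP => h1; last by lia.
by case: (ltnP (len r)) => h2 h3; case: (A r =P l) => h4; [left|right; split; lia|left|right; split; lia].
Qed.
End FirstBad.

(** ** Stages *)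

Lemma PV_spec x : x <= n - k + 2 -> TT 11 x 0 0 = pvs W k Sk x.
Proof.
have [s1 s2 _ _ _] := S_facts; elim: x => [|x IH] hx; rewrite /TT m_eq; try by inr.
  by rewrite /= mod0n.
rewrite /= -!/(TT _ _ _ _) subSS subn0 ltnS /tPV IH; last by lia.
have hp : pvs W k Sk x <= x by case: (x) => // x'; rewrite ltnW // pvs_lt.
case: (posnP x) => [->|x0]; first by rewrite modS.
have -> : x < 1 = false by lia.
have e : TT 0 0 0 (n + (n + 2 - (k + x.+1))) = (qpos W k x \in Sk).
  rewrite /TT m_Sk; last by lia.
  by congr (nat_of_bool (_ \in Sk)); rewrite /qpos; case: eqP; lia.
by rewrite e /=; case: (_ \in Sk) => /=; rewrite modS //; lia.
Qed.

Definition prev (x : nat) : nat := x - 1 - (x - 1 - TT 11 x 0 0).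

Lemma prevE x : x <= n - k + 2 -> prev x = pvs W k Sk x.
Proof.
move=> hx; rewrite /prev PV_spec //; case: x hx => [|x] hx; first by rewrite !sub0n.
by have := @pvs_lt W k Sk x.+1 isT; lia.
Qed.

Lemma shr_lt u v r : u < B -> r <= tau -> u %/ 2 ^ r + (v * 2 ^ (tau - r)) %% B < B.
Proof.
move=> hu hr; have eB : B = 2 ^ r * 2 ^ (tau - r) by rewrite -expnD subnKC.
have h1 : u %/ 2 ^ r < 2 ^ (tau - r) by rewrite ltn_divLR ?expn_gt0 // mulnC -eB.
rewrite [X in _ %% X]eB -muln_modl.
have h2 : v %% 2 ^ r < 2 ^ r by rewrite ltn_pmod ?expn_gt0.
apply: (@leq_trans ((v %% 2 ^ r).+1 * 2 ^ (tau - r))); first by rewrite mulSn ltn_add2r.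
by rewrite [X in _ <= X]eB leq_mul2r h2 orbT.
Qed.

Lemma shl_lt u v : v < B -> (u * 2) %% B + v %/ (B %/ 2) < B.
Proof.
have eB : B = 2 ^ tau.-1 * 2 by rewrite mulnC -expnS prednK.
rewrite half_B [X in _ %% X]eB -muln_modl => hv.
have h1 : v %/ 2 ^ tau.-1 < 2 by rewrite ltn_divLR ?expn_gt0 // mulnC -eB.
have h2 : u %% 2 ^ tau.-1 < 2 ^ tau.-1 by rewrite ltn_pmod ?expn_gt0.
by rewrite [X in _ < X]eB; lia.
Qed.

Definition prow (y : nat) : nat := if y == 0 then 0 else k - 1 + y.

Lemma prow_q y : y <= n - k + 1 -> prow y <= n /\ n - prow y = qpos W k y.
Proof. by rewrite /prow /qpos; case: eqP; lia. Qed.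

Lemma word_le c : c <= k -> c %/ tau <= 2 * NB.
Proof. by move=> h; apply: leq_trans (ltnW (word_lt h)) _; rewrite leq_pmull. Qed.

Lemma pr_bit y p c : y <= n - k + 1 -> p <= n -> c <= k ->
  bit (TT 8 (prow y) p (c %/ tau)) (c %% tau) = prb W k (qpos W k y) p c.
Proof.
move=> hy hp hc; have [h1 <-] := prow_q hy; rewrite -PR_bit // /vbit PR_load //.
exact: word_le.
Qed.

Lemma pr_lt y p b : y <= n - k + 1 -> p <= n -> b <= 2 * NB -> TT 8 (prow y) p b < B.
Proof. by move=> hy hp hb; have [h1 _] := prow_q hy; rewrite PR_load // row8_lt. Qed.

Lemma src0_eqs x : x <= n - k + 1 ->
  (forall s b, s <= n -> b < NB -> TT 25 x (n - s) b =
    Nat.lor (Nat.land (Nat.lor (TT 8 (prow x) s b)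
      (if s < fch s then (if n < fch s then 0 else TT 25 x (n - fch s) b) else 0))
       (2 ^ minn (len s + 1 - b * tau) tau - 1))
    (if s < nsb s then (if n < nsb s then 0 else TT 25 x (n - nsb s) b) else 0) %% M) /\
  (forall s b, s <= n -> b < NB -> TT 26 x s b =
    Nat.lor (Nat.lor (TT 8 (prow x) s b)
      (if s < fch s then (if n < fch s then 0 else TT 25 x (n - fch s) b) else 0))
      (if par s < s then
     Nat.land (TT 26 x (par s) b) (2 ^ minn (len s + 1 - b * tau) tau - 1) else 0) %% M).
Proof.
move=> hx; split=> s b hs hb.
  rewrite {1}/TT m_eq; last by inr.
  by rewrite /= (subKn hs) -!/(TT _ _ _ _) lowE.
rewrite {1}/TT m_eq; last by inr.
by rewrite /= -!/(TT _ _ _ _) lowE.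
Qed.

Lemma dn0_lt x s b : x <= n - k + 1 -> s <= n -> b < NB -> TT 26 x s b < B.
Proof.
move=> hx hs hb; have [h1 h2] := src0_eqs hx.
by apply: (dn_lt _ h1 h2) => // s' b' hs' hb'; apply: pr_lt => //; lia.
Qed.

Lemma dn0_bit x s l : x <= n - k + 1 -> s <= n -> l <= k ->
  bit (TT 26 x s (l %/ tau)) (l %% tau) <->
  exists p, [/\ p <= n, nearp lcp l s p & prb W k (qpos W k x) p l].
Proof.
move=> hx hs hl; have [h1 h2] := src0_eqs hx.
have h3 s' b' : s' <= n -> b' < NB -> TT 8 (prow x) s' b' < B.
  by move=> hs' hb'; apply: pr_lt => //; lia.
apply: (iff_trans (tree_pass h3 h1 h2 hs hl)); split=> [[p [k1 k2 k3]]|[p [k1 k2 k3]]];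
  by exists p; split=> //; move: k3; rewrite pr_bit.
Qed.

(* Words of a vector shifted by one position, from row y of table 27. *)
Definition shl27 (x y b : nat) : nat :=
  (TT 27 x y b * 2) %% B + (if b < 1 then 0 else TT 27 x y (b - 1) %/ (B %/ 2)).

Lemma bb_eq x y b : x <= n - k + 1 -> y <= n -> b < NB ->
  TT 27 x y b = Nat.lor (TT 26 x (n - y) b)
    (if 0 < y then shl27 x (y - 1) b else 0) %% M.
Proof.
by move=> hx hy hb; rewrite {1}/TT m_eq; [rewrite /= -!/(TT _ _ _ _)|inr].
Qed.

Lemma shl27_lt x y b : (forall b, b < NB -> TT 27 x y b < B) -> b < NB -> shl27 x y b < B.
Proof.
move=> h hb; rewrite /shl27; case: (ltnP b 1) => h1; last by apply: shl_lt; apply: h; lia.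
by rewrite addn0 ltn_pmod // B_gt0.
Qed.

Lemma bb_lt x y b : x <= n - k + 1 -> y <= n -> b < NB -> TT 27 x y b < B.
Proof.
move=> hx; elim: y b => [|y IH] b hy hb; rewrite bb_eq //;
  apply: leq_ltn_trans (leq_mod _ _) _; apply: lor_lt; try by [exact: B_gt0].
- by apply: dn0_lt => //; lia.
- by apply: dn0_lt => //; lia.
- by rewrite subn1; apply: shl27_lt => // b' hb'; apply: IH => //; lia.
Qed.

Definition Bb (x s l : nat) : bool := bit (TT 27 x (n - s) (l %/ tau)) (l %% tau).

Lemma shl27_bit x s l : x <= n - k + 1 -> s <= n -> l <= k ->
  bit (shl27 x (n - s) (l %/ tau)) (l %% tau) = (0 < l) && Bb x s l.-1.
Proof.
move=> hx hs hl; pose F b := if b < NB then TT 27 x (n - s) b else 0.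
have hF b : F b < B.
  by rewrite /F; case: (ltnP b NB); rewrite ?B_gt0 // => h; apply: bb_lt => //; lia.
have := vbit_shl1 tau_pos l hF; rewrite subn1 /vbit => e.
have hb := word_lt hl; have hb' : l.-1 %/ tau < NB by apply: word_lt; lia.
rewrite /Bb -[TT 27 _ _ (l.-1 %/ tau)]/(TT 27 x (n - s) (l.-1 %/ tau)).
move: e; rewrite /F hb hb' => <-; congr bit; rewrite /shl27.
case: (ltnP _ 1) => // h; suff -> : l %/ tau - 1 < NB by [].
exact: leq_ltn_trans (leq_subr _ _) hb.
Qed.

Lemma Bb_spec x s l : x <= n - k + 1 -> s <= n -> l < k -> s + l <= n ->
  Bb x s l <-> (exists p, [/\ p <= n, nearp lcp l s p & prb W k (qpos W k x) p l]) \/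
             [/\ 0 < l, s < n & Bb x s.+1 l.-1].
Proof.
move=> hx hs hl hsl; have hb := word_lt (ltnW hl).
have e : Bb x s l = bit (TT 26 x s (l %/ tau)) (l %% tau) ||
    [&& 0 < l, s < n & Bb x s.+1 l.-1].
  rewrite {1}/Bb bb_eq //; try by lia.
  rewrite modB; last first.
    apply: lor_lt; first by apply: dn0_lt => //; lia.
    by apply: if_lt => _; [apply: shl27_lt => // b h; apply: bb_lt => //; lia|exact: B_gt0].
  rewrite bit_lor subKn //; congr (_ || _); rewrite subn_gt0; case: ltnP => h.
    have -> : n - s - 1 = n - s.+1 by lia.
    by rewrite shl27_bit //; lia.
  by rewrite bit_0; case: (0 < l).
rewrite e; split.
  case/orP=> [/(dn0_bit hx hs (ltnW hl)) h|/and3P[]]; [by left|by right].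
by case=> [h|[-> -> ->]]; apply/orP; [left; apply/(dn0_bit hx hs (ltnW hl))|right].
Qed.

Lemma bok_bits x j l : x <= n - k + 1 -> j + l <= n -> l < k ->
  bok W k x j l = ~~ Bb x j l.
Proof.
move=> hx hj hl; rewrite (bb_char k_gt1 kn lcpE (q' := qpos W k x)) //; try by lia.
  by rewrite /qpos; case: eqP; lia.
by move=> s i hs hi hsi; apply: Bb_spec.
Qed.

Section PositiveStage.
Variable x : nat.
Hypothesis hx : 0 < x <= n - k + 1.
Local Notation X := (prev x).
Local Notation q := (n - k + 1 - x).

Lemma X_lt : X < x.
Proof. by rewrite prevE; [apply: pvs_lt|]; lia. Qed.

Lemma X_le : X <= n - k + 1.
Proof. by have := X_lt; lia. Qed.

Lemma x_neq0 : (x == 0) = false. Proof. lia. Qed.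

Definition lam (p : nat) : nat := minn k.-1 (lcs p (q + k)).

Lemma LM_val s : s <= n -> TT 12 x s 0 = lam s.
Proof.
move=> hs; have [_ s2 _ _ _] := S_facts; rewrite {1}/TT m_eq; last by inr.
rewrite /= x_neq0 subminn -!/(TT _ _ _ _) modS; last by lia.
by rewrite /lam /lcs subn1; congr (minn _ (TT 5 _ _ _)); lia.
Qed.

Lemma lam_lt p : lam p < k.
Proof. by have : lam p <= k.-1 by [exact: geq_minl]; lia. Qed.

Lemma MK_eq s b : s <= n -> b < NB -> TT 13 x s b =
  TT 8 (prow X) (s - lam s) (b + lam s %/ tau) %/ 2 ^ (lam s %% tau) +
  (TT 8 (prow X) (s - lam s) (b + lam s %/ tau + 1) * 2 ^ (tau - lam s %% tau)) %% B.
Proof.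
move=> hs hb; have hr : lam s %% tau <= tau by rewrite ltnW // ltn_pmod.
have hw := word_lt (ltnW (lam_lt s)).
rewrite {1}/TT m_eq; last by inr.
rewrite /= x_neq0 -!/(TT _ _ _ _) -/X -/(prow X) LM_val // !PW_val ?leq_subr // modB //.
by apply: shr_lt => //; apply: pr_lt; [exact: X_le|lia|lia].
Qed.

Lemma MK_lt s b : s <= n -> b < NB -> TT 13 x s b < B.
Proof.
move=> hs hb; have hr : lam s %% tau <= tau by rewrite ltnW // ltn_pmod.
have hw := word_lt (ltnW (lam_lt s)); rewrite MK_eq //.
by apply: shr_lt => //; apply: pr_lt; [exact: X_le|lia|lia].
Qed.

Lemma MK_bit s l : s <= n -> l <= k -> bit (TT 13 x s (l %/ tau)) (l %% tau) =
  prb W k (qpos W k X) (s - lam s) (l + lam s).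
Proof.
move=> hs hl; have [h1 <-] := prow_q X_le; rewrite -PR_bit // MK_eq ?word_lt //.
have hw := word_lt (ltnW (lam_lt s)); have hl' := word_lt hl.
rewrite -(vbit_shr tau_pos) ?/vbit; last by move=> b; apply: row8_lt.
by rewrite !PR_load //; lia.
Qed.

Lemma src1_eqs :
  (forall s b, s <= n -> b < NB -> TT 14 x (n - s) b =
    Nat.lor (Nat.land (Nat.lor (TT 13 x s b)
      (if s < fch s then (if n < fch s then 0 else TT 14 x (n - fch s) b) else 0))
       (2 ^ minn (len s + 1 - b * tau) tau - 1))
    (if s < nsb s then (if n < nsb s then 0 else TT 14 x (n - nsb s) b) else 0) %% M) /\
  (forall s b, s <= n -> b < NB -> TT 15 x s b =
    Nat.lor (Nat.lor (TT 13 x s b)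
      (if s < fch s then (if n < fch s then 0 else TT 14 x (n - fch s) b) else 0))
      (if par s < s then
     Nat.land (TT 15 x (par s) b) (2 ^ minn (len s + 1 - b * tau) tau - 1) else 0) %% M).
Proof.
split=> s b hs hb.
  rewrite {1}/TT m_eq; last by inr.
  by rewrite /= x_neq0 (subKn hs) -!/(TT _ _ _ _) lowE.
rewrite {1}/TT m_eq; last by inr.
by rewrite /= x_neq0 -!/(TT _ _ _ _) lowE.
Qed.

Lemma dn1_lt s b : s <= n -> b < NB -> TT 15 x s b < B.
Proof. by move=> hs hb; have [h1 h2] := src1_eqs; apply: (dn_lt MK_lt h1 h2). Qed.

Definition M1 (s l : nat) : bool := bit (TT 15 x s (l %/ tau)) (l %% tau).

Lemma M1_spec s l : s <= n -> l <= k -> M1 s l <->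
  exists p, [/\ p <= n, nearp lcp l s p & prb W k (qpos W k X) (p - lam p) (l + lam p)].
Proof.
move=> hs hl; have [h1 h2] := src1_eqs.
apply: (iff_trans (tree_pass MK_lt h1 h2 hs hl)); split=> [[p [k1 k2 k3]]|[p [k1 k2 k3]]];
  by exists p; split=> //; move: k3; rewrite MK_bit.
Qed.

Definition fb (s : nat) : nat := TT 17 x s 0.
Definition ini (s : nat) : nat := if n < s + (k - lam s) then k else k - lam s.

Lemma ini_le s : s <= n -> ini s <= k.
Proof. by move=> _; rewrite /ini; case: ifP => // _; apply: leq_subr. Qed.

Lemma uf_eqs :
  (forall s, s <= n -> let A := minn (ini s)
     (if s < fch s then (if n < fch s then k else TT 16 x (n - fch s) 0) else k) in
   TT 16 x (n - s) 0 = minn (if len s < A then k else A)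
    (if s < nsb s then (if n < nsb s then k else TT 16 x (n - nsb s) 0) else k)) /\
  (forall s, s <= n -> let A := minn (ini s)
     (if s < fch s then (if n < fch s then k else TT 16 x (n - fch s) 0) else k) in
   fb s =
   minn A (if par s < s then (if len s < fb (par s) then k else fb (par s)) else k)).
Proof.
have [_ s2 _ _ _] := S_facts; have kS u : u <= k -> u %% M = u by move=> h; apply: modS; lia.
split=> s hs /=.
  rewrite {1}/TT m_eq; last by inr.
  rewrite /= x_neq0 (subKn hs) !subminn -!/(TT _ _ _ _) -/(fch s) -/(nsb s) -/(len s).
  rewrite !LM_val // -/(ini s) kS // geq_min; apply/orP; left.
  case: ifP => _ //; rewrite geq_min ini_le //.
rewrite {1}/fb {1}/TT m_eq; last by inr.
rewrite /= x_neq0 !subminn -!/(TT _ _ _ _) -/(fch s) -/(len s) -/(par s).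
by rewrite !LM_val // -/(ini s) kS // !geq_min ini_le.
Qed.

Lemma fb_le s : s <= n -> fb s <= k.
Proof. by have [h1 h2] := uf_eqs; apply: (@df_le ini (fun s => TT 16 x (n - s) 0) fb ini_le h2). Qed.

Lemma fb_min s p : s <= n -> p <= n -> p + (k - lam p) <= n ->
  nearp lcp (k - lam p) s p -> fb s <= k - lam p.
Proof.
have [h1 h2] := uf_eqs; move=> hs hp hk hn.
by apply: (@df_min ini (fun s => TT 16 x (n - s) 0) fb ini_le h1 h2) hn => //; rewrite /ini ltnNge hk.
Qed.

Lemma fb_ex s : s <= n -> fb s < k ->
  exists p, [/\ p <= n, p + fb s <= n, nearp lcp (fb s) s p & fb s = k - lam p].
Proof.
have [h1 h2] := uf_eqs; move=> hs hf.
have [p [k1 k2 k3]] := @df_ex ini (fun s => TT 16 x (n - s) 0) fb h1 h2 s hs hf; exists p; move: k3; rewrite /ini.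
by case: ltnP => h3 e; split=> //; lia.
Qed.

Lemma fb_gt0 s : s <= n -> 0 < fb s <= k.
Proof.
move=> hs; rewrite fb_le // andbT; case: (ltnP (fb s) k) => h; last by lia.
by have [p [_ _ _ ->]] := fb_ex hs h; have := lam_lt p; lia.
Qed.

Lemma qk : q + k <= n. Proof. lia. Qed.
Lemma qX : qpos W k X <= n. Proof. by rewrite /qpos; case: eqP; lia. Qed.

Lemma pat_sub : pat W k x = factor W q k.
Proof. by rewrite /pat /qpos x_neq0. Qed.

Lemma fok_fb s l : s + l <= n -> fok W k x s l = (l < fb s).
Proof.
move=> h; rewrite /fok pat_sub.
exact: (fok_char k_gt1 kn lcpE lcsE qX qk fb_le fb_min fb_ex h).
Qed.

Lemma dir_bits s l : s + l <= n -> l < k ->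
  dir W k Sk x s l = [&& l < fb s, ~~ M1 s l & (l == 0) || ~~ Bb X s.+1 l.-1].
Proof.
move=> h hl; rewrite /dir pat_sub -prevE; last by lia.
apply: (dir_char k_gt1 kn lcpE lcsE qX _ qk fb_le fb_min fb_ex) => //.
  by move=> s' l' h1 h2 h3; apply: Bb_spec => //; exact: X_le.
by move=> s' l' h1 h2 h3; apply: M1_spec => //; exact: ltnW.
Qed.

Lemma dir_lt s l : s + l <= n -> dir W k Sk x s l -> l < k.
Proof.
by move=> h; rewrite /dir nof_cat => /andP[_ h2]; apply: (@nof_sub_lt W k k_gt1 kn s l [::] _ h h2).
Qed.

End PositiveStage.

(** ** Masked minima of columns *)

Lemma dsum_tel (v : nat -> nat) c i : (forall a, a < i -> v a.+1 + 1 = v a + dg c a) ->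
  v 0 + dsum c i = v i + i.
Proof.
elim: i => [|i IH] h //=; have := h i (ltnSn i).
have := IH (fun a ha => h a (ltnW ha)); lia.
Qed.

Lemma minrun (F c : nat -> nat) N : (forall z, z < N -> F z.+1 = minn (F z) (c z)) ->
  [/\ F N <= F 0, forall b, b < N -> F N <= c b &
      F N = F 0 \/ exists2 b, b < N & F N = c b].
Proof.
elim: N => [|N IH] h; first by split=> //; left.
have [h1 h2 h3] := IH (fun z hz => h z (ltnW hz)); rewrite h //; split.
- by rewrite geq_min h1.
- move=> b; rewrite ltnS leq_eqVlt => /orP[/eqP->|hb]; first exact: geq_minr.
  by rewrite geq_min h2.
rewrite /minn; case: ifP => _; last by right; exists N.
by case: h3 => [|[b hb e]]; [left|right; exists b => //; apply: ltnW].
Qed.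

Definition cnd := cand tau S (TT 2).

(* Entry l of a column has cost v l and code off + l. *)
Lemma block_min (base cd mk v : nat -> nat) off N :
  (forall b, b < N -> cd b < B * B) -> (forall b, b < N -> mk b < B) ->
  (forall b i, b < N -> i < tau -> bit (mk b) i ->
     base b + dsum (cd b) i = v (b * tau + i) + i) ->
  (forall l, l %/ tau < N -> bit (mk (l %/ tau)) (l %% tau) ->
     cnd (base (l %/ tau)) (cd (l %/ tau)) (mk (l %/ tau)) (off + l %/ tau * tau) <=
       v l * S + (off + l)) /\
  (forall b, b < N ->
     (exists l, [/\ l %/ tau = b, bit (mk b) (l %% tau) &
        cnd (base b) (cd b) (mk b) (off + b * tau) = v l * S + (off + l)]) \/
     S * S <= cnd (base b) (cd b) (mk b) (off + b * tau)).
Proof.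
move=> h1 h2 h3; split=> [l hl hb|b hb].
  have ht : l %% tau < tau by rewrite ltn_pmod.
  have := cand_le MP_eq0 MP_eqS (off + l %/ tau * tau) (h1 _ hl) (h2 _ hl) ht hb (h3 _ _ hl ht hb).
  rewrite -divn_eq -/cnd => h; apply: leq_trans h _.
  by have := divn_eq l tau; set u := l %/ tau * tau; set u' := l %% tau; lia.
case: (cand_ex MP_eq0 MP_eqS (base b) (off + b * tau) (h1 _ hb) (h2 _ hb)); last by right.
case=> i hi [hbi e]; left; exists (b * tau + i).
rewrite divnMDl // divn_small // addn0 modnMDl modn_small //; split=> //.
rewrite -/cnd in e; rewrite (e _ (h3 _ _ hb hi hbi)); lia.
Qed.

Definition V (x j : nat) : nat := TT 23 x (n - j) 0.

Lemma VC_mod x y : x <= n - k + 1 -> y < n ->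
  TT 24 x y.+1 0 = (TT 23 x y 0 + 1 - TT 23 x y.+1 0 +
    4 * (TT 24 x y 0 %% (B * B %/ 4))) %% M.
Proof.
by move=> hx hy; rewrite {1}/TT m_eq; [rewrite /= -!/(TT _ _ _ _) subn1|inr].
Qed.

Lemma BB4 : B * B %/ 4 = 4 ^ tau.-1.
Proof. by rewrite -B4 -{1}(prednK tau_pos) expnS mulKn. Qed.

Section Codes.
Variable x : nat.
Hypothesis hx : x <= n - k + 1.
Hypothesis V_lip : forall j, j < n -> V x j <= (V x j.+1).+1 /\ V x j.+1 <= (V x j).+1.

(** Beyond the end of W the digits mean nothing; the masks never select such entries. *)
Lemma VC_spec j : j <= n -> TT 24 x (n - j) 0 < B * B /\
  forall i, i < tau -> j + i < n ->
    V x (j + i.+1) + 1 = V x (j + i) + dg (TT 24 x (n - j) 0) i.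
Proof.
move: {2}(n - j) (leqnn (n - j)) => d; elim: d j => [|d IH] j hd hj.
  have -> : j = n by lia.
  rewrite subnn /TT m_eq; last by inr.
  rewrite /= mod0n muln_gt0 B_gt0; split=> // i; lia.
case: (ltnP j n) => hjn; last by apply: IH => //; lia.
have [h1 h2] := IH j.+1 ltac:(lia) hjn; have [l1 l2] := V_lip hjn.
have e : TT 24 x (n - j) 0 = (V x j.+1 + 1 - V x j) + 4 * (TT 24 x (n - j.+1) 0 %% 4 ^ tau.-1).
  have -> : n - j = (n - j.+1).+1 by lia.
  rewrite VC_mod //; last by lia.
  have -> : (n - j.+1).+1 = n - j by lia.
  rewrite -/(V x j.+1) -/(V x j) BB4 modS1 //.
  have : TT 24 x (n - j.+1) 0 %% 4 ^ tau.-1 <= S by apply: leq_trans (leq_mod _ _) _; case: S_facts; lia.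
  by case: S_facts; nia.
have hmod : TT 24 x (n - j.+1) 0 %% 4 ^ tau.-1 < 4 ^ tau.-1 by rewrite ltn_pmod // expn_gt0.
have eB : B * B = 4 * 4 ^ tau.-1 by rewrite -B4 -{1}(prednK tau_pos) expnS.
rewrite e; split; first by rewrite eB; lia.
case=> [|i] hi hji; first by rewrite dg_push0 ?addn0 ?addn1; lia.
rewrite dg_push ?dg_mod; try lia.
by rewrite !(addnS j) -!addSn -(h2 i) ?addnS //; lia.
Qed.

Lemma VC_dsum j i : j + i <= n -> i <= tau ->
  V x j + dsum (TT 24 x (n - j) 0) i = V x (j + i) + i.
Proof.
move=> hj hi; have [_ h] := @VC_spec j ltac:(lia).
by have := @dsum_tel (fun a => V x (j + a)) (TT 24 x (n - j) 0) i; rewrite addn0; apply=> a ha; apply: h; lia.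
Qed.
End Codes.

(** ** What precedes the next pattern *)

Definition K (x j : nat) : nat := TT 28 x (n - j) NB %/ S.
Definition Kc (x j : nat) : nat := TT 28 x (n - j) NB %% S.

Definition kf0 (x y : nat) : nat :=
  if y < k then S * S else (TT 28 x (y - k) NB %/ S + 1) * S + 4 * k.

Definition kc1 (x y b : nat) : nat :=
  cnd (TT 23 x (y - b * tau) 0) (TT 24 x (y - b * tau) 0)
    (Nat.land (2 ^ minn (minn (y + 1) k - b * tau) tau - 1) (B - 1 - TT 27 x y b))
    (k + b * tau).
Definition kc2 (x y b : nat) : nat :=
  cnd (TT 23 x (y - (b * tau + 1)) 0 + 1) (TT 24 x (y - (b * tau + 1)) 0)
    (2 ^ minn (minn y k - b * tau) tau - 1) (3 * k + 1 + b * tau).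

Lemma KF_mod x y z : x <= n - k + 1 -> y <= n -> z <= NB ->
  TT 28 x y z = (if z is b.+1 then minn (TT 28 x y b) (minn (kc1 x y b) (kc2 x y b))
                 else kf0 x y) %% M.
Proof.
move=> hx hy hz; case: z hz => [|b] hz.
  by rewrite {1}/TT m_eq; [rewrite /= -!/(TT _ _ _ _)|inr].
rewrite {1}/TT m_eq; last by inr.
have low h : tau - (tau - h) = minn h tau by rewrite subminn minnC.
by rewrite /= subSS subn0 !subminn -!/(TT _ _ _ _) -[minn tau (_ - _)]subminn lowE
  -[minn tau (minn y k - _)]subminn lowE.
Qed.

Hypothesis S_big : forall u, u <= 8 * ((n + 1) * (n + 1)) -> u <= S.

Lemma code_S : 4 * k + 2 < S.
Proof. by apply: S_big; rewrite mulnA; nia. Qed.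

(** A # after k - 1 copied letters adds at most 2S to the packed value and lowers [y] by k, so even
    the infinite entries stay below [S ^ 3] and no reduction takes place. *)
Lemma KF_bound x y z : x <= n - k + 1 -> y <= n -> z <= NB ->
  TT 28 x y z <= S * S + y * (2 * S) /\
  (if z is b.+1 then minn (TT 28 x y b) (minn (kc1 x y b) (kc2 x y b)) else kf0 x y) <=
     S * S + y * (2 * S).
Proof.
move=> hx; move: {2}y (leqnn y) => d; elim: d y z => [|d IHd] y z hd hy hz.
all: elim: z hz => [|z IHz] hz; rewrite {1}KF_mod //.
all: set e := (X in _ /\ X <= _).
all: suff h : e <= S * S + y * (2 * S) by [split; [apply: leq_trans (leq_mod _ _) h|]].
all: rewrite /e {e}.
- by rewrite /kf0 ifT ?leq_addr //; lia.
- by have [h _] := IHz (ltnW hz); rewrite geq_min h.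
- rewrite /kf0; case: ltnP => hk; first by rewrite leq_addr.
  have [h _] := IHd (y - k) NB ltac:(lia) ltac:(lia) (leqnn _).
  have h2 := leq_divM (TT 28 x (y - k) NB) S; have h3 := code_S.
  have h4 : (y - k).+1 * (2 * S) <= y * (2 * S) by rewrite leq_mul2r; lia.
  rewrite mulnDl mul1n; move: h4; rewrite mulSn; lia.
- by have [h _] := IHz (ltnW hz); rewrite geq_min h.
Qed.

Lemma S3_le : S * S + S * (2 * S) + 4 * S < S * S * S.
Proof.
have [h _ _ _ _] := S_facts; have : 1000 * (S * S) <= S * (S * S) by rewrite leq_mul2r h orbT.
have : 1000 * S <= S * S by rewrite leq_mul2r h orbT.
by rewrite [S * (2 * S)]mulnCA -[S * S * S]mulnA; lia.
Qed.

Lemma KF_eq x y z : x <= n - k + 1 -> y <= n -> z <= NB ->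
  TT 28 x y z = if z is b.+1 then minn (TT 28 x y b) (minn (kc1 x y b) (kc2 x y b))
                else kf0 x y.
Proof.
move=> hx hy hz; rewrite KF_mod // modM //; have [_ h] := KF_bound hx hy hz.
have [_ h2 _ _ _] := S_facts; have h3 := S3_le.
have : y * (2 * S) <= S * (2 * S) by rewrite leq_mul2r; lia.
lia.
Qed.

Lemma div_code v c : c < S -> (v * S + c) %/ S = v.
Proof. by move=> h; rewrite divnMDl ?divn_small ?addn0 //; lia. Qed.

Lemma mod_code v c : c < S -> (v * S + c) %% S = c.
Proof. by move=> h; rewrite modnMDl modn_small. Qed.

Lemma le_code u v c : u <= v * S + c -> c < S -> u %/ S <= v.
Proof. by move=> h1 h2; have := leq_div2r S h1; rewrite div_code. Qed.

Lemma lt_code v c : v + 1 < S -> c < S -> v * S + c < S * S.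
Proof.
move=> h1 h2; apply: (@leq_trans (v.+1 * S)); first by rewrite mulSn; lia.
by rewrite leq_mul2r; lia.
Qed.

Section StageK.
Variable x : nat.
Hypothesis hx : x <= n - k + 1.
Hypothesis V_ex : exact W (T W k Sk x) id (V x).
Hypothesis V_lt : forall j, j <= n -> V x j + 1 < S.

Lemma V_lip j : j < n -> V x j <= (V x j.+1).+1 /\ V x j.+1 <= (V x j).+1.
Proof. exact: (exact_lip k_gt1 kn V_ex). Qed.

Lemma col_min j mk (ok : nat -> bool) c off : (forall b, b < NB -> mk b < B) ->
  (forall l, l %/ tau < NB -> bit (mk (l %/ tau)) (l %% tau) = ok l) ->
  (forall l, ok l -> j + l <= n) ->
  let cd b := cnd (TT 23 x (n - j - b * tau) 0 + c) (TT 24 x (n - j - b * tau) 0)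
    (mk b) (off + b * tau) in
  (forall l, l %/ tau < NB -> ok l -> cd (l %/ tau) <= (V x (j + l) + c) * S + (off + l)) /\
  (forall b, b < NB -> (exists2 l, ok l & cd b = (V x (j + l) + c) * S + (off + l)) \/
     S * S <= cd b).
Proof.
move=> hm hok hle /=.
have [||h1 h2] := @block_min (fun b => TT 23 x (n - j - b * tau) 0 + c)
  (fun b => TT 24 x (n - j - b * tau) 0) mk (fun l => V x (j + l) + c) off NB _ hm.
- move=> b hb; have [] := @VC_spec x hx V_lip (n - (n - j - b * tau)) (leq_subr _ _).
  by rewrite subKn //; lia.
- move=> b i hb hi hbit.
  have el : (b * tau + i) %/ tau = b by rewrite divnMDl // divn_small // addn0.
  have er : (b * tau + i) %% tau = i by rewrite modnMDl modn_small.
  have := hok (b * tau + i); rewrite el er hbit => /(_ hb)/esym/hle hl.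
  have := @VC_dsum x hx V_lip (j + b * tau) i ltac:(lia) (ltnW hi).
  rewrite /V subnDA -addnA; lia.
split=> [l hl ho|b hb]; first by apply: h1; rewrite ?hok.
case: (h2 b hb) => [[l [e hb1 hb2]]|]; [left|by right].
by exists l => //; rewrite -hok ?e.
Qed.

Lemma kc1_spec j : j <= n ->
  (forall l, l < k -> j + l <= n -> bok W k x j l ->
     kc1 x (n - j) (l %/ tau) <= V x (j + l) * S + (k + l)) /\
  (forall b, b < NB -> (exists l, [/\ l < k, j + l <= n, bok W k x j l &
     kc1 x (n - j) b = V x (j + l) * S + (k + l)]) \/ S * S <= kc1 x (n - j) b).
Proof.
move=> hj; pose mk b := Nat.land (2 ^ minn (minn (n - j + 1) k - b * tau) tau - 1)
  (B - 1 - TT 27 x (n - j) b).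
have [|||h1 h2] := @col_min j mk (fun l => [&& l < k, j + l <= n & bok W k x j l]) 0 k.
- by move=> b hb; apply: land_lt; exact: low_lt.
- move=> l hl; rewrite /mk bit_land low_bit bit_compl; last first.
    by apply: bb_lt => //; lia.
  rewrite ltn_pmod //= -/(Bb x j l).
  have -> : (l < minn (n - j + 1) k) = (l < k) && (j + l <= n) by lia.
  rewrite -andbA; case: (ltnP l k) => // k1; case: (leqP (j + l) n) => //= k2.
  by rewrite bok_bits.
- by move=> l /and3P[].
rewrite /= in h1 h2; split=> [l k1 k2 k3|b hb].
  have := h1 l (word_lt (ltnW k1)); rewrite !addn0; apply.
  by rewrite k1 k2.
have := h2 b hb; rewrite addn0 => -[[l /and3P[k1 k2 k3] e]|]; [left|by right].
by exists l; rewrite addn0 in e.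
Qed.

Lemma kc2_spec j : j <= n ->
  (forall l, l < k -> j + 1 + l <= n ->
     kc2 x (n - j) (l %/ tau) <= (V x (j + 1 + l) + 1) * S + (3 * k + 1 + l)) /\
  (forall b, b < NB -> (exists l, [/\ l < k, j + 1 + l <= n &
     kc2 x (n - j) b = (V x (j + 1 + l) + 1) * S + (3 * k + 1 + l)]) \/
     S * S <= kc2 x (n - j) b).
Proof.
move=> hj; pose mk b := 2 ^ minn (minn (n - j) k - b * tau) tau - 1.
have eq2 b : n - j - (b * tau + 1) = n - (j + 1) - b * tau by lia.
have [|||h1 h2] := @col_min (j + 1) mk (fun l => (l < k) && (j + 1 + l <= n)) 1 (3 * k + 1).
- by move=> b hb; exact: low_lt.
- by move=> l hl; rewrite /mk low_bit; lia.
- by move=> l /andP[].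
rewrite /= in h1 h2; rewrite /kc2; split=> [l k1 k2|b hb].
  by rewrite eq2; apply: h1; rewrite ?word_lt ?k1 // ltnW.
rewrite eq2; have := h2 b hb => -[[l /andP[k1 k2] e]|]; [left|by right].
by exists l.
Qed.

Lemma K_props :
  [/\ forall j l, j + l <= n -> l < k -> bok W k x j l -> K x j <= V x (j + l),
      forall j l, j + 1 + l <= n -> l < k -> K x j <= (V x (j + 1 + l)).+1,
      forall j, j + k <= n -> K x j <= (K x (j + k)).+1 &
      forall j, j <= n ->
  [\/ exists l, [/\ [/\ j + l <= n, l < k & bok W k x j l], K x j = V x (j + l) & Kc x j = k + l],
      exists l, [/\ j + 1 + l <= n, l < k, K x j = (V x (j + 1 + l)).+1 & Kc x j = 3 * k + 1 + l] |
      [/\ j + k <= n, K x j = (K x (j + k)).+1 & Kc x j = 4 * k]]].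
Proof.
have hc := code_S; have c1 l : l < k -> k + l < S by lia.
have c2 l : l < k -> 3 * k + 1 + l < S by lia.
have run j : j <= n -> [/\ TT 28 x (n - j) NB <= kf0 x (n - j),
    forall b, b < NB -> TT 28 x (n - j) NB <= minn (kc1 x (n - j) b) (kc2 x (n - j) b) &
    TT 28 x (n - j) NB = kf0 x (n - j) \/
    exists2 b, b < NB & TT 28 x (n - j) NB = minn (kc1 x (n - j) b) (kc2 x (n - j) b)].
  move=> hj; have e0 : TT 28 x (n - j) 0 = kf0 x (n - j) by rewrite KF_eq //; lia.
  rewrite -e0; apply: minrun => z hz; rewrite KF_eq //; lia.
have l1 j l : j + l <= n -> l < k -> bok W k x j l ->
    TT 28 x (n - j) NB <= V x (j + l) * S + (k + l).
  move=> hj hl hb; have hj' : j <= n by lia.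
  have [_ r _] := run j hj'; have [h1 _] := kc1_spec hj'.
  apply: leq_trans (h1 l hl hj hb); apply: leq_trans (r _ (word_lt (ltnW hl))) _.
  exact: geq_minl.
split.
- move=> j l hj hl hb; apply: le_code (c1 l hl); exact: l1.
- move=> j l hj hl; have hj' : j <= n by lia.
  have [_ r _] := run j hj'; have [h1 _] := kc2_spec hj'.
  rewrite -addn1; apply: le_code (c2 l hl); apply: leq_trans (h1 l hl hj).
  by apply: leq_trans (r _ (word_lt (ltnW hl))) _; exact: geq_minr.
- move=> j hj; have hj' : j <= n by lia.
  have [r _ _] := run j hj'; move: r; rewrite /kf0 ifF; last by lia.
  rewrite -subnDA -/(K x (j + k)) addn1 => r.
  by apply: le_code r _; lia.
move=> j hj; have [_ _ r] := run j hj.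
(* Copying nothing in front of the pattern is always allowed, so the infinite value [S * S] is never
   the minimum. *)
have lt : TT 28 x (n - j) NB < S * S.
  apply: leq_ltn_trans (@l1 j 0 _ _ _) _; rewrite ?addn0 //; first by lia.
    by rewrite /bok /factor take0.
  by apply: lt_code; [exact: V_lt|lia].
rewrite /K /Kc; case: r => [e|[b hb e]].
  move: lt; rewrite e /kf0; case: (ltnP (n - j) k) => hk; first by rewrite ltnn.
  rewrite -subnDA => _; apply: Or33.
  have c3 : 4 * k < S by lia.
  by rewrite div_code // mod_code // addn1; split=> //; lia.
have [_ h1] := kc1_spec hj; have [_ h2] := kc2_spec hj.
move: lt; rewrite e /minn; case: ifP => _ lt.
  case: (h1 b hb) => [[l [k1 k2 k3 e2]]|]; last by lia.
  by apply: Or31; exists l; rewrite e2 div_code ?mod_code //; apply: c1.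
case: (h2 b hb) => [[l [k1 k2 e2]]|]; last by lia.
have c3 := c2 _ k1; apply: Or32; exists l.
by rewrite e2 div_code // mod_code //; split=> //; exact: addn1.
Qed.

Lemma K_ex : (forall x, x \in W -> 0 < x) -> exact W (Az W k Sk x) id (K x).
Proof.
move=> W_pos; have [h1 h2 h3 h4] := K_props.
apply: (K_exact k_gt1 kn W_pos hx V_ex h1 h2 h3) => j /h4.
case=> [[l [[k1 k2 k3] k4 _]]|[l [k1 k2 k3 _]]|[k1 k2 _]].
- by apply: Or31; exists l.
- by apply: Or32; exists l.
- exact: Or33.
Qed.
End StageK.

(** ** How the next pattern is entered *)

Definition Dv (x s : nat) : nat := TT 20 x s NB %/ S.
Definition Dc (x s : nat) : nat := TT 20 x s NB %% S.

(** Rows add the letters of the pattern from its last one, at n - x, leftwards. The rows beyond [k]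
    that fill up the last block simply go on in W; the guard stops them at its left end. *)
Definition letter_eq (x y d : nat) : bool :=
  (y < n + 1 - x) && (nth 0 W (n - x - y) == nth 0 W (n - d)).

(* Column n - d, row y of the edit distance table of stage x. *)
Fixpoint vf (x y : nat) : nat -> nat :=
  if y is y'.+1 then
    fix g d := if d is d'.+1 then
        minn (minn (vf x y' d + 1) (g d' + 1)) (vf x y' d' + (1 - letter_eq x y' d))
      else (vf x y' 0).+1
  else fun d => Dv x (n - d).

Lemma vf0 x d : vf x 0 d = Dv x (n - d). Proof. by []. Qed.
Lemma vfS0 x y : vf x y.+1 0 = (vf x y 0).+1. Proof. by []. Qed.
Lemma vfSS x y d : vf x y.+1 d.+1 = minn (minn (vf x y d.+1 + 1) (vf x y.+1 d + 1))
  (vf x y d + (1 - letter_eq x y d.+1)).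
Proof. by []. Qed.

Lemma vf_le x y d : vf x y d <= Dv x (n - d) + y.
Proof.
elim: y => [|y IH]; first by rewrite vf0 addn0.
case: d IH => [|d] IH; first by rewrite vfS0 addnS ltnS.
by rewrite vfSS; lia.
Qed.

Definition VV (x y j : nat) : nat := if x == 0 then n - j else vf x y (n - j).

Section StageD.
Variable x : nat.
Hypothesis hx : 0 < x <= n - k + 1.
Local Notation X := (prev x).
Local Notation q := (n - k + 1 - x).
Local Notation fb := (fb x).

Definition dd0 (s : nat) : nat :=
  if n < s + fb s then S * S else
  (TT 28 X (n - (s + fb s)) NB %/ S + 1) * S + (3 * k + fb s).
Definition dcV (s b : nat) : nat :=
  cnd (TT 22 X (n - s) b) (TT 21 X (n - s) b %/ 4) (TT 18 x b tau) (b * tau).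
Definition dcD (s b : nat) : nat :=
  cnd (TT 23 X (n - (s + b * tau)) 0) (TT 24 X (n - (s + b * tau)) 0)
    (TT 19 x s b) (k + b * tau).
Definition lim (s : nat) : nat := minn (n + 1 - s) (fb s).
Definition dcH (s b : nat) : nat :=
  cnd (TT 23 X (n - (s + b * tau)) 0 + 1) (TT 24 X (n - (s + b * tau)) 0)
    (2 ^ minn (lim s - b * tau) tau - 1) (3 * k + b * tau).

Lemma DD_mod s z : s <= n -> z <= NB ->
  TT 20 x s z = (if z is b.+1 then
    minn (TT 20 x s b) (minn (dcV s b) (minn (dcD s b) (dcH s b))) else dd0 s) %% M.
Proof.
move=> hs hz; have x0 := x_neq0 hx; case: z hz => [|b] hz.
  by rewrite {1}/TT m_eq; [rewrite /= x0 -!/(TT _ _ _ _) -/(fb s)|inr].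
rewrite {1}/TT m_eq; last by inr.
by rewrite /= x0 subSS subn0 -!/(TT _ _ _ _) -!/(prev x) !subminn lowM.
Qed.

Lemma DD_eq s z : s <= n -> z <= NB ->
  TT 20 x s z = if z is b.+1 then
    minn (TT 20 x s b) (minn (dcV s b) (minn (dcD s b) (dcH s b))) else dd0 s.
Proof.
move=> hs hz; have [_ s2 _ _ _] := S_facts; have h3 := S3_le; have h4 := code_S.
have hf : fb s <= k by apply: fb_le.
have b0 : dd0 s <= S * S + S * (2 * S) + 3 * S.
  rewrite /dd0; case: (ltnP n) => h; first by lia.
  have [h1 _] := @KF_bound X (n - (s + fb s)) NB (X_le hx) (leq_subr _ _) (leqnn _).
  have h2 := leq_divM (TT 28 X (n - (s + fb s)) NB) S.
  have : (n - (s + fb s)) * (2 * S) <= S * (2 * S) by rewrite leq_mul2r; lia.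
  by rewrite mulnDl; lia.
have main z' : z' <= NB -> TT 20 x s z' <= S * S + S * (2 * S) + 3 * S.
  elim: z' => [|z' IH] hz'; rewrite DD_mod //; apply: leq_trans (leq_mod _ _) _ => //.
  by rewrite geq_min IH // ltnW.
rewrite DD_mod // modM //; case: z hz => [|z] hz; first by lia.
by have := main z (ltnW hz); lia.
Qed.

Definition ov (d : nat) : bool :=
  [&& 0 < d, d < k, k - d <= lcp (q + d) (qpos W k X) & d <= fb (qpos W k X + (k - d))].

(** The empty pattern of stage 0 cannot be overlapped, so the columns of stage 0, which are not
    computed, are never consulted. *)
Lemma ovE d : 0 < d < k -> ov d = ovl W k Sk x d /\ (ov d -> 0 < X).
Proof.
move=> hd; have hX := X_le hx; rewrite /ov /ovl -prevE; last by lia.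
case/andP: (hd) => -> -> /=; case: (posnP X) => X0.
  rewrite X0 /qpos eqxx; have -> : (k - d <= lcp (q + d) n) = false.
    by rewrite lcpE ?eqxx ?orbT //; lia.
  split=> //; symmetry; apply/negbTE/negP => /andP[/eqP e _].
  have := congr1 size e; rewrite size_cat pat0 /= size_take_min size_pat //; lia.
split=> //; have hq : qpos W k X + k <= n by rewrite /qpos; case: eqP; lia.
have -> : qpos W k X + (k - d) = qpos W k X + k - d by lia.
rewrite (pat_sub hx); symmetry.
exact: (@ovl_char W k k_gt1 kn lcp lcs lcpE lcsE (qpos W k X) (qX hx) q (qk hx) fb
  (fb_le hx) (fb_min hx) (fb_ex hx) d hd hq).
Qed.

(** The word is built from its top bit: after [z] steps it holds the last [z] distances of the
    block. *)
Lemma AW_spec b z : b < NB -> z <= tau -> TT 18 x b z < 2 ^ z /\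
  forall i, i < z -> bit (TT 18 x b z) i = ov (b * tau + tau - z + i).
Proof.
move=> hb; have x0 := x_neq0 hx; elim: z => [|z IH] hz.
  by rewrite /TT m_eq; [rewrite /= x0 mod0n|inr].
have [h1 h2] := IH (ltnW hz); pose d := b * tau + tau - z.+1.
have e : TT 18 x b z.+1 = ov d + 2 * TT 18 x b z.
  rewrite -(@modB (ov d + _)); last first.
    apply: leq_trans (_ : 2 ^ z.+1 <= _); last by rewrite leq_exp2l.
    by rewrite expnS; case: (ov d) => /=; lia.
  rewrite {1}/TT m_eq; last by inr.
  rewrite /= x0 -!/(TT _ _ _ _) subSS subn0 -/d -!/(prev x); congr ((_ + _) %% M).
  have -> : (if X == 0 then n else n + 1 - (k + X)) = qpos W k X.
    by rewrite /qpos; case: eqP => // _; lia.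
  have -> : n + 1 - (k + x) = q by lia.
  rewrite -/(lcp (q + d) (qpos W k X)) -/(fb _) /ov.
  by case: (ltnP 0 d) => // _; case: (ltnP d k) => // _; do 2 case: leqP => //.
rewrite e; split; first by rewrite expnS; case: (ov d) => /=; lia.
case=> [|i] hi; rewrite bit_push; first by rewrite addn0.
rewrite h2 //; congr ov; rewrite /d.
have : tau <= b * tau + tau by rewrite leq_addl.
by lia.
Qed.

Lemma AW_bit b i : b < NB -> i < tau -> bit (TT 18 x b tau) i = ov (b * tau + i).
Proof. by move=> hb hi; have [_ ->] := AW_spec hb (leqnn tau); rewrite ?addnK. Qed.

Definition md (s b : nat) : nat := Nat.land (2 ^ minn (lim s - b * tau) tau - 1)
  (B - 1 - Nat.lor (TT 15 x s b) (if s < n then shl27 X (n - s - 1) b else 0)).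

Lemma md_lt s b : md s b < B.
Proof. by apply: land_lt; exact: low_lt. Qed.

Lemma MD_eq s b : s <= n -> b < NB -> TT 19 x s b = md s b.
Proof.
move=> hs hb; rewrite -(modB (md_lt s b)) {1}/TT m_eq; last by inr.
by rewrite /= (x_neq0 hx) -!/(TT _ _ _ _) -!/(prev x) !subminn lowM.
Qed.

Lemma MD_bit s l : s <= n -> l %/ tau < NB ->
  bit (TT 19 x s (l %/ tau)) (l %% tau) = (s + l <= n) && dir W k Sk x s l.
Proof.
move=> hs hl; rewrite MD_eq // bit_land low_bit.
have -> : (l < lim s) = (s + l <= n) && (l < fb s) by rewrite /lim; lia.
case: (leqP (s + l) n) => h1 //=; case: (ltnP l (fb s)) => h2 /=; last first.
  apply/esym/negbTE/negP => hd; have hk := dir_lt h1 hd.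
  by move: hd; rewrite dir_bits // ltnNge h2.
have hk : l < k by have := fb_le hx hs; lia.
rewrite dir_bits // h2 /= bit_compl; last first.
  apply: lor_lt; first exact: dn1_lt.
  apply: if_lt => h3; last exact: B_gt0.
  apply: shl27_lt => // b hb; apply: bb_lt => //; [exact: X_le|lia].
rewrite ltn_pmod //= bit_lor negb_or -/(M1 x s l); congr (_ && _).
case: (ltnP s n) => h3.
  have -> : n - s - 1 = n - s.+1 by lia.
  rewrite shl27_bit //; [|exact: X_le|exact: ltnW].
  by case: (l).
by rewrite bit_0; have -> : l = 0 by lia.
Qed.

Hypothesis V_exX : exact W (T W k Sk X) id (V X).
Hypothesis V_ltX : forall j, j <= n -> V X j + 1 < S.
Hypothesis code_lt : forall y b, y <= n -> b < NB -> TT 21 X y b %/ 4 < B * B.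
Hypothesis col_sum : 0 < X -> forall s b i, s <= n -> b < NB -> i <= tau ->
  TT 22 X (n - s) b + dsum (TT 21 X (n - s) b %/ 4) i = VV X (b * tau + i) s + i.

Lemma dcV_spec s : s <= n ->
  (forall d, 0 < d < k -> ovl W k Sk x d -> dcV s (d %/ tau) <= VV X d s * S + d) /\
  (forall b, b < NB -> (exists d, [/\ 0 < d < k, ovl W k Sk x d &
     dcV s b = VV X d s * S + d]) \/ S * S <= dcV s b).
Proof.
move=> hs; have [|||h1 h2] := @block_min (fun b => TT 22 X (n - s) b)
  (fun b => TT 21 X (n - s) b %/ 4) (fun b => TT 18 x b tau) (fun l => VV X l s) 0 NB.
- by move=> b hb; apply: code_lt => //; lia.
- by move=> b hb; have [] := AW_spec hb (leqnn tau).
- move=> b i hb hi; rewrite AW_bit // => hov; apply: col_sum => //; last exact: ltnW.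
  have hd : 0 < b * tau + i < k by case/and4P: hov => -> ->.
  by have [_] := ovE hd; apply.
split=> [d hd ho|b hb].
  have hw : d %/ tau < NB by apply: word_lt; lia.
  apply: (h1 d hw); rewrite AW_bit ?ltn_pmod // -divn_eq.
  by have [-> _] := ovE hd.
case: (h2 b hb) => [[l [e hb1 e2]]|]; [left|by right].
have hl : l = b * tau + l %% tau by rewrite -e -divn_eq.
move: hb1; rewrite AW_bit ?ltn_pmod // -hl => hov.
have hd : 0 < l < k by case/and4P: hov => -> ->.
by exists l; have [<- _] := ovE hd.
Qed.

Lemma dcD_spec s : s <= n ->
  (forall l, s + l <= n -> dir W k Sk x s l -> dcD s (l %/ tau) <= V X (s + l) * S + (k + l)) /\
  (forall b, b < NB -> (exists l, [/\ s + l <= n, dir W k Sk x s l &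
     dcD s b = V X (s + l) * S + (k + l)]) \/ S * S <= dcD s b).
Proof.
move=> hs; have [|||h1 h2] := @col_min X (X_le hx) V_exX s (fun b => TT 19 x s b)
  (fun l => (s + l <= n) && dir W k Sk x s l) 0 k.
- by move=> b hb; rewrite MD_eq // md_lt.
- by move=> l hl; rewrite MD_bit.
- by move=> l /andP[].
rewrite /= in h1 h2; split=> [l k1 k2|b hb].
  have hw : l %/ tau < NB by apply/word_lt/ltnW/(dir_lt k1 k2).
  by have := h1 l hw; rewrite !addn0 k1 k2 -subnDA; apply.
have := h2 b hb; rewrite addn0 -subnDA -/(dcD s b) => -[[l /andP[k1 k2] e]|]; [left|by right].
by exists l; rewrite addn0 in e.
Qed.

Lemma dcH_spec s : s <= n ->
  (forall l, s + l <= n -> l < fb s -> dcH s (l %/ tau) <= (V X (s + l) + 1) * S + (3 * k + l)) /\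
  (forall b, b < NB -> (exists l, [/\ s + l <= n, l < fb s &
     dcH s b = (V X (s + l) + 1) * S + (3 * k + l)]) \/ S * S <= dcH s b).
Proof.
move=> hs; have [|||h1 h2] := @col_min X (X_le hx) V_exX s
  (fun b => 2 ^ minn (lim s - b * tau) tau - 1)
  (fun l => (s + l <= n) && (l < fb s)) 1 (3 * k).
- by move=> b hb; exact: low_lt.
- by move=> l hl; rewrite low_bit /lim; lia.
- by move=> l /andP[].
rewrite /= in h1 h2; split=> [l k1 k2|b hb].
  have hw : l %/ tau < NB by apply: word_lt; have := fb_le hx hs; lia.
  by have := h1 l hw; rewrite k1 k2 -subnDA; apply.
have := h2 b hb; rewrite -subnDA -/(dcH s b) => -[[l /andP[k1 k2] e]|]; [left|by right].
by exists l.
Qed.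

Lemma D_props :
  [/\ forall s d, s <= n -> 0 < d < k -> ovl W k Sk x d -> Dv x s <= VV X d s,
      forall s l, s + l <= n -> dir W k Sk x s l -> Dv x s <= V X (s + l),
      forall s l, s + l <= n -> l < fb s -> Dv x s <= (V X (s + l)).+1,
      forall s, s + fb s <= n -> Dv x s <= (K X (s + fb s)).+1 &
      forall s, s <= n ->
  [\/ exists d, [/\ 0 < d < k, ovl W k Sk x d, Dv x s = VV X d s & Dc x s = d],
      exists l, [/\ s + l <= n, dir W k Sk x s l, Dv x s = V X (s + l) & Dc x s = k + l],
      exists l, [/\ s + l <= n, l < fb s, Dv x s = (V X (s + l)).+1 & Dc x s = 3 * k + l] |
      [/\ s + fb s <= n, Dv x s = (K X (s + fb s)).+1 & Dc x s = 3 * k + fb s]]].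
Proof.
have hc := code_S; have hf s : s <= n -> 0 < fb s <= k by apply: fb_gt0.
have run s : s <= n -> let c b := minn (dcV s b) (minn (dcD s b) (dcH s b)) in
    [/\ TT 20 x s NB <= dd0 s, forall b, b < NB -> TT 20 x s NB <= c b &
    TT 20 x s NB = dd0 s \/ exists2 b, b < NB & TT 20 x s NB = c b].
  move=> hs c; have e0 : TT 20 x s 0 = dd0 s by rewrite DD_eq.
  by rewrite -e0; apply: (minrun (F := TT 20 x s)) => z hz; rewrite DD_eq.
have le3 a b c : minn a (minn b c) <= a /\ minn a (minn b c) <= b /\ minn a (minn b c) <= c by lia.
have lH s l : s + l <= n -> l < fb s -> TT 20 x s NB <= (V X (s + l) + 1) * S + (3 * k + l).
  move=> hs hl; have hs' : s <= n by lia.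
  have [_ r _] := run s hs'; have [h1 _] := dcH_spec hs'.
  have hw : l %/ tau < NB by apply: word_lt; have := hf s hs'; lia.
  apply: leq_trans (h1 l hs hl); apply: leq_trans (r _ hw) _.
  by case: (le3 (dcV s (l %/ tau)) (dcD s (l %/ tau)) (dcH s (l %/ tau))) => _ [].
split.
- move=> s d hs hd ho; have [_ r _] := run s hs; have [h1 _] := dcV_spec hs.
  have hw : d %/ tau < NB by apply: word_lt; lia.
  have hdS : d < S by lia.
  apply: le_code _ hdS.
  apply: leq_trans (h1 d hd ho); apply: leq_trans (r _ hw) _.
  by case: (le3 (dcV s (d %/ tau)) (dcD s (d %/ tau)) (dcH s (d %/ tau))).
- move=> s l hs hd; have hs' : s <= n by lia.
  have [_ r _] := run s hs'; have [h1 _] := dcD_spec hs'; have hl := dir_lt hs hd.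
  have hw : l %/ tau < NB by apply/word_lt/ltnW.
  have hdS : k + l < S by lia.
  apply: le_code _ hdS.
  apply: leq_trans (h1 l hs hd); apply: leq_trans (r _ hw) _.
  by case: (le3 (dcV s (l %/ tau)) (dcD s (l %/ tau)) (dcH s (l %/ tau))) => _ [].
- move=> s l hs hl; rewrite -addn1; apply: le_code (lH s l hs hl) _.
  by have := hf s ltac:(lia); lia.
- move=> s hs; have hs' : s <= n by lia.
  have [r _ _] := run s hs'; move: r; rewrite /dd0 ltnNge hs /= -/(K X (s + fb s)) addn1 => r.
  by apply: le_code r _; have := hf s hs'; lia.
move=> s hs; have [_ _ r] := run s hs; have hfs := hf s hs.
(* As [fb s > 0], a # may follow the pattern immediately, so some candidate is finite. *)
have lt : TT 20 x s NB < S * S.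
  apply: leq_ltn_trans (@lH s 0 _ _) _; rewrite ?addn0 //; first by lia.
  apply: (@leq_trans ((V X s + 2) * S)); last by rewrite leq_mul2r; have := V_ltX hs; lia.
  by rewrite !mulnDl; lia.
rewrite /Dv /Dc; case: r => [e|[b hb e]].
  move: lt; rewrite e /dd0; case: (ltnP n) => h1; first by rewrite ltnn.
  have c3 : 3 * k + fb s < S by lia.
  by move=> _; apply: Or44; rewrite div_code // mod_code // addn1.
have [_ h1] := dcV_spec hs; have [_ h2] := dcD_spec hs; have [_ h3] := dcH_spec hs.
have [e3|[e3|e3]] : TT 20 x s NB = dcV s b \/ TT 20 x s NB = dcD s b \/ TT 20 x s NB = dcH s b by lia.
- case: (h1 b hb) => [[d [k1 k2 k3]]|]; last by lia.
  have c3 : d < S by lia.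
  by apply: Or41; exists d; rewrite e3 k3 div_code // mod_code.
- case: (h2 b hb) => [[l [k1 k2 k3]]|]; last by lia.
  have c3 : k + l < S by have := dir_lt k1 k2; lia.
  by apply: Or42; exists l; rewrite e3 k3 div_code // mod_code.
- case: (h3 b hb) => [[l [k1 k2 k3]]|]; last by lia.
  have c3 : 3 * k + l < S by lia.
  by apply: Or43; exists l; rewrite e3 k3 div_code // mod_code // addn1.
Qed.
End StageD.

(** ** Columns *)

(** The number is the repetition of the digit 2 in base 4: it encodes a column in which every entry
    is one more than the previous one. *)
Lemma rep2 t : (4 ^ t - 1) %/ 3 * 2 < 4 ^ t /\ forall i, i < t -> dg ((4 ^ t - 1) %/ 3 * 2) i = 2.
Proof.
have [r] : exists r, 4 ^ t = r * 3 + 1.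
  by elim: t => [|t [r e]]; [exists 0|exists (4 * r + 1); rewrite expnS e; lia].
elim: t r => [|t IH] r e; first by split.
have [r' e'] : exists r', 4 ^ t = r' * 3 + 1.
  by elim: (t) => [|u [v e']]; [exists 0|exists (4 * v + 1); rewrite expnS e'; lia].
have [h1 h2] := IH _ e'; have er : r = 4 * r' + 1 by move: e; rewrite expnS e'; lia.
have e2 : (4 ^ t.+1 - 1) %/ 3 * 2 = 2 + 4 * ((4 ^ t - 1) %/ 3 * 2).
  by rewrite e e' !addnK !mulnK // er; lia.
rewrite e2; split; first by rewrite expnS; lia.
by case=> [|i] hi; rewrite ?dg_push0 ?dg_push // h2.
Qed.

Lemma dsum_le c i : dsum c i <= 3 * i.
Proof.
elim: i => //= i IH; have : dg c i < 4 by rewrite /dg ltn_pmod.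
by lia.
Qed.

Lemma tau_small : 3 * tau + 1 <= S.
Proof.
have [h1 _ h2 _ _] := S_facts; have h3 : tau.+1 <= B by exact: ltn_expl.
have h4 : tau.+1 * tau.+1 <= B * B by exact: leq_mul.
by case: (leqP tau 300) => h5; nia.
Qed.

(** With a single bit as mask the minimum is a prefix sum of the digits; this is how one entry is
    read from a coded column. *)
Lemma MP_single c i : c < B * B -> i < tau ->
  TT 2 tau c (2 ^ i) %/ S = tau - i + dsum c i.
Proof.
move=> hc hi; have hz : 2 ^ i < B by rewrite ltn_exp2l.
have [h1 h2] := MP_spec MP_eq0 MP_eqS (leqnn tau) hc hz.
have [_ _ _ s4 _] := S_facts; have hiS : i < S by lia.
have := h1 i hi; rewrite bit_pow eqxx => /(_ isT) h3.
case: h2 => [[j [hj]]|h2].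
  by rewrite bit_pow => /eqP-> ->; rewrite div_code.
have : (tau - i + dsum c i) * S + i < S * S + tau * S; last by lia.
have h4 : tau - i + dsum c i <= tau + 3 * tau by have := dsum_le c i; lia.
have h5 : (tau - i + dsum c i) * S <= (tau + 3 * tau) * S by rewrite leq_mul2r h4 orbT.
have h6 : (3 * tau).+1 * S <= S * S by rewrite leq_mul2r; have := tau_small; lia.
by move: h5 h6; rewrite mulnDl mulSn; lia.
Qed.

Lemma and3_impl (P Q R : Prop) : [/\ P, Q & R] -> [/\ P, Q & true -> R].
Proof. by case. Qed.

Section Columns.
Variable x : nat.
Hypothesis hx : 0 < x <= n - k + 1.
Hypothesis D_lip : forall j, j < n ->
  Dv x j <= (Dv x j.+1).+1 /\ Dv x j.+1 <= (Dv x j).+1.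
Hypothesis D_lt : forall j, j <= n -> Dv x j + k < S.

Lemma vf_col0 y : vf x y 0 = Dv x n + y.
Proof. by elim: y => [|y IH]; rewrite ?vf0 ?subn0 ?addn0 // vfS0 IH addnS. Qed.

Lemma RR_spec y b : y <= n -> b < NB -> [/\ TT 21 x y b %/ 4 < B * B,
    forall i, i < tau -> dg (TT 21 x y b %/ 4) i <= 2 /\
      vf x (b * tau + i).+1 y + 1 = vf x (b * tau + i) y + dg (TT 21 x y b %/ 4) i &
    0 < y -> TT 21 x y b %% 4 <= 2 /\
      vf x (b * tau + tau) y + 1 = vf x (b * tau + tau) y.-1 + TT 21 x y b %% 4].
Proof.
have x0 := x_neq0 hx; have [_ _ s3 _ _] := S_facts.
elim: y b => [|y IHy] b hy.
  move=> hb; have e : TT 21 x 0 b = (4 ^ tau - 1) %/ 3 * 2 * 4 + 2.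
    rewrite {1}/TT m_eq; last by inr.
    rewrite /= x0 -B4 modS1 //; have [h _] := rep2 tau; rewrite B4 in h *.
    by case: S_facts; nia.
  have [h1 h2] := rep2 tau.
  rewrite e divnMDl // (@divn_small 2) // addn0 -B4; split=> // i hi.
  by rewrite h2 // !vf_col0; lia.
have hny : n - y.+1 < n by lia.
have step c h : c < NB -> h <= 2 -> vf x (c * tau) y.+1 + 1 = vf x (c * tau) y + h ->
    TT 21 x y.+1 c = TT 3 tau (TT 21 x y c %/ 4)
      (TT 7 (n + 1 - x - c * tau) (n - y.+1) 0 * 4 + h) %% M ->
    [/\ TT 21 x y.+1 c %/ 4 < B * B,
    forall i, i < tau -> dg (TT 21 x y.+1 c %/ 4) i <= 2 /\
      vf x (c * tau + i).+1 y.+1 + 1 = vf x (c * tau + i) y.+1 + dg (TT 21 x y.+1 c %/ 4) i &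
    TT 21 x y.+1 c %% 4 <= 2 /\
      vf x (c * tau + tau) y.+1 + 1 = vf x (c * tau + tau) y + TT 21 x y.+1 c %% 4].
  move=> hc hh h0 ->; have [o1 o2 _] := IHy c (ltnW hy) hc.
  have hE : TT 7 (n + 1 - x - c * tau) (n - y.+1) 0 < B by apply: EQ_lt => //; lia.
  rewrite (_ : _ %% M = TT 3 tau (TT 21 x y c %/ 4)
    (TT 7 (n + 1 - x - c * tau) (n - y.+1) 0 * 4 + h)); last first.
    apply: modS1; have := @ST_small tau (TT 21 x y c %/ 4)
      (TT 7 (n + 1 - x - c * tau) (n - y.+1) 0 * 4 + h) (leqnn _) o1 ltac:(lia).
    by rewrite expnS B4; have [? _ _ _ _] := S_facts; nia.
  have [|||r1 r2 r3 r4] := @ST_spec tau (TT 3) ST_eq0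
    (fun x y z h1 h2 h3 => ST_eqS h1 h2 h3) tau _ _ _ (fun i => vf x (c * tau + i) y)
    (fun i => vf x (c * tau + i) y.+1) (leqnn _) o1 hE hh.
  - by rewrite addn0.
  - by move=> i hi; rewrite (addnS (c * tau)); apply: o2.
  - move=> i hi; rewrite (addnS (c * tau)) vfSS EQR_bit //; last by lia.
    do 4 f_equal; rewrite /letter_eq.
    have -> : (i < n + 1 - x - c * tau) = (c * tau + i < n + 1 - x) by lia.
    by congr (_ && (nth 0 W _ == _)); lia.
  by split; rewrite // -?B4 // => i hi; rewrite -(addnS (c * tau)); apply: r4.
elim: b => [|b IHb] hb.
  have [l1 l2] := D_lip hny; have eS : n - y = (n - y.+1).+1 by lia.
  apply: and3_impl (step 0 (Dv x (n - y.+1) + 1 - Dv x (n - y.+1).+1) hb _ _ _).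
  - by lia.
  - by rewrite mul0n !vf0 eS; lia.
  - by rewrite {1}/TT m_eq; [rewrite /= x0 -!/(TT _ _ _ _) subSS subn0 (addn1 (n - y.+1))|inr].
have hb' : b < NB by lia.
have [_ _ /(_ isT)[k1 k2]] := IHb hb'.
apply: and3_impl (step b.+1 (TT 21 x y.+1 b %% 4) hb k1 _ _).
- by have -> : b.+1 * tau = b * tau + tau by rewrite mulSn addnC.
- by rewrite {1}/TT m_eq; [rewrite /= x0 -!/(TT _ _ _ _) !subSS !subn0|inr].
Qed.

Lemma col_sums s b i : s <= n -> b < NB -> i <= tau ->
  vf x (b * tau) s + dsum (TT 21 x s b %/ 4) i = vf x (b * tau + i) s + i.
Proof.
move=> hs hb hi; have [_ h _] := RR_spec hs hb.
have := @dsum_tel (fun a => vf x (b * tau + a) s) (TT 21 x s b %/ 4) i.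
by rewrite addn0; apply=> a ha; rewrite (addnS (b * tau)); have [] := h a ltac:(lia).
Qed.

Lemma BS_spec y b : y <= n -> b < NB -> TT 22 x y b = vf x (b * tau) y.
Proof.
have x0 := x_neq0 hx; have [s1 s2 _ s4 _] := S_facts.
move=> hy hb; have hbt : b * tau <= 2 * S + tau.
  apply: (@leq_trans ((k %/ tau + 1) * tau)); first by rewrite leq_mul2r; lia.
  by rewrite mulnDl mul1n; have := leq_divM k tau; lia.
have small u : u <= n -> vf x (b * tau) u <= S * S.
  move=> hu; apply: leq_trans (vf_le _ _ _) _.
  have h1 := @D_lt (n - u) (leq_subr _ _); have h2 : 1000 * S <= S * S by rewrite leq_mul2r s1 orbT.
  by lia.
elim: y hy => [|y IH] hy.
  have e : TT 22 x 0 b = (if b == 0 then Dv x (n - 0) else Dv x n + b * tau) %% M.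
    by rewrite {1}/TT m_eq; [rewrite /= x0 -!/(TT _ _ _ _)|inr].
  rewrite e; have := small 0 hy; rewrite vf_col0 subn0 => h.
  by case: eqP => [->|_]; rewrite ?mul0n ?addn0 modS1 //; have := D_lt (leqnn n); nia.
have e : TT 22 x y.+1 b = (if b == 0 then Dv x (n - y.+1) else
    TT 22 x y b + TT 21 x y.+1 (b - 1) %% 4 - 1) %% M.
  by rewrite {1}/TT m_eq; [rewrite /= x0 -!/(TT _ _ _ _) subSS subn0|inr].
rewrite e IH; last exact: ltnW.
have := small y.+1 hy; case: b hb {e IH hbt small} => [|b] hb h; first by rewrite mul0n vf0 modS1 // -vf0.
have hb' : b < NB by lia.
have [_ _ /(_ isT)[k1 k2]] := RR_spec hy hb'; rewrite subSS subn0 /=.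
have eb : b.+1 * tau = b * tau + tau by rewrite mulSn addnC.
have -> : vf x (b.+1 * tau) y + TT 21 x y.+1 b %% 4 - 1 = vf x (b.+1 * tau) y.+1.
  by rewrite eb /= in k2 *; lia.
exact: modS1.
Qed.

Lemma val_spec y d : y %/ tau < NB -> d <= n ->
  TT 22 x d (y %/ tau) + TT 2 tau (TT 21 x d (y %/ tau) %/ 4) (2 ^ (y %% tau)) %/ S - tau =
  vf x y d.
Proof.
move=> hy hd; have hi : y %% tau < tau by rewrite ltn_pmod.
have [h1 _ _] := RR_spec hd hy; rewrite MP_single // BS_spec //.
by have := col_sums hd hy (ltnW hi); rewrite -divn_eq; lia.
Qed.

Lemma VV_spec y : y <= n -> TT 23 x y 0 = vf x k y.
Proof.
move=> hy; have hw := word_lt (leqnn k); have hr : k %% tau <= tau by rewrite ltnW // ltn_pmod.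
rewrite -val_spec // {1}/TT m_eq; last by inr.
rewrite /= (x_neq0 hx) subKn // -!/(TT _ _ _ _) PW_val // modS //.
rewrite val_spec //; apply: leq_trans (vf_le _ _ _) _.
by have := @D_lt (n - y) (leq_subr _ _); lia.
Qed.

(** All strings of [T x] start with the same [k] letters, so each row puts one and the same letter
    in front of every string. *)
Lemma vf_exact : exact W (T W k Sk x) (drop k) (Dv x) ->
  forall y, y <= k -> exact W (T W k Sk x) (fun u => drop (k - y) u) (fun j => vf x y (n - j)).
Proof.
move=> hD; have hx' : x <= n - k + 1 by lia.
elim=> [|y IH] hy.
  by apply: exact_ext hD => [s hs|u _]; rewrite ?vf0 ?subKn ?subn0.
apply: (exact_cons k_gt1 kn (c := nth 0 W (n - x - y)) (IH (ltnW hy))).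
- move=> u hu; have eu := T_pat hx' hu; have hs := size_pat k_gt1 kn hx.
  have hsu : k <= size u by rewrite eu size_cat hs leq_addr.
  have eS : k - y = (k - y.+1).+1 by lia.
  rewrite eS (drop_nth 0); last by lia.
  congr (_ :: _); rewrite eu nth_cat hs; have -> : k - y.+1 < k by lia.
  rewrite /pat /window nth_take; last by lia.
  by rewrite nth_drop /qpos (x_neq0 hx); congr nth; lia.
- by rewrite subnn vfS0.
move=> j hj; have -> : n - j = (n - j.+1).+1 by lia.
rewrite vfSS /letter_eq; have -> : y < n + 1 - x by lia.
have -> : n - (n - j.+1).+1 = j by lia.
by rewrite !addn1 /=; case: eqP.
Qed.
End Columns.

(** * Induction over the stages *)

Hypothesis W_pos : forall x, x \in W -> 0 < x.

(** In [st_le] each stage adds at most [k + 1], for the letters of its pattern and one #; this keeps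
    all values below [S]. *)
Record stage (x : nat) : Prop := Stage {
  st_V : exact W (T W k Sk x) id (V x);
  st_le : forall j, j <= n -> V x j <= n + x * (k + 1) + k;
  st_VV : forall y, y <= k ->
    exact W (T W k Sk x) (fun u => drop (k - y) u) (VV x y);
  st_D : 0 < x -> exact W (T W k Sk x) (drop k) (Dv x);
  st_Dlt : 0 < x -> forall j, j <= n -> Dv x j + k < S;
  st_code : forall y b, y <= n -> b < NB -> TT 21 x y b %/ 4 < B * B;
  st_sum : 0 < x -> forall s b i, s <= n -> b < NB -> i <= tau ->
    TT 22 x (n - s) b + dsum (TT 21 x (n - s) b %/ 4) i = VV x (b * tau + i) s + i
}.

Lemma stage_lt x : x <= n - k + 1 -> n + x * (k + 1) + k + k + 2 < S.
Proof.
move=> hx; apply: S_big; have h : x * (k + 1) <= (n + 1) * (n + 1) by apply: leq_mul; lia.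
by have h2 : n + 1 <= (n + 1) * (n + 1); [rewrite leq_pmulr; lia|lia].
Qed.

Lemma V_small x j : x <= n - k + 1 -> stage x -> j <= n -> V x j + 1 < S.
Proof. by move=> hx hs hj; have := st_le hs hj; have := stage_lt hx; lia. Qed.

Lemma stage_V x j : x <= n - k + 1 -> stage x -> j <= n -> VV x k j = V x j.
Proof.
move=> hx hs hj; have h := st_VV hs (leqnn k).
have h' : exact W (T W k Sk x) id (VV x k).
  by apply: exact_ext h => [s _|u _]; rewrite ?subnn ?drop0.
exact: (exact_eq k_gt1 kn h' (st_V hs) hj).
Qed.

Lemma stage0 : stage 0.
Proof.
have [s1 s2 s3 _ _] := S_facts.
have v0 j : j <= n -> V 0 j = n - j.
  move=> hj; rewrite /V /TT m_eq; last by inr.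
  by rewrite /= modS //; lia.
have ex g F : (forall u, u = [::] -> g u = [::]) -> (forall s, s <= n -> F s = n - s) ->
    exact W (T W k Sk 0) g F.
  move=> hg hF s hs; rewrite hF // /T eqxx; split=> [u hu|].
    by rewrite hg // lev0s size_drop.
  by exists [::] => //; rewrite hg // lev0s size_drop.
split=> //.
- by apply: ex.
- by move=> j hj; rewrite v0 //; lia.
- by move=> y hy; apply: ex => [u ->|].
- move=> y b hy hb; rewrite {1}/TT m_eq; last by inr.
  by rewrite /= mod0n div0n muln_gt0 !B_gt0.
Qed.

Lemma stage_step x : 0 < x <= n - k + 1 -> stage (prev x) -> stage x.
Proof.
move=> hx hs; have hX := X_le hx; have hlt := X_lt hx; set X := prev x in hs hX hlt *.
have eX : pvs W k Sk x = X by rewrite /X prevE //; lia.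
have Vs j : j <= n -> V X j + 1 < S by apply: V_small.
have col0 y b : y <= n -> b < NB -> TT 21 X y b %/ 4 < B * B by exact: (st_code hs).
have [d1 d2 d3 d4 d5] := D_props hx (st_V hs) Vs col0 (st_sum hs).
have [p1 p2 p3 p4] := K_props hX (st_V hs) Vs.
have hK := K_ex hX (st_V hs) Vs W_pos.
have VkE j : j <= n -> VV X k j = V X j by apply: stage_V.
have hD : exact W (T W k Sk x) (drop k) (Dv x).
  apply: (@D_exact W k k_gt1 kn W_pos Sk x (VV X) (Dv x) (K X) (fb x) hx).
  - by move=> y hy; rewrite eX; apply: (st_VV hs).
  - by rewrite eX.
  - move=> j hj; rewrite eX; case: (p4 j hj) => [[l [[h1 h2 h3] h4 _]]|[l [h1 h2 h3 _]]|[h1 h2 _]].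
    + by apply: Or31; exists l; rewrite VkE.
    + by apply: Or32; exists l; rewrite VkE.
    + exact: Or33.
  - exact: fb_gt0.
  - exact: fok_fb.
  - by move=> s d h1 h2 h3; apply: d1.
  - by move=> s l h1 h2; rewrite VkE //; apply: d2.
  - by move=> s l h1 h2; rewrite VkE //; apply: d3.
  - exact: d4.
  move=> s hs'; case: (d5 s hs') => [[d [h1 h2 h3 _]]|[l [h1 h2 h3 _]]|[l [h1 h2 h3 _]]|[h1 h2 _]].
  - by apply: Or41; exists d.
  - by apply: Or42; exists l; rewrite VkE.
  - by apply: Or43; exists l; rewrite VkE.
  - exact: Or44.
have Dle j : j <= n -> Dv x j <= n + x * (k + 1).
  move=> hj; have := @d3 j 0; rewrite addn0 => /(_ hj) h.
  have {}h : Dv x j <= (V X j).+1 by apply: h; have := fb_gt0 hx hj; lia.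
  have h2 := st_le hs hj; have h3 : X.+1 * (k + 1) <= x * (k + 1) by rewrite leq_mul2r; lia.
  by move: h3; rewrite mulSn; lia.
have Dlt j : j <= n -> Dv x j + k < S.
  by move=> hj; have := Dle j hj; have := @stage_lt x ltac:(lia); lia.
have Dlip j : j < n -> Dv x j <= (Dv x j.+1).+1 /\ Dv x j.+1 <= (Dv x j).+1.
  by move=> hj; apply: (exact_lip k_gt1 kn hD hj).
have x0 := x_neq0 hx.
have eV j : j <= n -> V x j = vf x k (n - j).
  by move=> hj; rewrite /V VV_spec // leq_subr.
have hvf := vf_exact hx hD.
split=> //.
- apply: exact_ext (hvf k (leqnn k)) => [s hs'|u _]; first exact: eV.
  by rewrite subnn drop0.
- move=> j hj; rewrite eV //; apply: leq_trans (vf_le _ _ _) _.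
  by rewrite subKn //; have := Dle j hj; lia.
- by move=> y hy; rewrite /VV x0; apply: hvf.
- by move=> y b hy hb; case: (RR_spec hx Dlip hy hb).
- move=> _ s b i hs' hb hi; rewrite /VV x0 BS_spec // ?leq_subr //.
  by apply: col_sums => //; apply: leq_subr.
Qed.

Lemma stages x : x <= n - k + 1 -> stage x.
Proof.
elim/ltn_ind: x => x IH hx; case: (posnP x) => [->|x0]; first exact: stage0.
have hx' : 0 < x <= n - k + 1 by rewrite x0.
by apply: (stage_step hx'); apply: IH; [apply: X_lt|apply: X_le].
Qed.

Lemma val_table x y d : 0 < x <= n - k + 1 -> y %/ tau < NB -> d <= n ->
  TT 22 x d (y %/ tau) + TT 2 tau (TT 21 x d (y %/ tau) %/ 4) (2 ^ (y %% tau)) %/ S - tau =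
  vf x y d.
Proof.
move=> hx hy hd; have hx' : x <= n - k + 1 by lia.
have hs := stages hx'; have x0 : 0 < x by lia.
apply: val_spec => // j hj; first exact: (exact_lip k_gt1 kn (st_D hs x0) hj).
exact: (st_Dlt hs x0).
Qed.

(** ** The trace *)

Hypothesis W_lt : forall i, nth 0 W i < M.
Local Notation N := (steps n k).
Local Notation x_ u := (TT 29 u 0 0).
Local Notation y_ u := (TT 30 u 0 0).
Local Notation j_ u := (TT 31 u 0 0).
Local Notation o_ u := (TT 32 u 0 0).
Local Notation v_ u i := (TT 33 u i 0).
Local Notation a_ u := (TT 34 u 0 0).
Local Notation l_ u := (TT 35 u 0 0).

Lemma steps_S : N <= S.
Proof.
apply: S_big; rewrite /steps; apply: (@leq_trans ((2 * (n + 1)) * (4 * (n + 1)))).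
  by apply: leq_mul; lia.
by rewrite mulnACA.
Qed.

Lemma small_mod v : v <= 1000 -> v %% M = v.
Proof. by move=> h; apply: modS; case: S_facts; lia. Qed.

Definition action (X Y J v0 v1 v2 : nat) : nat :=
  let body :=
    if Y == 0 then 1 else
    if Y < k + 1 then
      (if J < n then (if v0 == v1 + 1 then 3 else
        if v0 == v2 + (if TT 0 0 0 (n + 1 - (X + Y)) == TT 0 0 0 J then 0 else 1) then 4
        else 5) else 5) else
    if Y < 2 * k + 1 then 6 else
    if Y == 2 * k + 1 then 2 else
    if Y == 3 * k then 8 else
    if Y == 3 * k + 1 then 7 else 6 in
  if X == 0 then (if Y == k then 0 else body) else body.

Lemma action_le X Y J v0 v1 v2 : action X Y J v0 v1 v2 <= 1000.
Proof. by rewrite /action; do ?[case: ifP => _ //]. Qed.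

Lemma a_eq u : u <= N -> a_ u = action (x_ u) (y_ u) (j_ u) (v_ u 0) (v_ u 1) (v_ u 2).
Proof.
move=> hu; rewrite {1}/TT m_eq; last by inr.
rewrite -[RHS]small_mod; first by [].
exact: action_le.
Qed.

Lemma x_eq u : u < N -> x_ u.+1 = (if a_ u == 1 then prev (x_ u) else x_ u) %% M.
Proof. by move=> hu; rewrite {1}/TT m_eq; [rewrite /= subn1|inr]. Qed.

Lemma y_eq u : u < N -> y_ u.+1 =
  (if a_ u == 1 then TT 20 (x_ u) (j_ u) NB %% S else
   if a_ u == 2 then TT 28 (x_ u) (n - j_ u) NB %% S else
   if a_ u < 4 then y_ u else if a_ u < 7 then y_ u - 1 else 2 * k + 1) %% M.
Proof. by move=> hu; rewrite {1}/TT m_eq; [rewrite /= subn1|inr]. Qed.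

Lemma j_eq u : u < N -> j_ u.+1 = (if a_ u < 3 then j_ u else
  if a_ u == 5 then j_ u else if a_ u == 8 then j_ u else j_ u + 1) %% M.
Proof. by move=> hu; rewrite {1}/TT m_eq; [rewrite /= subn1|inr]. Qed.

Lemma o_le u : u <= N -> o_ u <= u.
Proof.
elim: u => [|u IH] hu; rewrite {1}/TT m_eq; try by inr.
  by rewrite /= small_mod.
rewrite /= subn1 /=; apply: leq_trans (leq_mod _ _) _; have := IH (ltnW hu).
by rewrite /tTA /tTO -!/(TT _ _ _ _); case: ifP => _; lia.
Qed.

Lemma o_eq u : u < N -> o_ u.+1 = o_ u + (4 <= a_ u).
Proof.
move=> hu; rewrite {1}/TT m_eq; last by inr.
rewrite /= subn1 /= /tTA /tTO -!/(TT _ _ _ _); have h := o_le (ltnW hu); have hS := steps_S.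
by case: (ltnP (a_ u) 4) => _; rewrite ?addn0 modS //; lia.
Qed.

Lemma o0 : o_ 0 = 0.
Proof. by rewrite {1}/TT m_eq; [rewrite /= small_mod|inr]. Qed.

Lemma l_eq u : u <= N -> l_ u = (if a_ u < 4 then 0 else
  if a_ u < 6 then TT 0 0 0 (n + 1 - (x_ u + y_ u)) else
  if a_ u == 6 then TT 0 0 0 (j_ u) else 0) %% M.
Proof. by move=> hu; rewrite {1}/TT m_eq; [|inr]. Qed.

Lemma letter_W i : i < n -> TT 0 0 0 i %% M = nth 0 W i.
Proof. by move=> h; rewrite TT_W // modn_small. Qed.

Lemma v_eq u i : u <= N -> i < 3 -> 0 < x_ u <= n - k + 1 -> y_ u <= k -> j_ u < n ->
  v_ u i = VV (x_ u) (y_ u - (1 < i)) (j_ u + (0 < i)).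
Proof.
move=> hu hi hx hy hj; have hx' : x_ u <= n - k + 1 by lia.
have x0 : 0 < x_ u by lia.
have e : v_ u i = vf (x_ u) (y_ u - (1 < i)) (n - (j_ u + (0 < i))) %% M.
  rewrite {1}/TT m_eq; last by inr.
  rewrite -val_table //; [|by apply: word_lt; lia|by lia].
  have pw y : TT 1 0 0 (y %% tau) = 2 ^ (y %% tau) by rewrite PW_val // ltnW // ltn_pmod.
  by case: i hi => [|[|[|i]]] // _; rewrite -pw /= ?subn0 ?addn0.
rewrite e /VV (x_neq0 hx) modS //; apply: leq_trans (vf_le _ _ _) _.
have := st_Dlt (stages hx') x0 (leq_subr (n - (j_ u + (0 < i))) n); lia.
Qed.

Lemma stage_D x : 0 < x <= n - k + 1 -> forall s, s <= n ->
  [\/ exists d, [/\ 0 < d < k, ovl W k Sk x d, Dv x s = VV (prev x) d s & Dc x s = d],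
      exists l, [/\ s + l <= n, dir W k Sk x s l, Dv x s = V (prev x) (s + l) &
        Dc x s = k + l],
      exists l, [/\ s + l <= n, l < fb x s, Dv x s = (V (prev x) (s + l)).+1 &
        Dc x s = 3 * k + l] |
      [/\ s + fb x s <= n, Dv x s = (K (prev x) (s + fb x s)).+1 &
        Dc x s = 3 * k + fb x s]].
Proof.
move=> hx; have hX := X_le hx; have hs := stages hX.
have Vs j : j <= n -> V (prev x) j + 1 < S by apply: V_small.
by have [_ _ _ _] := D_props hx (st_V hs) Vs (st_code hs) (st_sum hs).
Qed.

Lemma stage_K x : x <= n - k + 1 -> forall j, j <= n ->
  [\/ exists l, [/\ [/\ j + l <= n, l < k & bok W k x j l], K x j = V x (j + l) &
        Kc x j = k + l],
      exists l, [/\ j + 1 + l <= n, l < k, K x j = (V x (j + 1 + l)).+1 &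
        Kc x j = 3 * k + 1 + l] |
      [/\ j + k <= n, K x j = (K x (j + k)).+1 & Kc x j = 4 * k]].
Proof.
move=> hx; have hs := stages hx.
have Vs j : j <= n -> V x j + 1 < S by apply: V_small.
by have [_ _ _] := K_props hx (st_V hs) Vs.
Qed.

Lemma K_le_V x j : x <= n - k + 1 -> j <= n -> K x j <= V x j.
Proof.
move=> hx hj; have hs := stages hx.
have Vs i : i <= n -> V x i + 1 < S by apply: V_small.
have [p1 _ _ _] := K_props hx (st_V hs) Vs.
have := @p1 j 0; rewrite addn0; apply=> //; first by lia.
by rewrite /bok /factor take0.
Qed.

Lemma T_letter x y u : 0 < x <= n - k + 1 -> 0 < y <= k -> T W k Sk x u ->
  drop (k - y) u = nth 0 W (n + 1 - (x + y)) :: drop (k - (y - 1)) u.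
Proof.
move=> hx hy hu; have hx' : x <= n - k + 1 by lia.
have eu := T_pat hx' hu; have hs := size_pat k_gt1 kn hx.
have hsu : k <= size u by rewrite eu size_cat hs leq_addr.
have eS : k - (y - 1) = (k - y).+1 by lia.
rewrite eS (drop_nth 0); last by lia.
congr (_ :: _); rewrite eu nth_cat hs; have -> : k - y < k by lia.
rewrite /pat /window nth_take; last by lia.
by rewrite nth_drop /qpos (x_neq0 hx); congr nth; lia.
Qed.

(** The part of the output emitted from step [u] on; steps with an action below 4 emit nothing. *)
Definition rest (u : nat) : seq nat := [seq l_ v | v <- iota u (N - u) & 4 <= a_ v].

Lemma restS u : u < N -> rest u = (if 4 <= a_ u then [:: l_ u] else [::]) ++ rest u.+1.
Proof.
by move=> h; rewrite /rest (_ : N - u = (N - u.+1).+1) /=; [case: ifP|lia].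
Qed.

(** A potential that drops in every step until the trace halts. The factor 2 pays for a # that
    consumes a letter and raises the last summand from k to k + 1; [k + 3] pays for entering a new
    stage, where that summand is at most k + 2. *)
Definition remaining (X Y J : nat) : nat := 2 * (n - J) + (k + 3) * X +
  (if Y <= k then Y else if Y == 2 * k + 1 then k + 1 else if Y == 3 * k then k + 2 else k).

(** The states a trace can meet, with enough of W left for the letters still to be copied. Stage 0
    with [Y = k] is the halting state: only the empty pattern remains. *)
Definition live (X Y J : nat) : Prop := [/\ X <= n - k + 1, J <= n &
  [|| (Y <= k) && ((0 < X) || (Y == k)), (k < Y <= 2 * k) && (J + (Y - k) <= n),
      Y == 2 * k + 1, Y == 3 * k | (3 * k < Y <= 4 * k) && (J + (Y - 3 * k) <= n)]].

(** What the letters still to be emitted must achieve in each state: [Y <= k] letters of the pattern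
    remain; [Y - k] letters are copied before the whole pattern; the choice in front of a pattern is
    open; or a # follows, after some copied letters. *)
Definition good (X Y J : nat) (o : seq nat) : Prop :=
  if Y <= k then exists2 u, T W k Sk X u &
    o = drop (k - Y) u /\ lev o (drop J W) <= VV X Y J
  else if Y <= 2 * k then exists2 u, T W k Sk X u &
    o = factor W J (Y - k) ++ u /\ lev u (drop (J + (Y - k)) W) <= V X (J + (Y - k))
  else if Y == 2 * k + 1 then Az W k Sk X o /\ lev o (drop J W) <= K X J
  else exists2 z, Az W k Sk X z & o = factor W J (Y - 3 * k).-1 ++ hash :: z /\
    lev z (drop (J + (Y - 3 * k)) W) <= K X (J + (Y - 3 * k)).

Definition letters (o : seq nat) : Prop := forall c, c \in o -> c \in W \/ c = hash.

Lemma letters_cons i o : letters o -> letters (nth 0 W i :: o).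
Proof.
move=> h c; rewrite inE => /orP[/eqP->|/h//].
by case: (ltnP i n) => hi; [left; apply: mem_nth|right; rewrite nth_default].
Qed.

Lemma good_copy X J l o : X <= n - k + 1 -> l <= k -> J + l <= n -> good X (k + l) J o ->
  exists2 u, T W k Sk X u &
    o = factor W J l ++ u /\ lev u (drop (J + l) W) <= V X (J + l).
Proof.
move=> hX hl hJ; rewrite /good; case: (posnP l) => [->|l0].
  rewrite !addn0 leqnn subnn => -[u hu]; rewrite drop0 => -[-> h].
  have eV := stage_V hX (stages hX) (leq_trans (leq_addr l J) hJ).
  by exists u => //; rewrite /factor take0 -eV.
have -> : (k + l <= k) = false by lia.
by have -> : k + l <= 2 * k; [lia|rewrite addKn].
Qed.

Lemma good_hash X J l o : good X (3 * k + l) J o ->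
  exists2 z, Az W k Sk X z & o = factor W J l.-1 ++ hash :: z /\
    lev z (drop (J + l) W) <= K X (J + l).
Proof.
rewrite /good; have -> : (3 * k + l <= k) = false by lia.
have -> : (3 * k + l <= 2 * k) = false by lia.
have -> : (3 * k + l == 2 * k + 1) = false by lia.
by rewrite addKn.
Qed.

Lemma drop_factor J l : drop J W = factor W J l ++ drop (J + l) W.
Proof. by rewrite /factor addnC -drop_drop cat_take_drop. Qed.

Lemma lev_copy J l u : lev (factor W J l ++ u) (drop J W) <= lev u (drop (J + l) W).
Proof. by rewrite (drop_factor J l) lev_same. Qed.

Lemma lev_hash J l z : J + l <= n ->
  lev (factor W J l.-1 ++ hash :: z) (drop J W) <= (lev z (drop (J + l) W)).+1.
Proof.
case: l => [|l] hJ; first by rewrite /factor take0 addn0 lev_insl.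
apply: leq_trans (lev_copy _ _ _) _ => /=; rewrite (drop_nth 0); last by lia.
by rewrite addnS; apply: leq_trans (lev_match _ _ _ _) _; case: (_ != _); lia.
Qed.

Lemma action0 X Y J a b c : X = 0 -> Y = k -> action X Y J a b c = 0.
Proof. by move=> -> ->; rewrite /action !eqxx. Qed.
Lemma action1 X Y J a b c : 0 < X -> Y = 0 -> action X Y J a b c = 1.
Proof. by rewrite /action => h ->; case: eqP => //; lia. Qed.
Lemma action2 X Y J a b c : Y = 2 * k + 1 -> action X Y J a b c = 2.
Proof. by rewrite /action => ->; do !case: ifP => //; lia. Qed.
Lemma action6 X Y J a b c : (k < Y <= 2 * k) || (3 * k + 1 < Y) -> action X Y J a b c = 6.
Proof. by rewrite /action => h; do !case: ifP => //; lia. Qed.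
Lemma action7 X Y J a b c : Y = 3 * k + 1 -> action X Y J a b c = 7.
Proof. by rewrite /action => ->; do !case: ifP => //; lia. Qed.
Lemma action8 X Y J a b c : Y = 3 * k -> action X Y J a b c = 8.
Proof. by rewrite /action => ->; do !case: ifP => //; lia. Qed.
Lemma action345 X Y J a b c : 0 < X -> 0 < Y <= k -> action X Y J a b c =
  if J < n then (if a == b + 1 then 3 else
    if a == c + (if TT 0 0 0 (n + 1 - (X + Y)) == TT 0 0 0 J then 0 else 1) then 4 else 5)
  else 5.
Proof.
move=> hX hY; rewrite /action; have -> : (X == 0) = false by lia.
have -> : (Y == 0) = false by lia.
by have -> : Y < k + 1 by lia.
Qed.

Lemma halted u v : x_ u = 0 -> y_ u = k -> j_ u <= n -> u <= v -> v <= N ->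
  [/\ a_ v = 0, x_ v = 0, y_ v = k & j_ v <= n].
Proof.
move=> h1 h2 h3; elim: v => [|v IH] huv hv.
  have e : u = 0 by lia.
  by move: h1 h2 h3; rewrite e => h1 h2 h3; rewrite a_eq // action0.
case: (u =P v.+1) => [e|ne].
  by move: h1 h2 h3; rewrite e => h1 h2 h3; rewrite a_eq // action0.
have [a0 e1 e2 e3] : [/\ a_ v = 0, x_ v = 0, y_ v = k & j_ v <= n] by apply: IH; lia.
have [s1 s2 _ _ _] := S_facts.
have e1' : x_ v.+1 = 0 by rewrite x_eq // a0 /= e1 mod0n.
have e2' : y_ v.+1 = k by rewrite y_eq // a0 /= e2 modS //; lia.
by rewrite a_eq // action0 //; split=> //; rewrite j_eq // a0 /= modS //; lia.
Qed.

Lemma halted_rest u : x_ u = 0 -> y_ u = k -> j_ u <= n -> rest u = [::].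
Proof.
move=> h1 h2 h3; rewrite /rest (@eq_in_filter _ _ pred0) ?filter_pred0 // => v.
rewrite mem_iota => hv /=; have [||-> //] := @halted u v h1 h2 h3; lia.
Qed.

Lemma step_D u : u < N -> a_ u = 1 -> x_ u <= n - k + 1 -> j_ u <= n ->
  Dc (x_ u) (j_ u) <= S ->
  [/\ x_ u.+1 = prev (x_ u), y_ u.+1 = Dc (x_ u) (j_ u), j_ u.+1 = j_ u & rest u = rest u.+1].
Proof.
move=> hu ha hx hj hD; have [s1 s2 _ _ _] := S_facts.
rewrite x_eq // y_eq // j_eq // restS // ha /= !modS //; try lia.
by apply: leq_trans (leq_subr _ _) _; lia.
Qed.

Lemma step_K u : u < N -> a_ u = 2 -> x_ u <= n - k + 1 -> j_ u <= n ->
  Kc (x_ u) (j_ u) <= S ->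
  [/\ x_ u.+1 = x_ u, y_ u.+1 = Kc (x_ u) (j_ u), j_ u.+1 = j_ u & rest u = rest u.+1].
Proof.
move=> hu ha hx hj hD; have [s1 s2 _ _ _] := S_facts.
by rewrite x_eq // y_eq // j_eq // restS // ha /= !modS //; lia.
Qed.

Lemma step_del u : u < N -> a_ u = 3 -> x_ u <= n - k + 1 -> j_ u < n -> y_ u <= 4 * k ->
  [/\ x_ u.+1 = x_ u, y_ u.+1 = y_ u, j_ u.+1 = (j_ u).+1 & rest u = rest u.+1].
Proof.
move=> hu ha hx hj hy; have [s1 s2 _ _ _] := S_facts; have s6 := code_S.
by rewrite x_eq // y_eq // j_eq // restS // ha /= !modS ?addn1 //; lia.
Qed.

Lemma step_letter u (b : bool) : u < N -> a_ u = (if b then 4 else 5) ->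
  0 < x_ u <= n - k + 1 -> j_ u < n + ~~ b -> 0 < y_ u <= k ->
  [/\ x_ u.+1 = x_ u, y_ u.+1 = y_ u - 1, j_ u.+1 = j_ u + b &
      rest u = nth 0 W (n + 1 - (x_ u + y_ u)) :: rest u.+1].
Proof.
move=> hu ha hx hj hy; have [s1 s2 _ _ _] := S_facts.
rewrite x_eq // y_eq // j_eq // restS // l_eq; last by lia.
by case: b ha hj => -> /= hj; rewrite letter_W ?modS ?addn0 //; lia.
Qed.

Lemma step_copy u : u < N -> a_ u = 6 -> x_ u <= n - k + 1 -> j_ u < n -> y_ u <= 4 * k ->
  [/\ x_ u.+1 = x_ u, y_ u.+1 = y_ u - 1, j_ u.+1 = (j_ u).+1 &
      rest u = nth 0 W (j_ u) :: rest u.+1].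
Proof.
move=> hu ha hx hj hy; have [s1 s2 _ _ _] := S_facts; have s6 := code_S.
rewrite x_eq // y_eq // j_eq // restS // l_eq; last by lia.
by rewrite ha /= letter_W ?modS ?addn1 //; lia.
Qed.

Lemma step_hash u (b : bool) : u < N -> a_ u = (if b then 7 else 8) ->
  x_ u <= n - k + 1 -> j_ u < n + ~~ b ->
  [/\ x_ u.+1 = x_ u, y_ u.+1 = 2 * k + 1, j_ u.+1 = j_ u + b & rest u = hash :: rest u.+1].
Proof.
move=> hu ha hx hj; have [s1 s2 _ _ _] := S_facts; have s6 := code_S.
rewrite x_eq // y_eq // j_eq // restS // l_eq; last by lia.
by case: b ha hj => -> /= hj; rewrite mod0n ?modS ?addn0 //; lia.
Qed.

Lemma K_code x j : x <= n - k + 1 -> j <= n -> Kc x j <= S.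
Proof.
by move=> hx hj; have := code_S; case: (stage_K hx hj) => [[l [[_ h _] _ ->]]|[l [_ h _ ->]]|[_ _ ->]]; lia.
Qed.

Lemma D_code x j : 0 < x <= n - k + 1 -> j <= n -> Dc x j <= S.
Proof.
move=> hx hj; have hc := code_S; have hf := fb_le hx hj.
case: (stage_D hx hj) => [[l [h _ _ ->]]|[l [h1 h2 _ ->]]|[l [_ h _ ->]]|[_ _ ->]]; try lia.
by have := dir_lt h1 h2; lia.
Qed.

Lemma good_copyV X Y J o : X <= n - k + 1 -> k < Y <= 2 * k -> J + (Y - k) <= n ->
  good X (Y - 1) J.+1 o -> good X Y J (nth 0 W J :: o).
Proof.
move=> hX hY hJ h; have e : Y - 1 = k + (Y - 1 - k) by lia.
rewrite e in h; have [|||z hz [e1 e2]] := good_copy _ _ _ h; try lia.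
rewrite /good; have -> : (Y <= k) = false by lia.
have -> : Y <= 2 * k by lia.
exists z => //; have eS : Y - k = (Y - 1 - k).+1 by lia.
rewrite eS sub_cons ?e1; last by lia.
by rewrite -addSnnS.
Qed.

Lemma good_tail X Y J o : 3 * k <= Y -> good X Y J o = exists2 z, Az W k Sk X z &
  o = factor W J (Y - 3 * k).-1 ++ hash :: z /\
  lev z (drop (J + (Y - 3 * k)) W) <= K X (J + (Y - 3 * k)).
Proof.
move=> hY; rewrite /good; have -> : (Y <= k) = false by lia.
have -> : (Y <= 2 * k) = false by lia.
by have -> : (Y == 2 * k + 1) = false by lia.
Qed.

Lemma good_mid X J o : good X (2 * k + 1) J o = (Az W k Sk X o /\ lev o (drop J W) <= K X J).
Proof.
rewrite /good eqxx; have -> : (2 * k + 1 <= k) = false by lia.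
by have -> : (2 * k + 1 <= 2 * k) = false by lia.
Qed.

Lemma good_copyK X Y J o : 3 * k + 1 < Y -> J + (Y - 3 * k) <= n ->
  good X (Y - 1) J.+1 o -> good X Y J (nth 0 W J :: o).
Proof.
move=> hY hJ; rewrite !good_tail; try lia.
case=> z hz [e1 e2]; exists z => //.
have eS : (Y - 3 * k).-1 = (Y - 1 - 3 * k).-1.+1 by lia.
rewrite eS sub_cons ?e1; last by lia.
by split=> //; have -> : J + (Y - 3 * k) = J.+1 + (Y - 1 - 3 * k) by lia.
Qed.

Lemma good_enter X J (b : bool) o : good X (2 * k + 1) (J + b) o ->
  good X (3 * k + b) J (hash :: o).
Proof.
rewrite good_mid good_tail ?leq_addr // => -[h1 h2]; exists o => //.
by rewrite addKn; case: b h1 h2 => h1 h2; rewrite /factor take0.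
Qed.

Lemma good_K X J o : X <= n - k + 1 -> J <= n -> good X (Kc X J) J o ->
  good X (2 * k + 1) J o.
Proof.
move=> hX hJ; rewrite good_mid.
case: (stage_K hX hJ) => [[l [[h1 h2 h3] h4 ->]]|[l [h1 h2 h3 ->]]|[h1 h3 ->]] h.
- have [|||z hz [-> e2]] := good_copy _ _ _ h; try lia.
  by rewrite h4; split; [exact: comp_bok|exact: leq_trans (lev_copy _ _ _) e2].
- rewrite -addnA add1n in h; have [z hz [-> e2]] := good_hash h.
  rewrite h3; split; first exact: comp_bhash.
  rewrite -addnA add1n in h1 *; apply: leq_trans (lev_hash _ h1) _; rewrite ltnS.
  exact: leq_trans e2 (K_le_V hX h1).
have e : 4 * k = 3 * k + k by lia.
rewrite e in h; have [z hz [-> e2]] := good_hash h.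
rewrite h3; split; first by apply: comp_bhash => //; lia.
by apply: leq_trans (lev_hash _ h1) _; rewrite ltnS.
Qed.

Lemma ovl_pos x d : 0 < x <= n - k + 1 -> 0 < d < k -> ovl W k Sk x d -> 0 < prev x.
Proof.
move=> hx hd; rewrite prevE; last by lia.
case/andP=> /eqP e _; case: (posnP (pvs W k Sk x)) => // h0; move/(congr1 size): e.
rewrite h0 pat0 cats0 (size_take d) (size_pat k_gt1 kn hx).
by case: (ltnP d k); lia.
Qed.

Lemma good_D X J o : 0 < X <= n - k + 1 -> J <= n -> good (prev X) (Dc X J) J o ->
  good X 0 J o.
Proof.
move=> hx hJ; have hX := X_le hx; have x0 := x_neq0 hx.
have eX : prev X = pvs W k Sk X by rewrite prevE //; lia.
rewrite {2}/good /= subn0 /VV x0 vf0 subKn //.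
(* Both kinds of # have the code 3k + l, and the trace then continues freely; where the pattern was
   to follow at once this is sound because [K] is at most [V]. *)
have hash_case l : l <= fb X J -> J + l <= n ->
    (K (prev X) (J + l)).+1 <= Dv X J -> good (prev X) (3 * k + l) J o ->
    exists2 u, T W k Sk X u & o = drop k u /\ lev o (drop J W) <= Dv X J.
  move=> h1 h2 h3 h; have [z hz [eo e2]] := good_hash h; rewrite eX in hz.
  have hf : fok W k X J l.-1 by rewrite (fok_fb hx) //; have := fb_gt0 hx hJ; lia.
  exists (pat W k X ++ o); first by rewrite eo; apply: comp_hash.
  rewrite drop_size_cat ?(size_pat k_gt1 kn hx) //; split=> //.
  by rewrite eo; apply: leq_trans (lev_hash _ h2) (leq_trans _ h3); rewrite ltnS.
case: (stage_D hx hJ) => [[d [h1 h2 h3 ->]]|[l [h1 h2 h3 ->]]|[l [h1 h2 h3 ->]]|[h1 h3 ->]].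
- rewrite /good; have -> : d <= k by lia.
  case=> u hu [eo e2]; rewrite eX in hu; have [c1 c2] := comp_ovl k_gt1 kn hx h1 h2 hu.
  by exists (take d (pat W k X) ++ u); rewrite // c2 -eo h3.
- move=> h; have hl := dir_lt h1 h2.
  have [|||u hu [eo e2]] := good_copy _ _ _ h => //; first exact: ltnW.
  rewrite eX in hu; exists (pat W k X ++ o); first by rewrite eo; apply: comp_dir.
  rewrite drop_size_cat ?(size_pat k_gt1 kn hx) //; split=> //.
  by rewrite eo h3; apply: leq_trans (lev_copy _ _ _) e2.
- apply: hash_case => //; first exact: ltnW.
  by rewrite h3 ltnS; apply: K_le_V.
- by apply: hash_case => //; rewrite h3.
Qed.

Lemma good_del X Y J o : J < n -> Y <= k -> VV X Y J = VV X Y J.+1 + 1 ->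
  good X Y J.+1 o -> good X Y J o.
Proof.
move=> hJ hY e; rewrite /good hY => -[u hu [e1 e2]]; exists u => //; split=> //.
by rewrite (drop_nth 0 hJ) e addn1; apply: leq_trans (lev_insr _ _ _) _; rewrite ltnS.
Qed.

Lemma good_ins X Y J o : 0 < X <= n - k + 1 -> 0 < Y <= k ->
  VV X Y J = (VV X (Y - 1) J).+1 ->
  good X (Y - 1) J o -> good X Y J (nth 0 W (n + 1 - (X + Y)) :: o).
Proof.
move=> hX hY e; rewrite /good; have -> : Y <= k by lia.
have -> : Y - 1 <= k by lia.
case=> u hu [e1 e2]; exists u => //; rewrite (T_letter hX hY hu) -e1 e; split=> //.
exact: leq_trans (lev_insl _ _ _) _.
Qed.

Lemma good_sub X Y J o : 0 < X <= n - k + 1 -> 0 < Y <= k -> J < n ->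
  VV X Y J = VV X (Y - 1) J.+1 + (nth 0 W (n + 1 - (X + Y)) != nth 0 W J) ->
  good X (Y - 1) J.+1 o -> good X Y J (nth 0 W (n + 1 - (X + Y)) :: o).
Proof.
move=> hX hY hJ e; rewrite /good; have -> : Y <= k by lia.
have -> : Y - 1 <= k by lia.
case=> u hu [e1 e2]; exists u => //; rewrite (T_letter hX hY hu) -e1 e; split=> //.
by rewrite (drop_nth 0 hJ); apply: leq_trans (lev_match _ _ _ _) _; rewrite leq_add2r.
Qed.

Lemma VV_rec X Y J : 0 < X <= n - k + 1 -> 0 < Y <= k -> J < n ->
  VV X Y J = minn (minn (VV X (Y - 1) J + 1) (VV X Y J.+1 + 1))
    (VV X (Y - 1) J.+1 + (nth 0 W (n + 1 - (X + Y)) != nth 0 W J)).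
Proof.
move=> hX hY hJ; rewrite /VV (x_neq0 hX).
have -> : n - J = (n - J.+1).+1 by lia.
have -> : Y = (Y - 1).+1 by lia.
rewrite vfSS subSS subn0 /letter_eq; have -> : Y - 1 < n + 1 - X by lia.
have -> : n - (n - J.+1).+1 = J by lia.
have -> : n - X - (Y - 1) = n + 1 - (X + (Y - 1).+1) by lia.
by rewrite /=; case: eqP.
Qed.

Lemma VV_end X Y : 0 < X <= n - k + 1 -> 0 < Y -> VV X Y n = (VV X (Y - 1) n).+1.
Proof.
by move=> hX; case: Y => // Y _; rewrite /VV (x_neq0 hX) subnn vfS0 subSS subn0.
Qed.

(** Induction on the number of steps left, since [rest] grows at its front: a good remainder after a
    step gives a good one before it. *)
Lemma trace u : u <= N -> live (x_ u) (y_ u) (j_ u) ->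
  u + remaining (x_ u) (y_ u) (j_ u) <= N ->
  letters (rest u) /\ good (x_ u) (y_ u) (j_ u) (rest u).
Proof.
move: {2}(N - u) (erefl (N - u)) => d; elim: d u => [|d IH] u hd hu hl hr.
  have e : remaining (x_ u) (y_ u) (j_ u) = 0 by lia.
  have [_ _] := hl; move: e; rewrite /remaining; do !case: ifP => //; lia.
have huN : u < N by lia.
have {}IH X' Y' J' : x_ u.+1 = X' -> y_ u.+1 = Y' -> j_ u.+1 = J' -> live X' Y' J' ->
    remaining X' Y' J' < remaining (x_ u) (y_ u) (j_ u) ->
    letters (rest u.+1) /\ good X' Y' J' (rest u.+1).
  by move=> <- <- <- h1 h2; apply: IH => //; lia.
have [hX hJ hY] := hl; have aE := a_eq hu.
have hash_letters o : letters o -> letters (hash :: o).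
  by move=> h c; rewrite inE => /orP[/eqP->|/h//]; right.
case: (leqP (y_ u) k) => hYk; last first.
  case: (leqP (y_ u) (2 * k)) => hY2.
    have hJY : j_ u + (y_ u - k) <= n by move: hY; lia.
    clear hY hl.
    have [||||xE yE jE ->] := step_copy huN; try lia; first by rewrite aE action6 //; lia.
    have [||h1 h2] := IH _ _ _ xE yE jE.
    + by split=> //; lia.
    + by rewrite /remaining; do !case: ifP; lia.
    by split; [exact: letters_cons|apply: good_copyV => //; lia].
  case: (y_ u =P 2 * k + 1) => hY3.
    clear hY hl.
    have [||||xE yE jE ->] := step_K huN => //; first by rewrite aE action2.
      exact: K_code.
    have hc : live (x_ u) (Kc (x_ u) (j_ u)) (j_ u) /\ remaining (x_ u) (Kc (x_ u) (j_ u)) (j_ u) <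
        remaining (x_ u) (y_ u) (j_ u).
      case: (stage_K hX hJ) => [[l [[h1 h2 h3] h4 ->]]|[l [h1 h2 h3 ->]]|[h1 h3 ->]].
      + by split; [split=> //; lia|rewrite /remaining; do !case: ifP; lia].
      + by split; [split=> //; lia|rewrite /remaining; do !case: ifP; lia].
      + by split; [split=> //; lia|rewrite /remaining; do !case: ifP; lia].
    have [h1 h2] := IH _ _ _ xE yE jE hc.1 hc.2.
    by split; rewrite // hY3; apply: good_K.
  have hY4 : 3 * k <= y_ u by move: hY; lia.
  case: (y_ u =P 3 * k) => hY5.
    clear hY hl.
    have [|||xE yE jE ->] := @step_hash u false huN => //; first by rewrite aE action8.
      by rewrite addn1.
    have [||h1 h2] := IH _ _ _ xE yE jE.
    + by split=> //; lia.
    + by rewrite /remaining; do !case: ifP; lia.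
    by split; [exact: hash_letters|rewrite hY5 -(addn0 (3 * k)); exact: (@good_enter _ _ false)].
  have hJY : j_ u + (y_ u - 3 * k) <= n by move: hY; lia.
  have hY7 : y_ u <= 4 * k by move: hY; lia.
  clear hY hl.
  case: (y_ u =P 3 * k + 1) => hY6.
    have [|||xE yE jE ->] := @step_hash u true huN => //; first by rewrite aE action7.
      by rewrite addn0; lia.
    have [||h1 h2] := IH _ _ _ xE yE jE.
    + by split=> //; lia.
    + by rewrite /remaining; do !case: ifP; lia.
    by split; [exact: hash_letters|rewrite hY6; exact: (@good_enter _ _ true)].
  have [||||xE yE jE ->] := step_copy huN; try lia; first by rewrite aE action6 //; lia.
  have [||h1 h2] := IH _ _ _ xE yE jE.
  + by split=> //; lia.
  + by rewrite /remaining; do !case: ifP; lia.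
  by split; [exact: letters_cons|apply: good_copyK => //; lia].
case: (posnP (x_ u)) => [X0|X0].
  have hY' : y_ u = k by move: hY; lia.
  rewrite (halted_rest X0 hY' hJ); split=> //; rewrite /good hYk hY' X0.
  by exists [::] => //; rewrite lev0s size_drop.
have hx : 0 < x_ u <= n - k + 1 by rewrite X0.
clear hY hl.
case: (posnP (y_ u)) => hY0.
  have [||||xE yE jE ->] := step_D huN => //; first by rewrite aE action1.
    exact: D_code.
  have hX' := X_le hx; have hlt := X_lt hx; have hf := fb_le hx hJ.
  have hc : live (prev (x_ u)) (Dc (x_ u) (j_ u)) (j_ u) /\
      remaining (prev (x_ u)) (Dc (x_ u) (j_ u)) (j_ u) < remaining (x_ u) (y_ u) (j_ u).
    have hm : (k + 3) * (prev (x_ u)).+1 <= (k + 3) * x_ u by rewrite leq_mul2l hlt orbT.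
    rewrite mulnS in hm.
    case: (stage_D hx hJ) => [[d' [h1 h2 _ ->]]|[l [h1 h2 _ ->]]|[l [h1 h2 _ ->]]|[h1 _ ->]].
    + have h3 := ovl_pos hx h1 h2.
      by split; [split=> //; lia|rewrite /remaining; do !case: ifP; lia].
    + have h3 := dir_lt h1 h2.
      by split; [split=> //; lia|rewrite /remaining; do !case: ifP; lia].
    + by split; [split=> //; lia|rewrite /remaining; do !case: ifP; lia].
    + by split; [split=> //; lia|rewrite /remaining; do !case: ifP; lia].
  have [h1 h2] := IH _ _ _ xE yE jE hc.1 hc.2.
  by split; rewrite // hY0; apply: good_D.
have hy : 0 < y_ u <= k by lia.
have lv j : j_ u <= j <= n -> live (x_ u) (y_ u - 1) j /\
    remaining (x_ u) (y_ u - 1) j < remaining (x_ u) (y_ u) (j_ u).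
  by move=> hj; split; [split=> //; lia|rewrite /remaining; do !case: ifP; lia].
have lv3 : j_ u < n -> live (x_ u) (y_ u) (j_ u).+1 /\
    remaining (x_ u) (y_ u) (j_ u).+1 < remaining (x_ u) (y_ u) (j_ u).
  by move=> hj; split; [split=> //; lia|rewrite /remaining; do !case: ifP; lia].
(* Insertion is the default action; it is taken when W is exhausted or when neither deletion nor
   substitution attains the table value, so the recurrence forces the remaining term. *)
have ins : a_ u = 5 -> VV (x_ u) (y_ u) (j_ u) = (VV (x_ u) (y_ u - 1) (j_ u)).+1 ->
    letters (rest u) /\ good (x_ u) (y_ u) (j_ u) (rest u).
  move=> h5 e; have [|xE yE jE ->] := @step_letter u false huN h5 hx _ hy.
    by rewrite addn1.
  have [|l1 l2] := lv (j_ u) _; first by rewrite leqnn.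
  rewrite addn0 in jE; have [h1 h2] := IH _ _ _ xE yE jE l1 l2.
  by split; [exact: letters_cons|apply: good_ins].
rewrite (action345 _ _ _ _ X0 hy) in aE.
case: (ltnP (j_ u) n) aE => hj aE; last first.
  have eJ : j_ u = n by lia.
  by apply: ins; rewrite // eJ VV_end.
have eV i : i < 3 -> v_ u i = VV (x_ u) (y_ u - (1 < i)) (j_ u + (0 < i)).
  by move=> hi; apply: v_eq => //; lia.
have r := VV_rec hx hy hj.
have v0 : v_ u 0 = VV (x_ u) (y_ u) (j_ u) by rewrite eV // subn0 addn0.
have v1 : v_ u 1 = VV (x_ u) (y_ u) (j_ u).+1 by rewrite eV // subn0 addn1.
have v2 : v_ u 2 = VV (x_ u) (y_ u - 1) (j_ u).+1 by rewrite eV // addn1.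
rewrite v0 v1 v2 !TT_W // in aE; last by lia.
move: aE; case: eqP => [e aE|e1].
  have [||||xE yE jE ->] := step_del huN => //; first by apply: leq_trans hYk _; exact: leq_pmull.
  have [l1 l2] := lv3 hj; have [h1 h2] := IH _ _ _ xE yE jE l1 l2.
  by split; rewrite //; apply: good_del.
case: (_ =P _ + (if _ then _ else _)) => [e aE|e2 aE].
  have [|xE yE jE ->] := @step_letter u true huN aE hx _ hy; first by rewrite addn0.
  have [|l1 l2] := lv (j_ u).+1 _; first by rewrite leqnSn.
  rewrite addn1 in jE; have [h1 h2] := IH _ _ _ xE yE jE l1 l2.
  split; [exact: letters_cons|apply: good_sub => //].
  by rewrite e; case: eqP.
apply: ins => //; move: e1 e2 r; move: (VV _ _ _) (VV _ _ (j_ u)) (VV _ _ _) => b a c.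
by rewrite -addn1; case: eqP => /= _; clear; lia.
Qed.

(** The trace starts at the leftmost non-sensitive stage in the state that chooses what precedes its
    pattern, with nothing of W consumed; its goal there is an element of [Az] at distance [K] from
    all of W. *)
Lemma trace_solution : letters (rest 0) /\ fw W k (rest 0) = tailp W k Sk (n - k + 2) /\
  forall Z, fw W k Z = tailp W k Sk (n - k + 2) -> lev (rest 0) W <= lev Z W.
Proof.
have [s1 s2 _ _ _] := S_facts; have s6 := code_S.
have hp : prev (n - k + 2) <= n - k + 1 by rewrite prevE //; have := @pvs_lt W k Sk (n - k + 2); lia.
have xE : x_ 0 = prev (n - k + 2).
  rewrite {1}/TT m_eq; last by inr.
  have e : n - k + 2 = n + 2 - k by lia.
  by rewrite e -[RHS](@modS _) // -e; lia.
have yE : y_ 0 = 2 * k + 1.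
  by rewrite {1}/TT m_eq; [rewrite -[RHS](@modS _) //; lia|inr].
have jE : j_ 0 = 0 by rewrite {1}/TT m_eq; [rewrite /= mod0n|inr].
have [||] := @trace 0 (leq0n _).
- by rewrite xE yE jE; split=> //; rewrite eqxx !orbT.
- rewrite xE yE jE /remaining eqxx subn0 /steps.
  have h : (k + 3) * prev (n - k + 2) <= (k + 3) * (n - k + 1) by rewrite leq_mul2l hp orbT.
  have -> : (2 * k + 1 <= k) = false by lia.
  have h2 : (k + 3) * (n - k + 1) <= (k + 3) * n by rewrite leq_mul2l; lia.
  have -> : (n + 2) * (k + 8) = (k + 3) * n + 5 * n + 2 * k + 16 by ring.
  lia.
have eT : pats W k Sk (prev (n - k + 2)) = tailp W k Sk (n - k + 2).
  by rewrite tailp_pats prevE.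
rewrite xE yE jE good_mid /Az eT drop0 => h1 [h2 h3]; split=> //; split=> // Z hZ.
have hs := stages hp.
have Vs i : i <= n -> V (prev (n - k + 2)) i + 1 < S by apply: V_small.
have [h4 _] := K_ex hp (st_V hs) Vs W_pos (leq0n n).
by apply: leq_trans h3 _; have := h4 Z; rewrite drop0 /Az eT; apply.
Qed.

End Semantics.

(** * The complete program and its correctness *)

Definition outP : program :=
  loopP rx xSteps (Seq (compile (EL tTO (EV rx) (EC 0) (EC 0)) nreg)
    (Seq (compile (EL tTL (EV rx) (EC 0) (EC 0)) nreg.+1) (Write (Reg nreg) (Reg nreg.+1)))).

Definition etfsP (a : nat) : program :=
  Seq (setupP a) (Seq (systemP sys) (Seq outP
    (Seq (compile (EL tTO xSteps (EC 0) (EC 0)) nreg) (Assign 0 OpAdd (Reg nreg) (Cst 0))))).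

Definition entry_cost := cost (EL 0 (EV rx) (EC 0) (EC 0)).

Definition etfsT (a n k : nat) (rho : nat -> nat) : nat :=
  setupT a n + (systemT sys rho + (loopT xSteps (steps n k) (entry_cost + (entry_cost + 1)) +
    (cost (EL tTO xSteps (EC 0) (EC 0)) + 1))).

Section Solve.
Variables (w a : nat) (Sigma : {fset nat}) (W : seq nat) (k : nat) (Sk : {fset nat}).
Hypothesis inst : etfs_instance Sigma W k Sk.
Hypothesis W_le : forall x, x \in W -> x <= size W ^ a.
Local Notation n := (size W).
Local Notation S := (side n).
Local Notation Q := (range a n).
Local Notation tau := (wbits n).
Local Notation NB := (k %/ tau + 2).
Hypothesis Qw : Q ^ 12 <= 2 ^ w.

Let k_gt1 : 1 < k. Proof. by have /andP[] := etfs_k_bounds inst. Qed.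
Let kn : k < n. Proof. by have /andP[] := etfs_k_bounds inst. Qed.
Let n2 : 2 < n. Proof. lia. Qed.
Let sb := size_bounds a n2.

Lemma S_pos : 0 < S. Proof. by case: sb; lia. Qed.

Lemma S3_Q : S ^ 3 * maxconst.+2 <= Q.
Proof.
have [h1 _ h3] := sb; apply: leq_trans h3; rewrite (expnSr _ 3) leq_mul2l.
by rewrite /maxconst; apply/orP; right; lia.
Qed.

Lemma S3_M : S ^ 3 <= Q.-1.
Proof. by have := S3_Q; have : 0 < S ^ 3 by [rewrite expn_gt0 S_pos]; rewrite /maxconst; lia. Qed.

Lemma B8 : (2 ^ tau) ^ 8 <= 256 * n.
Proof.
rewrite -expnM mulnC expnM /wbits expnS; apply: leq_mul; first by rewrite -[256]/(2 ^ 8).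
by apply: trunc_logP; lia.
Qed.

Lemma S_sq : S = 256 * (n + 1) ^ 2. Proof. by []. Qed.

Local Notation rho := (prm n k S Q.-1 tau).
Let tau_pos : 0 < tau. Proof. by []. Qed.
Let facts := size_facts k_gt1 kn tau_pos S_sq B8 S3_M.

Let m0 := smem (etfs_input w W k Sk).
Let m := foldl (store sys Q S rho) m0 (cells sys rho).

Lemma le_S3 x : x <= S -> x <= S ^ 3.
Proof. by move=> h; apply: leq_trans h _; rewrite -{1}(expn1 S) leq_pexp2l // S_pos. Qed.

Lemma W_range i : nth 0 W i < Q.-1.
Proof.
have [h1 h2 h3] := sb; case: (ltnP i n) => hi; last first.
  by rewrite nth_default //; apply: leq_trans S3_M; rewrite expn_gt0 S_pos.
have h := W_le (mem_nth 0 hi); apply: (@leq_ltn_trans (S ^ a)).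
  by apply: leq_trans h _; case: a => // b; rewrite leq_exp2r //; lia.
have h4 : 0 < S ^ a by rewrite expn_gt0 S_pos.
have : S ^ a * 2 <= Q.
  rewrite /range expnD leq_mul2l; apply/orP; right.
  apply: (@leq_trans S); first by lia.
  by rewrite -{1}(expn1 S) leq_pexp2l // S_pos.
by lia.
Qed.

Let bits := [seq nat_of_bool (p \in Sk) | p <- positions k W].

Lemma m0_range i : m0 i < Q /\ m0 i = nth 0 (W ++ bits) i.
Proof.
have h : nth 0 (W ++ bits) i < Q.-1.
  rewrite nth_cat; case: (ltnP i n) => hi; first exact: W_range.
  have : nth 0 bits (i - n) <= 1.
    case: (ltnP (i - n) (size bits)) => hb; last by rewrite nth_default.
    by have /mapP[p _ ->] := mem_nth 0 hb; case: (_ \in _).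
  have h3 := S3_M; have h4 : 2 ^ 3 <= S ^ 3 by rewrite leq_exp2r //; case: sb; lia.
  by move=> h5; apply: leq_ltn_trans h5 _; apply: leq_trans h3; apply: leq_trans h4.
have e : m0 i = nth 0 (W ++ bits) i.
  apply: (word_range k_gt1 kn Qw); exact: leq_trans (ltnW h) (leq_pred _).
by rewrite e; split=> //; lia.
Qed.

Lemma size_bits : size bits = n + 1 - k.
Proof. by rewrite size_map size_iota addn1. Qed.

Lemma input_runs : runs w (setupP a) (etfs_input w W k Sk) (setupT a n) (fun s =>
  exists x, parm Q S rho x m0 s).
Proof.
have [f1 f2 f3 f4 f5] := facts.
have hk : known [:: n; k] (etfs_input w W k Sk).
  move=> r; rewrite /etfs_input /=; apply: (S1 k_gt1 kn Qw).
  by case: r => [|[|r]] /=; rewrite ?nth_nil; lia.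
apply: runs_weak (setup_runs k_gt1 kn Qw hk) (leqnn _) _ => s [e1 e2].
have eR r : r < 12 -> regs s r = nth 0 (params a n k) r by exact: e2.
have SQ : S < Q.
  by have := le_S3 (leqnn S); have := S3_M; have := S_pos; lia.
exists 0; split; last by move=> i; rewrite e1.
- split; last by move=> r hr; rewrite eR //; move: hr; rewrite /rx; lia.
  split=> [r hr|]; last by split=> [i|]; [rewrite e1; case: (m0_range i)|rewrite eR].
  rewrite eR //; have B1 : 2 ^ tau <= S by apply: leq_trans f3; rewrite leq_pmull // expn_gt0.
  by do 7! [case: r hr => [|r] hr; first by rewrite /=; lia]; rewrite /= nth_nil; lia.
- by rewrite eR.
- by rewrite eR.
Qed.

Lemma sys_dims t : 0 < t <= size (s_tabs sys) ->
  [/\ NX sys rho (grp sys t) <= S, NY sys rho t <= S & NZ sys rho t <= S].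
Proof.
by move=> h; rewrite NX_dim // NY_dim // NZ_dim //; apply: (dims_S k_gt1 kn tau_pos S_sq B8 S3_M).
Qed.

Lemma sys_dimX i : i < ngrp sys -> NX sys rho i <= S.
Proof.
have h t : 0 < t <= 35 -> NX sys rho (gnum t) <= S.
  by move=> ht; rewrite -grp_num //; have [] := sys_dims ht.
case: i => [_|i]; first exact: (h 1 isT).
case: i => [_|i]; first exact: (h 2 isT).
case: i => [_|i]; first exact: (h 4 isT).
case: i => [_|i]; first exact: (h 8 isT).
case: i => [_|i]; first exact: (h 9 isT).
case: i => [_|i]; first exact: (h 10 isT).
case: i => [_|i]; first exact: (h 11 isT).
case: i => [_|i]; first exact: (h 12 isT).
by case: i => [_|i] //; exact: (h 29 isT).
Qed.

Lemma sys_off : off sys (ngrp sys) = (size (s_tabs sys)).+1. Proof. by []. Qed.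

Lemma tables_run s : (exists x, parm Q S rho x m0 s) ->
  runs w (systemP sys) s (systemT sys rho) (fun s' => exists x, parm Q S rho x m s').
Proof.
move=> h; exact: (system_runs S_pos S3_Q Qw erefl erefl etfs_system_ok sys_dims sys_dimX sys_off h).
Qed.

Lemma m_eq t x y z : in_dims n k tau t x y z -> m (adr S t x y z) =
  eval (nth 0 [:: n; k; S; Q.-1; tau; 2 ^ tau; NB; 0; x; y; z]) m (f_e (tab sys t)) %% Q.-1.
Proof.
move=> h; have hl := loads_ok k_gt1 kn tau_pos S_sq B8 S3_M h.
rewrite /m (cells_eq S_pos S3_Q Qw erefl erefl etfs_system_ok sys_dims sys_off m0 hl) ?env_nth //.
by rewrite inr_inrt.
Qed.

Lemma adr_big t x y z : 0 < t -> S ^ 3 <= adr S t x y z.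
Proof.
Local Transparent adr.
move=> h; rewrite /adr !expnS muln1; apply: leq_trans (leq_addr _ _).
rewrite mulnA leq_mul2r; apply/orP; right; apply: leq_trans (leq_addr _ _).
by rewrite leq_mul2r; apply/orP; right; apply: leq_trans (leq_addr _ _); rewrite leq_pmull.
Local Opaque adr.
Qed.

Lemma adr_low z : z < S -> adr S 0 0 0 z = z.
Proof.
Local Transparent adr.
by move=> h; rewrite /adr !mod0n modn_small.
Local Opaque adr.
Qed.

Lemma m_out t x y z : 0 < t -> x < S -> y < S -> z < S ->
  ~~ in_dims n k tau t x y z -> m (adr S t x y z) = 0.
Proof.
move=> ht hx hy hz h; rewrite -(inr_inrt n k S Q.-1) in h.
rewrite [LHS](cells_unused S_pos S3_Q Qw erefl erefl etfs_system_ok sys_dims sys_off m0 hx hy hz h).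
have [_ ->] := m0_range (adr S t x y z); rewrite nth_default //.
apply: leq_trans (adr_big x y z ht); rewrite size_cat size_bits.
have h1 : S * 2 <= S ^ 3.
  rewrite expnS leq_mul2l; apply/orP; right; have [? _ _] := sb.
  by apply: (@leq_trans S); [lia|rewrite -{1}(expn1 S) leq_pexp2l // S_pos].
by apply: leq_trans h1; have [_ ? _] := sb; lia.
Qed.

Lemma m_low z : z < S -> m (adr S 0 0 0 z) = nth 0 (W ++ bits) z.
Proof.
move=> hz; have [_ <-] := m0_range z; rewrite -{2}(adr_low hz).
have h : ~~ inr sys rho 0 0 0 z by rewrite inr_inrt.
by rewrite [LHS](cells_unused S_pos S3_Q Qw erefl erefl etfs_system_ok sys_dims sys_off m0 _ _ hz h) // S_pos.
Qed.

Lemma m_W z : z < n -> m (adr S 0 0 0 z) = nth 0 W z.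
Proof. by move=> h; rewrite m_low ?nth_cat ?h //; case: sb; lia. Qed.

Lemma m_Sk p : p <= n - k -> m (adr S 0 0 0 (n + p)) = (p \in Sk).
Proof.
move=> h; rewrite m_low; last first.
  have : 8 * n <= S; last by lia.
  have h1 : n + 1 <= (n + 1) ^ 2 by rewrite expnS expn1 leq_pmulr // addn1.
  by rewrite S_sq; lia.
rewrite nth_cat ltnNge leq_addr /= addKn (nth_map 0) ?size_iota ?nth_iota //; lia.
Qed.

Lemma S_large u : u <= 8 * ((n + 1) * (n + 1)) -> u <= S.
Proof. by move=> h; apply: leq_trans h _; rewrite S_sq !expnS expn0 muln1 leq_mul2r orbC. Qed.

Local Notation N := (steps n k).
Local Notation o_ u := (TT S m 32 u 0 0).
Local Notation a_ u := (TT S m 34 u 0 0).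
Local Notation l_ u := (TT S m 35 u 0 0).

Lemma N_S : N <= S. Proof. exact: (steps_S k_gt1 kn tau_pos S3_M S_large). Qed.

Definition emitted (u : nat) : seq nat := [seq l_ v | v <- iota 0 u & 4 <= a_ v].

Let o_step u : u < N -> o_ u.+1 = o_ u + (4 <= a_ u).
Proof. exact: (o_eq k_gt1 kn tau_pos facts S3_M m_eq S_large). Qed.
Let o_bound u : u <= N -> o_ u <= u.
Proof. exact: (o_le k_gt1 kn tau_pos facts S3_M m_eq). Qed.

Definition copied (u : nat) (s : state) : Prop := [/\ holds_params Q S rho s, regs s rx = u,
  forall i, S ^ 3 <= i -> smem s i = m i & mkseq (smem s) (o_ u) = emitted u].

Lemma mkseq_ext (f g : nat -> nat) i : (forall j, j < i -> f j = g j) -> mkseq f i = mkseq g i.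
Proof. by move=> h; apply/eq_in_map => j; rewrite mem_iota => hj; apply: h. Qed.

(** Every step writes its letter at address [o_ u], even if it emits nothing; the address then stays
    the same and is written again. The output covers the input and stays below [S ^ 3], where the
    tables begin, so these remain intact. *)
Lemma out_runs s : (exists x, parm Q S rho x m s) ->
  runs w outP s (loopT xSteps N (entry_cost + (entry_cost + 1))) (copied N).
Proof.
case=> x [hp _ _ hm].
apply: (loop_runs (rho := rho) S_pos S3_Q Qw erefl erefl etfs_system_ok) => //.
- exact: N_S.
- move=> i s1 s2 [p1 p2 p3 p4] em er.
  have er' q : q < rx -> regs s2 q = regs s1 q by rewrite /rx => h; apply: er; rewrite /nreg; lia.
  split; [|by rewrite er|by move=> j; rewrite em; exact: p3|by rewrite em].
  case: p1 => [[q1 [q2 q3]] q4]; split; last by move=> r hr; rewrite er' ?q4.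
  by split=> [r hr|]; [rewrite er ?q1|split=> [j|]; rewrite ?em ?er'].
- by move=> i s1 [p1 p2 _ _].
- move=> s1 em er e0 p1; split=> //; first by move=> i _; rewrite em hm.
  by rewrite (o0 k_gt1 kn tau_pos facts S3_M m_eq).
move=> u s1 hu [p1 p2 p3 p4].
have val s2 t d : 0 < t <= 100 -> nreg <= d -> small Q S s2 -> regs s2 rx = u ->
    (forall i, S ^ 3 <= i -> smem s2 i = m i) ->
    runs w (compile (EL t (EV rx) (EC 0) (EC 0)) d) s2 entry_cost
      (result s2 d (TT S m t u 0 0)).
  move=> ht hd hs2 hx2 hm2; have [_ [_ e]] := hs2.
  have wf : wfe (EL t (EV rx) (EC 0) (EC 0)) by case/andP: ht => _ h; rewrite /= h.
  apply: runs_weak (comp_correct S_pos S3_Q Qw wf isT hd hs2) (leqnn _) _ => s' [c1 c2 c3].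
  split=> //; rewrite c3 [LHS]/= e hx2 hm2 //; apply: adr_big; lia.
have [sm1 _] := p1.
apply: runs_seq (val s1 tTO nreg isT (leqnn _) sm1 p2 p3) _ => s2 [a1 a2 a3].
have sm2 : small Q S s2.
  have [q1 [q2 q3]] := sm1; split=> [r hr|]; first by rewrite a2 ?q1.
  by split=> [i|]; rewrite ?a1 ?a2.
have x2 : regs s2 rx = u by rewrite a2.
have m2 i : S ^ 3 <= i -> smem s2 i = m i by rewrite a1; exact: p3.
apply: runs_seq (val s2 tTL nreg.+1 isT (leqnSn _) sm2 x2 m2) _ => s3 [b1 b2 b3].
have lQ : l_ u < Q.
  rewrite /TT; have -> : m (adr S 35 u 0 0) = smem s1 (adr S 35 u 0 0).
    by rewrite p3 // adr_big.
  by have [_ [-> _]] := sm1.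
have er r : r < nreg -> regs s3 r = regs s1 r by move=> hr; rewrite b2 ?a2 //; exact: leqW.
have e1 : regs s3 nreg = o_ u by rewrite b2.
apply: runs_write; rewrite /= e1 b3 b1 a1; set s4 := State _ _.
have p4' : holds_params Q S rho s4.
  have [[q1 [q2 q3]] q4] := p1; split; last by move=> r hr; rewrite /= er ?q4 //; move: hr; rewrite /rx /nreg; lia.
  split=> [r hr|]; first by rewrite /= er ?q1.
  by split=> [i|]; [rewrite /= /update; case: eqP|rewrite /= er].
have ou := o_bound (ltnW hu).
split=> //; first by rewrite /= er.
move=> s5 em5 er5 x5 p5; split=> // [i hi|]; rewrite em5 /=.
  rewrite update_neq ?p3 //; apply/eqP => ei; have := le_S3 N_S.
  by move: hi; rewrite ei; lia.
rewrite o_step // /emitted -(addn1 u) iotaD filter_cat map_cat /= add0n -/(emitted u) -p4.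
have ext : mkseq (update (smem s1) (o_ u) (l_ u)) (o_ u) = mkseq (smem s1) (o_ u).
  by apply: mkseq_ext => j hj; rewrite update_lt.
case: (4 <= a_ u); rewrite ?addn0 ?cats0 //= addn1 mkseqS ext update_eq.
by rewrite cats1.
Qed.

Theorem etfs_runs : runs w (etfsP a) (etfs_input w W k Sk) (etfsT a n k rho)
  (fun s => etfs_solution Sigma W k Sk (string_output s)).
Proof.
apply: runs_seq input_runs _ => s1 h1.
apply: runs_seq (tables_run h1) _ => s2 h2.
apply: runs_seq (out_runs h2) _ => s3 [[p1 p2] p3 p4 p5].
apply: runs_seq (comp_correct S_pos S3_Q Qw (e := EL tTO xSteps (EC 0) (EC 0)) isT isT (leqnn _) p1) _.
move=> s4 [a1 a2 a3]; have [_ [_ eS]] := p1.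
have eN : eval (regs s3) (smem s3) xSteps = N by rewrite /= !p2.
apply: runs_assign; rewrite /string_output.
have [_ [f2 _ _ _ _]] := (0, facts).
have hN := o_bound (leqnn N); have hNS := N_S.
have e0 : to_word w 0 = 0 by rewrite /to_word mod0n.
have e4 : regs s4 nreg = o_ N.
  have -> : regs s4 nreg =
      smem s3 (adr (regs s3 rS) tTO (eval (regs s3) (smem s3) xSteps) 0 0) by exact: a3.
  by rewrite eN eS p4 // adr_big.
rewrite /= update_eq e4 /eval_binop /= e0 addn0 (S1 k_gt1 kn Qw); last exact: leq_trans hN hNS.
rewrite a1 p5.
have [h3 [h4 h5]] := trace_solution k_gt1 kn tau_pos facts S3_M m_eq m_out m_W m_Sk S_large
  (etfs_W_pos inst) W_range.
have er : rest W k S m 0 = emitted N by rewrite /rest subn0.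
rewrite er in h3 h4 h5; apply: solution_intro => //.
by move=> x /h3[hx|->]; [left; exact: (etfs_string inst)|right].
Qed.
End Solve.

Local Transparent modn divn expn adr.

(** * The running time *)

Lemma loopT_le e N T : loopT e N T <= N.+1 * (T + cost e + 3).
Proof. by rewrite /loopT mulSn; nia. Qed.

(** Covers the instructions for one cell of any table together with the overhead of its loops;
    checked by computation. *)
Definition table_cost := 2000.
Definition cell_cost := 900.

Lemma table_costs : all (fun f => cellT (f_e f) + cost (f_nz f) + cost (f_ny f) + 6 <= table_cost)
  (s_tabs sys) && all (fun g => cost g.1 + 4 <= table_cost) (s_groups sys).
Proof. by vm_compute. Qed.

Lemma sumn_iota_le (f : nat -> nat) K X a c : (forall t, a <= t < a + c -> K * f t <= X) ->
  K * sumn [seq f t | t <- iota a c] <= c * X.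
Proof.
elim: c a => [|c IH] a h; first by rewrite muln0.
rewrite /= mulnDr mulSn; apply: leq_add; first by apply: h; lia.
by apply: IH => t ht; apply: h; lia.
Qed.

Section Time.
Variables (n k S M : nat).
Local Notation tau := (wbits n).
Local Notation NB := (k %/ tau + 2).
Local Notation rho := (prm n k S M tau).
Hypothesis k_gt1 : 1 < k.
Hypothesis kn : k < n.
Local Notation U := (n ^ 2 * NB).

Lemma fillT_le t : 0 < t <= 35 ->
  fillT sys rho t <= (dimy n k tau t).+1 * (dimz k tau t).+1 * table_cost.
Proof.
move=> ht; rewrite /fillT NY_dim // NZ_dim //.
apply: leq_trans (loopT_le _ _ _) _; rewrite -mulnA leq_mul2l; apply/orP; right.
have h := loopT_le (f_nz (tab sys t)) (dimz k tau t) (cellT (f_e (tab sys t))).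
have hc : cellT (f_e (tab sys t)) + cost (f_nz (tab sys t)) + cost (f_ny (tab sys t)) + 6 <=
    table_cost.
  case/andP: table_costs => /all_nthP-/(_ dfill) hh _; apply: (hh t.-1).
  by have -> : size (s_tabs sys) = 35 by []; lia.
by move: (cellT _) (cost _) (cost _) (loopT _ _ _) h hc => c1 c2 c3 l; nia.
Qed.

Lemma tau_n : tau <= n.
Proof.
have h : 256 ^ (trunc_log 256 n) <= n by apply: trunc_logP; lia.
by apply: leq_trans h; exact: ltn_expl.
Qed.

(** Most tables are within 2n by 2n by 2 NB. [tAW] has about k / tau blocks of tau + 1 entries per
    stage, hence order n k cells, and the tables of blocks have of order tau * B ^ 3 cells, which is
    bounded through [B ^ 4 <= 256 n]. *)
Lemma cells_le t : 0 < t <= 35 ->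
  (dimx n k tau t).+1 * (dimy n k tau t).+1 * (dimz k tau t).+1 <= 900 * U.
Proof.
have h256 : 256 ^ (trunc_log 256 n) <= n by apply: trunc_logP; lia.
have hB8 : (2 ^ tau) ^ 8 <= 256 * n.
  by rewrite -expnM mulnC expnM [(2 ^ 8) ^ tau]expnS; apply: leq_mul.
have hn2 : n <= n ^ 2 by rewrite expnS expn1 leq_pmulr; lia.
have hU : n ^ 2 * 2 <= U by rewrite leq_mul2l leq_addl orbT.
have ht := tau_n.
have mul3 a b c A B C : a <= A -> b <= B -> c <= C -> a * b * c <= A * B * C.
  by move=> *; do !apply: leq_mul.
have gen a b c : a <= 2 * n -> b <= 2 * n -> c <= 2 * NB -> a * b * c <= 900 * U.
  move=> h1 h2 h3; apply: leq_trans (mul3 _ _ _ _ _ _ h1 h2 h3) _.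
  have -> : 2 * n * (2 * n) * (2 * NB) = 8 * U by ring.
  by rewrite leq_mul2r orbT.
have small a b c : a * b * c <= 900 * (n ^ 2 * 2) -> a * b * c <= 900 * U.
  by move=> h; apply: leq_trans h _; rewrite leq_mul2l hU orbT.
have hB : tau < 2 ^ tau by exact: ltn_expl.
have hB1 : 1 < 2 ^ tau by rewrite -{1}(expn0 2) ltn_exp2l.
have hB4 : (2 ^ tau) ^ 4 <= 256 * n by apply: leq_trans hB8; rewrite leq_pexp2l //; lia.
have bits c : c <= 5 * 2 ^ tau ->
    (tau + 1).+1 * (2 ^ tau * 2 ^ tau).+1 * c <= 900 * U.
  move=> hc; apply: small; apply: leq_trans (_ : (2 * 2 ^ tau) * (2 * (2 ^ tau * 2 ^ tau)) *
    (5 * 2 ^ tau) <= _).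
    have h1 : 1 * 1 <= 2 ^ tau * 2 ^ tau by apply: leq_mul; exact: ltnW.
    by apply: mul3 => //; lia.
  have -> : 2 * 2 ^ tau * (2 * (2 ^ tau * 2 ^ tau)) * (5 * 2 ^ tau) = 20 * (2 ^ tau) ^ 4 by ring.
  (* This case determines the constant 900: 20 * 256 n <= 900 * 2 n ^ 2 holds because n >= 3. *)
  have hn3 : 3 * n <= n ^ 2 by rewrite expnS expn1 leq_mul2r; lia.
  by move: (_ ^ 4) (n ^ 2) hB4 hn3 => b q; lia.
have steps_le b c : b <= 5 -> c <= 2 -> (steps n k + 1).+1 * b * c <= 900 * U.
  move=> hb hc; apply: small; apply: leq_trans (mul3 _ _ _ _ _ _ (leqnn _) hb hc) _.
  by rewrite /steps expnS expn1; nia.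
have powers : 2 * 2 * (tau + 1).+1 <= 900 * U by apply: small; lia.
have aw : (n + 2 - k).+1 * NB.+1 * (tau + 1).+1 <= 900 * U.
  have h1 := leq_div k tau; have h2 := leq_divM k tau.
  apply: small; rewrite -mulnA; apply: (@leq_trans (2 * n * (10 * n))); last first.
    by rewrite mulnACA expnS expn1; move: (n * n) => q; lia.
  by apply: leq_mul; [lia|rewrite !mulSn !mulnDl; nia].
have NB2 : 2 <= NB by exact: leq_addl.
clear - k_gt1 kn NB2 powers bits gen aw steps_le hB1.
case: t => // t; rewrite /dimx /dimy /dimz.
case: t => [_|t]; first exact: powers.
case: t => [_|t]; first by apply: bits => /=; lia.
case: t => [_|t]; first by apply: bits => /=; lia.
do 14! [case: t => [_|t]; first by apply: gen => /=; lia].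
case: t => [_|t]; first exact: aw.
do 10! [case: t => [_|t]; first by apply: gen => /=; lia].
by do 7! [case: t => [_|t]; first by apply: steps_le].
Qed.

Lemma U_ge : n ^ 2 * 2 <= U. Proof. by rewrite leq_mul2l leq_addl orbT. Qed.

(** Nine groups, each with at most 17 tables and one further unit for its own loop; the summand 1
    pays for the sequence of the groups. *)
Definition system_cost := 9 * (18 * (cell_cost * table_cost)) + 1.

Lemma systemT_le : systemT sys rho <= system_cost * U.
Proof.
have hU := U_ge; have hn : 9 <= n ^ 2 by rewrite -[9]/(3 ^ 2) leq_exp2r //; lia.
pose X := cell_cost * table_cost * U.
have cell t : 0 < t <= 35 -> (NX sys rho (grp sys t)).+1 * fillT sys rho t <= X.
  move=> ht; rewrite NX_dim //; apply: leq_trans (leq_mul (leqnn _) (fillT_le ht)) _.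
  rewrite !mulnA (_ : X = cell_cost * U * table_cost); last by rewrite /X mulnAC.
  by rewrite leq_mul2r cells_le ?orbT.
have dim t : 0 < t <= 35 -> (NX sys rho (grp sys t)).+1 * table_cost <= X.
  move=> ht; rewrite NX_dim //.
  rewrite (_ : X = cell_cost * U * table_cost); last by rewrite /X mulnAC.
  by rewrite leq_mul2r; apply/orP; right; apply: leq_trans (cells_le ht); rewrite -mulnA leq_pmulr.
have group i : i < 9 -> groupT sys rho i <= 18 * X.
  move=> hi; have [h1 h2 h3] : [/\ 0 < off sys i, off sys i + ntab sys i <= 36 &
      0 < ntab sys i <= 17] by do 9! [case: i hi => [|i] hi //].
  rewrite /groupT; apply: leq_trans (loopT_le _ _ _) _.
  have hc : cost (nxe sys i) + 4 <= table_cost.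
    by case/andP: table_costs => _ /all_nthP-/(_ (EC 0, 0)); apply.
  have s1 := @sumn_iota_le (fillT sys rho) (NX sys rho i).+1 X (off sys i) (ntab sys i).
  have {}s1 : (NX sys rho i).+1 * sumn [seq fillT sys rho t | t <- iota (off sys i) (ntab sys i)] <=
      ntab sys i * X.
    apply: s1 => t ht; rewrite -[i in NX _ _ i](@grp_off sys i t) //; apply: cell; lia.
  have s2 : (NX sys rho i).+1 * table_cost <= X.
    rewrite -[i in NX _ _ i](@grp_off sys i (off sys i)) //; [apply: dim; lia|lia].
  have s3 : ntab sys i * X <= 17 * X by rewrite leq_mul2r; lia.
  apply: (@leq_trans ((NX sys rho i).+1 *
    (sumn [seq fillT sys rho t | t <- iota (off sys i) (ntab sys i)] + table_cost))).
    by rewrite leq_mul2l; lia.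
  by rewrite mulnDr (mulSn 17 X) addnC leq_add // (leq_trans s1).
have := @sumn_iota_le (groupT sys rho) 1 (18 * X) 0 9; rewrite mul1n => h.
have {}h : sumn [seq groupT sys rho i | i <- iota 0 9] <= 9 * (18 * X).
  by apply: h => i hi; rewrite mul1n group.
rewrite /systemT -[ngrp sys]/9; apply: (@leq_trans (9 * (18 * X) + U)).
  by rewrite -addn1 leq_add //; lia.
by rewrite /system_cost /X; move: cell_cost table_cost => b c; rewrite mulnDl mul1n leq_add2r !mulnA.
Qed.

Definition time_cost (a : nat) : nat :=
  a + 30 + system_cost + (entry_cost + entry_cost + cost xSteps + 5) * 5 +
  cost (EL tTO xSteps (EC 0) (EC 0)).

Lemma etfsT_le a : etfsT a n k rho <= time_cost a * U.
Proof.
have hU := U_ge; have hn : 9 <= n ^ 2 by rewrite -[9]/(3 ^ 2) leq_exp2r //; lia.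
have hn2 : n <= n ^ 2 by rewrite expnS expn1 leq_pmulr; lia.
have h1 : setupT a n <= (a + 29) * U.
  rewrite /setupT mulnDl; have h : a <= a * U by rewrite leq_pmulr; lia.
  by have := tau_n; lia.
have h2 : loopT xSteps (steps n k) (entry_cost + (entry_cost + 1)) <=
    (entry_cost + entry_cost + cost xSteps + 5) * 5 * U.
  apply: leq_trans (loopT_le _ _ _) _; rewrite -mulnA mulnC; apply: leq_mul; first by lia.
  by rewrite /steps; move: hU; rewrite expnS expn1; nia.
have h3 : cost (EL tTO xSteps (EC 0) (EC 0)) <= cost (EL tTO xSteps (EC 0) (EC 0)) * U.
  by rewrite leq_pmulr; lia.
have h4 := systemT_le.
move: h1 h2 h3 h4; rewrite /etfsT /time_cost.
move: (setupT a n) (loopT _ _ _) (systemT _ _) system_cost (_ * 5) (cost (EL _ _ _ _)).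
by move=> u1 u2 u3 c1 c2 c3; rewrite !mulnDl; lia.
Qed.
End Time.

(** With L the bit length of n, [side n] is at most 2 ^ 8 * 2 ^ (2 L) <= 2 ^ (10 L); raising to a +
    4 and then to 12 gives the factor 120 (a + 4). *)
Lemma range_word a n : 2 < n -> range a n ^ 12 <= 2 ^ word_length (120 * (a + 4)) n.
Proof.
move=> hn; rewrite /range /word_length; set L := (trunc_log 2 n).+1.
have hL : n < 2 ^ L by exact: trunc_log_ltn.
have h1 : (n + 1) ^ 2 <= 2 ^ (L * 2) by rewrite expnM leq_exp2r // addn1.
have h2 : side n <= 2 ^ (10 * L).
  have -> : 10 * L = 8 * L + L * 2 by lia.
  rewrite /side expnD; apply: leq_mul => //; rewrite -[256]/(2 ^ 8) leq_exp2l //; lia.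
rewrite -expnM; apply: leq_trans (_ : (2 ^ (10 * L)) ^ ((a + 4) * 12) <= _).
  by rewrite leq_exp2r //; lia.
by rewrite -expnM leq_exp2l //; lia.
Qed.

Import Order.TTheory GRing.Theory Num.Theory.
Local Open Scope ring_scope.

(** * The logarithm to base sigma against the block length *)

Section Logarithm.
Variable R : realType.

Lemma ln_nat_gt0 n : (1 < n)%N -> 0 < ln n%:R :> R.
Proof. by move=> h; rewrite ln_gt0 // ltr1n. Qed.

(** From n < 256 ^ tau = 2 ^ (8 tau) and sigma >= 2: the logarithm to base sigma is at most that to
    base 2, hence at most 8 tau. *)
Lemma logb_wbits n sigma : (2 < n)%N -> (1 < sigma)%N ->
  0 < logb sigma%:R n%:R :> R /\ logb sigma%:R n%:R <= 8 * (wbits n)%:R :> R.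
Proof.
move=> hn hs; have ls := ln_nat_gt0 hs; have h2 := @ln_nat_gt0 2 isT.
split; first by rewrite /logb divr_gt0 ?ln_nat_gt0 //; lia.
rewrite /logb ler_pdivrMr //.
have h3 : ln 2%:R <= ln sigma%:R :> R by rewrite ler_ln ?posrE ?ltr0n ?ler_nat //; lia.
have h4 : ln n%:R <= ln (2 ^ (8 * wbits n))%:R :> R.
  rewrite ler_ln ?posrE ?ltr0n ?ler_nat ?expn_gt0 //; last by lia.
  by rewrite expnM ltnW // trunc_log_ltn.
apply: le_trans h4 _; rewrite natrX lnXn ?ltr0n // -[_ *+ _]mulr_natl natrM.
by rewrite ler_wpM2l // mulr_ge0.
Qed.
End Logarithm.

Theorem theorem5 (R : realType) (a : nat) :
  exists (P : program) (c C : nat),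
  forall (Sigma : {fset nat}) (W : seq nat) (k : nat) (Sk : {fset nat}),
    etfs_instance Sigma W k Sk ->
    (1 < #|` Sigma|)%N ->
    (forall x, x \in Sigma -> (x <= size W ^ a)%N) ->
    let n := size W in
    let w := word_length c n in
    exists (t : nat) (s : state),
      [/\ exec w P (etfs_input w W k Sk) t s,
          etfs_solution Sigma W k Sk (string_output s) &
          t%:R <= C%:R * (n%:R ^+ 2
                    + n%:R ^+ 2 * k%:R / logb (#|` Sigma|%:R : R) n%:R)].
Proof.
(* The factor 8 in the constant turns k / tau + 2 into 8 (k / L + 1), where L is the logarithm of n
   to base sigma and L <= 8 tau. *)
exists (etfsP a), (120 * (a + 4))%N, (8 * time_cost a)%N => Sigma W k Sk inst hS hle n w.
have /andP[k1 kn] := etfs_k_bounds inst; have n2 : (2 < n)%N by rewrite /n; lia.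
have W_le x : x \in W -> (x <= n ^ a)%N by move=> hx; apply: hle; apply: (etfs_string inst).
have [t [s [h1 h2 h3]]] := etfs_runs inst W_le (range_word a n2).
exists t, s; split=> //.
have ht := leq_trans h2 (etfsT_le _ _ k1 kn a).
have [l0 l8] := logb_wbits R n2 hS; set L := logb _ _ in l0 l8 *.
rewrite -/n in ht; move: (time_cost a) ht => c ht.
have kL : (k %/ wbits n)%:R <= 8 * (k%:R / L) :> R.
  rewrite mulrA ler_pdivlMr //; apply: le_trans (ler_wpM2l (ler0n _ _) l8) _.
  by rewrite mulrCA -!natrM ler_nat leq_mul2l leq_divM orbT.
apply: (@le_trans _ _ (c * (n ^ 2 * (k %/ wbits n + 2)))%:R); first by rewrite ler_nat.
rewrite (natrM R c) (natrM R (n ^ 2)) (natrM R 8) natrX natrD -[_ ^+ 2 * _ / _]mulrA.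
move: (_ / L) (n%:R ^+ 2) (@exprn_ge0 R 2 n%:R (ler0n _ _)) kL => X A A0 kL.
have -> : 8%:R * c%:R * (A + A * X) = c%:R * (A * (8 * X + 8)) by ring.
rewrite ler_wpM2l // ler_wpM2l // lerD // ler_nat //.
Qed.
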